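(* Let $r\ge0$, $g\in\mathcal M$, $g_h\in\mathcal M_h^r$, and $\overline g_h\in\mathcal M_h^0$. The following statements hold: 1. $\operatorname{div}_h\circ\,\pi_h^W=\pi_h^V\circ\operatorname{div}_{\rm dist}$ as maps $W'\to V_h^{r+1}$. 2. If $g=g_h=\overline g_h$, then $(\operatorname{div}\operatorname{div}S)_h\circ\pi_h^\Sigma=\pi_h^V\circ(\operatorname{div}\operatorname{div}S)_{\rm dist}$ as maps $\Sigma\to V_h^{r+1}$. 3. If $\mathcal S$ is planar and $g=g_h=\overline g_h=\delta$ (the Euclidean metric), then $\operatorname{def}\circ\,\pi_h^U=\pi_h^\Sigma\circ\operatorname{def}$ as maps $U\to\Sigma_h^r$.
   Context: Let $\mathcal S$ be a finite triangulation of an oriented two-dimensional manifold (possibly with boundary $\partial\mathcal S$), with sets $\mathcal T_h,\mathcal E_h,\mathcal V_h$ of (closed) triangles, edges, vertices; $\mathcal E_h^0$ is the set of interior edges (edges not contained in $\partial\mathcal S$, each shared by two triangles). Polynomials on triangles and edges are with respect to affine coordinates. $i_{T,e}:e\hookrightarrow T$ is the inclusion. $\mathcal M$ (Regge metrics): collections $g=(g_T)$ of smooth Riemannian metrics on the triangles with $i_{T_1,e}^*g_{T_1}=i_{T_2,e}^*g_{T_2}$ for all $e=T_1\cap T_2\in\mathcal E_h^0$. On each $T$: $\nabla$ is the Levi-Civita connection of $g_T$, $\omega$ its volume form, $S\sigma=\sigma-g\operatorname{Tr}\sigma$; $\langle\cdot,\cdot\rangle_{g,T}=\int_T\langle\cdot,\cdot\rangle_g\omega$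 and $\langle\cdot,\cdot\rangle_{g,\mathcal S}=\sum_T\langle\cdot,\cdot\rangle_{g,T}$. On $e\subset\partial T$, $n,\tau$ are the $g_T$-unit outward normal and unit tangent with $(n,\tau)$ right-handed, $\langle u,v\rangle_{g,e}=\int_euv\,ds$ (with $uv$ replaced by a dot product for vector-valued functions). $\llbracket q\rrbracket=q|_{T_1}+q|_{T_2}$ on $e=T_1\cap T_2$ (each side with its own metric, $n,\tau$), $\llbracket q\rrbracket=q$ on boundary edges. Spaces: $V=\{v\in\prod_TH^2(T): v_{T_1}|_e=v_{T_2}|_e\ \forall e=T_1\cap T_2\in\mathcal E_h^0,\ v|_{\partial\mathcal S}=0\}$; $W=\{\alpha\in\prod_TH^1\Lambda^1(T): i_{T_1,e}^*\alpha_{T_1}=i_{T_2,e}^*\alpha_{T_2}\ \forall e=T_1\cap T_2\in\mathcal E_h^0,\ i_{T,e}^*\alpha_T=0\ \forall e\in\mathcal E_h\setminus\mathcal E_h^0,T\supset e\}$ ($H^1\Lambda^1(T)$: one-forms with $H^1$ coefficients); $\Sigma=\{\sigma\in\prod_TH^1S_2^0(T): i_{T_1,e}^*\sigma_{T_1}=i_{T_2,e}^*\sigma_{T_2}\ \forall e=T_1\cap T_2\in\mathcal E_h^0\}$ ($H^1S^0_2(T)$: symmetric $(0,2)$-tensor fields with $H^1$ coefficients). $V',W'$ are the duals. $\mathcal P_r(T)$: polynomials of degree $\le r$ on $T$ (zero if $r<0$); $\mathcal P_rS_2^0(T)$, $\mathcal P_r\Lambda^k(T)$: symmetric $(0,2)$-tensors,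 $k$-forms with such coefficients; $\mathcal P_r^-\Lambda^1(T)=\{\alpha\in\mathcal P_r\Lambda^1(T):\operatorname{kos}\alpha\in\mathcal P_r(T)\}$, $\operatorname{kos}$ being the Koszul differential (contraction with the position vector field). Finite element spaces: $V_h^{r+1}=\{v\in V: v|_T\in\mathcal P_{r+1}(T)\ \forall T\}$, $W_h^{r+1}=\{\alpha\in W:\alpha|_T\in\mathcal P_{r+1}^-\Lambda^1(T)\ \forall T\}$, $\Sigma_h^r=\{\sigma\in\Sigma:\sigma|_T\in\mathcal P_rS_2^0(T)\ \forall T\}$, $\mathcal M_h^r=\{g\in\mathcal M: g|_T\in\mathcal P_rS_2^0(T)\ \forall T\}$. $c_h(g;\sigma,\alpha)=\sum_T\langle S\sigma,\nabla\alpha\rangle_{g,T}+\sum_{e\in\mathcal E_h}\langle\sigma(\tau,\tau),\llbracket\alpha(n)\rrbracket\rangle_{g,e}$. Operators: $\operatorname{div}_{\rm dist}:W'\to V'$, $\langle\operatorname{div}_{\rm dist}\alpha,v\rangle_{V',V}=-\langle\alpha,dv\rangle_{W',W}$ for $v\in V$; $(\operatorname{div}S)_{\rm dist}:\Sigma\to W'$, $\langle(\operatorname{div}S)_{\rm dist}\sigma,\alpha\rangle_{W',W}=-c_h(g;\sigma,\alpha)$ for $\alpha\in W$; $(\operatorname{div}\operatorname{div}S)_{\rm dist}=\operatorname{div}_{\rm dist}(\operatorname{div}S)_{\rm dist}$. $\operatorname{div}_h:W_h^{r+1}\to V_h^{r+1}$, $\langle\operatorname{div}_h\alpha,v\rangle_{g_h,\mathcal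 S}=-\langle\alpha,dv\rangle_{g_h,\mathcal S}$ for $v\in V_h^{r+1}$; $(\operatorname{div}S)_h:\Sigma_h^r\to W_h^{r+1}$, $\langle(\operatorname{div}S)_h\sigma,\alpha\rangle_{g_h,\mathcal S}=-c_h(g_h;\sigma,\alpha)$ for $\alpha\in W_h^{r+1}$; $(\operatorname{div}\operatorname{div}S)_h=\operatorname{div}_h(\operatorname{div}S)_h$. Projections: $\pi_h^V:V'\to V_h^{r+1}$, $\langle\pi_h^Vu,v\rangle_{g_h,\mathcal S}=\langle u,v\rangle_{V',V}$ for $v\in V_h^{r+1}$; $\pi_h^W:W'\to W_h^{r+1}$, $\langle\pi_h^W\alpha,\beta\rangle_{g_h,\mathcal S}=\langle\alpha,\beta\rangle_{W',W}$ for $\beta\in W_h^{r+1}$; $\pi_h^\Sigma:\Sigma\to\Sigma_h^r$ is determined by $\langle\pi_h^\Sigma\sigma-\sigma,\rho\rangle_{\overline g_h,T}=0$ for all $\rho\in\mathcal P_{r-1}S_2^0(T)$, $T\in\mathcal T_h$, and $\langle(\pi_h^\Sigma\sigma)(\overline\tau_h,\overline\tau_h)-\sigma(\overline\tau_h,\overline\tau_h),v\rangle_{\overline g_h,e}=0$ for all $v\in\mathcal P_r(e)$, $e\in\mathcal E_h$, where $\overline\tau_h$ is the $\overline g_h$-unit tangent. If $\mathcal S$ triangulates a planar domain $\Omega\subset\mathbb R^2$ and $g$ is smooth: $U=\{u\in H^1(\Omega)\otimes\mathbb R^2: u|_T\in H^2(T)\otimes\mathbb R^2\ \forall T\}$,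 $U_h^{r+1}=\{u\in U: u|_T\in\mathcal P_{r+1}(T)\otimes\mathbb R^2\ \forall T\}$, $\operatorname{def}u=\frac12\mathcal L_ug$ ($\mathcal L$ the Lie derivative), a map $U\to\Sigma$; and $\pi_h^U:U\to U_h^{r+1}$ is determined by $\langle\pi_h^Uu-u,v\rangle_{\overline g_h,T}=0$ for $v\in\mathcal P_{r-2}(T)\otimes\mathbb R^2$, $T\in\mathcal T_h$; $\langle\pi_h^Uu-u,v\rangle_{\overline g_h,e}=0$ for $v\in\mathcal P_{r-1}(e)\otimes\mathbb R^2$, $e\in\mathcal E_h$; and $\pi_h^Uu(z)=u(z)$ for $z\in\mathcal V_h$. *)

(* Defs.v *)
From mathcomp Require Import all_boot all_order all_algebra.
From mathcomp Require Import all_classical all_reals all_analysis.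

Set Implicit Arguments.
Unset Strict Implicit.
Unset Printing Implicit Defensive.

Import Order.TTheory GRing.Theory Num.Theory.
Import numFieldNormedType.Exports.

Local Open Scope classical_set_scope.
Local Open Scope ring_scope.

(* Fields are given by their components, with
    respect to affine coordinates: one-forms and vectors are rows ['rV_2],
    (0,2)-tensors are matrices ['M_2]. *)

Definition plane_measure (R : realType) :=
  ((@lebesgue_measure R) \x (@lebesgue_measure R))%E.
Arguments plane_measure : clear implicits.

Definition unit_vec (R : realType) (i : 'I_2) : R * R :=
  ((i == 0)%:R, (i == 1)%:R).
Arguments unit_vec : clear implicits.

Definition row_of (R : realType) (p : R * R) : 'rV[R]_2 :=
  \row_i (if i == 0 then p.1 else p.2).

Definition pderiv (R : realType) (i : 'I_2) (f : R * R -> R) : R * R -> R :=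
  fun p => 'D_(unit_vec R i) f p.

Definition pderivs (R : realType) (w : seq 'I_2) (f : R * R -> R) :=
  foldr (@pderiv R) f w.

Definition smooth (R : realType) (f : R * R -> R) : Prop :=
  forall w : seq 'I_2, continuous (pderivs w f : R * R -> R) /\
    forall (i : 'I_2) (p : R * R), derivable (pderivs w f) p (unit_vec R i).

(* For a closed triangle A: smooth up to the boundary. *)
Definition smooth_on (R : realType) (A : set (R * R)) (f : R * R -> R) : Prop :=
  exists2 F, smooth F & forall p, A p -> f p = F p.

(* [sobolev k A] is H^k(A) as the completion
    of C^oo(closure A) in the H^k norm, realized inside L^2(A); on a triangle
    this is the same space as the one defined by weak derivatives.  Elements
    are representatives: every notion below only depends on the values a.e.
    in A. The integrals are taken in the extended reals, so that a divergent
    one does not count as 0. *)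

Definition L2_cvg (R : realType) (A : set (R * R)) (f : nat -> R * R -> R)
    (u : R * R -> R) : Prop :=
  (fun n => \int[plane_measure R]_(p in A) ((f n p - u p) ^+ 2)%:E)%E
    @ \oo --> (0 : \bar R)%E.

Definition sobolev (R : realType) (k : nat) (A : set (R * R))
    (u : R * R -> R) : Prop :=
  exists f : nat -> R * R -> R, exists D : seq 'I_2 -> R * R -> R,
    [/\ D [::] = u, forall n, smooth (f n) &
      forall w, (size w <= k)%N ->
        measurable_fun A (D w) /\ L2_cvg A (fun n => pderivs w (f n)) (D w)].

Definition weak_pderiv (R : realType) (A : set (R * R)) (i : 'I_2)
    (u : R * R -> R) : R * R -> R :=
  get [set G | measurable_fun A G /\
    exists f : nat -> R * R -> R, [/\ forall n, smooth (f n), L2_cvg A f u &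
      L2_cvg A (fun n => pderiv i (f n)) G]].

Definition test_function (R : realType) (A : set (R * R)) (phi : R * R -> R) :
    Prop :=
  smooth phi /\ exists K : set (R * R),
    [/\ compact K, K `<=` A & forall p, ~ K p -> phi p = 0].

Definition square_integrable (R : realType) (A : set (R * R))
    (u : R * R -> R) : Prop :=
  measurable_fun A u /\
  (\int[plane_measure R]_(p in A) ((u p) ^+ 2)%:E < +oo)%E.

(* On a planar domain, H^1 by weak derivatives. *)
Definition H1_domain (R : realType) (A : set (R * R)) (u : R * R -> R) : Prop :=
  square_integrable A u /\
  forall i : 'I_2, exists2 G, square_integrable A G &
    forall phi, test_function A phi ->
      \int[plane_measure R]_(p in A) (u p * pderiv i phi p) =
      - \int[plane_measure R]_(p in A) (G p * phi p).

(* As for [size] of a [{poly R}], the bound [n] is strict: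
    [is_poly n] is P_(n-1), and [is_poly 0] is the zero space.  Hence P_r,
    P_(r-1), P_(r-2) are obtained with [r.+1], [r], [r.-1]. *)

Definition is_poly (R : realType) (n : nat) (f : R * R -> R) : Prop :=
  exists c : nat -> nat -> R, forall p,
    f p = \sum_(i < n) \sum_(j < n - i) c i j * p.1 ^+ i * p.2 ^+ j.

Definition poly_on (R : realType) (n : nat) (A : set (R * R))
    (f : R * R -> R) : Prop :=
  exists2 F, is_poly n F &
    \forall p \ae plane_measure R, A p -> f p = F p.

(* A finite simplicial complex of triangles.  The vertices
    of each triangle are listed in positive cyclic order.  The condition on
    directed edges says that an edge lies in at most two triangles and that
    these induce opposite orientations on it; the last one says that the link
    of each vertex is connected (hence a circle or an arc), so that the
    complex is an oriented surface with boundary.  [corner t] gives affine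
    coordinates on [t]: it identifies [t], preserving orientation, with a
    nondegenerate triangle of the plane. *)

Record triangulation (R : realType) := Triangulation {
  vert : finType;
  tri : finType;
  vtx : tri -> 'I_3 -> vert;
  corner : tri -> 'I_3 -> R * R;
  _ : forall t, injective (vtx t);
  _ : injective (fun t => [set vtx t k | k : 'I_3]%SET);
  _ : forall z, exists t, exists k, vtx t k = z;
  _ : injective (fun h : tri * 'I_3 => (vtx h.1 (h.2 + 1), vtx h.1 (h.2 + 2)));
  _ : forall z t t', z \in codom (vtx t) -> z \in codom (vtx t') ->
        connect [rel s s' |
          [&& z \in codom (vtx s), z \in codom (vtx s') &
            (1 < #|[set vtx s k | k : 'I_3]%SET :&:
                   [set vtx s' k | k : 'I_3]%SET|)%N]] t t';
  _ : forall t, 0 < \det (\matrix_(i < 2, j < 2)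
        (row_of (corner t (lift ord0 i)) - row_of (corner t ord0)) 0 j)
}.

Arguments vtx {R} _ _ _.
Arguments corner {R} _ _ _.

Definition triangle (R : realType) (S : triangulation R) (t : tri S) :
    set (R * R) :=
  [set p | exists l : 'I_3 -> R, [/\ forall k, 0 <= l k, \sum_k l k = 1 &
                                    p = \sum_k l k *: corner S t k]].

Definition open_triangle (R : realType) (S : triangulation R) (t : tri S) :
    set (R * R) := interior (triangle t).

(* (t, k) is the edge of t opposite to vertex k, seen from t. *)
Definition side (R : realType) (S : triangulation R) := (tri S * 'I_3)%type.

(* Positively oriented traversal of the boundary of h.1, for s in [0, 1]. *)
Definition side_point (R : realType) (S : triangulation R) (h : side S)
    (s : R) : R * R :=
  (1 - s) *: corner S h.1 (h.2 + 1) + s *: corner S h.1 (h.2 + 2).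

Definition side_vec (R : realType) (S : triangulation R) (h : side S) :
    'rV[R]_2 :=
  row_of (corner S h.1 (h.2 + 2)) - row_of (corner S h.1 (h.2 + 1)).

(* The two sides of an interior edge are traversed in opposite directions: the
   point of parameter s on one has parameter 1 - s on the other. *)
Definition twin (R : realType) (S : triangulation R) (h h' : side S) : bool :=
  (vtx S h.1 (h.2 + 1) == vtx S h'.1 (h'.2 + 2)) &&
  (vtx S h.1 (h.2 + 2) == vtx S h'.1 (h'.2 + 1)).

Definition boundary_side (R : realType) (S : triangulation R) (h : side S) :
    bool := [forall h' : side S, ~~ twin h h'].

(* The edges of S, each represented by exactly one of its sides. *)
Definition edges (R : realType) (S : triangulation R) : {set side S} :=
  [set h | [forall h' : side S, twin h h' ==> (enum_rank h < enum_rank h')%N]]%SET.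

Definition jump (R : realType) (S : triangulation R) (q : side S -> R -> R)
    (h : side S) (s : R) : R :=
  q h s + \sum_(h' : side S | twin h h') q h' (1 - s).

(* The restriction to a side, extended by continuity from
    C^oo(closure T) to H^1(T), with values in L^2 of the side. *)

Definition is_trace (R : realType) (S : triangulation R) (h : side S)
    (u : R * R -> R) (w : R -> R) : Prop :=
  measurable_fun (`[0, 1] : set R) w /\
  exists f : nat -> R * R -> R, exists G : 'I_2 -> R * R -> R,
    [/\ forall n, smooth (f n),
        L2_cvg (open_triangle h.1) f u,
        forall i, measurable_fun (open_triangle h.1) (G i) /\
          L2_cvg (open_triangle h.1) (fun n => pderiv i (f n)) (G i) &
        (fun n => \int[@lebesgue_measure R]_(s in `[0%R, 1%R])
           ((f n (side_point h s) - w s) ^+ 2)%:E)%E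
          @ \oo --> (0 : \bar R)%E].

Definition edge_trace (R : realType) (S : triangulation R) (h : side S)
    (u : R * R -> R) : R -> R := get [set w | is_trace h u w].

Definition scal_field (R : realType) (S : triangulation R) :=
  tri S -> R * R -> R.
Definition form_field (R : realType) (S : triangulation R) :=
  tri S -> R * R -> 'rV[R]_2.
Definition tens_field (R : realType) (S : triangulation R) :=
  tri S -> R * R -> 'M[R]_2.

Definition form_trace (R : realType) (S : triangulation R)
    (alpha : form_field S) (h : side S) (x : 'rV[R]_2) (s : R) : R :=
  \sum_j edge_trace h (fun p => alpha h.1 p 0 j) s * x 0 j.

Definition tens_trace (R : realType) (S : triangulation R)
    (sigma : tens_field S) (h : side S) (x y : 'rV[R]_2) (s : R) : R :=
  \sum_i \sum_j edge_trace h (fun p => sigma h.1 p i j) s * x 0 i * y 0 j.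

(* The pullback of a one-form to an edge changes
    sign with the direction of the edge; that of a (0,2)-tensor does not.
    As H^2(T) embeds in C^0(T) for T closed, an element of V is represented by
    its continuous representative on each closed triangle. *)

Definition V_space (R : realType) (S : triangulation R) : set (scal_field S) :=
  [set v : scal_field S | [/\ forall t, sobolev 2 (open_triangle t) (v t),
    forall t, {within triangle t, continuous (v t)},
    forall h h' : side S, twin h h' -> forall s, s \in `[0, 1] ->
      v h.1 (side_point h s) = v h'.1 (side_point h' (1 - s)) &
    forall h : side S, boundary_side h -> forall s, s \in `[0, 1] ->
      v h.1 (side_point h s) = 0]].

Definition W_space (R : realType) (S : triangulation R) : set (form_field S) :=
  [set alpha : form_field S |
   [/\ forall t j, sobolev 1 (open_triangle t) (fun p => alpha t p 0 j),
    forall h h' : side S, twin h h' ->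
      \forall s \ae (@lebesgue_measure R), s \in `[0, 1] ->
        form_trace alpha h (side_vec h) s =
        - form_trace alpha h' (side_vec h') (1 - s) &
    forall h : side S, boundary_side h ->
      \forall s \ae (@lebesgue_measure R), s \in `[0, 1] ->
        form_trace alpha h (side_vec h) s = 0]].

Definition Sigma_space (R : realType) (S : triangulation R) :
    set (tens_field S) :=
  [set sigma : tens_field S |
   [/\ forall t i j, sobolev 1 (open_triangle t) (fun p => sigma t p i j),
    forall t, \forall p \ae plane_measure R,
      open_triangle t p -> (sigma t p)^T = sigma t p &
    forall h h' : side S, twin h h' ->
      \forall s \ae (@lebesgue_measure R), s \in `[0, 1] ->
        tens_trace sigma h (side_vec h) (side_vec h) s =
        tens_trace sigma h' (side_vec h') (side_vec h') (1 - s)]].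

(* The finite element spaces V_h^(r+1), W_h^(r+1), Sigma_h^r. *)
Definition Vh_space (R : realType) (S : triangulation R) (r : nat) :
    set (scal_field S) :=
  [set v : scal_field S | V_space v /\ forall t, poly_on r.+2 (open_triangle t) (v t)].

Definition Wh_space (R : realType) (S : triangulation R) (r : nat) :
    set (form_field S) :=
  [set alpha : form_field S | [/\ W_space alpha,
    forall t j, poly_on r.+2 (open_triangle t) (fun p => alpha t p 0 j) &
    forall t, poly_on r.+2 (open_triangle t)
      (fun p => \sum_j row_of p 0 j * alpha t p 0 j)]].

Definition Sigmah_space (R : realType) (S : triangulation R) (r : nat) :
    set (tens_field S) :=
  [set sigma : tens_field S | Sigma_space sigma /\
    forall t i j, poly_on r.+1 (open_triangle t) (fun p => sigma t p i j)].

Definition bilin (R : realType) (x : 'rV[R]_2) (G : 'M[R]_2) (y : 'rV[R]_2) :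
    R := (x *m G *m y^T) 0 0.

Definition regge_metric (R : realType) (S : triangulation R) :
    set (tens_field S) :=
  [set g : tens_field S | [/\ forall t i j, smooth_on (triangle t) (fun p => g t p i j),
    forall t p, triangle t p -> (g t p)^T = g t p /\
      forall x : 'rV[R]_2, x != 0 -> 0 < bilin x (g t p) x &
    forall h h' : side S, twin h h' -> forall s, s \in `[0, 1] ->
      bilin (side_vec h) (g h.1 (side_point h s)) (side_vec h) =
      bilin (side_vec h') (g h'.1 (side_point h' (1 - s))) (side_vec h')]].

Definition regge_metric_h (R : realType) (S : triangulation R) (r : nat) :
    set (tens_field S) :=
  [set g : tens_field S | regge_metric g /\
    forall t i j, poly_on r.+1 (open_triangle t) (fun p => g t p i j)].

Definition metric_eq (R : realType) (S : triangulation R)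
    (g g' : tens_field S) : Prop :=
  forall t p, triangle t p -> g t p = g' t p.

Definition density (R : realType) (S : triangulation R) (g : tens_field S)
    (t : tri S) (p : R * R) : R := Num.sqrt (\det (g t p)).

Definition tri_int (R : realType) (S : triangulation R) (g : tens_field S)
    (t : tri S) (f : R * R -> R) : R :=
  \int[plane_measure R]_(p in open_triangle t) (f p * density g t p).

(* g^{ik} g^{jl} A_ij B_kl *)
Definition tens_dot (R : realType) (G A B : 'M[R]_2) : R :=
  \tr (invmx G *m A *m invmx G *m B^T).

Definition scal_inner (R : realType) (S : triangulation R) (g : tens_field S)
    (v w : scal_field S) : R :=
  \sum_t tri_int g t (fun p => v t p * w t p).

Definition form_inner (R : realType) (S : triangulation R) (g : tens_field S)
    (alpha beta : form_field S) : R :=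
  \sum_t tri_int g t (fun p => bilin (alpha t p) (invmx (g t p)) (beta t p)).

Definition S_op (R : realType) (G A : 'M[R]_2) : 'M[R]_2 :=
  A - \tr (invmx G *m A) *: G.

(* christoffel g t p k i j = Gamma^k_ij *)
Definition christoffel (R : realType) (S : triangulation R) (g : tens_field S)
    (t : tri S) (p : R * R) (k i j : 'I_2) : R :=
  2^-1 * \sum_l invmx (g t p) k l *
    (pderiv i (fun q => g t q j l) p + pderiv j (fun q => g t q i l) p
     - pderiv l (fun q => g t q i j) p).

Definition cov_deriv (R : realType) (S : triangulation R) (g : tens_field S)
    (alpha : form_field S) : tens_field S :=
  fun t p => \matrix_(i, j)
    (weak_pderiv (open_triangle t) i (fun q => alpha t q 0 j) p
     - \sum_k christoffel g t p k i j * alpha t p 0 k).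

Definition speed (R : realType) (S : triangulation R) (g : tens_field S)
    (h : side S) (s : R) : R :=
  Num.sqrt (bilin (side_vec h) (g h.1 (side_point h s)) (side_vec h)).

Definition unit_tangent (R : realType) (S : triangulation R) (g : tens_field S)
    (h : side S) (s : R) : 'rV[R]_2 := (speed g h s)^-1 *: side_vec h.

(* The normal is determined by g(n, .) = omega(., tau): it is of length one,
   orthogonal to tau, and omega(n, tau) = 1.  It points outwards since the
   boundary is traversed positively. *)
Definition unit_normal (R : realType) (S : triangulation R) (g : tens_field S)
    (h : side S) (s : R) : 'rV[R]_2 :=
  let tau := unit_tangent g h s in
  density g h.1 (side_point h s) *:
    ((\row_j (if j == 0 then tau 0 1 else - tau 0 0))
       *m invmx (g h.1 (side_point h s))).

Definition edge_int (R : realType) (S : triangulation R) (g : tens_field S)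
    (h : side S) (f : R -> R) : R :=
  \int[@lebesgue_measure R]_(s in `[0, 1]) (f s * speed g h s).

(* On an interior edge, sigma(tau, tau) and ds are the same seen from both
   sides; they are taken from the side representing the edge. *)
Definition c_h (R : realType) (S : triangulation R) (g sigma : tens_field S)
    (alpha : form_field S) : R :=
  \sum_t tri_int g t (fun p =>
     tens_dot (g t p) (S_op (g t p) (sigma t p)) (cov_deriv g alpha t p))
  + \sum_(h in edges S) edge_int g h (fun s =>
      tens_trace sigma h (unit_tangent g h s) (unit_tangent g h s) s *
      jump (fun h' s' => form_trace alpha h' (unit_normal g h' s') s') h s).

(* The norm of the product of the H^1(T). *)

Definition W_norm (R : realType) (S : triangulation R) (alpha : form_field S) :
    R :=
  Num.sqrt (\sum_t \sum_j
    (\int[plane_measure R]_(p in open_triangle t) (alpha t p 0 j) ^+ 2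
     + \sum_i \int[plane_measure R]_(p in open_triangle t)
         (weak_pderiv (open_triangle t) i (fun q => alpha t q 0 j) p) ^+ 2)).

Definition W_dual (R : realType) (S : triangulation R) :
    set (form_field S -> R) :=
  [set l : form_field S -> R |
   (forall (a : R) (alpha beta : form_field S), W_space alpha -> W_space beta ->
      l (fun t p => a *: alpha t p + beta t p) = a * l alpha + l beta) /\
   exists C : R, forall alpha, W_space alpha -> `|l alpha| <= C * W_norm alpha].

(* Functionals on V (or W) are functions of which only the values on V (or W)
   are relevant.  An operator determined by a variational problem is the chosen
   ([get]) solution of that problem; the solution is unique (a.e. for one-forms
   and tensors). *)

Definition ext_d (R : realType) (S : triangulation R) (v : scal_field S) :
    form_field S :=
  fun t p => \row_j weak_pderiv (open_triangle t) j (v t) p.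

Definition div_dist (R : realType) (S : triangulation R)
    (l : form_field S -> R) : scal_field S -> R :=
  fun v => - l (ext_d v).

Definition divS_dist (R : realType) (S : triangulation R) (g sigma : tens_field S)
    : form_field S -> R :=
  fun alpha => - c_h g sigma alpha.

Definition divdivS_dist (R : realType) (S : triangulation R)
    (g sigma : tens_field S) : scal_field S -> R :=
  div_dist (divS_dist g sigma).

Definition div_h (R : realType) (S : triangulation R) (r : nat)
    (gh : tens_field S) (alpha : form_field S) : scal_field S :=
  get [set w : scal_field S | Vh_space r w /\ forall v, Vh_space r v ->
    scal_inner gh w v = - form_inner gh alpha (ext_d v)].

Definition divS_h (R : realType) (S : triangulation R) (r : nat)
    (gh sigma : tens_field S) : form_field S :=
  get [set beta : form_field S | Wh_space r beta /\ forall alpha, Wh_space r alpha ->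
    form_inner gh beta alpha = - c_h gh sigma alpha].

Definition divdivS_h (R : realType) (S : triangulation R) (r : nat)
    (gh sigma : tens_field S) : scal_field S :=
  div_h r gh (divS_h r gh sigma).

Definition pi_V (R : realType) (S : triangulation R) (r : nat)
    (gh : tens_field S) (l : scal_field S -> R) : scal_field S :=
  get [set w : scal_field S | Vh_space r w /\ forall v, Vh_space r v ->
    scal_inner gh w v = l v].

Definition pi_W (R : realType) (S : triangulation R) (r : nat)
    (gh : tens_field S) (l : form_field S -> R) : form_field S :=
  get [set alpha : form_field S | Wh_space r alpha /\ forall beta, Wh_space r beta ->
    form_inner gh alpha beta = l beta].

Definition pi_Sigma (R : realType) (S : triangulation R) (r : nat)
    (gbar sigma : tens_field S) : tens_field S :=
  get [set sh : tens_field S | [/\ Sigmah_space r sh,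
    forall (t : tri S) (rho : R * R -> 'M[R]_2),
      (forall i j, is_poly r (fun p => rho p i j)) ->
      (forall p, (rho p)^T = rho p) ->
      tri_int gbar t (fun p =>
        tens_dot (gbar t p) (sh t p - sigma t p) (rho p)) = 0 &
    forall h : side S, h \in edges S -> forall v : {poly R}, (size v <= r.+1)%N ->
      edge_int gbar h (fun s =>
        let tau := unit_tangent gbar h s in
        (tens_trace sh h tau tau s - tens_trace sigma h tau tau s) * v.[s])
      = 0]].

(* The coordinates of the triangles come from positions
    of the vertices in the plane, and triangles only meet along common faces. *)

Definition planar (R : realType) (S : triangulation R) : Prop :=
  exists P : vert S -> R * R,
    (forall t k, corner S t k = P (vtx S t k)) /\
    forall t t' p, triangle t p -> triangle t' p ->
      exists l : vert S -> R,
        [/\ forall z, 0 <= l z,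
            forall z, l z != 0 -> (z \in codom (vtx S t)) && (z \in codom (vtx S t')),
            \sum_z l z = 1 &
            p = \sum_z l z *: P z].

Definition domain (R : realType) (S : triangulation R) : set (R * R) :=
  interior (\bigcup_(t in [set: tri S]) triangle t).

Definition euclidean (R : realType) (S : triangulation R) : tens_field S :=
  fun _ _ => 1%:M.
Arguments euclidean {R} S.

(* As for V, an element of U is represented by its continuous representative. *)
Definition U_space (R : realType) (S : triangulation R) :
    set (R * R -> 'rV[R]_2) :=
  [set u : R * R -> 'rV[R]_2 | [/\ forall j, H1_domain (domain S) (fun p => u p 0 j),
    forall t j, sobolev 2 (open_triangle (S := S) t) (fun p => u p 0 j) &
    forall t j, {within triangle (S := S) t, continuous (fun p => u p 0 j)}]].

Definition Uh_space (R : realType) (S : triangulation R) (r : nat) :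
    set (R * R -> 'rV[R]_2) :=
  [set u : R * R -> 'rV[R]_2 | U_space S u /\
    forall t j, poly_on r.+2 (open_triangle (S := S) t) (fun p => u p 0 j)].

(* (L_u g)_ij = u^k d_k g_ij + g_kj d_i u^k + g_ik d_j u^k *)
Definition def_op (R : realType) (S : triangulation R) (g : tens_field S)
    (u : R * R -> 'rV[R]_2) : tens_field S :=
  fun t p => \matrix_(i, j) (2^-1 * \sum_k
    (u p 0 k * pderiv k (fun q => g t q i j) p
     + g t p k j * weak_pderiv (open_triangle t) i (fun q => u q 0 k) p
     + g t p i k * weak_pderiv (open_triangle t) j (fun q => u q 0 k) p)).

Definition pi_U (R : realType) (S : triangulation R) (r : nat)
    (gbar : tens_field S) (u : R * R -> 'rV[R]_2) : R * R -> 'rV[R]_2 :=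
  get [set uh : R * R -> 'rV[R]_2 | [/\ Uh_space S r uh,
    forall (t : tri S) (v : R * R -> 'rV[R]_2),
      (forall j, is_poly r.-1 (fun p => v p 0 j)) ->
      tri_int gbar t (fun p => bilin (uh p - u p) (gbar t p) (v p)) = 0,
    forall h : side S, h \in edges S ->
      forall v : 'I_2 -> {poly R}, (forall j, (size (v j) <= r)%N) ->
      edge_int gbar h (fun s => \sum_j
        (uh (side_point h s) - u (side_point h s)) 0 j * (v j).[s]) = 0 &
    forall (t : tri S) (k : 'I_3), uh (corner S t k) = u (corner S t k)]].

(* Main.v *)
(** Parts 1 and 2.  Both sides are the chosen solution of a variational problem
    in V_h, and it suffices that the two problems coincide.  As d maps V_h into
    W_h, this follows from the defining equations of pi_W, div_h and (div S)_h,
    once these are known to be solvable: Riesz representation on the coefficients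
    of polynomials, modulo equality almost everywhere.  For part 2 one also needs
    c_h(pi_Sigma sigma, dv) = c_h(sigma, dv).  For a piecewise constant metric
    the Christoffel symbols vanish, so that <S sigma, nabla dv> pairs sigma with
    a symmetric tensor of degree r - 1 and the edge terms pair sigma(tau, tau)
    with a polynomial of degree r, and these pairings only see the degrees of
    freedom of sigma.

    Part 3.  A symmetric tensor sigma is determined by its values
    s_k = sigma(x_k, x_k) on the edge vectors x_k of a triangle, and in the s_k
    the degrees of freedom decouple: moments of s_k of degree r - 1 in the
    triangle and of degree r on the edge k.  For sigma = def u, s_k is the
    derivative of u . x_k along x_k, so integration by parts expresses its
    moments through vertex values, edge moments of degree r - 1 and interior
    moments of degree r - 2 of u, which pi_U preserves.  Hence def (pi_U u) and
    pi_Sigma (def u) have the same degrees of freedom, and these determine an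
    element of Sigma_h^r.  The integrations by parts are justified for H^2
    functions by approximation, using the trace inequality and the sup bound in
    H^2; tangential continuity of def u comes from the absolute continuity of u
    along edges.  The interpolant pi_U u is assembled from vertex values, edge
    bubbles and interior bubbles; it is in H^1 of the domain because in Green's
    formula the contributions of twin sides cancel, and the test functions vanish
    on boundary sides. *)

From HB Require Import structures.
From mathcomp Require Import all_boot all_order all_algebra.
From mathcomp Require Import all_classical all_reals all_analysis measurable_realfun.
From mathcomp Require Import ring lra.
Require Import Defs.

Set Implicit Arguments.
Unset Strict Implicit.
Unset Printing Implicit Defensive.

Import Order.TTheory GRing.Theory Num.Theory.
Import numFieldNormedType.Exports.

Local Open Scope classical_set_scope.
Local Open Scope ring_scope.

(** * Affine maps and functions of class C1 in the plane *)

(** Every function is a representative up to null sets, and every operator is a choice by [get];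
    this raises two obstacles. First, [weak_pderiv] and [edge_trace] pick one limit among those of
    all smooth approximations. They are meaningful only because the gradient is closable and the
    trace is bounded, and both facts come from Green's formula for C1 functions on a single
    triangle. Second, a chosen solution can be exploited only once the problem is known to be
    solvable. The bilinear forms are degenerate on coefficients, so the representation lemma asks
    the functional to vanish on the null vectors of the form. In parts 1 and 2 the two solution sets
    in V_h are the same set, so the chosen elements agree at every point. In part 3 the two sides
    solve different problems, and uniqueness up to null sets identifies them. The interior moments
    stop at degree r - 1 for tensors and r - 2 for vector fields because a polynomial of degree r
    that vanishes on a side is divisible by one barycentric coordinate, and one of degree r + 1 that
    vanishes on the boundary is divisible by the cubic bubble: the quotients have exactly these
    degrees. *)

Notation plane R := (measurableTypeR R * measurableTypeR R)%type.

(** [plane_measure] is a constant that unfolds to a product; with this instance the lemmas on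
    measures accept it under its own name. *)
HB.instance Definition _ (R : realType) :=
  Measure.copy (plane_measure R : set (plane R) -> \bar R)
    (@lebesgue_measure R \x @lebesgue_measure R)%E.

(** Boxes with rational corners are countably many, which makes open sets measurable for the product
    structure. *)
Lemma open_subball_rat_prod (R : realType) (A : set (R * R)) (p : R * R) :
  open A -> A p -> exists a b c d : rat,
    (`]ratr a, ratr b[ `*` `]ratr c, ratr d[) p /\
    `]ratr a, ratr b[%classic `*` `]ratr c, ratr d[%classic `<=` A.
Proof.
move=> oA Ap; have /nbhs_ballP[e /= e0 Ae] := open_nbhs_nbhs (conj oA Ap).
have ratl (x : R) : exists2 q : rat, x - e < ratr q & ratr q < x.
  have /rat_in_itvoo[q] : x - e < x by lra.
  by rewrite in_itv/= => /andP[]; exists q.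
have ratu (x : R) : exists2 q : rat, x < ratr q & ratr q < x + e.
  have /rat_in_itvoo[q] : x < x + e by lra.
  by rewrite in_itv/= => /andP[]; exists q.
have [a a1 a2] := ratl p.1; have [b b1 b2] := ratu p.1.
have [c c1 c2] := ratl p.2; have [d d1 d2] := ratu p.2.
exists a, b, c, d; split; first by split; rewrite /= in_itv/= ?a2 ?c2.
move=> [x y] /= [] /=; rewrite !in_itv/= => /andP[x1 x2] /andP[y1 y2].
apply: Ae; split; rewrite /ball/= ltr_norml; apply/andP; split; lra.
Qed.

Lemma open_measurable_prod (R : realType) (A : set (R * R)) :
  open A -> measurable A.
Proof.
move=> oA; pose B (q : (rat * rat) * (rat * rat)) : set (R * R) :=
  `]ratr q.1.1, ratr q.1.2[%classic `*` `]ratr q.2.1, ratr q.2.2[%classic.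
(* Boxes that leave [A] are replaced by the empty set, so that the union runs over a whole countable
   type. *)
pose B' q := if pselect (B q `<=` A) then B q else set0.
have -> : A = \bigcup_q B' q.
  apply/seteqP; split => [p Ap|p [q _]]; last first.
    by rewrite /B'; case: pselect => // /[apply].
  have [a [b [c [d [Bp BA]]]]] := open_subball_rat_prod oA Ap.
  by exists ((a, b), (c, d)) => //; rewrite /B'; case: pselect.
apply: countable_bigcupT_measurable; first exact: countableP.
move=> q; rewrite /B'; case: pselect => [?|?]; last exact: measurable0.
by apply: measurableX; exact: measurable_itv.
Qed.

Lemma closed_measurable_prod (R : realType) (A : set (R * R)) :
  closed A -> measurable A.
Proof.
move=> /closed_openC oA; rewrite -(setCK A); apply: measurableC.
exact: open_measurable_prod oA.
Qed.

Lemma continuous_measurable_prod (R : realType) (f : R * R -> R) (A : set (R * R)) :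
  measurable A -> continuous f -> measurable_fun A f.
Proof.
move=> mA /continuousP cf; apply: (measurability _ (RGenOpens.measurableE R)).
move=> _ [_ [a [b ->] <-]]; apply: measurableI; last first.
  by apply: open_measurable_prod; apply: cf; apply: interval_open.
exact: mA.
Qed.


Definition push_measure d1 d2 (T1 : measurableType d1) (T2 : measurableType d2)
    (R : realType) (mu : {measure set T1 -> \bar R}) (f : T1 -> T2)
    (mf : measurable_fun setT f) : {measure set T2 -> \bar R} :=
  measure_function_pushforward__canonical__measure_function_Measure mu mf.

(** Lebesgue measure is determined by its values on half-open intervals, and the rescaled
    pushforward under the affine map has the same values there. *)
Lemma lebesgue_affine (R : realType) (c d : R) (B : set R) :
  c != 0%R -> measurable B ->
  (@lebesgue_measure R B =
  `|c|%:E * @lebesgue_measure R ((fun y => c * y + d)%R @^-1` B))%E.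
Proof.
move=> c0 mB.
have mf : measurable_fun [set: measurableTypeR R] (fun y => c * y + d : measurableTypeR R).
  by apply: measurable_funD => //; apply: measurable_funM => //.
pose m := mscale (NngNum (normr_ge0 c)) (push_measure (@lebesgue_measure R) mf).
have := @lebesgue_measure_unique R m _ _ mB; apply.
move=> _ [[a b]] _ <-; rewrite /m/= /mscale/= /push_measure/= /pushforward.
have [c1|c1|c1] := ltgtP c 0; last by rewrite c1 eqxx in c0.
(* For [c < 0] the preimage is half-open on the other side; only its length matters. *)
- have -> : (fun y : R => c * y + d) @^-1` `]a, b]%classic = `[(b - d) / c, (a - d) / c[%classic.
    apply/seteqP; split => y /=; rewrite !in_itv/= ler_ndivrMr// ltr_ndivlMr// => /andP[]? ?;
      apply/andP; split; lra.
  rewrite !lebesgue_measure_itv/= !lte_fin.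
  rewrite ltr_ndivrMr// divfK// ltrD2r ltr0_norm//.
  case: ifP => _; last by rewrite mule0.
  by rewrite -!EFinB -EFinM; congr EFin; field.
- have -> : (fun y : R => c * y + d) @^-1` `]a, b]%classic = `](a - d) / c, (b - d) / c]%classic.
    apply/seteqP; split => y /=; rewrite !in_itv/= ltr_pdivrMr// ler_pdivlMr// => /andP[]? ?;
      apply/andP; split; lra.
  rewrite !lebesgue_measure_itv/= !lte_fin.
  rewrite ltr_pdivrMr// divfK// ltrD2r gtr0_norm//.
  case: ifP => _; last by rewrite mule0.
  by rewrite -!EFinB -EFinM; congr EFin; field.
Qed.


(** [k] is the absolute Jacobian determinant of [phi]. The condition is stated with preimages, so
    that composition and change of variables do without inverse maps. *)
Definition scales (R : realType) (k : R) (phi : plane R -> plane R) :=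
  measurable_fun setT phi /\
  forall X, measurable X -> (plane_measure R X = k%:E * plane_measure R (phi @^-1` X))%E.

Lemma scales_comp (R : realType) (k l : R) (phi psi : plane R -> plane R) :
  scales k phi -> scales l psi -> scales (l * k) (psi \o phi).
Proof.
move=> [mp sp] [mq sq]; split; first exact: measurableT_comp.
move=> X mX; rewrite sq// sp; first by rewrite muleA EFinM.
by rewrite -[X in measurable X]setTI; exact: mq.
Qed.

Lemma scales_swap (R : realType) : scales 1 (fun p : plane R => (p.2, p.1)).
Proof.
have mf : measurable_fun [set: plane R] (fun p : plane R => (p.2, p.1) : plane R).
  exact: measurable_fun_pair.
split => // X mX; rewrite mul1e.
pose m := push_measure (plane_measure R) mf.
apply: (@product_measure_unique _ _ _ _ _ (@lebesgue_measure R) (@lebesgue_measure R) m _ X mX).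
move=> A B mA mB; rewrite /m/= /push_measure/= /pushforward.
have -> : (fun p : plane R => (p.2, p.1)) @^-1` (A `*` B) = B `*` A.
  by apply/seteqP; split => -[x y] /= [].
by rewrite [LHS]product_measure1E// muleC.
Qed.

(** By Fubini: on each vertical line the map is affine with slope [d], so each section is measured
    by [lebesgue_affine]. *)
Lemma scales_shear (R : realType) (c d f : R) : d != 0 ->
  scales `|d| (fun p : plane R => (p.1, c * p.1 + d * p.2 + f)).
Proof.
move=> d0.
have mf : measurable_fun [set: plane R] (fun p : plane R => (p.1, c * p.1 + d * p.2 + f) : plane R).
  apply: measurable_fun_pair => //.
  by apply: measurable_funD => //; apply: measurable_funD; apply: measurable_funM.
split => // X mX.
pose m := mscale (NngNum (normr_ge0 d)) (push_measure (plane_measure R) mf).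
apply: (@product_measure_unique _ _ _ _ _ (@lebesgue_measure R) (@lebesgue_measure R) m _ X mX).
move=> A B mA mB; rewrite /m/= /mscale /push_measure/= /pushforward/=.
set E := _ @^-1` _.
have mE : measurable (E : set (plane R)).
  by rewrite /E -[X in measurable X]setTI; exact: (mf _ _ (measurableX mA mB)).
rewrite /plane_measure /product_measure1 -ge0_integralZl//; last first.
  exact: measurable_fun_xsection.
transitivity (\int[@lebesgue_measure R]_x ((\1_A x)%:E * @lebesgue_measure R B))%E; last first.
  rewrite ge0_integralZr// ?integral_indic ?setIT//.
  by apply/measurable_EFinP.
apply: eq_integral => x _ /=; rewrite indicE.
have [xA|xA] := boolP (x \in A).
  rewrite mul1e [RHS](lebesgue_affine (c * x + f) d0)//.
  congr (_ * lebesgue_measure _)%E; apply/seteqP; split => y; rewrite /xsection/= inE/E/=.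
    by move=> -[_]; rewrite addrAC addrC.
  by move=> yB; split; [exact/set_mem|rewrite addrAC addrC].
rewrite (_ : xsection E x = set0) ?measure0 ?mule0 ?mul0e//.
apply/seteqP; split => // y; rewrite /xsection/= inE/E/= => -[xA' _].
by move: xA; rewrite mem_set.
Qed.

(** If the lower right entry is nonzero, the map is a shear of the second coordinate followed by one
    of the first, the latter being a shear of the second coordinate between two swaps. *)
Lemma scales_affine (R : realType) (a b c d e f : R) : a * d - b * c != 0 ->
  scales `|a * d - b * c| (fun p : plane R => (a * p.1 + b * p.2 + e, c * p.1 + d * p.2 + f)).
Proof.
have key (a' b' c' d' e' f' : R) : a' * d' - b' * c' != 0 -> d' != 0 ->
    scales `|a' * d' - b' * c'|
      (fun p : plane R => (a' * p.1 + b' * p.2 + e', c' * p.1 + d' * p.2 + f')).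
  move=> D0 d0.
  have s1 := scales_shear c' f' d0.
  have D1 : (a' * d' - b' * c') / d' != 0 by rewrite mulf_neq0 ?invr_eq0.
  have s2 := scales_shear (b' / d') (e' - b' * f' / d') D1.
  have := scales_comp (scales_comp (scales_comp s1 (scales_swap R)) s2) (scales_swap R).
  rewrite !mul1r normf_div divfK ?normr_eq0//; congr scales.
  by apply/funext => -[x y]/=; congr pair; field.
(* If [d = 0], then [b] is nonzero, and exchanging the two output coordinates reduces to the
   previous case. *)
move=> D0; have [d0|d0] := eqVneq d 0; last exact: key.
have b0 : b != 0 by apply: contraNneq D0 => ->; rewrite d0 mulr0 mul0r subrr.
have D1 : c * b - d * a != 0 by rewrite d0 mul0r subr0; move: D0; rewrite d0 mulr0 sub0r oppr_eq0 mulrC.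
have := scales_comp (key c d a b f e D1 b0) (scales_swap R).
by rewrite mul1r distrC; congr scales; congr Num.norm; ring.
Qed.

Lemma ge0_integral_scales (R : realType) (k : R) (phi : plane R -> plane R)
    (D : set (plane R)) (F : plane R -> \bar R) :
  0 <= k -> scales k phi -> measurable D -> measurable_fun D F ->
  (forall p, D p -> (0 <= F p)%E) ->
  (\int[plane_measure R]_(p in D) F p =
   k%:E * \int[plane_measure R]_(p in phi @^-1` D) F (phi p))%E.
Proof.
move=> k0 [mphi sphi] mD mF F0.
pose m := mscale (NngNum k0) (push_measure (plane_measure R) mphi).
transitivity (\int[m]_(p in D) F p)%E.
  by apply: eq_measure_integral => A mA _; exact: sphi.
apply: etrans (ge0_integral_mscale (push_measure (plane_measure R) mphi) mD (NngNum k0) mF F0) _.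
have F0' : {in D, forall y, (0 <= F y)%E} by move=> p /set_mem; exact: F0.
have E1 := ge0_integral_pushforward mphi (plane_measure R) mD mF F0'.
exact: (congr1 (mule k%:E) E1).
Qed.


Lemma integral_scales (R : realType) (k : R) (phi : plane R -> plane R)
    (D : set (plane R)) (F : plane R -> R) :
  0 <= k -> scales k phi -> measurable D -> measurable_fun D F ->
  \int[plane_measure R]_(p in D) F p =
   k * \int[plane_measure R]_(p in phi @^-1` D) F (phi p).
Proof.
move=> k0 sphi mD mF; rewrite /Rintegral.
have mF' : measurable_fun D (EFin \o F) by exact/measurable_EFinP.
pose x := (\int[plane_measure R]_(p in phi @^-1` D) (EFin \o F)^\+ (phi p))%E.
pose y := (\int[plane_measure R]_(p in phi @^-1` D) (EFin \o F)^\- (phi p))%E.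
transitivity (fine (k%:E * x - k%:E * y)).
  congr fine; rewrite integralE; congr (_ - _)%E.
    exact: (ge0_integral_scales k0 sphi mD (measurable_funepos mF')).
  exact: (ge0_integral_scales k0 sphi mD (measurable_funeneg mF')).
transitivity (k * fine (x - y)); last first.
  suff -> : (\int[plane_measure R]_(p in phi @^-1` D) (F (phi p))%:E = x - y)%E by [].
  by rewrite integralE; congr (_ - _)%E; apply: eq_integral => p _; rewrite ?funeposE ?funenegE.
have : (0 <= x)%E by exact: integral_ge0.
have : (0 <= y)%E by exact: integral_ge0.
(* [F] may fail to be integrable: for [k > 0] an infinite part stays infinite after scaling, so both
   sides take the same default value of [fine]; for [k = 0] both are zero. *)
clearbody x y; have [->|kn0] := eqVneq k 0; first by rewrite !mul0e mul0r subee.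
have {k0 kn0}k0 : 0 < k by rewrite lt_neqAle eq_sym kn0.
case: x => [x| |] //; case: y => [y| |] // _ _; rewrite ?gt0_muley ?lte_fin//= ?mulr0//.
by rewrite mulrBr.
Qed.

Section C1.
Context (R : realType).
Implicit Types (f g : R * R -> R).

Definition C1 f := continuous f /\ forall i,
  (forall p, derivable f p (unit_vec R i)) /\ continuous (pderiv i f).

Lemma smooth_pderiv f i : smooth f -> smooth (pderiv i f).
Proof.
by move=> sf w; have := sf (rcons w i); rewrite /pderivs foldr_rcons.
Qed.

Lemma smooth_C1 f : smooth f -> C1 f.
Proof.
move=> sf; have [cf df] := sf [::]; split => // i; split; first exact: df.
by have [] := sf [:: i].
Qed.

Lemma derive_slice1 f (x y : R) : derivable f (x, y) (unit_vec R 0) ->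
  is_derive x 1 (fun x' => f (x', y)) (pderiv 0 f (x, y)).
Proof.
have E : (fun h : R => h^-1 *: (((fun x' => f (x', y)) \o shift x) (h *: 1) - f (x, y))) =
   (fun h : R => h^-1 *: ((f \o shift (x, y)) (h *: unit_vec R 0) - f (x, y))).
  apply/funext => h; congr (_ *: (f _ - _)) => /=; rewrite /unit_vec/=.
  by congr pair; rewrite /= /GRing.scale/= ?mulr1 ?mulr0 ?add0r.
move=> df; apply: DeriveDef; first by rewrite /derivable E.
by rewrite /derive E.
Qed.

Lemma derive_slice2 f (x y : R) : derivable f (x, y) (unit_vec R 1) ->
  is_derive y 1 (fun y' => f (x, y')) (pderiv 1 f (x, y)).
Proof.
have E : (fun h : R => h^-1 *: (((fun y' => f (x, y')) \o shift y) (h *: 1) - f (x, y))) =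
   (fun h : R => h^-1 *: ((f \o shift (x, y)) (h *: unit_vec R 1) - f (x, y))).
  apply/funext => h; congr (_ *: (f _ - _)) => /=; rewrite /unit_vec/=.
  by congr pair; rewrite /= /GRing.scale/= ?mulr1 ?mulr0 ?add0r.
move=> df; apply: DeriveDef; first by rewrite /derivable E.
by rewrite /derive E.
Qed.

(** The increment [h] may be negative, so the intermediate point is located by its distance to
    [a]. *)
Lemma MVT_abs (g g' : R -> R) (a h : R) :
  (forall x : R, is_derive x (1 : R) g (g' x)) ->
  exists2 c, `|c - a| <= `|h| & g (a + h) - g a = g' c * h.
Proof.
move=> dg; have cg (A : set R) : {within A, continuous g}.
  apply: continuous_subspaceT => x; apply: differentiable_continuous.
  by apply/derivable1_diffP; have [] := dg x.
have [h0|h0] := leP 0 h.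
- have ah : a <= a + h by lra.
  have [c] := MVT_segment ah (fun x _ => dg x) (cg _).
  rewrite in_itv/= => /andP[c1 c2] E; exists c; last by rewrite E; congr (_ * _); ring.
  by rewrite !ger0_norm//; lra.
- have ah : a + h <= a by lra.
  have [c] := MVT_segment ah (fun x _ => dg x) (cg _).
  rewrite in_itv/= => /andP[c1 c2] E; exists c; last by rewrite -opprB E; ring.
  by rewrite !ler0_norm//; lra.
Qed.

Lemma C1_increment f (x y h k : R) : C1 f -> exists xi eta,
  [/\ `|xi - x| <= `|h|, `|eta - y| <= `|k| &
    f (x + h, y + k) - f (x, y) =
    pderiv 0 f (xi, y + k) * h + pderiv 1 f (x, eta) * k].
Proof.
move=> [_ df].
have [xi xi1 xi2] := @MVT_abs (fun x' => f (x', y + k)) (fun x' => pderiv 0 f (x', y + k)) x h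
  (fun x' => derive_slice1 ((df 0).1 _)).
have [eta e1 e2] := @MVT_abs (fun y' => f (x, y')) (fun y' => pderiv 1 f (x, y')) y k
  (fun y' => derive_slice2 ((df 1).1 _)).
by exists xi, eta; split => //; rewrite -xi2 -e2; ring.
Qed.

Definition dir_deriv f (v : R * R) (p : R * R) : R :=
  v.1 * pderiv 0 f p + v.2 * pderiv 1 f p.

(** The increment is split into a horizontal and a vertical step, with the mean value theorem on
    each; continuity of the partial derivatives at [p] then controls the error. *)
Lemma C1_is_derive f (p v : R * R) : C1 f -> is_derive p v f (dir_deriv f v p).
Proof.
move=> cf.
suff H : (fun h : R => h^-1 *: ((f \o shift p) (h *: v) - f p)) @ 0^' --> dir_deriv f v p.
  by apply: DeriveDef; [apply/cvg_ex; eexists; exact: H|exact/cvg_lim].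
apply/cvgrPdist_le => e e0.
(* [M] dominates the sum of the two absolute values, so errors of [e / M] in each partial derivative
   add up to at most [e], and [|h| * M < d] keeps both intermediate points in the balls. *)
pose M := 1 + `|v.1| + `|v.2|.
have M0 : 0 < M by rewrite /M -addrA ltr_pwDl// addr_ge0.
have eM : 0 < e / M by rewrite divr_gt0.
have [_ df] := cf.
have /cvgrPdist_le/(_ _ eM)/nbhs_ballP[d0 /= d00 B0] := (df 0).2 p.
have /cvgrPdist_le/(_ _ eM)/nbhs_ballP[d1 /= d10 B1] := (df 1).2 p.
pose d := Num.min d0 d1.
have dd0 : 0 < d by rewrite lt_min d00.
near=> h.
have h0 : h != 0 by near: h; exact: nbhs_dnbhs_neq.
have hM : `|h| * M < d.
  rewrite -ltr_pdivlMr//; near: h; apply: dnbhs0_lt; exact: divr_gt0.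
have [xi [eta [x1 e1 E]]] := C1_increment p.1 p.2 (h * v.1) (h * v.2) cf.
have -> : (f \o shift p) (h *: v) - f p = f (p.1 + h * v.1, p.2 + h * v.2) - f (p.1, p.2).
  congr (f _ - f _); last by case: (p).
  by rewrite /shift/= addrC; case: (p); case: (v).
have h1 : `|h * v.1| < d.
  rewrite normrM (le_lt_trans _ hM)// ler_wpM2l// /M; have := normr_ge0 v.2; lra.
have h2 : `|h * v.2| < d.
  rewrite normrM (le_lt_trans _ hM)// ler_wpM2l// /M; have := normr_ge0 v.1; lra.
rewrite E /dir_deriv /GRing.scale/=.
have -> : v.1 * pderiv 0 f p + v.2 * pderiv 1 f p - h^-1 *
   (pderiv 0 f (xi, p.2 + h * v.2) * (h * v.1) + pderiv 1 f (p.1, eta) * (h * v.2)) =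
   v.1 * (pderiv 0 f p - pderiv 0 f (xi, p.2 + h * v.2)) +
   v.2 * (pderiv 1 f p - pderiv 1 f (p.1, eta)) by field.
have b0 : `|pderiv 0 f p - pderiv 0 f (xi, p.2 + h * v.2)| <= e / M.
  apply: B0; split; rewrite /ball/=.
    by rewrite distrC (le_lt_trans x1)// (lt_le_trans h1)// ge_min lexx.
  by rewrite opprD addrA subrr sub0r normrN (lt_le_trans h2)// ge_min lexx.
have b1 : `|pderiv 1 f p - pderiv 1 f (p.1, eta)| <= e / M.
  apply: B1; split; rewrite /ball/=; first by rewrite subrr normr0.
  by rewrite distrC (le_lt_trans e1)// (lt_le_trans h2)// ge_min lexx orbT.
rewrite (le_trans (ler_normD _ _))// !normrM.
apply: (@le_trans _ _ (`|v.1| * (e / M) + `|v.2| * (e / M))).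
  by apply: lerD; rewrite ler_wpM2l.
rewrite -mulrDl -[leRHS](divfK (lt0r_neq0 M0)) [leRHS]mulrC ler_wpM2r ?ltW//.
rewrite /M; lra.
Unshelve. all: by end_near.
Qed.

Lemma C1_line f (p v : R * R) (t : R) : C1 f ->
  is_derive t 1 (fun t => f (p + t *: v)) (dir_deriv f v (p + t *: v)).
Proof.
move=> /(C1_is_derive (p + t *: v) v)[df <-].
have E : (fun h : R => h^-1 *: (((fun t => f (p + t *: v)) \o shift t) (h *: 1) - f (p + t *: v))) =
   (fun h : R => h^-1 *: ((f \o shift (p + t *: v)) (h *: v) - f (p + t *: v))).
  apply/funext => h; congr (_ *: (f _ - _)) => /=.
  by rewrite [h *: 1]mulr1 scalerDl addrCA.
apply: DeriveDef; first by rewrite /derivable E.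
by rewrite /derive E.
Qed.

End C1.

(** * Green's formula on a triangle *)

Lemma lebesgue_bounded_integrable (R : realType) (A : set (plane R)) (f : plane R -> R) (M : R) :
  measurable A -> (plane_measure R A < +oo)%E -> measurable_fun A f ->
  (forall p, A p -> `|f p| <= M) -> (plane_measure R).-integrable A (EFin \o f).
Proof.
move=> mA Aoo mf fM; apply: measurable_bounded_integrable => //.
exists M; split; first exact: num_real.
by move=> x Mx p Ap; apply: le_trans (fM _ Ap) _; exact: ltW.
Qed.

Lemma ftc_line (R : realType) (F f : R -> R) (a b : R) : a <= b ->
  (forall x : R, is_derive x (1 : R) F (f x)) -> continuous f ->
  (\int[@lebesgue_measure R]_(x in `[a, b]) (f x)%:E = (F b - F a)%:E)%E.
Proof.
rewrite le_eqVlt => /predU1P[<- _ _|ab dF cf].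
  by rewrite set_itv1 integral_set1 subrr.
have cF : continuous F.
  move=> x; apply: differentiable_continuous; apply/derivable1_diffP.
  by have [] := dF x.
rewrite (continuous_FTC2 (F := F) ab) ?EFinB//.
- exact: continuous_subspaceT.
- split => [x _||]; first by have [] := dF x.
    by apply: cvg_at_right_filter; exact: cF.
  by apply: cvg_at_left_filter; exact: cF.
- by move=> x _; rewrite derive1E; exact: derive_val.
Qed.

Lemma continuous_pair (R : realType) (T : topologicalType) (f g : T -> R) :
  continuous f -> continuous g -> continuous (fun y => (f y, g y) : R * R).
Proof. by move=> cf cg y; exact: (cvg_pair (cf y) (cg y)). Qed.

Lemma continuous_comp_pair (R : realType) (T : topologicalType) (F : R * R -> R)
    (f g : T -> R) : continuous F -> continuous f -> continuous g ->
  continuous (fun y => F (f y, g y)).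
Proof.
move=> cF cf cg y; apply: (@continuous_comp _ _ _ (fun y => (f y, g y)) F); last exact: cF.
exact: continuous_pair.
Qed.

Lemma continuous_onem (R : realType) (a : R) : continuous (fun y : R => a - y).
Proof. by move=> y; apply: cvgB; [exact: cvg_cst|exact: cvg_id]. Qed.

Definition ref_triangle (R : realType) : set (plane R) :=
  [set p | [/\ 0 < p.1, 0 < p.2 & p.1 + p.2 < 1]].

Lemma measurable_ref_triangle (R : realType) : measurable (@ref_triangle R).
Proof.
rewrite (_ : @ref_triangle R =
  fst @^-1` `]0, +oo[%classic `&` (snd @^-1` `]0, +oo[%classic `&`
  (fun p : R * R => p.1 + p.2) @^-1` `]-oo, 1[%classic)); last first.
  apply/seteqP; split => p; rewrite /ref_triangle/= !in_itv/= !andbT; first by case.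
  by case=> ? [].
apply: measurableI.
  by rewrite -[X in measurable X]setTI; apply: measurable_fst => //; exact: measurable_itv.
apply: measurableI.
  by rewrite -[X in measurable X]setTI; apply: measurable_snd => //; exact: measurable_itv.
rewrite -[X in measurable X]setTI; apply: measurable_funD => //; exact: measurable_itv.
Qed.

Lemma ref_triangle_finite (R : realType) : (plane_measure R (@ref_triangle R) < +oo)%E.
Proof.
apply: (@le_lt_trans _ _ (plane_measure R (`[0, 1]%classic `*` `[0, 1]%classic))).
  apply: le_measure; rewrite ?inE; first exact: measurable_ref_triangle.
    by apply: measurableX; exact: measurable_itv.
  move=> p [p1 p2 p12]; split => /=; rewrite in_itv/=; apply/andP; split; lra.
have I01 : @lebesgue_measure R `[0, 1]%classic = 1%E.
  by rewrite lebesgue_measure_itv/= lte_fin ltr01 oppr0 adde0.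
have -> : plane_measure R (`[0, 1]%classic `*` `[0, 1]%classic) = (1 * 1)%E.
  apply: etrans (product_measure1E _ _ _ _) _; [exact: measurable_itv..|].
  by congr (_ * _)%E; exact: I01.
by rewrite mule1 ltry.
Qed.

(** By Fubini: the section at height [y] is the interval from 0 to [1 - y], where the fundamental
    theorem of calculus applies. *)
Lemma ref_triangle_Green (R : realType) (F g : R * R -> R) :
  continuous F -> continuous g ->
  (forall x y : R, is_derive x (1 : R) (fun x => F (x, y)) (g (x, y))) ->
  \int[plane_measure R]_(p in @ref_triangle R) g p =
  \int[@lebesgue_measure R]_(y in `[0, 1]) (F (1 - y, y) - F (0, y)).
Proof.
move=> cF cg dF.
have mT := @measurable_ref_triangle R.
have [M gM] : exists M, forall p, ref_triangle p -> `|g p| <= M.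
  have cK : compact (`[0, 1]%classic `*` `[0, 1]%classic : set (R * R)).
    by apply: compact_setX; exact: segment_compact.
  have /compact_bounded[M [_ HM]] : compact (g @` (`[0, 1]%classic `*` `[0, 1]%classic)).
    by apply: continuous_compact => //; exact: continuous_subspaceT.
  exists (M + 1) => p [p1 p2 p12]; apply: (HM (M + 1)); first by rewrite ltrDl.
  by exists p => //; split => /=; rewrite in_itv/=; apply/andP; split; lra.
have ig : (plane_measure R).-integrable (@ref_triangle R) (EFin \o g).
  apply: (lebesgue_bounded_integrable (M := M)) => //.
    exact: (@ref_triangle_finite R).
  exact: continuous_measurable_prod.
have ig' : (plane_measure R).-integrable setT ((EFin \o g) \_ (@ref_triangle R)).
  exact/(integrable_mkcond _ mT).
rewrite /Rintegral integral_mkcond; congr fine.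
rewrite -[LHS](integral21_prod_meas1 ig').
have cst (a : R) : continuous (fun _ : R => a) by move=> y; exact: cvg_cst.
have cid : continuous (fun y : R => y) by move=> y; exact: cvg_id.
have com := @continuous_onem R 1.
have mh : measurable_fun (`]0, 1[%classic : set R) (fun y : R => F (1 - y, y) - F (0, y)).
  apply: measurable_funTS; apply: continuous_measurable_fun => y.
  by apply: cvgB; exact: continuous_comp_pair.
rewrite [RHS]integral_itv_bndoo; last exact/measurable_EFinP.
rewrite [RHS]integral_mkcond; apply: eq_integral => y _.
rewrite /fubini_G patchE; have [|yn] := boolP (y \in _).
  rewrite inE/= in_itv/= => /andP[y0 y1].
  rewrite -(ftc_line (F := fun x => F (x, y)) (f := fun x => g (x, y))) ?subr_ge0 ?ltW//; last first.
    exact: continuous_comp_pair.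
  rewrite [RHS]integral_itv_bndoo; last first.
    apply/measurable_EFinP; apply: measurable_funTS; apply: continuous_measurable_fun.
    exact: continuous_comp_pair.
  rewrite [RHS]integral_mkcond; apply: eq_integral => x _; rewrite !patchE.
  suff -> : ((x, y) \in @ref_triangle R) = (x \in (`]0, (1 - y)[%classic : set R)) by [].
  apply/idP/idP; rewrite !inE /ref_triangle/= in_itv/=.
    by case=> x0 _ xy; apply/andP; split; lra.
  by move=> /andP[x0 xy]; split => //; lra.
apply: integral0_eq => x _; rewrite patchE ifF//; apply/negbTE; apply: contra yn.
rewrite !inE/= in_itv/= => -[/= x0 y0 xy]; apply/andP; split => //; lra.
Qed.

Section Triangle.
Context (R : realType) (c : 'I_3 -> R * R).
Implicit Types (p v w : R * R) (k : 'I_3).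

Definition cross v w := v.1 * w.2 - v.2 * w.1.
(** Twice the signed area of the triangle. *)
Definition jac := cross (c 1 - c 0) (c 2 - c 0).
Definition edge k := c (k + 2) - c (k + 1).
(** The differential of the barycentric coordinate [lam k]. *)
Definition dlam k v := cross (edge k) v / jac.
(** The barycentric coordinate attached to [c k]: it vanishes on the line through the two other
    corners. *)
Definition lam k p := dlam k (p - c (k + 1)).
(** Same as [triangle], but for any triple of points: the sup bound also uses triangles that do not
    belong to the complex. *)
Definition tri_set : set (R * R) :=
  [set p | exists l : 'I_3 -> R, [/\ forall k, 0 <= l k, \sum_k l k = 1 &
                                    p = \sum_k l k *: c k]].

Lemma sum3 (V : zmodType) (F : 'I_3 -> V) : \sum_k F k = F 0 + F 1 + F 2.
Proof.
rewrite !big_ord_recl big_ord0 addr0 addrA; congr (F _ + F _ + F _); exact/val_inj.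
Qed.

Lemma ord3P k (P : 'I_3 -> Prop) : P 0 -> P 1 -> P 2 -> P k.
Proof.
case: k => [[|[|[|//]]] i] P0 P1 P2.
- by rewrite (_ : Ordinal i = 0)//; exact: val_inj.
- by rewrite (_ : Ordinal i = 1)//; exact: val_inj.
- by rewrite (_ : Ordinal i = 2)//; exact: val_inj.
Qed.

Lemma ord3E : [/\ 0 + 1 = 1 :> 'I_3, 0 + 2 = 2 :> 'I_3, 1 + 1 = 2 :> 'I_3 &
  [/\ 1 + 2 = 0 :> 'I_3, 2 + 1 = 0 :> 'I_3 & 2 + 2 = 1 :> 'I_3]].
Proof. by do !split; exact: val_inj. Qed.
Definition ord01 := let: And4 e _ _ _ := ord3E in e.
Definition ord02 := let: And4 _ e _ _ := ord3E in e.
Definition ord11 := let: And4 _ _ e _ := ord3E in e.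
Definition ord12 := let: And4 _ _ _ (And3 e _ _) := ord3E in e.
Definition ord21 := let: And4 _ _ _ (And3 _ e _) := ord3E in e.
Definition ord22 := let: And4 _ _ _ (And3 _ _ e) := ord3E in e.
Definition ord3D := (ord01, ord02, ord11, ord12, ord21, ord22).

Lemma ord3_neq : (((0 : 'I_3) == 1) = false) * (((0 : 'I_3) == 2) = false) *
  (((1 : 'I_3) == 0) = false) * (((1 : 'I_3) == 2) = false) *
  (((2 : 'I_3) == 0) = false) * (((2 : 'I_3) == 1) = false).
Proof. by do !split. Qed.

Lemma pair_fstD v w : (v + w).1 = v.1 + w.1. Proof. by []. Qed.
Lemma pair_sndD v w : (v + w).2 = v.2 + w.2. Proof. by []. Qed.
Lemma pair_fstN v : (- v).1 = - v.1. Proof. by []. Qed.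
Lemma pair_sndN v : (- v).2 = - v.2. Proof. by []. Qed.
Lemma pair_fstZ a v : (a *: v).1 = a * v.1. Proof. by []. Qed.
Lemma pair_sndZ a v : (a *: v).2 = a * v.2. Proof. by []. Qed.
Definition pairE := (pair_fstD, pair_sndD, pair_fstN, pair_sndN, pair_fstZ, pair_sndZ).

Lemma pair_eqP v w : v.1 = w.1 -> v.2 = w.2 -> v = w.
Proof. by case: v w => ? ? [? ?] /= -> ->. Qed.

Hypothesis jac_gt0 : 0 < jac.
Let jac0 : jac != 0. Proof. exact: lt0r_neq0. Qed.

Lemma sum_lam p : \sum_k lam k p = 1.
Proof.
rewrite sum3 /lam /dlam -!mulrDl; apply/eqP; rewrite -(inj_eq (mulIf jac0)) mulfVK// mul1r; apply/eqP.
by rewrite /edge !ord3D /jac /cross !pairE; ring.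
Qed.

Lemma lam_baryc p : p = \sum_k lam k p *: c k.
Proof.
rewrite sum3 /lam /dlam; apply: pair_eqP; rewrite !pairE;
  apply: (mulfI jac0); rewrite !mulrDr !mulrA ![jac * _ / _]mulrAC !divff// !mul1r
    /edge !ord3D /jac /cross !pairE; ring.
Qed.

Lemma lam_comb (l : 'I_3 -> R) k : \sum_k l k = 1 -> lam k (\sum_k l k *: c k) = l k.
Proof.
rewrite !sum3 => l1; have l0E : l 0 = 1 - l 1 - l 2 by rewrite -l1; ring.
rewrite /lam /dlam; apply: (mulIf jac0); rewrite mulfVK//.
by elim/ord3P: k; rewrite /edge !ord3D /jac /cross !pairE l0E; ring.
Qed.

Lemma lamD k p v : lam k (p + v) = lam k p + dlam k v.
Proof. by rewrite /lam /dlam -mulrDl; congr (_ / _); rewrite /cross !pairE; ring. Qed.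

Lemma dlamZ k a v : dlam k (a *: v) = a * dlam k v.
Proof. by rewrite /dlam mulrA; congr (_ / _); rewrite /cross !pairE; ring. Qed.

Lemma lam_corner k j : lam k (c j) = (k == j)%:R.
Proof.
rewrite /lam /dlam; apply: (mulIf jac0); rewrite mulfVK//.
by elim/ord3P: k; elim/ord3P: j; rewrite ?eqxx ?ord3_neq /edge ?ord3D /jac /cross !pairE/= ?mulr1n ?mulr0n; ring.
Qed.

Lemma tri_setP p : tri_set p <-> forall k, 0 <= lam k p.
Proof.
split => [[l [l0 l1 ->]] k|h]; first by rewrite lam_comb.
by exists (lam ^~ p); split => //; [exact: sum_lam|exact: lam_baryc].
Qed.

Lemma continuous_dlam k : continuous (dlam k).
Proof.
move=> p; rewrite /dlam /cross.
apply: cvgM; last exact: cvg_cst.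
apply: cvgB; (apply: cvgM; first exact: cvg_cst).
exact: cvg_snd. exact: cvg_fst.
Qed.

Lemma continuous_lam k : continuous (lam k).
Proof.
move=> p; rewrite /lam.
apply: (@continuous_comp _ _ _ (fun p => p - c (k + 1)) (dlam k)); last exact: continuous_dlam.
by apply: cvgB; [exact: cvg_id|exact: cvg_cst].
Qed.

Lemma dlam_sub j a b : dlam j (c a - c b) = (j == a)%:R - (j == b)%:R.
Proof. by have := lamD j (c b) (c a - c b); rewrite subrKC !lam_corner => ->; ring. Qed.

Lemma dlam_neq0 k : exists v, dlam k v = -1.
Proof.
exists (c (k + 1) - c k).
have : lam k (c k + (c (k + 1) - c k)) = 0 by rewrite addrC subrK lam_corner; elim/ord3P: k.
by rewrite lamD lam_corner eqxx => /eqP; rewrite addr_eq0 => /eqP E; rewrite -[LHS]opprK -E.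
Qed.

Lemma closed_tri_set : closed tri_set.
Proof.
rewrite (_ : tri_set = (lam 0 @^-1` [set x | 0 <= x]) `&`
    ((lam 1 @^-1` [set x | 0 <= x]) `&` (lam 2 @^-1` [set x | 0 <= x]))); last first.
  apply/seteqP; split => p; first by move=> /tri_setP h; split; [|split]; exact: h.
  by move=> [h0 [h1 h2]]; apply/tri_setP => k; elim/ord3P: k.
by apply: closedI; [|apply: closedI]; apply: closed_comp; try exact: closed_ge;
  move=> x _; exact: continuous_lam.
Qed.

Lemma interior_tri_set : interior tri_set = [set p | forall k, 0 < lam k p].
Proof.
apply/seteqP; split => p.
  move=> /nbhs_ballP[e /= e0 pe] k.
  (* Moving by [t] along [v] lowers [lam k] by [t] and stays in the ball, hence in the triangle; so
     [lam k p] is at least [t]. *)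
  have [v vE] := dlam_neq0 k.
  have [t t0 tv] : exists2 t, 0 < t & ball p e (p + t *: v).
    exists (e / (2 * (1 + `|v.1| + `|v.2|))).
      by rewrite divr_gt0// mulr_gt0// -addrA ltr_pwDl// addr_ge0.
    have V0 : 0 < 2 * (1 + `|v.1| + `|v.2|) by rewrite mulr_gt0// -addrA ltr_pwDl// addr_ge0.
    split; rewrite /ball/= opprD addrA subrr sub0r normrN /GRing.scale/= normrM ger0_norm ?divr_ge0 ?ltW//
      mulrAC ltr_pdivrMr// ltr_pM2l//; have := normr_ge0 v.1; have := normr_ge0 v.2; lra.
  have /tri_setP/(_ k) := pe _ tv.
  by rewrite lamD dlamZ vE; lra.
move=> /= h; pose A := (lam 0 @^-1` [set x | 0 < x]) `&`
    ((lam 1 @^-1` [set x | 0 < x]) `&` (lam 2 @^-1` [set x | 0 < x])).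
have AE q : A q -> forall k, 0 < lam k q.
  by move=> [h0 [h1 h2]] k; elim/ord3P: k.
have oA : open A.
  by apply: openI; [|apply: openI]; apply: open_comp; try exact: open_gt;
    move=> x _; exact: continuous_lam.
have : nbhs p A by apply: open_nbhs_nbhs; split => //; split; [|split]; exact: h.
by apply: filterS => q Aq; apply/tri_setP => k; apply: ltW; exact: AE.
Qed.

Lemma open_triP p : interior tri_set p <-> forall k, 0 < lam k p.
Proof. by rewrite interior_tri_set. Qed.

Lemma measurable_open_tri : measurable (interior tri_set : set (plane R)).
Proof. by apply: open_measurable_prod; exact: open_interior. Qed.

(** The affine parametrization by the reference triangle that sends the origin to [c k]; the
    parameters are the barycentric coordinates [k + 1] and [k + 2]. *)
Definition tri_map k p : R * R :=
  c k + p.1 *: (c (k + 1) - c k) + p.2 *: (c (k + 2) - c k).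

Lemma lam_tri_map k p : [/\ lam (k + 1) (tri_map k p) = p.1,
  lam (k + 2) (tri_map k p) = p.2 & lam k (tri_map k p) = 1 - p.1 - p.2].
Proof.
rewrite /tri_map; split; rewrite !lamD !dlamZ !lam_corner !dlam_sub;
  elim/ord3P: k; rewrite ?ord3D ?eqxx ?ord3_neq/= ?mulr1n ?mulr0n; ring.
Qed.

Lemma tri_map_open k : tri_map k @^-1` interior tri_set = @ref_triangle R.
Proof.
apply/seteqP; split => p.
  move=> /open_triP h; have [h1 h2 h0] := lam_tri_map k p.
  by split; [rewrite -h1|rewrite -h2|have := h k; rewrite h0; lra].
move=> [p1 p2 p12]; apply/open_triP => j.
have [h1 h2 h0] := lam_tri_map k p.
have [->|->|->] : [\/ j = k, j = k + 1 | j = k + 2].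
  by elim/ord3P: j; elim/ord3P: k {h0 h1 h2}; rewrite ?ord3D;
    by [constructor 1|constructor 2|constructor 3].
- by rewrite h0; lra.
- by rewrite h1.
- by rewrite h2.
Qed.

Lemma scales_tri_map k : scales jac (tri_map k).
Proof.
have E : (c (k + 1) - c k).1 * (c (k + 2) - c k).2 - (c (k + 2) - c k).1 * (c (k + 1) - c k).2 = jac.
  by elim/ord3P: k; rewrite ?ord3D /jac /cross !pairE; ring.
have := @scales_affine R (c (k + 1) - c k).1 (c (k + 2) - c k).1
  (c (k + 1) - c k).2 (c (k + 2) - c k).2 (c k).1 (c k).2.
rewrite E gtr0_norm// => /(_ jac0); congr scales.
by apply/funext => p; apply: pair_eqP; rewrite /tri_map !pairE /=; ring.
Qed.

Lemma open_tri_finite : (plane_measure R (interior tri_set) < +oo)%E.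
Proof.
rewrite ((scales_tri_map 0).2 _ measurable_open_tri) tri_map_open.
apply: lte_mul_pinfty; rewrite ?lee_fin ?ltW//; exact: (@ref_triangle_finite R).
Qed.

Definition side_pt k (s : R) : R * R := (1 - s) *: c (k + 1) + s *: c (k + 2).
Definition side_int k (f : R * R -> R) : R :=
  \int[@lebesgue_measure R]_(s in `[0, 1]) f (side_pt k s).

Lemma continuous_side k : continuous (side_pt k).
Proof.
move=> s; apply: cvgD; apply: cvgZ; try exact: cvg_cst; last exact: cvg_id.
by apply: cvgB; [exact: cvg_cst|exact: cvg_id].
Qed.

Lemma continuous_tri_map k : continuous (tri_map k).
Proof.
move=> p; apply: cvgD; first apply: cvgD; try exact: cvg_cst.
  by apply: cvgZ; [exact: cvg_fst|exact: cvg_cst].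
by apply: cvgZ; [exact: cvg_snd|exact: cvg_cst].
Qed.

Lemma continuous_segment_integrable (f : R -> R) : continuous f ->
  (@lebesgue_measure R).-integrable `[0, 1] (EFin \o f).
Proof.
move=> cf; apply: continuous_compact_integrable; first exact: segment_compact.
exact: continuous_subspaceT.
Qed.

Lemma integral_onem (f : R -> R) : continuous f ->
  \int[@lebesgue_measure R]_(s in `[0, 1]) f (1 - s) =
  \int[@lebesgue_measure R]_(s in `[0, 1]) f s.
Proof.
move=> cf; rewrite (@Rintegration_by_substitution_onem R f 1) ?ler01 ?lexx//; last first.
  exact: continuous_subspaceT.
by rewrite /unstable.onem subrr.
Qed.

Lemma side_ptE k s : side_pt k s = c (k + 1) + s *: edge k.
Proof. by rewrite /side_pt /edge; apply: pair_eqP; rewrite !pairE; ring. Qed.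

Lemma side_int_rev k (f : R * R -> R) : continuous f ->
  \int[@lebesgue_measure R]_(s in `[0, 1]) f (side_pt k (1 - s)) = side_int k f.
Proof.
move=> cf; rewrite (integral_onem (f := f \o side_pt k))// => s.
by apply: continuous_comp; [exact: continuous_side|exact: cf].
Qed.

Lemma continuous_dir_deriv (f : R * R -> R) v : C1 f -> continuous (dir_deriv f v).
Proof.
move=> [_ df] p; apply: cvgD; apply: cvgM; try exact: cvg_cst; exact: (df _).2.
Qed.

(** In the parametrization [tri_map k] the direction from [c k] to [c (k + 1)] is the first axis, so
    this is the formula on the reference triangle. *)
Lemma Green_edge (f : R * R -> R) k : C1 f ->
  \int[plane_measure R]_(p in interior tri_set) dir_deriv f (c (k + 1) - c k) p =
  jac * (side_int k f - side_int (k + 1) f).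
Proof.
move=> C1f; set v : R * R := c (k + 1) - c k.
have cf := C1f.1; have cd : continuous (dir_deriv f v) by exact: continuous_dir_deriv.
have mT := measurable_open_tri.
rewrite (integral_scales (ltW jac_gt0) (scales_tri_map k) mT); last first.
  exact: continuous_measurable_prod.
congr (_ * _); rewrite tri_map_open.
have cc (g : R * R -> R) : continuous g -> continuous (g \o tri_map k).
  by move=> cg p; apply: continuous_comp; [exact: continuous_tri_map|exact: cg].
have dF (x y : R) : is_derive x (1 : R) (fun x => f (tri_map k (x, y))) (dir_deriv f v (tri_map k (x, y))).
  have := C1_line (c k + y *: (c (k + 2) - c k)) v x C1f.
  rewrite (_ : (fun t => _) = (fun x => f (tri_map k (x, y)))); last first.
    by apply/funext => t; rewrite /tri_map/= addrAC.
  by rewrite /tri_map/= addrAC.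
rewrite (ref_triangle_Green (cc _ cf) (cc _ cd) dF).
have cs j : continuous (fun s => f (side_pt j s)).
  by move=> s; apply: continuous_comp; [exact: continuous_side|exact: cf].
have cs' j : continuous (fun s : R => f (side_pt j (1 - s))).
  move=> s; apply: (@continuous_comp _ _ _ (fun s : R => 1 - s) (fun s => f (side_pt j s))); last exact: cs.
  by apply: cvgB; [exact: cvg_cst|exact: cvg_id].
(* The left side of the reference triangle runs from [c k] to [c (k + 2)], against the orientation
   of side [k + 1]. *)
rewrite -(side_int_rev (k + 1) cf) /side_int -RintegralB//; last 2 first.
  exact: continuous_segment_integrable (cs _).
  exact: continuous_segment_integrable (cs' _).
apply: eq_Rintegral => s _; congr (f _ - f _); rewrite /tri_map /side_pt/=;
  elim/ord3P: k {v cd dF cc cs cs'}; rewrite ?ord3D; apply: pair_eqP; rewrite !pairE; ring.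
Qed.

Lemma tri_bounded : exists M : R, forall p, tri_set p -> `|p.1| <= M /\ `|p.2| <= M.
Proof.
exists (\sum_k (`|(c k).1| + `|(c k).2|)) => p /tri_setP h.
have le1 k : lam k p <= 1.
  rewrite -(sum_lam p) (bigD1 k)//= lerDl sumr_ge0//.
have key (f : R * R -> R) : (forall v w, f (v + w) = f v + f w) ->
    (forall a v, f (a *: v) = a * f v) -> `|f p| <= \sum_k `|f (c k)|.
  move=> fD fZ; rewrite (lam_baryc p) !sum3 !fD !fZ.
  have Hk k : `|lam k p * f (c k)| <= `|f (c k)|.
    by rewrite normrM (ger0_norm (h k)) ler_piMl.
  rewrite (le_trans (ler_normD _ _))// lerD// (le_trans (ler_normD _ _))// lerD//.
split; [apply: (le_trans (key fst _ _))|apply: (le_trans (key snd _ _))] => //;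
  by apply: ler_sum => k _; rewrite ?lerDl ?lerDr.
Qed.

Lemma compact_tri_set : compact tri_set.
Proof.
have [M HM] := tri_bounded.
apply: (@subclosed_compact _ _ (`[- M, M]%classic `*` `[- M, M]%classic)).
- exact: closed_tri_set.
- by apply: compact_setX; exact: segment_compact.
- by move=> p /HM[]; rewrite !ler_norml => ? ?; split; rewrite /= in_itv.
Qed.

Lemma continuous_tri_bounded (f : R * R -> R) : {within tri_set, continuous f} ->
  exists M : R, forall p, tri_set p -> `|f p| <= M.
Proof.
move=> cf; have /compact_bounded[M [_ HM]] : compact (f @` tri_set).
  by apply: continuous_compact => //; exact: compact_tri_set.
by exists (M + 1) => p pT; apply: (HM (M + 1)); [rewrite ltrDl|exists p].
Qed.

Lemma open_tri_sub : interior tri_set `<=` tri_set.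
Proof. exact: interior_subset. Qed.

Lemma continuous_tri_integrable (f : R * R -> R) : continuous f ->
  (plane_measure R).-integrable (interior tri_set) (EFin \o f).
Proof.
move=> cf; have [M HM] := continuous_tri_bounded (continuous_subspaceT cf).
apply: (lebesgue_bounded_integrable (M := M)).
- exact: measurable_open_tri.
- exact: open_tri_finite.
- by apply: continuous_measurable_prod => //; exact: measurable_open_tri.
- by move=> p /open_tri_sub; exact: HM.
Qed.

Lemma dlam_decomp v : v = dlam 1 v *: (c 1 - c 0) + dlam 2 v *: (c 2 - c 0).
Proof.
rewrite /dlam; apply: pair_eqP; rewrite !pairE;
  apply: (mulfI jac0); rewrite !mulrDr !mulrA ![jac * _ / _]mulrAC !divff// !mul1r
    /edge !ord3D /jac /cross !pairE; ring.
Qed.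

(** Two edge directions span the plane, so [Green_edge] suffices. For a unit outward normal n,
    [- cross (edge k) v] is the length of the edge times the scalar product of n and v. *)
Theorem Green (f : R * R -> R) v : C1 f ->
  \int[plane_measure R]_(p in interior tri_set) dir_deriv f v p =
  - \sum_k cross (edge k) v * side_int k f.
Proof.
move=> C1f; have mT := measurable_open_tri.
have iG w : (plane_measure R).-integrable (interior tri_set) (EFin \o dir_deriv f w).
  by apply: continuous_tri_integrable; exact: continuous_dir_deriv.
have iZ a w : (plane_measure R).-integrable (interior tri_set) (EFin \o (fun p => a * dir_deriv f w p)).
  by apply: continuous_tri_integrable => p; apply: cvgM; [exact: cvg_cst|exact: continuous_dir_deriv].
have E p : dir_deriv f v p = dlam 1 v * dir_deriv f (c (0 + 1) - c 0) p +
    (- dlam 2 v) * dir_deriv f (c (2 + 1) - c 2) p.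
  by rewrite {1}(dlam_decomp v) /dir_deriv !ord3D !pairE; ring.
under eq_Rintegral do rewrite E.
rewrite RintegralD// !RintegralZl// !Green_edge// sum3 !ord3D /dlam.
(* The three edge vectors add up to zero. *)
have cE : cross (edge 0) v = - cross (edge 1) v - cross (edge 2) v.
  by rewrite /edge !ord3D /cross !pairE; ring.
rewrite cE; move: (cross (edge 1) v) (cross (edge 2) v) (side_int 0 f) (side_int 1 f) (side_int 2 f) jac jac0.
by move=> a b x y z J J0; field.
Qed.

Lemma C1M (f g : R * R -> R) : C1 f -> C1 g -> C1 (fun p => f p * g p) /\
  forall v p, dir_deriv (fun p => f p * g p) v p = dir_deriv f v p * g p + f p * dir_deriv g v p.
Proof.
move=> [cf df] [cg dg].
have dE i p : is_derive p (unit_vec R i) (fun p => f p * g p) (f p * pderiv i g p + g p * pderiv i f p).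
  have d1 : is_derive p (unit_vec R i) f (pderiv i f p) by apply: DeriveDef => //; exact: (df i).1.
  have d2 : is_derive p (unit_vec R i) g (pderiv i g p) by apply: DeriveDef => //; exact: (dg i).1.
  exact: (is_deriveM d1 d2).
have pE i : pderiv i (fun p => f p * g p) = (fun p => f p * pderiv i g p + g p * pderiv i f p).
  by apply/funext => p; have [_ <-] := dE i p.
split.
  split; first by move=> p; apply: cvgM; [exact: cf|exact: cg].
  move=> i; split; first by move=> p; have [] := dE i p.
  rewrite pE => p; apply: cvgD; apply: cvgM.
  + exact: cf.
  + exact: (dg i).2.
  + exact: cg.
  + exact: (df i).2.
by move=> v p; rewrite /dir_deriv !pE; ring.
Qed.

Lemma C1D (f g : R * R -> R) : C1 f -> C1 g -> C1 (fun p => f p + g p) /\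
  forall i p, pderiv i (fun p => f p + g p) p = pderiv i f p + pderiv i g p.
Proof.
move=> [cf df] [cg dg].
have dE i p : is_derive p (unit_vec R i) (fun p => f p + g p) (pderiv i f p + pderiv i g p).
  have d1 : is_derive p (unit_vec R i) f (pderiv i f p) by apply: DeriveDef => //; exact: (df i).1.
  have d2 : is_derive p (unit_vec R i) g (pderiv i g p) by apply: DeriveDef => //; exact: (dg i).1.
  exact: (is_deriveD d1 d2).
have pE i : pderiv i (fun p => f p + g p) = (fun p => pderiv i f p + pderiv i g p).
  by apply/funext => p; have [_ <-] := dE i p.
split; last by move=> i p; rewrite pE.
split; first by move=> p; apply: cvgD; [exact: cf|exact: cg].
move=> i; split; first by move=> p; have [] := dE i p.
by rewrite pE => p; apply: cvgD; [exact: (df i).2|exact: (dg i).2].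
Qed.

Lemma C1_cst (a : R) : C1 (fun _ => a) /\ forall i p, pderiv i (fun _ => a) p = 0.
Proof.
have dE i p : is_derive p (unit_vec R i) (fun _ : R * R => a) 0 by exact: is_derive_cst.
have pE i : pderiv i (fun _ => a) = (fun _ => 0).
  by apply/funext => p; have [_ <-] := dE i p.
split; last by move=> i p; rewrite pE.
split; first by move=> p; exact: cvg_cst.
by move=> i; split; [move=> p; have [] := dE i p|rewrite pE => p; exact: cvg_cst].
Qed.

Lemma Green_mul (f g : R * R -> R) v : C1 f -> C1 g ->
  \int[plane_measure R]_(p in interior tri_set) (dir_deriv f v p * g p) =
  (- \int[plane_measure R]_(p in interior tri_set) (f p * dir_deriv g v p))
  - (\sum_k cross (edge k) v * side_int k (fun p => f p * g p)).
Proof.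
move=> Cf Cg; have [CM dM] := C1M Cf Cg; have := Green v CM.
under eq_Rintegral do rewrite dM.
have mT := measurable_open_tri.
rewrite RintegralD//; first by move=> <-; ring.
  apply: continuous_tri_integrable => p; apply: cvgM; [exact: continuous_dir_deriv|exact: Cg.1].
apply: continuous_tri_integrable => p; apply: cvgM; [exact: Cf.1|exact: continuous_dir_deriv].
Qed.

End Triangle.

(** * Square-integrable functions *)

Section L2.
Context d (T : measurableType d) (R : realType) (mu : {measure set T -> \bar R}).
Context (D : set T) (mD : measurable D).
Implicit Types (f g u v w : T -> R).

(** The squared norm is extended-valued, so that its finiteness carries information. The section
    serves both the triangles and the unit segment. *)
Definition sqint f : \bar R := (\int[mu]_(x in D) (f x ^+ 2)%:E)%E.
Definition L2 f := measurable_fun D f /\ (sqint f < +oo)%E.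
Definition cvL2 (f_ : nat -> T -> R) u :=
  (fun n => sqint (fun x => f_ n x - u x)) @ \oo --> (0 : \bar R)%E.

Lemma sqint_ge0 f : (0 <= sqint f)%E.
Proof. by apply: integral_ge0 => x _; rewrite lee_fin sqr_ge0. Qed.
Hint Resolve sqint_ge0 : core.

Lemma measurable_sq f : measurable_fun D f -> measurable_fun D (fun x => (f x ^+ 2)%:E).
Proof. by move=> mf; apply/measurable_EFinP; apply: measurable_funX. Qed.

Lemma eq_sqint f g : {in D, f =1 g} -> sqint f = sqint g.
Proof. by move=> fg; apply: eq_integral => x xD; rewrite fg. Qed.

Lemma sqintN f : sqint (fun x => - f x) = sqint f.
Proof. by apply: eq_integral => x _; rewrite sqrrN. Qed.

Lemma sqintZ a f : measurable_fun D f -> sqint (fun x => a * f x) = ((a ^+ 2)%:E * sqint f)%E.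
Proof.
move=> mf; rewrite -ge0_integralZl//; first by apply: eq_integral => x _; rewrite exprMn.
- exact: measurable_sq.
- by move=> x _; rewrite lee_fin sqr_ge0.
- by rewrite lee_fin sqr_ge0.
Qed.

Lemma le_sqint f g : measurable_fun D f -> measurable_fun D g ->
  (forall x, D x -> `|f x| <= `|g x|) -> (sqint f <= sqint g)%E.
Proof.
move=> mf mg fg; apply: ge0_le_integral => //.
- by move=> x _; rewrite lee_fin sqr_ge0.
- exact: measurable_sq.
- exact: measurable_sq.
- by move=> x /fg h; rewrite lee_fin -(real_normK (num_real (f x))) -(real_normK (num_real (g x))) lerXn2r// nnegrE.
Qed.

Lemma sqintD_le f g : measurable_fun D f -> measurable_fun D g ->
  (sqint (fun x => (f x + g x)%R) <= 2%:E * sqint f + 2%:E * sqint g)%E.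
Proof.
move=> mf mg; rewrite -!ge0_integralZl//; do ?[exact: measurable_sq|by move=> x _; rewrite lee_fin sqr_ge0].
rewrite -ge0_integralD//; last 4 first.
- by move=> x _; rewrite -EFinM lee_fin mulr_ge0 ?sqr_ge0.
- by apply: measurable_funeM; exact: measurable_sq.
- by move=> x _; rewrite -EFinM lee_fin mulr_ge0 ?sqr_ge0.
- by apply: measurable_funeM; exact: measurable_sq.
apply: ge0_le_integral => //.
- by move=> x _; rewrite lee_fin sqr_ge0.
- by apply: measurable_sq; exact: measurable_funD.
- by apply: emeasurable_funD; apply: measurable_funeM; exact: measurable_sq.
- move=> x _; rewrite -!EFinM -EFinD lee_fin.
  by have := sqr_ge0 (f x - g x); rewrite !expr2; nra.
Qed.

Lemma L2D f g : L2 f -> L2 g -> L2 (fun x => f x + g x).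
Proof.
move=> [mf If] [mg Ig]; split; first exact: measurable_funD.
apply: le_lt_trans (sqintD_le mf mg) _.
by apply: lte_add_pinfty; apply: lte_mul_pinfty.
Qed.

Lemma L2N f : L2 f -> L2 (fun x => - f x).
Proof. by move=> [mf If]; split; [exact: measurableT_comp|rewrite sqintN]. Qed.

Lemma L2B f g : L2 f -> L2 g -> L2 (fun x => f x - g x).
Proof. by move=> Lf Lg; apply: L2D => //; exact: L2N. Qed.

Lemma L2Z a f : L2 f -> L2 (fun x => a * f x).
Proof.
move=> [mf If]; split; first by apply: measurable_funM.
by rewrite sqintZ//; apply: lte_mul_pinfty; rewrite ?lee_fin ?sqr_ge0.
Qed.

Lemma L2M_integrable f g : L2 f -> L2 g -> mu.-integrable D (EFin \o (fun x => f x * g x)).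
Proof.
move=> [mf If] [mg Ig].
have ms : measurable_fun D (fun x => ((f x ^+ 2)%:E + (g x ^+ 2)%:E)%E).
  by apply: emeasurable_funD; exact: measurable_sq.
apply: (@le_integrable _ _ _ mu D mD _ (fun x => ((f x ^+ 2)%:E + (g x ^+ 2)%:E)%E)).
- by apply/measurable_EFinP; exact: measurable_funM.
- move=> x _; rewrite /= lee_fin normrM [leRHS]ger0_norm ?addr_ge0 ?sqr_ge0//.
  rewrite -(real_normK (num_real (f x))) -(real_normK (num_real (g x))).
  have := sqr_ge0 (`|f x| - `|g x|); have := normr_ge0 (f x); have := normr_ge0 (g x).
  by rewrite !expr2; nra.
- apply/integrableP; split=> //.
  under eq_integral do rewrite -EFinD gee0_abs ?lee_fin ?addr_ge0 ?sqr_ge0// EFinD.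
  rewrite ge0_integralD//; do ?[exact: measurable_sq|by move=> x _; rewrite lee_fin sqr_ge0].
  exact: lte_add_pinfty.
Qed.

Lemma L2_integrable_sq f : L2 f -> mu.-integrable D (EFin \o (fun x => f x ^+ 2)).
Proof. by move=> Lf; have := L2M_integrable Lf Lf; under eq_fun do rewrite -expr2. Qed.

Lemma sqint_fin f : L2 f -> sqint f = (\int[mu]_(x in D) (f x ^+ 2))%:E.
Proof. move=> [mf If]; have F : sqint f \is a fin_num by rewrite ge0_fin_numE.
by rewrite /Rintegral -/(sqint f) fineK. Qed.

(** A weighted Young inequality; with the weight [e] left free it does the work of the
    Cauchy-Schwarz inequality. *)
Lemma le_int_mul f g (e : R) : 0 < e -> L2 f -> L2 g ->
  `|\int[mu]_(x in D) (f x * g x)| <=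
  e * \int[mu]_(x in D) (f x ^+ 2) + e^-1 * \int[mu]_(x in D) (g x ^+ 2).
Proof.
move=> e0 Lf Lg; have iM := L2M_integrable Lf Lg.
have if2 := L2_integrable_sq Lf; have ig2 := L2_integrable_sq Lg.
have iZ a (h : T -> R) : mu.-integrable D (EFin \o h) -> mu.-integrable D (EFin \o (fun x => a * h x)).
  by move=> ih; exact: (integrableZl mD a ih).
apply: (le_trans (le_normr_Rintegral mD iM)).
rewrite -!RintegralZl// -RintegralD//; [|exact: iZ..].
apply: le_Rintegral => //.
- have := integrable_norm iM; by [].
- have := integrableD mD (iZ e _ if2) (iZ e^-1 _ ig2); by under eq_fun do rewrite /= -EFinD.
- move=> x _; rewrite normrM.
  rewrite -(real_normK (num_real (f x))) -(real_normK (num_real (g x))).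
  set a := `|f x|; set b := `|g x|.
  have a0 : 0 <= a by exact: normr_ge0.
  have b0 : 0 <= b by exact: normr_ge0.
  rewrite -(ler_pM2l e0) mulrDr !mulrA mulfV ?gt_eqF// mul1r.
  have := sqr_ge0 (e * a - b); rewrite !expr2; nra.
Qed.

(** Convergence makes the norm of [f_ n - u] finite for some [n], and [u = f_ n - (f_ n - u)] is
    then square integrable; from there on the limit can be read in the reals. *)
Lemma cvL2P (f_ : nat -> T -> R) u : (forall n, L2 (f_ n)) -> measurable_fun D u -> cvL2 f_ u ->
  L2 u /\ (fun n => \int[mu]_(x in D) ((f_ n x - u x) ^+ 2)) @ \oo --> (0 : R).
Proof.
move=> Lf mu' cv.
have Lu : L2 u.
  have [[n _ /= Hn] _] := (fine_cvgP _ _).1 cv.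
  have Lfu : L2 (fun x => f_ n x - u x).
    split; first by apply: measurable_funB => //; exact: (Lf n).1.
    by rewrite -ge0_fin_numE// Hn/=.
  split => //; rewrite (@eq_sqint u (fun x => f_ n x - (f_ n x - u x))); last by move=> x _; ring.
  exact: (L2B (Lf n) Lfu).2.
split => //; have := cv; rewrite /cvL2.
have -> : (fun n => sqint (fun x => f_ n x - u x)) =
    (fun n => (\int[mu]_(x in D) ((f_ n x - u x) ^+ 2))%:E).
  by apply/funext => n; rewrite sqint_fin//; exact: L2B.
by move=> /fine_cvgP[_]; exact.
Qed.

Lemma cvL2_int (f_ : nat -> T -> R) u g : (forall n, L2 (f_ n)) -> L2 u -> L2 g -> cvL2 f_ u ->
  (fun n => \int[mu]_(x in D) (f_ n x * g x)) @ \oo --> \int[mu]_(x in D) (u x * g x).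
Proof.
move=> Lf Lu Lg cv; have [_ cv'] := cvL2P Lf Lu.1 cv.
apply/cvgrPdist_le => e e0.
pose G := \int[mu]_(x in D) (g x ^+ 2).
have G0 : 0 <= G by apply: Rintegral_ge0 => x _; exact: sqr_ge0.
(* With this weight the term in [g] is at most [e / 2] for every [n]; the summand 1 covers the case
   [G = 0]. *)
pose t := e / (2 * (G + 1)); have t0 : 0 < t by rewrite divr_gt0// mulr_gt0// ltr_wpDl.
have et : 0 < e * t / 2 by rewrite divr_gt0// mulr_gt0.
move/cvgrPdist_le/(_ _ et): cv'; apply: filterS => n; rewrite sub0r normrN => Hn.
rewrite -RintegralB//; [|exact: L2M_integrable..].
under eq_Rintegral do rewrite -mulrBl.
have ti : 0 < t^-1 by rewrite invr_gt0.
apply: (le_trans (le_int_mul ti (L2B Lu (Lf n)) Lg)).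
rewrite invrK.
have -> : \int[mu]_(x in D) ((u x - f_ n x) ^+ 2) = \int[mu]_(x in D) ((f_ n x - u x) ^+ 2).
  by apply: eq_Rintegral => x _; rewrite -sqrrN opprB.
have X : \int[mu]_(x in D) ((f_ n x - u x) ^+ 2) <= e * t / 2 by apply: le_trans (ler_norm _) Hn.
have : t^-1 * \int[mu]_(x in D) ((f_ n x - u x) ^+ 2) <= e / 2.
  by rewrite mulrC ler_pdivrMr//; lra.
have : t * G <= e / 2.
  rewrite /t -mulrA -ler_pdivlMl// mulrA mulVf ?gt_eqF// mul1r.
  by rewrite ler_pdivrMl ?mulr_gt0 ?ltr_wpDl//; lra.
rewrite -/G; lra.
Qed.

Lemma sqint_eq0 f : measurable_fun D f -> sqint f = 0%E -> {ae mu, forall x, D x -> f x = 0}.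
Proof.
move=> mf f0; have /(ae_eq_integral_abs _ mD (measurable_sq mf)) : (\int[mu]_(x in D) `|(f x ^+ 2)%:E| = 0)%E.
  by rewrite -[RHS]f0; apply: eq_integral => x _; rewrite gee0_abs// lee_fin sqr_ge0.
apply: filterS => x H Dx; have := H Dx => -[] /eqP; rewrite sqrf_eq0 => /eqP; exact.
Qed.

Lemma sqint_ae_eq f g : measurable_fun D f -> measurable_fun D g ->
  {ae mu, forall x, D x -> f x = g x} -> sqint f = sqint g.
Proof.
move=> mf mg fg; apply: ae_eq_integral => //; try exact: measurable_sq.
by apply: filterS fg => x h Dx; rewrite h.
Qed.

Lemma ae_eq0_sqint f : measurable_fun D f -> {ae mu, forall x, D x -> f x = 0} -> sqint f = 0%E.
Proof.
move=> mf f0; rewrite (@sqint_ae_eq f (fun _ => 0))//.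
by rewrite /sqint expr0n/= integral0.
Qed.

Lemma cvL2_ext (f_ g_ : nat -> T -> R) u v : (forall n, measurable_fun D (f_ n)) ->
  (forall n, measurable_fun D (g_ n)) ->
  measurable_fun D u -> measurable_fun D v ->
  (forall n, {ae mu, forall x, D x -> f_ n x - u x = g_ n x - v x}) -> cvL2 f_ u -> cvL2 g_ v.
Proof.
move=> mf mg mu' mv E; rewrite /cvL2.
suff -> : (fun n => sqint (fun x => f_ n x - u x)) = (fun n => sqint (fun x => g_ n x - v x)) by [].
apply/funext => n; apply: sqint_ae_eq; [exact: measurable_funB|exact: measurable_funB|exact: E].
Qed.

Lemma cvL2D (f_ g_ : nat -> T -> R) u v : (forall n, measurable_fun D (f_ n)) ->
  (forall n, measurable_fun D (g_ n)) -> measurable_fun D u -> measurable_fun D v ->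
  cvL2 f_ u -> cvL2 g_ v -> cvL2 (fun n x => f_ n x + g_ n x) (fun x => u x + v x).
Proof.
move=> mf mg mu' mv cf cg.
apply: (@squeeze_cvge _ _ _ _ (fun=> 0%E) _
  (fun n => 2%:E * sqint (fun x => (f_ n x - u x)%R) + 2%:E * sqint (fun x => (g_ n x - v x)%R))%E).
- apply: nearW => n; rewrite sqint_ge0/=.
  rewrite (_ : (fun x => _) = (fun x => (f_ n x - u x) + (g_ n x - v x))); last first.
    by apply/funext => x; ring.
  by apply: sqintD_le; exact: measurable_funB.
- exact: cvg_cst.
- rewrite [X in _ --> X](_ : _ = 2%:E * 0 + 2%:E * 0)%E; last by rewrite !mule0 adde0.
  by apply: cvgeD; [by rewrite !mule0|apply: cvgeZl|apply: cvgeZl].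
Qed.

Lemma cvL2Z (f_ : nat -> T -> R) u a : (forall n, measurable_fun D (f_ n)) ->
  measurable_fun D u -> cvL2 f_ u -> cvL2 (fun n x => a * f_ n x) (fun x => a * u x).
Proof.
move=> mf mu' cf; rewrite /cvL2.
rewrite [X in X @ _ --> _](_ : _ = fun n => (a ^+ 2)%:E * sqint (fun x => (f_ n x - u x)%R))%E; last first.
  apply/funext => n; rewrite -sqintZ; last exact: measurable_funB.
  by congr sqint; apply/funext => x; ring.
rewrite [X in _ --> X](_ : _ = (a ^+ 2)%:E * 0)%E; last by rewrite mule0.
exact: cvgeZl.
Qed.

Lemma cvL2B (f_ g_ : nat -> T -> R) u v : (forall n, measurable_fun D (f_ n)) ->
  (forall n, measurable_fun D (g_ n)) -> measurable_fun D u -> measurable_fun D v ->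
  cvL2 f_ u -> cvL2 g_ v -> cvL2 (fun n x => f_ n x - g_ n x) (fun x => u x - v x).
Proof.
move=> mf mg mu' mv cf cg.
have := cvL2Z (-1) mg mv cg.
rewrite (_ : (fun n x => -1 * g_ n x) = (fun n x => - g_ n x)); last first.
  by apply/funext => n; apply/funext => x; rewrite mulN1r.
rewrite (_ : (fun x => -1 * v x) = (fun x => - v x)); last first.
  by apply/funext => x; rewrite mulN1r.
apply: cvL2D => //; last exact: measurableT_comp.
by move=> n; exact: measurableT_comp.
Qed.

Lemma cvL2_cst f u : measurable_fun D f -> measurable_fun D u ->
  {ae mu, forall x, D x -> u x = f x} -> cvL2 (fun _ => f) u.
Proof.
move=> mf mu' fu; rewrite /cvL2 (_ : (fun n : nat => _) = fun=> 0%E); first exact: cvg_cst.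
apply/funext => n; apply: ae_eq0_sqint; first exact: measurable_funB.
by apply: filterS fu => x h Dx; rewrite h ?subrr.
Qed.

Lemma cvL2_unique (f_ : nat -> T -> R) u v : (forall n, measurable_fun D (f_ n)) ->
  measurable_fun D u -> measurable_fun D v -> cvL2 f_ u -> cvL2 f_ v ->
  {ae mu, forall x, D x -> u x = v x}.
Proof.
move=> mf mu' mv cu cv.
have := cvL2B mf mf mu' mv cu cv; rewrite /cvL2.
rewrite (_ : (fun n : nat => _) = fun=> sqint (fun x => u x - v x)); last first.
  by apply/funext => n; rewrite -sqintN; congr sqint; apply/funext => x; ring.
move=> /(cvg_unique _ (cvg_cst _)) => /(_ ltac:(exact: ereal_hausdorff)).
move=> /(sqint_eq0 (measurable_funB mu' mv)).
by apply: filterS => x h Dx; apply/eqP; rewrite -subr_eq0; apply/eqP; exact: h.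
Qed.

Lemma cvL2Mb (f_ : nat -> T -> R) u g M : (forall n, measurable_fun D (f_ n)) ->
  measurable_fun D u -> measurable_fun D g -> (forall x, D x -> `|g x| <= M) ->
  cvL2 f_ u -> cvL2 (fun n x => f_ n x * g x) (fun x => u x * g x).
Proof.
move=> mf mu' mg gM cf.
apply: (@squeeze_cvge _ _ _ _ (fun=> 0%E) _
  (fun n => (M ^+ 2)%:E * sqint (fun x => (f_ n x - u x)%R))%E).
- apply: nearW => n; rewrite sqint_ge0/=.
  rewrite -sqintZ; last exact: measurable_funB.
  apply: le_sqint.
  + by apply: measurable_funB; exact: measurable_funM.
  + by apply: measurable_funM => //; exact: measurable_funB.
  + move=> x Dx; rewrite -mulrBl !normrM mulrC ler_wpM2r//.
    by apply: le_trans (gM _ Dx) _; exact: ler_norm.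
- exact: cvg_cst.
- rewrite [X in _ --> X](_ : _ = (M ^+ 2)%:E * 0)%E; last by rewrite mule0.
  exact: cvgeZl.
Qed.

Lemma L2_bounded f M : (mu D < +oo)%E -> measurable_fun D f -> (forall x, D x -> `|f x| <= M) -> L2 f.
Proof.
move=> Doo mf fM; split => //.
apply: (@le_lt_trans _ _ (\int[mu]_(x in D) (M ^+ 2)%:E)%E).
  apply: ge0_le_integral => //.
  - by move=> x _; rewrite lee_fin sqr_ge0.
  - exact: measurable_sq.
  - move=> x Dx; rewrite lee_fin -(real_normK (num_real (f x))) lerXn2r ?nnegrE ?fM//.
    exact: le_trans (fM _ Dx).
rewrite integral_cst//; apply: lte_mul_pinfty; rewrite ?lee_fin ?sqr_ge0//.
Qed.

Lemma L2_integrable f : (mu D < +oo)%E -> L2 f -> mu.-integrable D (EFin \o f).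
Proof.
move=> Doo Lf; have L1 : L2 (fun _ => 1).
  by apply: (@L2_bounded _ 1) => //; move=> x _; rewrite normr1.
by have := L2M_integrable Lf L1; under eq_fun do rewrite mulr1.
Qed.

Lemma limn_einf_le (v : nat -> \bar R) (a : \bar R) :
  (\forall n \near \oo, (v n <= a)%E) -> (limn_einf v <= a)%E.
Proof.
move=> va; rewrite limn_einf_lim; apply: lime_le; first exact: is_cvg_einfs.
apply: filterS va => n; apply: le_trans; apply: ereal_inf_lbound.
by exists n => /=.
Qed.

(** Fatou's lemma: the norm is lower semicontinuous under pointwise convergence. *)
Lemma le_sqint_of_cv (f_ : nat -> T -> R) u (a : \bar R) : (forall n, measurable_fun D (f_ n)) ->
  (forall x, D x -> f_ ^~ x @ \oo --> u x) ->
  (\forall n \near \oo, (sqint (f_ n) <= a)%E) -> (sqint u <= a)%E.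
Proof.
move=> mf cf fa.
have := @fatou _ _ _ mu D mD (fun n x => (f_ n x ^+ 2)%:E) (fun n => measurable_sq (mf n)).
have f0 n x : D x -> (0 <= (f_ n x ^+ 2)%:E)%E by rewrite lee_fin sqr_ge0.
move=> /(_ f0).
rewrite (_ : (\int[mu]_(x in D) limn_einf _)%E = sqint u); last first.
  apply: eq_integral => x /set_mem Dx.
  have : (f_ n x ^+ 2)%:E @[n --> \oo] --> (u x ^+ 2)%:E.
    apply: cvg_EFin; first exact: nearW.
    by rewrite /comp/= !expr2; apply: cvgM; exact: cf.
  by move=> /cvg_limn_einf_sup[->].
by move=> /le_trans; apply; exact: limn_einf_le.
Qed.

(** Since |a| <= t a^2 + 1/t with t = 2^(k+1), the absolute values are dominated by the given sums
    plus a geometric series. *)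
Lemma cvg_of_sq_weights (a : nat -> R) (M : R) :
  (forall n, \sum_(0 <= k < n) (2 ^+ k.+1 * a k ^+ 2) <= M) -> cvgn (series a).
Proof.
move=> aM; apply: normed_cvg.
pose b k := 2 ^+ k.+1 * a k ^+ 2 + 2^-1 * 2^-1 ^+ k : R.
apply: (@series_le_cvg _ _ b).
- by move=> n; exact: normr_ge0.
- by move=> n; rewrite addr_ge0// mulr_ge0 ?sqr_ge0 ?exprn_ge0 ?invr_ge0.
- move=> n; rewrite /b /= -exprS -(real_normK (num_real (a n))) exprVn.
  set t : R := 2 ^+ n.+1; have t0 : 0 < t by rewrite exprn_gt0.
  set x := `|a n|; rewrite -(ler_pM2l t0) mulrDr mulfV ?gt_eqF// mulrA.
  by have := sqr_ge0 (t * x - 1); rewrite !expr2; nra.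
have -> : series b = series (fun k => 2 ^+ k.+1 * a k ^+ 2) + series (geometric 2^-1 2^-1).
  by rewrite -seriesD; apply/funext => n; rewrite /series/=; apply: eq_bigr.
apply: is_cvgD.
  apply: nondecreasing_is_cvgn.
    by apply: nondecreasing_series => n _ _; rewrite mulr_ge0 ?sqr_ge0 ?exprn_ge0.
  by exists M => _ [n _ <-]; exact: aM.
by apply: is_cvg_geometric_series; rewrite ger0_norm ?invr_ge0//; lra.
Qed.

(** Riesz-Fischer. Along a fast subsequence the increments d_k satisfy int 2^(k+1) d_k^2 <=
    2^-(k+1); the sum of these integrands is integrable, hence finite off a null set, and there the
    increments are summable. *)
Lemma L2_complete (g : nat -> T -> R) : (forall n, L2 (g n)) ->
  (forall e : R, 0 < e -> exists N, forall m n, (N <= m)%N -> (N <= n)%N ->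
     (sqint (fun x => (g m x - g n x)%R) <= e%:E)%E) ->
  exists w, L2 w /\ cvL2 g w.
Proof.
move=> Lg Cg.
have Cg' k : exists N, forall m n, (N <= m)%N -> (N <= n)%N ->
     (sqint (fun x => (g m x - g n x)%R) <= ((2^-1 ^+ k.+1) ^+ 2)%:E)%E.
  by apply: Cg; rewrite exprn_gt0// exprn_gt0// invr_gt0.
have [N NP] := choice Cg'.
(* Summing makes the indices nondecreasing while keeping them above both [N k] and [k]. *)
pose phi k := (\sum_(i < k.+1) (N i).+1)%N.
have phiN k : (N k <= phi k)%N by rewrite /phi big_ord_recr /= addnS leqW// leq_addl.
have phiS k : (phi k <= phi k.+1)%N by rewrite /phi [X in (_ <= X)%N]big_ord_recr leq_addr.
have phi_mono k l : (k <= l)%N -> (phi k <= phi l)%N.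
  by move=> /subnKC <-; elim: (l - k)%N => [|i IH]; rewrite ?addn0// addnS (leq_trans IH).
have phik k : (k <= phi k)%N.
  elim: k => [|k IH] //; rewrite /phi big_ord_recr /= addnS ltnS.
  by rewrite (leq_trans IH)// leq_addr.
pose dd k x := g (phi k.+1) x - g (phi k) x.
have md k : measurable_fun D (dd k).
  by apply: measurable_funB; [exact: (Lg _).1|exact: (Lg _).1].
have Sd k : (sqint (dd k) <= ((2^-1 ^+ k.+1) ^+ 2)%:E)%E.
  by apply: NP; rewrite // (leq_trans (phiN k)).
pose q k x := (2 ^+ k.+1 * dd k x ^+ 2)%:E.
have q0 k x : (0 <= q k x)%E by rewrite lee_fin mulr_ge0 ?sqr_ge0 ?exprn_ge0.
have mq k : measurable_fun D (q k).
  by apply/measurable_EFinP; apply: measurable_funM => //; exact: measurable_funX.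
pose h x := (\sum_(0 <= k <oo) q k x)%E.
have h0 x : (0 <= h x)%E by apply: nneseries_ge0 => n _ _; exact: q0.
have mh : measurable_fun D h.
  by apply: ge0_emeasurable_sum => //.
have Ih : (\int[mu]_(x in D) h x < +oo)%E.
  rewrite /h integral_nneseries//.
  apply: (@le_lt_trans _ _ (\sum_(0 <= k <oo) (0 + (1 / (2 ^ k.+1)%:R)%:E))%E); last first.
    apply: le_lt_trans (@epsilon_trick R (fun=> 0%E) 1 xpredT (fun n => lexx _) ler01) _.
    by rewrite eseries0// add0e ltry.
  apply: lee_nneseries => [k _ _|k _]; first by apply: integral_ge0.
  rewrite /q; under eq_integral do rewrite EFinM.
  rewrite ge0_integralZl//; last 2 first.
  - exact: measurable_sq.
  - by move=> x _; rewrite lee_fin sqr_ge0.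
  rewrite add0e; apply: (@le_trans _ _ ((2 ^+ k.+1)%:E * ((2^-1 ^+ k.+1) ^+ 2)%:E)%E).
    by apply: lee_wpmul2l; [rewrite lee_fin exprn_ge0|exact: Sd].
  rewrite -EFinM lee_fin expr2 mulrA -exprMn mulfV ?pnatr_eq0// expr1n mul1r.
  by rewrite mul1r natrX exprVn.
have ih : mu.-integrable D h.
  apply/integrableP; split=> //; rewrite (_ : (\int[mu]_(x in D) `|h x|)%E = (\int[mu]_(x in D) h x)%E)//.
  by apply: eq_integral => x _; rewrite gee0_abs.
have [N0 [mN0 N00 subN0]] := integrable_ae mD ih.
have cvg_g x : D x -> ~ N0 x -> cvgn (fun k => g (phi k) x).
  move=> Dx Nx.
  have hf : h x \is a fin_num.
    by apply: contrapT => hx; apply: Nx; apply: subN0 => /= /(_ Dx).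
  have : cvgn (series (dd ^~ x)).
    apply: (@cvg_of_sq_weights _ (fine (h x))) => n.
    rewrite -lee_fin fineK// -sumEFin.
    apply: (@nneseries_lim_ge _ (q ^~ x) xpredT 0%N n) => k _ _; exact: q0.
  move=> /cvg_ex[l Hl]; apply/cvg_ex; exists (l + g (phi 0%N) x).
  rewrite (_ : (fun k => _) = (fun k => series (dd ^~ x) k + g (phi 0%N) x)); last first.
    apply/funext => k; rewrite /series/= /dd telescope_sumr//; ring.
  by apply: cvgD => //; exact: cvg_cst.
(* Cancelling the functions on the exceptional null set makes the subsequence converge everywhere on
   [D], so the limit is measurable. *)
pose G n := (g n) \_ (~` N0).
pose w x := limn (fun k => G (phi k) x).
have mG n : measurable_fun D (G n).
  apply/measurable_restrict => //; first exact: measurableC.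
  apply: measurable_funS (Lg n).1 => //; by move=> x [].
have GE n : {ae mu, forall x, D x -> G n x = g n x}.
  exists N0; split => // x /= H; apply: contrapT => Nx; apply: H => _.
  by rewrite /G patchE mem_set.
have cvG x : D x -> G (phi k) x @[k --> \oo] --> w x.
  move=> Dx; have [Nx|Nx] := pselect (N0 x); last first.
    rewrite /w; have -> : (fun k => G (phi k) x) = (fun k => g (phi k) x).
      by apply/funext => k; rewrite /G patchE mem_set.
    exact: cvg_g.
  rewrite /w; have -> : (fun k => G (phi k) x) = (fun=> 0).
    by apply/funext => k; rewrite /G patchE memNset//=.
  by rewrite lim_cst//; exact: cvg_cst.
have mw : measurable_fun D w.
  exact: (measurable_fun_cvg (fun k => mG (phi k)) cvG).
have cw : cvL2 g w.
  apply: (@cvL2_ext G g w w) => //; first by move=> n; exact: (Lg n).1.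
    by move=> n; apply: filterS (GE n) => x E Dx; rewrite E.
  (* Fatou's lemma for [G m - G (phi k)] as [k] grows, the bound being the Cauchy condition. *)
  have Gbd (e : R) : 0 < e -> exists n0, forall m, (n0 <= m)%N -> (sqint (fun x => (G m x - w x)%R) <= e%:E)%E.
    move=> e0; have [n0 Hn0] := Cg _ e0; exists n0 => m mn0.
    apply: (@le_sqint_of_cv (fun k x => G m x - G (phi k) x)).
    - by move=> k; exact: measurable_funB.
    - by move=> x Dx; apply: cvgB; [exact: cvg_cst|exact: cvG].
    exists n0 => // k /= Kk; rewrite (@sqint_ae_eq _ (fun x => g m x - g (phi k) x)).
    - by apply: Hn0 => //; exact: leq_trans (phik k).
    - exact: measurable_funB.
    - by apply: measurable_funB; exact: (Lg _).1.
    - by apply: filterS2 (GE m) (GE (phi k)) => x E1 E2 Dx; rewrite E1// E2.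
  apply/fine_cvgP; split.
    have [n0 H] := Gbd 1 ltr01; exists n0 => // m /= Hm.
    by rewrite ge0_fin_numE// (le_lt_trans (H _ Hm))// ltry.
  apply/cvgrPdist_le => e e0; have [n0 H] := Gbd e e0; exists n0 => // m /= Hm.
  rewrite sub0r normrN ger0_norm ?fine_ge0//.
  have fn : sqint (fun x => G m x - w x) \is a fin_num.
    by rewrite ge0_fin_numE// (le_lt_trans (H _ Hm))// ltry.
  by rewrite -lee_fin fineK// H.
by exists w; split => //; have [] := cvL2P Lg mw cw.
Qed.
End L2.
Arguments sqint {d T R} mu D f.
Arguments L2 {d T R} mu D f.
Arguments cvL2 {d T R} mu D f_ u.

(** * Traces and the sup bound on a triangle *)

Section C1more.
Context (R : realType).
Implicit Types (f g : R * R -> R).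

Lemma is_derive_affine (a b e : R) (p v : R * R) :
  is_derive p v (fun q : R * R => a * q.1 + b * q.2 + e) (a * v.1 + b * v.2).
Proof.
have H : (fun h : R => h^-1 *: (((fun q : R * R => a * q.1 + b * q.2 + e) \o shift p) (h *: v)
    - (a * p.1 + b * p.2 + e))) @ 0^' --> a * v.1 + b * v.2.
  apply: cvg_near_cst; near=> h.
  have h0 : h != 0 by near: h; exact: nbhs_dnbhs_neq.
  by rewrite /= /GRing.scale/=; field.
by apply: DeriveDef; [apply/cvg_ex; eexists; exact: H|exact/cvg_lim].
Unshelve. all: by end_near.
Qed.

Lemma pderiv_affine (a b e : R) (i : 'I_2) (p : R * R) :
  pderiv i (fun q : R * R => a * q.1 + b * q.2 + e) p = if i == 0 then a else b.
Proof.
rewrite /pderiv; have [_ ->] := is_derive_affine a b e p (unit_vec R i).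
by rewrite /unit_vec/=; case: i => [[|[|//]] ?]/=; ring.
Qed.

Lemma continuous_affine (a b e : R) : continuous (fun q : R * R => a * q.1 + b * q.2 + e).
Proof.
move=> p; apply: cvgD; last exact: cvg_cst.
apply: cvgD; apply: cvgM; do ?exact: cvg_cst; [exact: cvg_fst|exact: cvg_snd].
Qed.

Lemma C1_affine (a b e : R) : C1 (fun q : R * R => a * q.1 + b * q.2 + e).
Proof.
split; first exact: continuous_affine.
move=> i; split; first by move=> p; have [] := is_derive_affine a b e p (unit_vec R i).
have -> : pderiv i (fun q : R * R => a * q.1 + b * q.2 + e) = fun=> if i == 0 then a else b.
  by apply/funext => p; exact: pderiv_affine.
by move=> p; exact: cvg_cst.
Qed.

Lemma C1Z a f : C1 f -> C1 (fun p => a * f p) /\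
  forall i p, pderiv i (fun p => a * f p) p = a * pderiv i f p.
Proof.
move=> Cf; have [Cc dc] := C1_cst a; have [CM dM] := C1M Cc Cf; split => // i p.
have := dM (unit_vec R i) p; rewrite /dir_deriv !dc /unit_vec/=.
case: i => [[|[|//]] Hi]/=.
  by rewrite (_ : Ordinal Hi = 0); [rewrite !(mul1r, mul0r, addr0, add0r)|exact: val_inj].
by rewrite (_ : Ordinal Hi = 1); [rewrite !(mul1r, mul0r, addr0, add0r)|exact: val_inj].
Qed.

Lemma C1B f g : C1 f -> C1 g -> C1 (fun p => f p - g p) /\
  forall i, pderiv i (fun p => f p - g p) = (fun p => pderiv i f p - pderiv i g p).
Proof.
move=> Cf Cg; have [CN dN] := C1Z (-1) Cg; have [CD dD] := C1D Cf CN.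
have E : (fun p => f p - g p) = (fun p => f p + -1 * g p).
  by apply/funext => p; rewrite mulN1r.
by rewrite E; split => // i; apply/funext => p; rewrite dD dN mulN1r.
Qed.

Lemma dir_deriv_unit f i p : dir_deriv f (unit_vec R i) p = pderiv i f p.
Proof.
rewrite /dir_deriv /unit_vec/=; case: i => [[|[|//]] Hi]/=.
  by rewrite (_ : Ordinal Hi = 0); [rewrite !(mul1r, mul0r, addr0, add0r)|exact: val_inj].
by rewrite (_ : Ordinal Hi = 1); [rewrite !(mul1r, mul0r, addr0, add0r)|exact: val_inj].
Qed.

Lemma plane_aeS (P Q : R * R -> Prop) : (forall p, P p -> Q p) ->
  {ae plane_measure R, forall p, P p} -> {ae plane_measure R, forall p, Q p}.
Proof.
move=> PQ; apply: (@filterS _ _ (ae_filter_ringOfSetsType (plane_measure R))).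
exact: PQ.
Qed.

Lemma plane_aeS2 (P Q K : R * R -> Prop) : (forall p, P p -> Q p -> K p) ->
  {ae plane_measure R, forall p, P p} -> {ae plane_measure R, forall p, Q p} ->
  {ae plane_measure R, forall p, K p}.
Proof.
move=> PQ; apply: (@filterS2 _ _ (ae_filter_ringOfSetsType (plane_measure R))).
exact: PQ.
Qed.

Definition C2 f := C1 f /\ forall i, C1 (pderiv i f).

Lemma smooth_C2 f : smooth f -> C2 f.
Proof.
move=> sf; split; first exact: smooth_C1.
by move=> i; apply: smooth_C1; exact: smooth_pderiv.
Qed.

Lemma C2B f g : C2 f -> C2 g -> C2 (fun p => f p - g p).
Proof.
move=> [Cf df] [Cg dg]; have [CB dB] := C1B Cf Cg; split; first exact: CB.
by move=> i; rewrite dB; exact: (C1B (df i) (dg i)).1.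
Qed.

Lemma continuous_L2_segment (g : R -> R) : continuous g -> L2 (@lebesgue_measure R) `[0, 1] g.
Proof.
move=> cg; have [M HM] : exists M, forall s, s \in (`[0, 1] : interval R) -> `|g s| <= M.
  have /compact_bounded[M [_ HM]] : compact (g @` `[0, 1]%classic).
    apply: continuous_compact; last exact: segment_compact.
    exact: continuous_subspaceT.
  by exists (M + 1) => s s01; apply: (HM (M + 1)); [rewrite ltrDl|exists s].
have mI : measurable (`[0, 1]%classic : set R) by exact: measurable_itv.
apply: (@L2_bounded _ (measurableTypeR R) R (@lebesgue_measure R) _ mI g M).
- by rewrite /= lebesgue_measure_itv/= lte_fin ltr01 oppr0 adde0 ltry.
- by apply: measurable_funTS; exact: continuous_measurable_fun.
- by move=> s; exact: HM.
Qed.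
Lemma segment_intZ (g : R -> R) a : continuous g ->
  \int[@lebesgue_measure R]_(s in `[0, 1]) (a * g s) = a * \int[@lebesgue_measure R]_(s in `[0, 1]) g s.
Proof.
move=> cg; apply: RintegralZl; first exact: measurable_itv.
exact: continuous_segment_integrable.
Qed.

Lemma segment_intD (g h : R -> R) : continuous g -> continuous h ->
  \int[@lebesgue_measure R]_(s in `[0, 1]) (g s + h s) =
  \int[@lebesgue_measure R]_(s in `[0, 1]) g s + \int[@lebesgue_measure R]_(s in `[0, 1]) h s.
Proof.
move=> cg ch; apply: RintegralD; first exact: measurable_itv.
  exact: continuous_segment_integrable.
exact: continuous_segment_integrable.
Qed.
End C1more.

Section TriAnalysis.
Context (R : realType) (c : 'I_3 -> R * R).
Hypothesis jac_gt0 : 0 < jac c.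
Notation T := (interior (tri_set c)).
Notation mu := (plane_measure R).
Notation leb := (@lebesgue_measure R).
Implicit Types (f g u v w : R * R -> R).

Let mT : measurable (T : set (plane R)). Proof. exact: measurable_open_tri. Qed.
Let mI : measurable (`[0, 1]%classic : set R). Proof. exact: measurable_itv. Qed.

Lemma continuous_L2 f : continuous f -> L2 mu T f.
Proof.
move=> cf; have [M HM] := continuous_tri_bounded jac_gt0 (continuous_subspaceT cf).
apply: (L2_bounded mT (M := M)).
- exact: open_tri_finite.
- exact: continuous_measurable_prod.
- by move=> p /open_tri_sub; exact: HM.
Qed.

Lemma lam_affine k : exists a b e, lam c k = fun q : R * R => a * q.1 + b * q.2 + e.
Proof.
exists (- (edge c k).2 / jac c), ((edge c k).1 / jac c),
  (- cross (edge c k) (c (k + 1)) / jac c).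
apply/funext => p; rewrite /lam /dlam /cross !pairE; ring.
Qed.

Lemma C1_lam k : C1 (lam c k).
Proof. by have [a [b [e ->]]] := lam_affine k; exact: C1_affine. Qed.

(** The cubic bubble: positive inside and zero on the boundary, so as a factor it removes the
    boundary terms of Green's formula. *)
Definition bubble (p : R * R) : R := lam c 0 p * lam c 1 p * lam c 2 p.

Lemma C1_bubble : C1 bubble.
Proof. by apply: (C1M _ _).1; [apply: (C1M _ _).1|]; exact: C1_lam. Qed.

Lemma lam_side k s : [/\ lam c k (side_pt c k s) = 0, lam c (k + 1) (side_pt c k s) = 1 - s
  & lam c (k + 2) (side_pt c k s) = s].
Proof.
rewrite side_ptE /edge; split; rewrite !lamD !dlamZ !dlam_sub// !lam_corner//;
  elim/ord3P: k; rewrite ?ord3D ?eqxx ?ord3_neq/= ?mulr1n ?mulr0n; ring.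
Qed.

Lemma bubble_side k s : bubble (side_pt c k s) = 0.
Proof.
have [h _ _] := lam_side k s; rewrite /bubble.
by elim/ord3P: k h => ->; ring.
Qed.

Lemma bubble_gt0 p : T p -> 0 < bubble p.
Proof. by move=> /(open_triP jac_gt0) h; apply: mulr_gt0; [apply: mulr_gt0|]; exact: h. Qed.

Lemma Green_zero f g i : C1 f -> C1 g -> (forall k s, g (side_pt c k s) = 0) ->
  \int[mu]_(p in T) (pderiv i f p * g p) = - \int[mu]_(p in T) (f p * pderiv i g p).
Proof.
move=> Cf Cg g0; have := Green_mul jac_gt0 (unit_vec R i) Cf Cg.
under eq_Rintegral do rewrite dir_deriv_unit.
under [in RHS]eq_Rintegral do rewrite dir_deriv_unit.
move=> ->; rewrite big1 ?subr0// => k _; rewrite /side_int.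
under eq_Rintegral do rewrite g0 mulr0.
by rewrite /Rintegral integral0 mulr0.
Qed.

Lemma cvL2_int0 (f_ : nat -> R * R -> R) g : (forall n, L2 mu T (f_ n)) -> L2 mu T g ->
  cvL2 mu T f_ (fun=> 0) -> (fun n => \int[mu]_(p in T) (f_ n p * g p)) @ \oo --> (0 : R).
Proof.
move=> Lf Lg cf; have L0 : L2 mu T (fun=> 0) by apply: continuous_L2 => p; exact: cvg_cst.
have := cvL2_int mT Lf L0 Lg cf.
by under eq_Rintegral do rewrite mul0r; rewrite /Rintegral integral0.
Qed.

(* For phi = bubble * d_i f_m, which vanishes on the boundary, Green's formula
   gives int G phi = lim int (d_i f_n) phi = - lim int f_n (d_i phi) = 0; as
   m tends to infinity this becomes int bubble G^2 = 0. *)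
Lemma grad_closable (f_ : nat -> R * R -> R) i G : (forall n, C2 (f_ n)) ->
  measurable_fun T G -> cvL2 mu T f_ (fun=> 0) -> cvL2 mu T (fun n => pderiv i (f_ n)) G ->
  {ae mu, forall p, T p -> G p = 0}.
Proof.
move=> C2f mG cf cG.
have Lf n : L2 mu T (f_ n) by apply: continuous_L2; exact: (C2f n).1.1.
have Ld n : L2 mu T (pderiv i (f_ n)) by apply: continuous_L2; exact: ((C2f n).2 i).1.
have [LG _] := cvL2P mT Ld mG cG.
pose phi m p := pderiv i (f_ m) p * bubble p.
have Cphi m : C1 (phi m) by apply: (C1M _ _).1; [exact: (C2f m).2|exact: C1_bubble].
have Lphi m : L2 mu T (phi m) by apply: continuous_L2; exact: (Cphi m).1.
have phi0 m k s : phi m (side_pt c k s) = 0 by rewrite /phi bubble_side mulr0.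
have key m : \int[mu]_(p in T) (G p * phi m p) = 0.
  have h1 := cvL2_int mT Ld LG (Lphi m) cG.
  have h2 : (fun n => \int[mu]_(p in T) (pderiv i (f_ n) p * phi m p)) @ \oo --> (0 : R).
    have E n := Green_zero i (C2f n).1 (Cphi m) (phi0 m).
    under eq_cvg do rewrite E.
    have Lm : L2 mu T (pderiv i (phi m)) by apply: continuous_L2; exact: ((Cphi m).2 i).2.
    by have := cvgN (cvL2_int0 Lf Lm cf); rewrite oppr0; exact.
  exact: (cvg_unique _ h1 h2).
have [M HM] := continuous_tri_bounded jac_gt0 (continuous_subspaceT C1_bubble.1).
have mb : measurable_fun T bubble by apply: continuous_measurable_prod => //; exact: C1_bubble.1.
have cphi : cvL2 mu T phi (fun p => G p * bubble p).
  apply: (cvL2Mb mT (M := M)) => //.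
  - by move=> n; exact: (Ld n).1.
  - by move=> p /open_tri_sub; exact: HM.
have LGb : L2 mu T (fun p => G p * bubble p).
  by have [] := cvL2P mT Lphi (measurable_funM mG mb) cphi.
have I0 : \int[mu]_(p in T) (G p * bubble p * G p) = 0.
  have h1 := cvL2_int mT Lphi LGb LG cphi.
  have h2 : (fun n => \int[mu]_(p in T) (phi n p * G p)) @ \oo --> (0 : R).
    under eq_cvg do (under eq_Rintegral do rewrite mulrC; rewrite key).
    exact: cvg_cst.
  exact: (cvg_unique _ h1 h2).
have P0 p : T p -> 0 <= G p * bubble p * G p.
  by move=> Tp; rewrite mulrAC -expr2 mulr_ge0 ?sqr_ge0// ltW// bubble_gt0.
have mP : measurable_fun T (fun p => (G p * bubble p * G p)%:E).
  by apply/measurable_EFinP; apply: measurable_funM => //; exact: measurable_funM.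
have iP := L2M_integrable mT LGb LG.
have : (\int[mu]_(p in T) `|(G p * bubble p * G p)%:E| = 0)%E.
  transitivity (\int[mu]_(p in T) (G p * bubble p * G p)%:E)%E.
    by apply: eq_integral => p /set_mem Tp; rewrite gee0_abs// lee_fin P0.
  move: I0; rewrite /Rintegral => I0; rewrite -[LHS]fineK ?I0//.
  exact: integrable_fin_num.
move=> /(ae_eq_integral_abs _ mT mP); apply: plane_aeS => p H Tp.
have := H Tp => -[] /eqP; rewrite mulrAC -expr2 mulf_eq0 (gt_eqF (bubble_gt0 Tp)) orbF sqrf_eq0.
by move=> /eqP.
Qed.

(** The difference of the two approximations tends to zero, so [grad_closable] applies to it. Hence
    the limit chosen by [weak_pderiv] is determined almost everywhere. *)
Lemma weak_deriv_unique (f_ g_ : nat -> R * R -> R) u i G H :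
  (forall n, C2 (f_ n)) -> (forall n, C2 (g_ n)) -> measurable_fun T u ->
  measurable_fun T G -> measurable_fun T H ->
  cvL2 mu T f_ u -> cvL2 mu T g_ u ->
  cvL2 mu T (fun n => pderiv i (f_ n)) G -> cvL2 mu T (fun n => pderiv i (g_ n)) H ->
  {ae mu, forall p, T p -> G p = H p}.
Proof.
move=> Cf Cg mu' mG mH cf cg cG cH.
have mc f : continuous f -> measurable_fun T f by exact: continuous_measurable_prod.
have c0 : cvL2 mu T (fun n p => f_ n p - g_ n p) (fun=> 0).
  have := cvL2B mT (fun n => mc _ (Cf n).1.1) (fun n => mc _ (Cg n).1.1) mu' mu' cf cg.
  by rewrite (_ : (fun x => u x - u x) = fun=> 0)//; apply/funext => x; rewrite subrr.
have c1 : cvL2 mu T (fun n => pderiv i (fun p => f_ n p - g_ n p)) (fun p => G p - H p).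
  have := cvL2B mT (fun n => mc _ ((Cf n).2 i).1) (fun n => mc _ ((Cg n).2 i).1) mG mH cG cH.
  rewrite (_ : (fun n x => pderiv i (f_ n) x - pderiv i (g_ n) x) = (fun n => pderiv i (fun p => f_ n p - g_ n p)))//.
  by apply/funext => n; rewrite (C1B (Cf n).1 (Cg n).1).2.
have := grad_closable (fun n => C2B (Cf n) (Cg n)) (measurable_funB mG mH) c0 c1.
by apply: plane_aeS => p E Tp; apply/eqP; rewrite -subr_eq0; apply/eqP; exact: E.
Qed.

(* The divergence theorem for the field f^2 (p - c_k), whose normal component
   vanishes on the two sides through c_k. *)
Lemma trace_identity f k : C1 f ->
  jac c * side_int c k (fun p => f p ^+ 2) =
  \int[mu]_(p in T) (2 * f p ^+ 2 + 2 * f p * dir_deriv f (p - c k) p).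
Proof.
move=> Cf.
have Cx : C1 (fun p : R * R => 1 * p.1 + 0 * p.2 + - (c k).1) by exact: C1_affine.
have Cy : C1 (fun p : R * R => 0 * p.1 + 1 * p.2 + - (c k).2) by exact: C1_affine.
have [Cff dff] := C1M Cf Cf.
have [C1x dx] := C1M Cff Cx; have [C1y dy] := C1M Cff Cy.
have Gx := Green jac_gt0 (1, 0) C1x; have Gy := Green jac_gt0 (0, 1) C1y.
have cont (v : R * R) (g : R * R -> R) : C1 g -> mu.-integrable T (EFin \o dir_deriv g v).
  by move=> Cg; apply: continuous_tri_integrable => //; exact: continuous_dir_deriv.
transitivity (\int[mu]_(p in T) (dir_deriv (fun p => f p * f p * (1 * p.1 + 0 * p.2 + - (c k).1)) (1, 0) p
  + dir_deriv (fun p => f p * f p * (0 * p.1 + 1 * p.2 + - (c k).2)) (0, 1) p)); last first.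
  apply: eq_Rintegral => p _; rewrite dx dy !dff /dir_deriv !pderiv_affine/= ?pairE; ring.
rewrite RintegralD//; [|exact: cont..].
rewrite Gx Gy -opprD -big_split/=.
have cs (g : R * R -> R) j : continuous g -> continuous (fun s => g (side_pt c j s)).
  by move=> cg s; apply: continuous_comp; [exact: continuous_side|exact: cg].
have E j : cross (edge c j) (1, 0) * side_int c j (fun p => f p * f p * (1 * p.1 + 0 * p.2 - (c k).1)) +
    cross (edge c j) (0, 1) * side_int c j (fun p => f p * f p * (0 * p.1 + 1 * p.2 - (c k).2)) =
    - ((j == k)%:R * (jac c * side_int c k (fun p => f p ^+ 2))).
  have csx := cs _ j C1x.1; have csy := cs _ j C1y.1.
  have cc (g : R -> R) a : continuous g -> continuous (fun s => a * g s).
    by move=> cg s; apply: cvgM; [exact: cvg_cst|exact: cg].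
  rewrite /side_int -(segment_intZ _ csx) -(segment_intZ _ csy).
  rewrite -(segment_intD (cc _ _ csx) (cc _ _ csy)).
  transitivity (\int[leb]_(s in `[0, 1]) (- ((j == k)%:R * jac c) * f (side_pt c j s) ^+ 2)).
    apply: eq_Rintegral => s _.
    have jE : cross (edge c j) (side_pt c j s - c k) = - ((j == k)%:R * jac c).
      have := lamD c j (c k) (side_pt c j s - c k); rewrite subrKC.
      have [-> _ _] := lam_side j s; rewrite lam_corner//.
      move=> /eqP; rewrite eq_sym addrC addr_eq0 => /eqP E.
      by rewrite -mulNr -E /dlam mulfVK// gt_eqF.
    rewrite -jE /cross !pairE/=; ring.
  have csf : continuous (fun s => f (side_pt c j s) ^+ 2).
    by under eq_fun do rewrite expr2; exact: (cs _ j Cff.1).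
  rewrite (segment_intZ _ csf).
  case: eqVneq => [->|_]; last by rewrite !mul0r oppr0 mul0r.
  by rewrite !mul1r mulNr.
under eq_bigr do rewrite E.
rewrite sumrN opprK (bigD1 k)//= eqxx mul1r big1 ?addr0// => j /negbTE ->; exact: mul0r.
Qed.

Definition h1sq f : R := \int[mu]_(p in T) (f p ^+ 2)
  + \sum_(i < 2) \int[mu]_(p in T) (pderiv i f p ^+ 2).

(** In [trace_identity] the components of [p - c k] are at most [B], and 2 |f d_i f| <= f^2 + (d_i
    f)^2; this gives the factor 2 + 2B. *)
Lemma trace_ineq f k B : C1 f ->
  (forall p, tri_set c p -> `|p.1 - (c k).1| <= B /\ `|p.2 - (c k).2| <= B) ->
  jac c * side_int c k (fun p => f p ^+ 2) <= (2 + 2 * B) * h1sq f.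
Proof.
move=> Cf HB; rewrite trace_identity//.
have B0 : 0 <= B.
  have ck : tri_set c (c k) by apply/tri_setP => // j; rewrite lam_corner.
  by have [h _] := HB _ ck; apply: le_trans h.
have ii (g : R * R -> R) : continuous g -> mu.-integrable T (EFin \o g) by exact: continuous_tri_integrable.
have csq (g : R * R -> R) : continuous g -> continuous (fun p => g p ^+ 2).
  by move=> cg; under eq_fun do rewrite expr2; move=> p; apply: cvgM; exact: cg.
have cf2 := csq _ Cf.1; have cd i := csq _ (Cf.2 i).2.
rewrite /h1sq big_ord_recl big_ord1.
set i0 : 'I_2 := ord0; set i1 : 'I_2 := lift _ _.
have i1E : i1 = 1 by exact: val_inj.
rewrite -!RintegralD//; do ?[exact: ii|apply: ii => p; apply: cvgD; [exact: cd|exact: cd]].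
rewrite -RintegralZl//; last first.
  apply: ii => p; apply: cvgD; [exact: cf2|apply: cvgD; exact: cd].
apply: le_Rintegral => //.
- apply: ii => p; apply: cvgD; first by apply: cvgM; [exact: cvg_cst|exact: cf2].
  apply: cvgM; first by apply: cvgM; [exact: cvg_cst|exact: Cf.1].
  apply: cvgD; (apply: cvgM; last exact: (Cf.2 _).2); apply: cvgB; do ?exact: cvg_cst.
  exact: cvg_fst. exact: cvg_snd.
- apply: ii => p; apply: cvgM; first exact: cvg_cst.
  apply: cvgD; [exact: cf2|apply: cvgD; exact: cd].
move=> p /open_tri_sub /HB[h1 h2]; rewrite /dir_deriv !pairE i1E.
rewrite (_ : i0 = 0)//.
set a := pderiv 0 f p; set b := pderiv 1 f p; set x := f p.
move: h1 h2; set X := (_ - _); set Y := (p.2 - _); rewrite !ler_norml => /andP[X1 X2] /andP[Y1 Y2].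
have hx : 2 * x * (X * a) <= B * (x ^+ 2 + a ^+ 2).
  have := mulr_ge0 (_ : 0 <= B - X) (sqr_ge0 (x + a)); have := mulr_ge0 (_ : 0 <= B + X) (sqr_ge0 (x - a)).
  rewrite !expr2 => /(_ ltac:(lra)) h1 /(_ ltac:(lra)) h2; nra.
have hy : 2 * x * (Y * b) <= B * (x ^+ 2 + b ^+ 2).
  have := mulr_ge0 (_ : 0 <= B - Y) (sqr_ge0 (x + b)); have := mulr_ge0 (_ : 0 <= B + Y) (sqr_ge0 (x - b)).
  rewrite !expr2 => /(_ ltac:(lra)) h1 /(_ ltac:(lra)) h2; nra.
have := sqr_ge0 x; have := sqr_ge0 a; have := sqr_ge0 b.
move: hx hy; rewrite !expr2; nra.
Qed.

Lemma int_sq_continuous_ge0 f : 0 <= \int[mu]_(p in T) (f p ^+ 2).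
Proof. by apply: Rintegral_ge0 => p _; exact: sqr_ge0. Qed.

Lemma h1sq_ge0 f : 0 <= h1sq f.
Proof.
by rewrite addr_ge0 ?int_sq_continuous_ge0// sumr_ge0// => i _; exact: int_sq_continuous_ge0.
Qed.

Lemma tri_diff_bounded : exists2 B : R, 0 <= B &
  forall p q, tri_set c p -> tri_set c q -> `|p.1 - q.1| <= B /\ `|p.2 - q.2| <= B.
Proof.
have [M HM] := tri_bounded jac_gt0.
have ck : tri_set c (c 0) by apply/tri_setP => // j; rewrite lam_corner.
have M0 : 0 <= M by have [h _] := HM _ ck; apply: le_trans h.
exists (M + M) => [|p q /HM[p1 p2] /HM[q1 q2]]; first by rewrite addr_ge0.
by split; apply: (le_trans (ler_normB _ _)); rewrite lerD.
Qed.

Lemma corner_in k : tri_set c (c k).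
Proof. by apply/tri_setP => // j; rewrite lam_corner. Qed.

Lemma side_in k s : s \in (`[0, 1] : interval R) -> tri_set c (side_pt c k s).
Proof.
rewrite in_itv/= => /andP[s0 s1]; apply/tri_setP => // j.
have [h0 h1 h2] := lam_side k s.
have [->|->|->] : [\/ j = k, j = k + 1 | j = k + 2].
  by elim/ord3P: j; elim/ord3P: k {h0 h1 h2}; rewrite ?ord3D;
    by [constructor 1|constructor 2|constructor 3].
- by rewrite h0.
- by rewrite h1 subr_ge0.
- by rewrite h2.
Qed.

Definition segI : measurable (`[0, 1]%classic : set (measurableTypeR R)) := measurable_itv _.

Lemma continuous_side_comp f k : continuous f -> continuous (fun s => f (side_pt c k s)).
Proof. by move=> cf s; apply: continuous_comp; [exact: continuous_side|exact: cf]. Qed.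

Lemma trace_cv0 (d : nat -> R * R -> R) k : (forall n, C1 (d n)) ->
  (fun n => h1sq (d n)) @ \oo --> (0 : R) ->
  cvL2 leb `[0, 1] (fun n s => d n (side_pt c k s)) (fun=> 0).
Proof.
move=> Cd cd; have [B B0 HB] := tri_diff_bounded.
have Ls n : L2 leb `[0, 1] (fun s => d n (side_pt c k s)).
  by apply: continuous_L2_segment; apply: continuous_side_comp; exact: (Cd n).1.
rewrite /cvL2 (_ : (fun n => sqint _ _ _) =
    (fun n => (side_int c k (fun p => d n p ^+ 2))%:E)); last first.
  apply/funext => n; rewrite -(sqint_fin (Ls n)).
  by apply: eq_sqint => s _; rewrite subr0.
apply: cvg_EFin; first exact: nearW.
have K0 : 0 < jac c by [].
apply: (@squeeze_cvgr _ _ _ _ (fun=> 0) (fun n => (2 + 2 * B) / jac c * h1sq (d n))).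
- apply: nearW => n; rewrite /comp/=; apply/andP; split.
    by apply: Rintegral_ge0 => s _; exact: sqr_ge0.
  rewrite mulrAC ler_pdivlMr// mulrC; apply: trace_ineq => // p pT.
  by apply: HB => //; exact: corner_in.
- exact: cvg_cst.
- by rewrite -[X in _ --> X](mulr0 ((2 + 2 * B) / jac c)); apply: cvgM => //; exact: cvg_cst.
Qed.

Let mc f : continuous f -> measurable_fun T f.
Proof. exact: continuous_measurable_prod. Qed.

Lemma h1sq_cv0 (d : nat -> R * R -> R) : (forall n, C1 (d n)) ->
  cvL2 mu T d (fun=> 0) -> (forall i, cvL2 mu T (fun n => pderiv i (d n)) (fun=> 0)) ->
  (fun n => h1sq (d n)) @ \oo --> (0 : R).
Proof.
move=> Cd c0 c1.
have L0 : L2 mu T (fun=> 0) by apply: continuous_L2 => p; exact: cvg_cst.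
have key (e : nat -> R * R -> R) : (forall n, continuous (e n)) -> cvL2 mu T e (fun=> 0) ->
    (fun n => \int[mu]_(p in T) (e n p ^+ 2)) @ \oo --> (0 : R).
  move=> ce cve; have [_] := cvL2P mT (fun n => continuous_L2 (ce n)) L0.1 cve.
  rewrite (_ : (fun n => \int[mu]_(p in T) (e n p - 0) ^+ 2) = (fun n => \int[mu]_(p in T) (e n p ^+ 2)))//.
  by apply/funext => n; apply: eq_Rintegral => p _; rewrite subr0.
have a := key d (fun n => (Cd n).1) c0.
have b i := key (fun n => pderiv i (d n)) (fun n => ((Cd n).2 i).2) (c1 i).
have H : (fun n => \int[mu]_(p in T) (d n p ^+ 2) + (\int[mu]_(p in T) (pderiv ord0 (d n) p ^+ 2) +
    \int[mu]_(p in T) (pderiv (lift ord0 ord0) (d n) p ^+ 2))) @ \oo --> (0 + (0 + 0) : R).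
  by apply: cvgD; [exact: a|apply: cvgD; exact: b].
rewrite !addr0 in H; rewrite (_ : (fun n => h1sq (d n)) = (fun n => \int[mu]_(p in T) (d n p ^+ 2) +
    (\int[mu]_(p in T) (pderiv ord0 (d n) p ^+ 2) +
    \int[mu]_(p in T) (pderiv (lift ord0 ord0) (d n) p ^+ 2))))//.
by apply/funext => n; rewrite /h1sq big_ord_recl big_ord1.
Qed.

Lemma cvL2_sub0 (f_ g_ : nat -> R * R -> R) u w : (forall n, continuous (f_ n)) ->
  (forall n, continuous (g_ n)) -> measurable_fun T u -> measurable_fun T w ->
  {ae mu, forall p, T p -> u p = w p} ->
  cvL2 mu T f_ u -> cvL2 mu T g_ w -> cvL2 mu T (fun n p => f_ n p - g_ n p) (fun=> 0).
Proof.
move=> Cf Cg mu' mw uw cf cg.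
have := cvL2B mT (fun n => mc (Cf n)) (fun n => mc (Cg n)) mu' mw cf cg.
apply: cvL2_ext => //.
- by move=> n; apply: measurable_funB; exact: mc.
- by move=> n; apply: measurable_funB; exact: mc.
- exact: measurable_funB.
- move=> n; apply: plane_aeS uw => p uw Tp; rewrite /= uw//; ring.
Qed.

(** [G] and [H] agree almost everywhere by uniqueness of weak derivatives, so the difference of the
    approximations tends to zero in H^1; by the trace inequality so do its restrictions to the
    side. *)
Lemma trace_unique (f_ g_ : nat -> R * R -> R) u (G H : 'I_2 -> R * R -> R) k (w w' : R -> R) :
  (forall n, C2 (f_ n)) -> (forall n, C2 (g_ n)) -> measurable_fun T u ->
  (forall i, measurable_fun T (G i)) -> (forall i, measurable_fun T (H i)) ->
  cvL2 mu T f_ u -> cvL2 mu T g_ u ->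
  (forall i, cvL2 mu T (fun n => pderiv i (f_ n)) (G i)) ->
  (forall i, cvL2 mu T (fun n => pderiv i (g_ n)) (H i)) ->
  measurable_fun (`[0, 1]%classic : set R) w -> measurable_fun (`[0, 1]%classic : set R) w' ->
  cvL2 leb `[0, 1] (fun n s => f_ n (side_pt c k s)) w ->
  cvL2 leb `[0, 1] (fun n s => g_ n (side_pt c k s)) w' ->
  {ae leb, forall s, `[0, 1]%classic s -> w s = w' s}.
Proof.
move=> Cf Cg mu' mG mH cf cg cG cH mw mw' cw cw'.
have CB n := C1B (Cf n).1 (Cg n).1.
have Cd n : C1 (fun p => f_ n p - g_ n p) := (CB n).1.
have uu : {ae mu, forall p, T p -> u p = u p} by exact: aeW.
have c0 := cvL2_sub0 (fun n => (Cf n).1.1) (fun n => (Cg n).1.1) mu' mu' uu cf cg.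
have c1 i : cvL2 mu T (fun n => pderiv i (fun p => f_ n p - g_ n p)) (fun=> 0).
  rewrite (_ : (fun n => _) = (fun n p => pderiv i (f_ n) p - pderiv i (g_ n) p)); last first.
    by apply/funext => n; exact: (CB n).2.
  apply: (@cvL2_sub0 _ _ (G i) (H i)) => //.
  - by move=> n; exact: ((Cf n).2 i).1.
  - by move=> n; exact: ((Cg n).2 i).1.
  - exact: (@weak_deriv_unique f_ g_ u i).
have h0 := trace_cv0 k Cd (h1sq_cv0 Cd c0 c1).
have ms (h : nat -> R * R -> R) n : C2 (h n) -> measurable_fun (`[0, 1]%classic : set (measurableTypeR R)) (fun s => h n (side_pt c k s)).
  move=> Ch; apply: measurable_funTS; apply: continuous_measurable_fun.
  by apply: continuous_side_comp; exact: Ch.1.1.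
have h1 := cvL2B segI (fun n => ms f_ n (Cf n)) (fun n => ms g_ n (Cg n)) mw mw' cw cw'.
have m0 : measurable_fun (`[0, 1]%classic : set (measurableTypeR R)) (fun=> 0 : R) by [].
have := cvL2_unique segI (fun n => measurable_funB (ms f_ n (Cf n)) (ms g_ n (Cg n)))
  (measurable_funB mw mw') m0 h1 h0.
apply: filterS => s E s01; apply/eqP; rewrite -subr_eq0; apply/eqP; exact: E.
Qed.

Lemma cvL2_cauchy (f_ : nat -> R * R -> R) u : (forall n, continuous (f_ n)) ->
  measurable_fun T u -> cvL2 mu T f_ u -> forall e : R, 0 < e -> exists N, forall m n,
    (N <= m)%N -> (N <= n)%N -> \int[mu]_(p in T) ((f_ m p - f_ n p) ^+ 2) <= e.
Proof.
move=> Cf mu' cf e e0.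
have Lf n := continuous_L2 (Cf n).
have [Lu cv] := cvL2P mT Lf mu' cf.
(* The squared norm of a difference is at most twice the sum of the squared norms: 2 (e/4) + 2 (e/4)
   = e. *)
have e4 : 0 < e / 4 by rewrite divr_gt0.
have [N _ HN] := (cvgrPdist_le _ _).1 cv _ e4.
exists N => m n mN nN.
have Lmu j := L2B mT (Lf j) Lu.
have LB := L2B mT (Lf m) (Lf n).
rewrite -lee_fin -(sqint_fin LB).
have H1 := sqintD_le mu mT (Lmu m).1 (L2N (Lmu n)).1.
have E1 : sqint mu T (fun p => f_ m p - f_ n p) = sqint mu T (fun p => (f_ m p - u p) + - (f_ n p - u p)).
  by apply: eq_sqint => p _; ring.
rewrite E1; apply: (le_trans H1).
rewrite sqintN !sqint_fin// -!EFinM -EFinD lee_fin.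
have := HN m mN; have := HN n nN; rewrite /= !sub0r !normrN.
move=> /(le_trans (ler_norm _)) h1 /(le_trans (ler_norm _)) h2; lra.
Qed.

Lemma h1sq_cauchy (f_ : nat -> R * R -> R) u (G : 'I_2 -> R * R -> R) :
  (forall n, C1 (f_ n)) -> measurable_fun T u -> (forall i, measurable_fun T (G i)) ->
  cvL2 mu T f_ u -> (forall i, cvL2 mu T (fun n => pderiv i (f_ n)) (G i)) ->
  forall e : R, 0 < e -> exists N, forall m n,
    (N <= m)%N -> (N <= n)%N -> h1sq (fun p => f_ m p - f_ n p) <= e.
Proof.
move=> Cf mu' mG cf cG e e0; have e3 : 0 < e / 3 by rewrite divr_gt0.
have [N HN] := cvL2_cauchy (fun n => (Cf n).1) mu' cf e3.
have [N0 HN0] := cvL2_cauchy (fun n => ((Cf n).2 ord0).2) (mG ord0) (cG ord0) e3.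
have [N1 HN1] := cvL2_cauchy (fun n => ((Cf n).2 (lift ord0 ord0)).2) (mG _) (cG (lift ord0 ord0)) e3.
exists (maxn N (maxn N0 N1)) => m n; rewrite !geq_max => /and3P[m1 m2 m3] /and3P[n1 n2 n3].
rewrite /h1sq big_ord_recl big_ord1 !(C1B (Cf m) (Cf n)).2.
apply: (le_trans (lerD (HN m n m1 n1) (lerD (HN0 m n m2 n2) (HN1 m n m3 n3)))); lra.
Qed.

(** By the trace inequality a Cauchy sequence in H^1 restricts to a Cauchy sequence in L^2 of the
    side, which is complete. *)
Lemma trace_exists (f_ : nat -> R * R -> R) u (G : 'I_2 -> R * R -> R) k :
  (forall n, C1 (f_ n)) -> measurable_fun T u -> (forall i, measurable_fun T (G i)) ->
  cvL2 mu T f_ u -> (forall i, cvL2 mu T (fun n => pderiv i (f_ n)) (G i)) ->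
  exists w : R -> R, L2 leb `[0, 1] w /\ cvL2 leb `[0, 1] (fun n s => f_ n (side_pt c k s)) w.
Proof.
move=> Cf mu' mG cf cG.
have Ls n : L2 leb `[0, 1] (fun s => f_ n (side_pt c k s)).
  by apply: continuous_L2_segment; apply: continuous_side_comp; exact: (Cf n).1.
apply: (L2_complete segI) => // e e0.
have [B B0 HB] := tri_diff_bounded.
pose K := (2 + 2 * B) / jac c.
have K0 : 0 < K by rewrite divr_gt0// ltr_pwDl// mulr_ge0.
have [N HN] := h1sq_cauchy Cf mu' mG cf cG (divr_gt0 e0 K0).
exists N => m n mN nN; rewrite sqint_fin ?lee_fin; last exact: L2B.
have Cd := (C1B (Cf m) (Cf n)).1.
have h1 := @trace_ineq _ k B Cd (fun p pT => HB _ _ pT (corner_in k)).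
rewrite -(ler_pM2l jac_gt0); apply: (le_trans h1).
have B2 : 0 < 2 + 2 * B by rewrite ltr_pwDl// mulr_ge0.
have -> : jac c * e = (2 + 2 * B) * (e / K).
  rewrite /K; move: (jac c) jac_gt0 => J J0; field; apply/andP; split; exact: lt0r_neq0.
by rewrite ler_pM2l// HN.
Qed.

(** g(0)^2 is the integral of the derivative of (s - 1) g^2, that is of g^2 + 2 (s - 1) g g', and
    the mixed term is at most g^2 + g'^2. *)
Lemma segment_value (g g' : R -> R) : (forall s : R, is_derive s (1 : R) g (g' s)) -> continuous g' ->
  g 0 ^+ 2 <= 2 * \int[leb]_(s in `[0, 1]) (g s ^+ 2) + \int[leb]_(s in `[0, 1]) (g' s ^+ 2).
Proof.
move=> dg cg'.
have cg : continuous g.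
  move=> s; apply: differentiable_continuous; apply/derivable1_diffP.
  by have [] := dg s.
have csq (h : R -> R) : continuous h -> continuous (fun s => h s ^+ 2).
  by move=> ch; under eq_fun do rewrite expr2; move=> s; apply: cvgM; exact: ch.
have cx := @continuous_onem R 1.
have dF (s : R) : is_derive s (1 : R) (fun s => (s - 1) * (g s * g s))
    (g s ^+ 2 + 2 * (s - 1) * g s * g' s).
  have d1 : is_derive s (1 : R) (fun s : R => s - 1) 1.
    by rewrite -[X in is_derive _ _ _ X]subr0; apply: is_deriveB.
  have [dF vF] := is_deriveM d1 (is_deriveM (dg s) (dg s)).
  apply: DeriveDef; first exact: dF.
  rewrite [LHS]vF [LHS](_ : _ = (s - 1) * (g s * g' s + g s * g' s) + (g s * g s) * 1)//; ring.
have cd : continuous (fun s : R => g s ^+ 2 + 2 * (s - 1) * g s * g' s).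
  move=> s; apply: cvgD; first exact: csq.
  apply: cvgM; last exact: cg'; apply: cvgM; last exact: cg.
  by apply: cvgM; [exact: cvg_cst|apply: cvgB; [exact: cvg_id|exact: cvg_cst]].
have -> : g 0 ^+ 2 = \int[leb]_(s in `[0, 1]) (g s ^+ 2 + 2 * (s - 1) * g s * g' s).
  by rewrite /Rintegral (ftc_line ler01 dF cd)/= expr2; ring.
have c2 (h : R -> R) : continuous h -> continuous (fun s => 2 * h s).
  by move=> ch s; apply: cvgM; [exact: cvg_cst|exact: ch].
rewrite -(segment_intZ _ (csq _ cg)) -(segment_intD (c2 _ (csq _ cg)) (csq _ cg')).
apply: le_Rintegral; first exact: segI.
- exact: continuous_segment_integrable.
- apply: continuous_segment_integrable => s; apply: cvgD; [exact: (c2 _ (csq _ cg))|exact: csq].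
move=> s; rewrite /= in_itv/= => /andP[s0 s1].
have := sqr_ge0 (g s + g' s); have := sqr_ge0 (g s - g' s).
rewrite !expr2; nra.
Qed.

Definition h2sq f : R := h1sq f + \sum_(i < 2) h1sq (pderiv i f).

(** The value at a corner is controlled along the side that starts there by the function and its
    tangential derivative; the trace inequality is then applied to [f] and to its two partial
    derivatives. *)
Lemma corner_bound f k B L : C2 f -> 0 <= B ->
  (forall p, tri_set c p -> `|p.1 - (c k).1| <= B /\ `|p.2 - (c k).2| <= B) ->
  `|(edge c k).1| <= L -> `|(edge c k).2| <= L ->
  f (c (k + 1)) ^+ 2 <= (2 + 2 * B) * (2 + 2 * L ^+ 2) / jac c * h2sq f.
Proof.
move=> [Cf Cd] B0 HB L1 L2'.
have dg (s : R) : is_derive s (1 : R) (fun s => f (side_pt c k s)) (dir_deriv f (edge c k) (side_pt c k s)).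
  rewrite (_ : (fun s => f (side_pt c k s)) = (fun s => f (c (k + 1) + s *: edge c k))); last first.
    by apply/funext => s'; rewrite side_ptE.
  by rewrite side_ptE; exact: C1_line.
have cg' : continuous (fun s => dir_deriv f (edge c k) (side_pt c k s)).
  by apply: continuous_side_comp; exact: continuous_dir_deriv.
have := segment_value dg cg'.
rewrite {1}side_ptE scale0r addr0 => /le_trans; apply.
have I0 := trace_ineq Cf HB.
have I1 i := trace_ineq (Cd i) HB.
set e1 := (edge c k).1 in L1; set e2 := (edge c k).2 in L2'.
have csq (h : R -> R) : continuous h -> continuous (fun s => h s ^+ 2).
  by move=> ch; under eq_fun do rewrite expr2; move=> s; apply: cvgM; exact: ch.
have cdi i : continuous (fun s => pderiv i f (side_pt c k s) ^+ 2).
  by apply: csq; apply: continuous_side_comp; exact: (Cd i).1.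
have cz (a : R) (h : R -> R) : continuous h -> continuous (fun s => a * h s).
  by move=> ch s; apply: cvgM; [exact: cvg_cst|exact: ch].
have E2 : \int[leb]_(s in `[0, 1]) (dir_deriv f (edge c k) (side_pt c k s) ^+ 2) <=
    2 * L ^+ 2 * side_int c k (fun p => pderiv 0 f p ^+ 2) +
    2 * L ^+ 2 * side_int c k (fun p => pderiv 1 f p ^+ 2).
  rewrite /side_int.
  apply: (@le_trans _ _ (\int[leb]_(s in `[0, 1]) (2 * L ^+ 2 * pderiv 0 f (side_pt c k s) ^+ 2 +
    2 * L ^+ 2 * pderiv 1 f (side_pt c k s) ^+ 2))); last first.
    have h0 := segment_intZ (2 * L ^+ 2) (cdi 0); have h1 := segment_intZ (2 * L ^+ 2) (cdi 1).
    have h := segment_intD (cz (2 * L ^+ 2) _ (cdi 0)) (cz (2 * L ^+ 2) _ (cdi 1)).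
    by rewrite h h0 h1.
  apply: le_Rintegral; first exact: segI.
  - by apply: continuous_segment_integrable; exact: csq.
  - apply: continuous_segment_integrable => s; apply: cvgD; exact: (cz _ _ (cdi _)).
  move=> s _; rewrite /dir_deriv -/e1 -/e2.
  set a := pderiv 0 f _; set b := pderiv 1 f _.
  have h1 : (e1 * a) ^+ 2 <= L ^+ 2 * a ^+ 2.
    rewrite exprMn ler_wpM2r ?sqr_ge0// -(real_normK (num_real e1)) lerXn2r ?nnegrE//.
    exact: le_trans L1.
  have h2 : (e2 * b) ^+ 2 <= L ^+ 2 * b ^+ 2.
    rewrite exprMn ler_wpM2r ?sqr_ge0// -(real_normK (num_real e2)) lerXn2r ?nnegrE//.
    exact: le_trans L2'.
  move: h1 h2; move: (e1 * a) (e2 * b) => x y; have := sqr_ge0 (x - y).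
  by rewrite sqrrB sqrrD; lra.
rewrite -(ler_pM2l jac_gt0).
have -> : jac c * ((2 + 2 * B) * (2 + 2 * L ^+ 2) / jac c * h2sq f) = (2 + 2 * B) * (2 + 2 * L ^+ 2) * h2sq f.
  by move: (jac c) jac_gt0 => J J0; field; exact: lt0r_neq0.
move: I0 (I1 0) (I1 1) E2; rewrite /h2sq big_ord_recl big_ord1.
rewrite (_ : lift ord0 ord0 = 1 :> 'I_2); last exact: val_inj.
rewrite (_ : ord0 = 0 :> 'I_2)// -/(side_int c k (fun p => f p ^+ 2)).
have := h1sq_ge0 f; have := h1sq_ge0 (pderiv 0 f); have := h1sq_ge0 (pderiv 1 f).
move: (h1sq f) (h1sq _) (h1sq _) (side_int c k _) (side_int c k _) (side_int c k _) (\int[leb]_(s in _) _).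
move=> x y z Z Y X W z0 y0 x0 HX HY HZ HW.
have l2 := sqr_ge0 L; move: (L ^+ 2) l2 HW => l l0 HW.
have J0 := ltW jac_gt0; move: (jac c) J0 HX HY HZ => J J0 HX HY HZ.
have h : J * W <= 2 * l * (J * Y) + 2 * l * (J * Z).
  by apply: le_trans (ler_wpM2l J0 HW) _; rewrite le_eqVlt; apply/orP; left; apply/eqP; ring.
have hy := ler_wpM2l (mulr_ge0 (ler0n R 2) l0) HY; have hz := ler_wpM2l (mulr_ge0 (ler0n R 2) l0) HZ.
have hB : 0 <= 2 + 2 * B by rewrite addr_ge0// mulr_ge0.
move: (2 + 2 * B) hB HX HY HZ hy hz => b b0 HX HY HZ hy hz.
have p1 : 0 <= b * x by rewrite mulr_ge0.
have p2 : 0 <= b * y by rewrite mulr_ge0.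
have p3 : 0 <= b * z by rewrite mulr_ge0.
have p4 : 0 <= l * (b * x) by rewrite mulr_ge0.
have -> : J * (2 * X + W) = 2 * (J * X) + J * W by ring.
have -> : b * (2 + 2 * l) * (x + (y + z)) = 2 * (b * x) + 2 * (b * y) + 2 * (b * z) + 2 * (l * (b * x))
  + 2 * l * (b * y) + 2 * l * (b * z) by ring.
lra.
Qed.
End TriAnalysis.

Section SupBound.
Context (R : realType) (c : 'I_3 -> R * R).
Hypothesis jac_gt0 : 0 < jac c.
Notation T := (interior (tri_set c)).
Notation mu := (plane_measure R).

Lemma h1sq_sub (c' : 'I_3 -> R * R) f : 0 < jac c' ->
  interior (tri_set c') `<=` interior (tri_set c) -> C1 f -> h1sq c' f <= h1sq c f.
Proof.
move=> J' sub Cf.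
have key (g : R * R -> R) : continuous g ->
    \int[mu]_(p in interior (tri_set c')) (g p ^+ 2) <= \int[mu]_(p in interior (tri_set c)) (g p ^+ 2).
  move=> cg; have L := continuous_L2 jac_gt0 cg; have L' := continuous_L2 J' cg.
  rewrite -lee_fin -(sqint_fin L) -(sqint_fin L').
  apply: ge0_subset_integral => //.
  - exact: measurable_open_tri.
  - exact: measurable_open_tri.
  - exact: (measurable_sq L.1).
  - by move=> p _; rewrite lee_fin sqr_ge0.
rewrite /h1sq; apply: lerD; first exact: key Cf.1.
by apply: ler_sum => i _; apply: key; exact: (Cf.2 i).2.
Qed.

(* [corner_bound] only controls the values at the corners, but every point p is
   a corner of a triangle of a third of the size contained in T: if
   lam_j p >= 1/3, translate the homothetic copy of T so that p replaces c_j. *)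
Lemma sup_bound : exists2 K, 0 <= K &
  forall f, C2 f -> forall p, tri_set c p -> f p ^+ 2 <= K * h2sq c f.
Proof.
have [M M0 HM] := tri_diff_bounded jac_gt0.
(* The constant of [corner_bound] for a copy scaled by 1/3: the area is divided by 9, and [M] still
   bounds all differences of coordinates. *)
pose K := (2 + 2 * M) * (2 + 2 * M ^+ 2) / (jac c / 9).
have K0 : 0 <= K.
  rewrite divr_ge0//; last by rewrite divr_ge0// ltW.
  by rewrite mulr_ge0 ?addr_ge0 ?mulr_ge0 ?sqr_ge0.
exists K => // f Cf p pT.
have [j hj] : exists j, 3^-1 <= lam c j p.
  apply: contrapT => /forallNP h.
  have := sum_lam jac_gt0 p; rewrite sum3.
  have := h 0; have := h 1; have := h 2 => /negP; rewrite -ltNge => a /negP; rewrite -ltNge => b /negP.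
  rewrite -ltNge => d; lra.
pose c' k := p + 3^-1 *: (c k - c j).
have J' : jac c' = jac c / 9.
  by rewrite /jac /c' /cross !pairE; field.
have J'0 : 0 < jac c' by rewrite J' divr_gt0.
have lamE i q : lam c i q = lam c i p + 3^-1 * (lam c' i q - (i == j)%:R).
  have s1 := sum_lam J'0 q.
  have qE : q = p + 3^-1 *: (\sum_k lam c' k q *: c k - c j).
    rewrite {1}(lam_baryc J'0 q) /c'; move: s1; rewrite !sum3.
    move: (lam _ 0 q) (lam _ 1 q) (lam _ 2 q) => a b d s1.
    have -> : a = 1 - b - d by rewrite -s1; ring.
    by apply: pair_eqP; rewrite !pairE; ring.
  have h := lamD c i (c j) (\sum_k lam c' k q *: c k - c j).
  rewrite subrKC (lam_comb jac_gt0)// lam_corner// in h.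
  by rewrite {1}qE lamD dlamZ h; ring.
have sub : tri_set c' `<=` tri_set c.
  move=> q /(tri_setP J'0) hq; apply/(tri_setP jac_gt0) => i; rewrite lamE.
  have := hq i; have := (tri_setP jac_gt0 p).1 pT i.
  by case: eqVneq => [->|_]; rewrite ?mulr1n ?mulr0n; lra.
have sub' : interior (tri_set c') `<=` interior (tri_set c) by move=> q; apply: filterS; exact: sub.
have cj : c' j = p by rewrite /c' subrr scaler0 addr0.
have jE : j = (j + 2) + 1 by elim/ord3P: (j); exact: val_inj.
have := @corner_bound _ c' J'0 f (j + 2) M M Cf M0.
rewrite -jE cj J' => /(_ _ _ _)/le_trans; apply.
- by move=> q qT; apply: HM; apply: sub => //; exact: corner_in.
- rewrite /edge; have [h _] := HM _ _ (sub _ (corner_in J'0 (j + 2 + 2))) (sub _ (corner_in J'0 (j + 2 + 1))).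
  exact: h.
- rewrite /edge; have [_ h] := HM _ _ (sub _ (corner_in J'0 (j + 2 + 2))) (sub _ (corner_in J'0 (j + 2 + 1))).
  exact: h.
rewrite -/K ler_wpM2l// /h2sq; apply: lerD; first exact: h1sq_sub Cf.1.
by apply: ler_sum => i _; apply: h1sq_sub => //; exact: (Cf.2 i).
Qed.

Lemma open_plane_positive (A : set (R * R)) p : open A -> A p -> (0 < plane_measure R A)%E.
Proof.
move=> oA Ap; have [a [b [a' [b' [[/= p1 p2] sub]]]]] := open_subball_rat_prod oA Ap.
apply: (@lt_le_trans _ _ (plane_measure R (`]ratr a, ratr b[ `*` `]ratr a', ratr b'[))); last first.
  apply: le_measure; rewrite ?inE//.
    by apply: measurableX; exact: measurable_itv.
  exact: open_measurable_prod.
have E : (plane_measure R (`]ratr a, ratr b[ `*` `]ratr a', ratr b'[) =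
    @lebesgue_measure R `]ratr a, ratr b[%classic * @lebesgue_measure R `]ratr a', ratr b'[%classic)%E.
  by apply: product_measure1E; exact: measurable_itv.
rewrite E.
move: p1 p2; rewrite !in_itv/= => /andP[x1 x2] /andP[y1 y2].
have xx := lt_trans x1 x2; have yy := lt_trans y1 y2.
apply: mule_gt0.
  by rewrite /= lebesgue_measure_itv/= lte_fin xx -EFinB lte_fin subr_gt0.
by rewrite /= lebesgue_measure_itv/= lte_fin yy -EFinB lte_fin subr_gt0.
Qed.

Lemma centroid_in : T (\sum_k 3^-1 *: c k).
Proof.
apply/(open_triP jac_gt0) => k; rewrite (lam_comb jac_gt0) ?invr_gt0//.
by rewrite sum3; field.
Qed.

(** A small step from [p] towards the centroid makes all barycentric coordinates positive. *)
Lemma tri_set_dense p (A : set (R * R)) : tri_set c p -> nbhs p A -> exists2 q, T q & interior A q.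
Proof.
move=> pT /nbhs_interior /nbhs_ballP[e /= e0 pe].
pose b := \sum_k 3^-1 *: c k.
have V0 : 0 < 2 * (1 + `|(b - p).1| + `|(b - p).2|) by rewrite mulr_gt0// -addrA ltr_pwDl// addr_ge0.
pose t := Num.min 1 (e / (2 * (1 + `|(b - p).1| + `|(b - p).2|))).
have t0 : 0 < t by rewrite lt_min ltr01 divr_gt0.
have t1 : t <= 1 by rewrite ge_min lexx.
have te : t * (2 * (1 + `|(b - p).1| + `|(b - p).2|)) <= e by rewrite -ler_pdivlMr// ge_min lexx orbT.
exists (p + t *: (b - p)).
  apply/(open_triP jac_gt0) => k; rewrite lamD dlamZ.
  have := lamD c k p (b - p); rewrite subrKC => h.
  have := (open_triP jac_gt0 b).1 centroid_in k; rewrite h.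
  have := (tri_setP jac_gt0 p).1 pT k; move: (lam c k p) (dlam c k _) => x y; nra.
apply: pe; have n1 := normr_ge0 (b - p).1; have n2 := normr_ge0 (b - p).2.
by split; rewrite /ball/= opprD addrA subrr sub0r normrN /GRing.scale/= normrM (gtr0_norm t0);
  apply: lt_le_trans te; rewrite ltr_pM2l//; lra.
Qed.

(** If the bound failed at one point, even a boundary point, it would fail on a nonempty open subset
    of the triangle, which has positive measure. *)
Lemma ae_tri_le (h : R * R -> R) (a : R) : {within tri_set c, continuous h} ->
  {ae mu, forall p, T p -> h p <= a} -> forall p, tri_set c p -> h p <= a.
Proof.
move=> ch [N [mN N0 subN]] p pT; rewrite leNgt; apply/negP => ap.
have /= H : nbhs p [set q | tri_set c q -> a < h q].
  have := (subspace_continuousP _ _).1 ch p pT => /(_ [set y | a < y]); apply.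
  by apply: open_nbhs_nbhs; split; [exact: open_gt|].
have [q qT qA] := tri_set_dense pT H.
have sub : interior [set q | tri_set c q -> a < h q] `&` T `<=` N.
  move=> x [/interior_subset /= x1 x2]; apply: subN => /= /(_ x2).
  by rewrite leNgt x1//; exact: open_tri_sub.
have := open_plane_positive (openI (open_interior _) (open_interior _)) (conj qA qT).
rewrite lt_neqAle => /andP[/eqP + _]; apply; apply/esym.
apply/eqP; rewrite -measure_le0; rewrite -N0; apply: le_measure; rewrite ?inE//.
by apply: open_measurable_prod; apply: openI; exact: open_interior.
Qed.

Lemma ae_tri_eq (g h : R * R -> R) : {within tri_set c, continuous g} ->
  {within tri_set c, continuous h} ->
  {ae mu, forall p, T p -> g p = h p} -> forall p, tri_set c p -> g p = h p.
Proof.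
move=> cg ch gh p pT; apply/eqP; rewrite eq_le; apply/andP; split; rewrite -subr_le0.
  have := @ae_tri_le (fun p => g p - h p) 0; apply => //.
    by move=> x; apply: cvgB; [exact: cg|exact: ch].
  by apply: plane_aeS gh => q E Tq; rewrite E// subrr.
have := @ae_tri_le (fun p => h p - g p) 0; apply => //.
  by move=> x; apply: cvgB; [exact: ch|exact: cg].
by apply: plane_aeS gh => q E Tq; rewrite E// subrr.
Qed.

(** By the sup bound the approximations are uniformly Cauchy. Their uniform limit is [u] almost
    everywhere, and everywhere on the closed triangle because [u] is continuous. *)
Lemma sobolev2_uniform (f_ : nat -> R * R -> R) u (D : seq 'I_2 -> R * R -> R) :
  (forall n, smooth (f_ n)) -> D [::] = u ->
  (forall w, (size w <= 2)%N -> measurable_fun T (D w) /\ cvL2 mu T (fun n => pderivs w (f_ n)) (D w)) ->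
  {within tri_set c, continuous u} ->
  forall e : R, 0 < e -> exists N, forall n, (N <= n)%N -> forall p, tri_set c p -> `|f_ n p - u p| <= e.
Proof.
have third (z : R) : z / 3 + (z / 3 + z / 3) <= z by lra.
move=> sf Du HD cu e e0; have [K K0 HK] := sup_bound.
have C2f n := smooth_C2 (sf n).
have K1 : 0 < K + 1 by rewrite ltr_wpDl.
(* A third for each term of [h2sq], and [K + 1] because [K] may be zero. *)
have e3 : 0 < e ^+ 2 / (K + 1) / 3 by rewrite !divr_gt0// exprn_gt0.
have mT := measurable_open_tri c.
have cau (w : seq 'I_2) : (size w <= 1)%N -> exists N, forall m n, (N <= m)%N -> (N <= n)%N ->
    h1sq c (fun p => pderivs w (f_ m) p - pderivs w (f_ n) p) <= e ^+ 2 / (K + 1) / 3.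
  move=> sw; apply: (@h1sq_cauchy _ c jac_gt0 (fun n => pderivs w (f_ n)) (D w) (fun i => D (i :: w))).
  - move=> n; apply: smooth_C1; case: w sw => [|i [|//]] _ /=; first exact: sf.
    exact: smooth_pderiv.
  - by apply: (HD w _).1; rewrite ltnW.
  - by move=> i; apply: (HD (i :: w) _).1.
  - by apply: (HD w _).2; rewrite ltnW.
  - by move=> i; apply: (HD (i :: w) _).2.
  - exact: e3.
have [N0 HN0] := cau [::] isT.
have [N1 HN1] := cau [:: ord0] isT.
have [N2 HN2] := cau [:: lift ord0 ord0] isT.
pose N := maxn N0 (maxn N1 N2); exists N => n Nn p pT.
have unif m q : (N <= m)%N -> tri_set c q -> `|f_ m q - f_ n q| <= e.
  move=> Nm qT.
  move: Nm Nn; rewrite !geq_max => /and3P[m1 m2 m3] /and3P[n1 n2 n3].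
  have CB := C2B (C2f m) (C2f n).
  have := HK _ CB _ qT; rewrite /h2sq big_ord_recl big_ord1.
  have [_ dB] := C1B (C2f m).1 (C2f n).1; rewrite !dB.
  have := HN0 m n m1 n1; have := HN1 m n m2 n2; have := HN2 m n m3 n3 => /= a b d.
  move=> /le_trans H.
  have : (f_ m q - f_ n q) ^+ 2 <= e ^+ 2.
    apply: H; apply: (@le_trans _ _ (K * (e ^+ 2 / (K + 1)))).
      rewrite ler_wpM2l//; exact: (le_trans (lerD d (lerD b a)) (third _)).
    by rewrite mulrCA ler_piMr ?sqr_ge0// ler_pdivrMr// mul1r lerDl.
  by move=> /ler_wsqrtr; rewrite !sqrtr_sqr (gtr0_norm e0).
have mcn : measurable_fun T (f_ n) by apply: continuous_measurable_prod => //; exact: (C2f n).1.1.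
have [mD0 cD0] := HD [::] isT; rewrite Du in mD0 cD0.
(* The excess of |f_n - u| over [e]. It is dominated by |f_m - u| for every [m] beyond [N], so its
   norm is zero. *)
pose h p := Num.max (`|f_ n p - u p| - e) 0.
have mh : measurable_fun T h.
  apply: measurable_maxr; last exact: measurable_cst.
  apply: measurable_funB; last exact: measurable_cst.
  by apply: measurableT_comp => //; exact: measurable_funB.
have h0 : sqint mu T h = 0%E.
  apply/eqP; rewrite eq_le sqint_ge0 andbT.
  apply/lee_addgt0Pr => d d0; rewrite add0e.
  have Lfm m : L2 mu T (f_ m) by apply: continuous_L2 => //; exact: (C2f m).1.1.
  have [_ /(cvgrPdist_le _ _).1/(_ d d0)[M _ HM]] := cvL2P mT Lfm mD0 cD0.
  pose m := maxn N M.
  have Lu := (cvL2P mT Lfm mD0 cD0).1.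
  apply: (@le_trans _ _ (sqint mu T (fun p => f_ m p - u p))).
    apply: le_sqint => //; first exact: (L2B mT (Lfm m) Lu).1.
    move=> q /open_tri_sub qT; rewrite ger0_norm ?le_max ?lexx ?orbT// ge_max normr_ge0 andbT.
    have := unif m q (leq_maxl _ _) qT; rewrite distrC => h1.
    rewrite lerBlDr; have := ler_normD (f_ n q - f_ m q) (f_ m q - u q); rewrite subrKA => /le_trans; apply.
    by rewrite addrC lerD2l.
  rewrite (sqint_fin (L2B mT (Lfm m) Lu)) lee_fin.
  have := HM m (leq_maxr _ _); rewrite /= sub0r normrN; exact: le_trans (ler_norm _).
have ae0 := sqint_eq0 mT mh h0.
apply: (@ae_tri_le (fun p => `|f_ n p - u p|) e) => //.
  by move=> x; apply: cvg_norm; apply: cvgB; [exact: continuous_subspaceT (C2f n).1.1 x|exact: cu].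
apply: plane_aeS ae0 => q E Tq; have := E Tq; rewrite /h.
by rewrite -subr_le0 => <-; rewrite le_max lexx.
Qed.
End SupBound.

(** * Polynomials in two variables *)

Section Poly.
Context (R : realType).
Implicit Types (f g h : R * R -> R) (n m : nat).

Lemma is_poly_ext n f g : (forall p, f p = g p) -> is_poly n f -> is_poly n g.
Proof. by move=> fg [c Hc]; exists c => p; rewrite -fg. Qed.

Lemma is_poly_cst0 n : @is_poly R n (fun=> 0).
Proof.
exists (fun _ _ => 0) => p; rewrite big1// => i _; rewrite big1// => j _; ring.
Qed.

Lemma is_polyD n f g : is_poly n f -> is_poly n g -> is_poly n (fun p => f p + g p).
Proof.
move=> [c Hc] [d Hd]; exists (fun i j => c i j + d i j) => p.
rewrite Hc Hd -big_split; apply: eq_bigr => i _; rewrite -big_split; apply: eq_bigr => j _ /=; ring.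
Qed.

Lemma is_polyZ n a f : is_poly n f -> is_poly n (fun p => a * f p).
Proof.
move=> [c Hc]; exists (fun i j => a * c i j) => p.
rewrite Hc big_distrr; apply: eq_bigr => i _; rewrite big_distrr; apply: eq_bigr => j _ /=; ring.
Qed.

Lemma is_polyB n f g : is_poly n f -> is_poly n g -> is_poly n (fun p => f p - g p).
Proof.
move=> pf pg; apply: is_poly_ext (is_polyD pf (is_polyZ (-1) pg)) => p; ring.
Qed.

Lemma is_poly_sum n (I : finType) (F : I -> R * R -> R) :
  (forall i, is_poly n (F i)) -> is_poly n (fun p => \sum_i F i p).
Proof.
move=> pF; elim: (index_enum I) => [|i s IH].
  by apply: is_poly_ext (is_poly_cst0 n) => p; rewrite big_nil.
by apply: is_poly_ext (is_polyD (pF i) IH) => p; rewrite big_cons.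
Qed.

Lemma is_poly0 f : is_poly 0 f -> forall p, f p = 0.
Proof. by move=> [c Hc] p; rewrite Hc big_ord0. Qed.

Lemma is_poly_S n f : is_poly n f -> is_poly n.+1 f.
Proof.
move=> [c Hc]; exists (fun i j => if (i + j < n)%N then c i j else 0) => p.
rewrite Hc big_ord_recr/= [X in _ + X]big1 ?addr0; last first.
  by move=> j _; rewrite ltnNge leq_addr/=; ring.
apply: eq_bigr => i _; rewrite (subSn (ltnW (ltn_ord i))) big_ord_recr/= (subnKC (ltnW (ltn_ord i))) ltnn !mul0r addr0.
apply: eq_bigr => j _; by rewrite -ltn_subRL ltn_ord.
Qed.

Lemma is_poly_le n m f : (n <= m)%N -> is_poly n f -> is_poly m f.
Proof.
by move=> /subnKC <-; elim: (m - n)%N => [|k IH]; rewrite ?addn0// addnS => /IH; exact: is_poly_S.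
Qed.

Lemma is_poly_X1 n f : is_poly n f -> is_poly n.+1 (fun p => p.1 * f p).
Proof.
move=> [c Hc]; exists (fun i j => if i is i'.+1 then c i' j else 0) => p.
rewrite Hc big_ord_recl/= [X in _ = X + _]big1 ?add0r; last by move=> j _; ring.
rewrite big_distrr; apply: eq_bigr => i _; rewrite /bump/= add1n subSS big_distrr.
apply: eq_bigr => j _ /=; rewrite exprS; ring.
Qed.

Lemma is_poly_X2 n f : is_poly n f -> is_poly n.+1 (fun p => p.2 * f p).
Proof.
move=> [c Hc]; exists (fun i j => if j is j'.+1 then c i j' else 0) => p.
rewrite Hc big_ord_recr/= [X in _ = _ + X]big1 ?addr0; last first.
  by move=> [[|j] /= Hj] _; [ring|move: Hj; rewrite subSnn].
rewrite big_distrr; apply: eq_bigr => i _; rewrite (subSn (ltnW (ltn_ord i))) big_ord_recl/= !mul0r add0r big_distrr.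
apply: eq_bigr => j _ /=; rewrite exprS; ring.
Qed.

Lemma is_poly_cst a n : @is_poly R n.+1 (fun=> a).
Proof.
apply: (is_poly_le (n := 1)) => //; exists (fun _ _ => a) => p.
by rewrite big_ord_recl big_ord0 addr0 big_ord_recl big_ord0 addr0 !expr0 !mulr1.
Qed.

Lemma is_poly_build a n f g : is_poly n f -> is_poly n g ->
  is_poly n.+1 (fun p => a + p.1 * f p + p.2 * g p).
Proof.
move=> pf pg; apply: is_polyD; last exact: is_poly_X2.
by apply: is_polyD; [exact: is_poly_cst|exact: is_poly_X1].
Qed.

(** The induction principle on the degree: products, substitutions, restrictions to lines and
    derivatives are all treated through this splitting. *)
Lemma is_poly_split n f : is_poly n.+1 f -> exists a g h,
  [/\ is_poly n g, is_poly n h & forall p, f p = a + p.1 * g p + p.2 * h p].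
Proof.
move=> [c Hc]; exists (c 0%N 0%N).
exists (fun p => \sum_(i < n) \sum_(j < n - i) c i.+1 j * p.1 ^+ i * p.2 ^+ j).
exists (fun p => \sum_(j < n) c 0%N j.+1 * p.2 ^+ j).
split; first by exists (fun i j => c i.+1 j).
  case: n Hc => [|n] Hc; first by exists c => p; rewrite !big_ord0.
  exists (fun i j => if i == 0%N then c 0%N j.+1 else 0) => p.
  rewrite [RHS]big_ord_recl/= [X in _ = _ + X]big1 ?addr0; last first.
    by move=> i _; rewrite big1// => j _; ring.
  by rewrite subn0; apply: eq_bigr => j _; rewrite expr0 mulr1.
move=> p; rewrite Hc big_ord_recl/= addrAC; congr (_ + _).
  rewrite big_ord_recl/= !expr0 !mulr1; congr (_ + _).
  rewrite big_distrr; apply: eq_bigr => j _ /=; rewrite /bump/= add1n exprS; ring.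
rewrite big_distrr; apply: eq_bigr => i _; rewrite /bump/= add1n subSS big_distrr.
apply: eq_bigr => j _ /=; rewrite exprS; ring.
Qed.

Lemma is_polyM m n f g : is_poly m.+1 f -> is_poly n.+1 g -> is_poly (m + n).+1 (fun p => f p * g p).
Proof.
move=> pf pg; elim: m f pf => [|m IH] f /is_poly_split[a [f1 [f2 [p1 p2 fE]]]].
  apply: is_poly_ext (is_polyZ a pg) => p.
  by rewrite fE (is_poly0 p1) (is_poly0 p2); ring.
rewrite addSn; apply: is_poly_ext (is_polyD (is_polyZ a (is_poly_le _ pg)) (is_poly_build 0 (IH _ p1) (IH _ p2))).
  by move=> p; rewrite /= fE; ring.
by rewrite ltnS ltnW// ltnS leq_addl.
Qed.

Lemma is_polyM2 n f g : is_poly 2 f -> is_poly n g -> is_poly n.+1 (fun p => f p * g p).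
Proof.
move=> pf; case: n => [/is_poly0 g0|n pg]; last by have := is_polyM pf pg; rewrite add1n.
by apply: is_poly_ext (is_poly_cst0 _) => p; rewrite g0 mulr0.
Qed.

Lemma is_poly_affine (a b e : R) : is_poly 2 (fun p => a * p.1 + b * p.2 + e).
Proof.
apply: is_poly_ext (is_poly_build e (is_poly_cst a 0) (is_poly_cst b 0)) => p; ring.
Qed.

Lemma is_poly_comp n f g h : is_poly 2 g -> is_poly 2 h -> is_poly n f ->
  is_poly n (fun p => f (g p, h p)).
Proof.
move=> pg ph; elim: n f => [|n IH] f.
  by move=> /is_poly0 f0; apply: is_poly_ext (is_poly_cst0 _) => p; rewrite f0.
move=> /is_poly_split[a [f1 [f2 [p1 p2 fE]]]].
apply: is_poly_ext (is_polyD (is_polyD (is_poly_cst a n) (is_polyM2 pg (IH _ p1))) (is_polyM2 ph (IH _ p2))) => p.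
by rewrite fE.
Qed.

Lemma is_poly_line n f (A v : R * R) : is_poly n f ->
  exists2 q : {poly R}, (size q <= n)%N & forall s, f (A + s *: v) = q.[s].
Proof.
elim: n f => [|n IH] f.
  by move=> /is_poly0 f0; exists 0 => [|s]; rewrite ?size_poly0// f0 horner0.
move=> /is_poly_split[a [f1 [f2 [/IH[q1 s1 E1] /IH[q2 s2 E2] fE]]]].
exists (a%:P + (A.1%:P + v.1 *: 'X) * q1 + (A.2%:P + v.2 *: 'X) * q2).
  have key (x y : R) (q : {poly R}) : (size q <= n)%N -> (size ((x%:P + y *: 'X) * q)%R <= n.+1)%N.
    move=> sq; have [->|q0] := eqVneq q 0; first by rewrite mulr0 size_poly0.
    apply: (leq_trans (size_polyMleq _ _)).
    have : (size (x%:P + y *: 'X)%R <= 2)%N.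
      rewrite (leq_trans (size_polyD _ _))// geq_max (leq_trans (size_polyC_leq1 _))//=.
      by rewrite (leq_trans (size_scale_leq _ _))// size_polyX.
    by move=> h; rewrite (leq_trans (n := (2 + n).-1))//; rewrite -!subn1 leq_sub2r// leq_add.
  rewrite (leq_trans (size_polyD _ _))// geq_max key// andbT.
  rewrite (leq_trans (size_polyD _ _))// geq_max key// andbT.
  by rewrite (leq_trans (size_polyC_leq1 _)).
by move=> s; rewrite fE E1 E2 !hornerE !pairE; ring.
Qed.

(** The points 1/(i + 1) lie in the segment, and there are as many of them as [size q], one more
    than the degree. *)
Lemma poly_segment0 (q : {poly R}) : (forall s, s \in (`[0, 1] : interval R) -> q.[s] = 0) -> q = 0.
Proof.
move=> h; apply: (@roots_geq_poly_eq0 _ q [seq (i.+1)%:R^-1 | i <- iota 0 (size q)]).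
- apply/allP => x /mapP[i _ ->]; apply/rootP/h; rewrite in_itv/= invr_ge0 ler0n/=.
  by rewrite invf_le1 ?ltr0n// ler1n.
- rewrite map_inj_uniq ?iota_uniq// => i j /invr_inj/eqP; rewrite eqr_nat eqSS => /eqP; exact.
- by rewrite size_map size_iota.
Qed.

Lemma is_poly_C1 n f : is_poly n f -> C1 f /\ forall i, is_poly n.-1 (pderiv i f).
Proof.
elim: n f => [|n IH] f.
  move=> /is_poly0 f0; have -> : f = fun=> 0 by apply/funext.
  have [C0 d0] := C1_cst (0 : R); split => // i.
  by apply: is_poly_ext (is_poly_cst0 _) => p; rewrite d0.
move=> /is_poly_split[a [g [h [pg ph fE]]]].
have [Cg dg] := IH _ pg; have [Ch dh] := IH _ ph.
have -> : f = fun p => (a + (1 * p.1 + 0 * p.2 + 0) * g p) + (0 * p.1 + 1 * p.2 + 0) * h p.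
  by apply/funext => p; rewrite fE; ring.
have [Ca da] := C1_cst a.
have Cx := C1_affine 1 0 (0 : R); have Cy := C1_affine 0 1 (0 : R).
have [C1x dx] := C1M Cx Cg; have [C1y dy] := C1M Cy Ch.
have [Cax dax] := C1D Ca C1x; have [CC dC] := C1D Cax C1y.
split; first exact: CC.
move=> i.
have E p : pderiv i (fun p => (a + (1 * p.1 + 0 * p.2 + 0) * g p) + (0 * p.1 + 1 * p.2 + 0) * h p) p =
    (if i == 0 then g p else 0) + (if i == 0 then 0 else h p) + (p.1 * pderiv i g p + p.2 * pderiv i h p).
  rewrite dC dax da -(dir_deriv_unit _ i) -(dir_deriv_unit (fun p => (0 * p.1 + 1 * p.2 + 0) * h p) i).
  rewrite dx dy !dir_deriv_unit !pderiv_affine; case: ifP => _; ring.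
apply: is_poly_ext (fun p => esym (E p)) _.
case: n {IH} pg ph dg dh => [|n] pg ph dg dh.
  apply: is_poly_ext (is_poly_cst0 _) => p.
  rewrite (is_poly0 pg) (is_poly0 ph) (is_poly0 (dg i)) (is_poly0 (dh i)); case: ifP => _; ring.
apply: is_polyD.
  by apply: is_polyD; case: (i == 0) => //=; exact: is_poly_cst0.
by apply: is_polyD; [exact: is_poly_X1|exact: is_poly_X2].
Qed.

Lemma is_poly_pderivs n f w : is_poly n f -> exists m, is_poly m (pderivs w f).
Proof.
move=> pf; elim: w => [|i w [m IH]]; first by exists n.
by exists m.-1; exact: (is_poly_C1 IH).2.
Qed.

Lemma is_poly_smooth n f : is_poly n f -> smooth f.
Proof.
move=> pf w; have [m pm] := is_poly_pderivs w pf; have [[cm dm] _] := is_poly_C1 pm.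
by split => // i; exact: (dm i).1.
Qed.

(** Vanishing on the second axis kills the coefficients of the pure powers of the second
    variable. *)
Lemma is_poly_factor1 n f : is_poly n.+1 f -> (forall y, f (0, y) = 0) ->
  exists2 g, is_poly n g & forall p, f p = p.1 * g p.
Proof.
move=> [c Hc] f0.
have c0 j : (j < n.+1)%N -> c 0%N j = 0.
  move=> jn; pose q : {poly R} := \poly_(j < n.+1) c 0%N j.
  have q0 : q = 0.
    apply: poly_segment0 => s _; rewrite -(f0 s) Hc big_ord_recl/= [X in _ = _ + X]big1 ?addr0.
      by rewrite horner_poly; apply: eq_bigr => i _; rewrite expr0 mulr1.
    by move=> i _; rewrite big1// => j' _; rewrite (_ : (0 : R) ^+ bump 0 i = 0) ?mulr0 ?mul0r// /bump/= add1n exprS mul0r.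
  by have := coef_poly n.+1 (c 0%N) j; rewrite jn -/q q0 coef0.
exists (fun p => \sum_(i < n) \sum_(j < n - i) c i.+1 j * p.1 ^+ i * p.2 ^+ j).
  by exists (fun i j => c i.+1 j).
move=> p; rewrite Hc big_ord_recl/= big1 ?add0r; last by move=> j _; rewrite c0//; ring.
rewrite big_distrr; apply: eq_bigr => i _; rewrite /bump/= add1n subSS big_distrr.
apply: eq_bigr => j _ /=; rewrite exprS; ring.
Qed.
End Poly.

Section PolyTri.
Context (R : realType) (c : 'I_3 -> R * R).
Hypothesis jac_gt0 : 0 < jac c.

Lemma is_poly_lam k : is_poly 2 (lam c k).
Proof. by have [a [b [e ->]]] := lam_affine c k; exact: is_poly_affine. Qed.

Lemma is_poly_side n f k : is_poly n f ->
  exists2 q : {poly R}, (size q <= n)%N & forall s, f (side_pt c k s) = q.[s].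
Proof.
move=> /(is_poly_line (c (k + 1)) (edge c k))[q sq E]; exists q => // s.
by rewrite side_ptE E.
Qed.

Lemma side_ptK k p : lam c k p = 0 -> side_pt c k (lam c (k + 2) p) = p.
Proof.
move=> h; rewrite [RHS](lam_baryc jac_gt0 p) /side_pt.
have := sum_lam jac_gt0 p; rewrite !sum3; elim/ord3P: k h; rewrite ?ord3D => ->.
- by rewrite scale0r !add0r => <-; rewrite addrK.
- by rewrite scale0r !addr0 => <-; rewrite addrC addrAC subrr add0r addrC.
- by rewrite scale0r !addr0 => <-; rewrite addrK.
Qed.

(** Vanishing on the segment forces vanishing on its whole line; in affine coordinates whose first
    one is [lam c k], this is [is_poly_factor1]. *)
Lemma is_poly_factor_lam n f k : is_poly n.+1 f ->
  (forall s, s \in (`[0, 1] : interval R) -> f (side_pt c k s) = 0) ->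
  exists2 g, is_poly n g & forall p, f p = lam c k p * g p.
Proof.
move=> pf f0; have [q sq qE] := is_poly_side k pf.
have q0 : q = 0 by apply: poly_segment0 => s /f0; rewrite qE.
have fz p : lam c k p = 0 -> f p = 0.
  by move=> /side_ptK <-; rewrite qE q0 horner0.
have k3 : k = (k + 2) + 1 by elim/ord3P: (k); exact: val_inj.
pose F p := f (tri_map c (k + 2) p).
have tE : exists a b e a' b' e', tri_map c (k + 2) = fun p => (a * p.1 + b * p.2 + e, a' * p.1 + b' * p.2 + e').
  set u := c (k + 2 + 1) - c (k + 2); set v := c (k + 2 + 2) - c (k + 2).
  exists u.1, v.1, (c (k + 2)).1, u.2, v.2, (c (k + 2)).2; apply/funext => q'.
  by rewrite /tri_map -/u -/v; apply: pair_eqP; rewrite !pairE/=; ring.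
have [a [b [e [a' [b' [e' tm]]]]]] := tE.
have pF : is_poly n.+1 F.
  by rewrite /F tm; apply: is_poly_comp => //; exact: is_poly_affine.
have F0 y : F (0, y) = 0.
  by apply: fz; have [] := lam_tri_map jac_gt0 (k + 2) (0, y); rewrite -k3.
have [G pG GE] := is_poly_factor1 pF F0.
exists (fun p => G (lam c k p, lam c (k + 2 + 2) p)).
  by apply: is_poly_comp => //; exact: is_poly_lam.
move=> p; have -> : f p = F (lam c k p, lam c (k + 2 + 2) p); last by rewrite GE.
rewrite /F; congr f; rewrite [LHS](lam_baryc jac_gt0 p) /tri_map.
have := sum_lam jac_gt0 p; rewrite !sum3; elim/ord3P: (k) => /=; rewrite ?ord3D => s1.
- have -> : lam c 2 p = 1 - lam c 0 p - lam c 1 p by rewrite -s1; ring.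
  by apply: pair_eqP; rewrite !pairE; ring.
- have -> : lam c 0 p = 1 - lam c 1 p - lam c 2 p by rewrite -s1; ring.
  by apply: pair_eqP; rewrite !pairE; ring.
- have -> : lam c 1 p = 1 - lam c 2 p - lam c 0 p by rewrite -s1; ring.
  by apply: pair_eqP; rewrite !pairE; ring.
Qed.
End PolyTri.

(** * Riesz representation *)

Section Riesz.
Context (R : realType).

(** A matrix of maximal rank among those with all rows in [P] spans [P]: a vector outside its row
    space would raise the rank. *)
Lemma subspace_rowspace N (P : set 'rV[R]_N) : P 0 ->
  (forall a c d, P c -> P d -> P (a *: c + d)) ->
  exists A : 'M[R]_N, forall c, P c <-> (c <= A)%MS.
Proof.
move=> P0 PL.
pose Q (A : 'M[R]_N) := forall i, P (row i A).
have Qsub (A : 'M[R]_N) : Q A -> forall c : 'rV_N, (c <= A)%MS -> P c.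
  move=> QA c /submxP[x ->]; rewrite mulmx_sum_row.
  elim: (index_enum _) => [|i s IH]; first by rewrite big_nil.
  by rewrite big_cons; apply: PL.
pose ranks := fun k => `[< exists A : 'M[R]_N, Q A /\ \rank A = k >].
have ex0 : exists k, ranks k.
  by exists (\rank (0 : 'M[R]_N)); apply/asboolP; exists 0; split => // i; rewrite row0.
have bd k : ranks k -> (k <= N)%N.
  by move=> /asboolP[A [_ <-]]; exact: rank_leq_row.
case: (ex_maxnP ex0 bd) => k /asboolP[A [QA rA]] kmax.
exists A => c; split; last exact: Qsub.
move=> Pc; pose B := (A + c)%MS.
have QB : Q B.
  move=> i.
  have : (row i B <= A + c)%MS by exact: row_sub.
  move=> /sub_addsmxP[[u v] /= ->]; rewrite -[u *m A](addr0) -addrA.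
  have [x ->] : exists x : R, v *m c = x *: c.
    by exists (v 0 0); rewrite [v]mx11_scalar mul_scalar_mx; congr (_ *: _); rewrite mxE eqxx mulr1n.
  rewrite add0r addrC; apply: PL => //; apply: (Qsub _ QA); exact: submxMl.
have rB : (\rank B <= \rank A)%N by rewrite rA; apply: kmax; apply/asboolP; exists B.
 have sAB : (A <= B)%MS by exact: addsmxSl.
apply: submx_trans (addsmxSr A c) _; rewrite -/B.
by have := mxrank_leqif_sup sAB; rewrite /leqif eqn_leq (mxrankS sAB) rB/= => -[_ <-].
Qed.

(** The Fredholm alternative: the columns of the cokernel matrix are the only obstructions to
    solvability. *)
Lemma solve_left N (G : 'M[R]_N) (b : 'rV[R]_N) :
  (forall u : 'cV[R]_N, G *m u = 0 -> b *m u = 0) -> exists x, x *m G = b.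
Proof.
move=> H; suff /submxP[x ->] : (b <= G)%MS by exists x.
rewrite submxE; apply/eqP/matrixP => i j; rewrite [RHS]mxE.
have := H (cokermx G *m delta_mx j (0 : 'I_1)); rewrite !(mulmxA _ (cokermx G)) mulmx_coker mul0mx => /(_ erefl).
by rewrite -colE => /matrixP/(_ i 0); rewrite !mxE.
Qed.

(** The form may be degenerate. If the Gram matrix of a basis of [P] kills [u], the vector c with
    coefficients [u] satisfies B(c, c) = 0, so l(c) = 0 by hypothesis, and this is the solvability
    condition of [solve_left]. *)
Lemma riesz_row N (P : set 'rV[R]_N) (B : 'rV[R]_N -> 'rV[R]_N -> R) (l : 'rV[R]_N -> R) :
  (forall a c c' d, B (a *: c + c') d = a * B c d + B c' d) ->
  (forall a c d d', B c (a *: d + d') = a * B c d + B c d') ->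
  P 0 -> (forall a c d, P c -> P d -> P (a *: c + d)) ->
  (forall a c d, P c -> P d -> l (a *: c + d) = a * l c + l d) ->
  (forall c, P c -> B c c = 0 -> l c = 0) ->
  exists2 c, P c & forall d, P d -> B c d = l d.
Proof.
move=> Bl Br P0 PL lL Bl0.
have [A PA] := subspace_rowspace P0 PL.
have l0 : l 0 = 0.
  by have := lL 1 0 0 P0 P0; rewrite scaler0 addr0 mul1r => /eqP; rewrite -subr_eq0 opprD addrA subrr sub0r oppr_eq0 => /eqP.
have B0l d : B 0 d = 0.
  by have := Bl 1 0 0 d; rewrite scaler0 addr0 mul1r => /eqP; rewrite -subr_eq0 opprD addrA subrr sub0r oppr_eq0 => /eqP.
have B0r d : B d 0 = 0.
  by have := Br 1 d 0 0; rewrite scaler0 addr0 mul1r => /eqP; rewrite -subr_eq0 opprD addrA subrr sub0r oppr_eq0 => /eqP.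
have PAi i : P (row i A) by apply/PA; exact: row_sub.
have PS (x : 'rV[R]_N) : P (x *m A) by apply/PA; exact: submxMl.
have lS (x : 'rV[R]_N) : l (x *m A) = \sum_i x 0 i * l (row i A).
  rewrite mulmx_sum_row.
  suff [//] : l (\sum_i x 0 i *: row i A) = \sum_i x 0 i * l (row i A) /\ P (\sum_i x 0 i *: row i A).
  elim: (index_enum _) => [|i s [IH1 IH2]]; first by rewrite !big_nil.
  by rewrite !big_cons; split; [rewrite lL// IH1|exact: PL].
have BSl (x : 'rV[R]_N) d : B (x *m A) d = \sum_i x 0 i * B (row i A) d.
  rewrite mulmx_sum_row; elim: (index_enum _) => [|i s IH]; first by rewrite !big_nil.
  by rewrite !big_cons Bl IH.
have BSr (x : 'rV[R]_N) d : B d (x *m A) = \sum_i x 0 i * B d (row i A).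
  rewrite mulmx_sum_row; elim: (index_enum _) => [|i s IH]; first by rewrite !big_nil.
  by rewrite !big_cons Br IH.
pose G := \matrix_(i, j) B (row i A) (row j A).
pose b := \row_j l (row j A).
have [u Gu|x xG] := @solve_left _ G b.
  apply/matrixP => i0 j0; rewrite [RHS]mxE !ord1 {i0 j0} mxE.
  have -> : \sum_j b 0 j * u j 0 = l (u^T *m A).
    by rewrite lS; apply: eq_bigr => j _; rewrite !mxE mulrC.
  apply: Bl0 => //; rewrite BSl big1// => i _; rewrite BSr.
  have /matrixP/(_ i 0) := Gu; rewrite !mxE => E.
  rewrite [X in _ * X](_ : _ = 0) ?mulr0// -[RHS]E; apply: eq_bigr => j _.
  by rewrite !mxE mulrC.
exists (x *m A) => // d /PA/submxP[y ->]; rewrite BSr lS; apply: eq_bigr => j _; congr (_ * _).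
by have /matrixP/(_ 0 j) := xG; rewrite !mxE => <-; rewrite BSl; apply: eq_bigr => i _; rewrite !mxE.
Qed.

Lemma riesz (I : finType) (P : set (I -> R)) (B : (I -> R) -> (I -> R) -> R) (l : (I -> R) -> R) :
  (forall a c c' d, B (fun i => a * c i + c' i) d = a * B c d + B c' d) ->
  (forall a c d d', B c (fun i => a * d i + d' i) = a * B c d + B c d') ->
  P (fun=> 0) -> (forall a c d, P c -> P d -> P (fun i => a * c i + d i)) ->
  (forall a c d, P c -> P d -> l (fun i => a * c i + d i) = a * l c + l d) ->
  (forall c, P c -> B c c = 0 -> l c = 0) ->
  exists2 c, P c & forall d, P d -> B c d = l d.
Proof.
move=> Bl Br P0 PL lL Bl0.
pose F (c : 'rV[R]_#|I|) : I -> R := fun i => c 0 (enum_rank i).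
pose G (c : I -> R) : 'rV[R]_#|I| := \row_k c (enum_val k).
have FG c : F (G c) = c by apply/funext => i; rewrite /F mxE enum_rankK.
have FL a c d : F (a *: c + d) = (fun i => a * F c i + F d i).
  by apply/funext => i; rewrite /F !mxE.
have F0 : F 0 = fun=> 0 by apply/funext => i; rewrite /F mxE.
have [] := @riesz_row _ (fun c => P (F c)) (fun c d => B (F c) (F d)) (fun c => l (F c)).
- by move=> a c c' d; rewrite FL Bl.
- by move=> a c d d'; rewrite FL Br.
- by rewrite F0.
- by move=> a c d Pc Pd; rewrite FL; exact: PL.
- by move=> a c d Pc Pd; rewrite FL; exact: lL.
- by move=> c; exact: Bl0.
move=> c Pc H; exists (F c) => // d Pd; have := H (G d); rewrite FG; exact.
Qed.

(** The index set is a fixed finite type, as [riesz] requires. The coefficients with [i + j >= n]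
    are ignored, so they are not unique and the forms below are degenerate in them. *)
Definition polyc n (c : 'I_n * 'I_n -> R) (p : R * R) : R :=
  \sum_(i < n) \sum_(j < n | (i + j < n)%N) c (i, j) * p.1 ^+ i * p.2 ^+ j.

Lemma polycL n a (c d : 'I_n * 'I_n -> R) p :
  polyc (fun i => a * c i + d i) p = a * polyc c p + polyc d p.
Proof.
rewrite /polyc big_distrr -big_split; apply: eq_bigr => i _.
rewrite big_distrr -big_split; apply: eq_bigr => j _ /=; ring.
Qed.

Lemma polyc_sum n (c : nat -> nat -> R) p :
  \sum_(i < n) \sum_(j < n | (i + j < n)%N) c i j * p.1 ^+ i * p.2 ^+ j =
  \sum_(i < n) \sum_(j < n - i) c i j * p.1 ^+ i * p.2 ^+ j.
Proof.
apply: eq_bigr => i _.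
rewrite (big_ord_widen_cond n xpredT (fun j => c i j * p.1 ^+ i * p.2 ^+ j)); last exact: leq_subr.
by apply: eq_bigl => j; rewrite ltn_subRL.
Qed.

Lemma is_poly_polyc n (c : 'I_n * 'I_n -> R) : is_poly n (polyc c).
Proof.
pose c' i j := if insub i is Some i' then if insub j is Some j' then c (i', j') else 0 else 0.
exists c' => p; rewrite -polyc_sum; apply: eq_bigr => i _; apply: eq_bigr => j _.
by rewrite /c' !valK.
Qed.

Lemma is_polyP n f : is_poly n f -> exists c, f = @polyc n c.
Proof.
move=> [c Hc]; exists (fun ij : 'I_n * 'I_n => c ij.1 ij.2); apply/funext => p.
by rewrite Hc -polyc_sum.
Qed.
End Riesz.

(** * Weak derivatives and traces on the triangles of the complex *)

Section Link.
Context (R : realType) (S : triangulation R).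
Notation mu := (plane_measure R).
Notation leb := (@lebesgue_measure R).

Lemma jac_corner (t : tri S) : 0 < jac (corner S t).
Proof.
case: S t => vert tri vtx corner H1 H2 H3 H4 H5 H6 t /=.
have := H6 t; congr (0 < _).
rewrite (expand_det_row _ 0) !big_ord_recl big_ord0 /cofactor !det_mx11 !mxE/= /jac /cross.
rewrite (_ : lift ord0 ord0 = 1 :> 'I_3); last exact: val_inj.
rewrite (_ : lift ord0 (lift ord0 ord0) = 2 :> 'I_3); last exact: val_inj.
rewrite expr0 (_ : (-1) ^+ (0 + bump 0 0) = -1 :> R) ?expr1// (_ : ord0 = 0)// !pairE; ring.
Qed.

Lemma measurable_open_triangle (t : tri S) : measurable (open_triangle t : set (plane R)).
Proof. exact: measurable_open_tri. Qed.

Lemma weak_pderiv_spec (t : tri S) i u G f : measurable_fun (open_triangle t) G ->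
  (forall n, smooth (f n)) -> L2_cvg (open_triangle t) f u ->
  L2_cvg (open_triangle t) (fun n => pderiv i (f n)) G ->
  measurable_fun (open_triangle t) (weak_pderiv (open_triangle t) i u) /\
  exists f' : nat -> R * R -> R, [/\ forall n, smooth (f' n), L2_cvg (open_triangle t) f' u &
      L2_cvg (open_triangle t) (fun n => pderiv i (f' n)) (weak_pderiv (open_triangle t) i u)].
Proof.
move=> mG sf cf cG; rewrite /weak_pderiv; case: xgetP => [x _ Hx|/(_ G)] //.
by case; split => //; exists f.
Qed.

Lemma weak_pderiv_ae (t : tri S) i u G f : measurable_fun (open_triangle t) u ->
  measurable_fun (open_triangle t) G ->
  (forall n, smooth (f n)) -> L2_cvg (open_triangle t) f u ->
  L2_cvg (open_triangle t) (fun n => pderiv i (f n)) G ->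
  measurable_fun (open_triangle t) (weak_pderiv (open_triangle t) i u) /\
  {ae mu, forall p, open_triangle t p -> weak_pderiv (open_triangle t) i u p = G p}.
Proof.
move=> mu' mG sf cf cG; have [mW [f' [sf' cf' cW]]] := weak_pderiv_spec mG sf cf cG.
split; first exact: mW.
exact: (@weak_deriv_unique R (corner S t) (jac_corner t) f' f u i _ _ (fun n => smooth_C2 (sf' n))
  (fun n => smooth_C2 (sf n)) mu' mW mG cf' cf cW cG).
Qed.

Lemma cvL2_poly (t : tri S) n u F : measurable_fun (open_triangle t) u -> is_poly n F ->
  {ae mu, forall p, open_triangle t p -> u p = F p} ->
  L2_cvg (open_triangle t) (fun=> F) u.
Proof.
move=> mu' pF uF; have mT := measurable_open_triangle t.
apply: (cvL2_cst mT) => //; apply: continuous_measurable_prod => //.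
exact: (is_poly_C1 pF).1.1.
Qed.

(** The constant sequence [F] is an admissible approximation of [u]. *)
Lemma weak_pderiv_poly (t : tri S) i u n F : measurable_fun (open_triangle t) u -> is_poly n F ->
  {ae mu, forall p, open_triangle t p -> u p = F p} ->
  measurable_fun (open_triangle t) (weak_pderiv (open_triangle t) i u) /\
  {ae mu, forall p, open_triangle t p -> weak_pderiv (open_triangle t) i u p = pderiv i F p}.
Proof.
move=> mu' pF uF; have [_ /(_ i) pdF] := is_poly_C1 pF.
have mdF : measurable_fun (open_triangle t) (pderiv i F).
  by apply: continuous_measurable_prod => //; [exact: measurable_open_triangle|exact: (is_poly_C1 pdF).1.1].
apply: (@weak_pderiv_ae t i u (pderiv i F) (fun=> F)) => //.
- by move=> _; exact: is_poly_smooth pF.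
- exact: cvL2_poly pF uF.
- by apply: (cvL2_poly mdF pdF); apply: aeW.
Qed.

Lemma edge_trace_unique (h : side S) u w w' : measurable_fun (open_triangle h.1) u ->
  is_trace h u w -> is_trace h u w' -> {ae leb, forall s, `[0, 1]%classic s -> w s = w' s}.
Proof.
move=> mu' [mw [f [G [sf cf cG cw]]]] [mw' [f' [G' [sf' cf' cG' cw']]]].
exact: (@trace_unique R (corner S h.1) (jac_corner h.1) f f' u G G' h.2 w w' (fun n => smooth_C2 (sf n))
  (fun n => smooth_C2 (sf' n)) mu' (fun i => (cG i).1) (fun i => (cG' i).1) cf cf'
  (fun i => (cG i).2) (fun i => (cG' i).2) mw mw' cw cw').
Qed.

Lemma edge_trace_is_trace (h : side S) u w : is_trace h u w -> is_trace h u (edge_trace h u).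
Proof.
by move=> tw; rewrite /edge_trace; case: xgetP => // /(_ w).
Qed.

Lemma edge_trace_ae (h : side S) u w : measurable_fun (open_triangle h.1) u ->
  is_trace h u w -> {ae leb, forall s, `[0, 1]%classic s -> edge_trace h u s = w s}.
Proof.
by move=> mu' tw; apply: (edge_trace_unique mu' (edge_trace_is_trace tw) tw).
Qed.

Lemma is_trace_L2 (h : side S) u w : is_trace h u w -> L2 leb `[0, 1] w.
Proof.
move=> [mw [f [G [sf cf cG cw]]]].
have L n : L2 leb `[0, 1] (fun s => f n (side_point h s)).
  apply: continuous_L2_segment; apply: (@continuous_side_comp R (corner S h.1) (f n) h.2).
  exact: (smooth_C1 (sf n)).1.
exact: (@cvL2P _ (measurableTypeR R) R leb _ (@segI R) _ w L mw cw).1.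
Qed.

(* If [u] has no trace, [edge_trace] is the default value of [get], which is the
   zero function. *)
Lemma edge_trace_L2 (h : side S) u : L2 leb `[0, 1] (edge_trace h u).
Proof.
rewrite /edge_trace; case: xgetP => [w _|_]; first exact: is_trace_L2.
by apply: continuous_L2_segment => s; exact: cvg_cst.
Qed.

Lemma edge_trace_poly (h : side S) u n F : measurable_fun (open_triangle h.1) u -> is_poly n F ->
  {ae mu, forall p, open_triangle h.1 p -> u p = F p} ->
  {ae leb, forall s, `[0, 1]%classic s -> edge_trace h u s = F (side_point h s)}.
Proof.
move=> mu' pF uF; apply: edge_trace_ae => //.
have cs : continuous (fun s => F (side_point h s)).
  apply: (@continuous_side_comp R (corner S h.1) F h.2); exact: (is_poly_C1 pF).1.1.
have ms : measurable_fun (`[0, 1]%classic : set R) (fun s => F (side_point h s)).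
  by apply: measurable_funTS; exact: continuous_measurable_fun.
split => //; exists (fun=> F), (fun i => pderiv i F); split => //.
- by move=> _; exact: is_poly_smooth pF.
- exact: cvL2_poly pF uF.
- move=> i; have [_ /(_ i) pdF] := is_poly_C1 pF.
  have mdF : measurable_fun (open_triangle h.1) (pderiv i F).
    by apply: continuous_measurable_prod => //; [exact: measurable_open_triangle|exact: (is_poly_C1 pdF).1.1].
  by split => //; apply: (cvL2_poly mdF pdF); apply: aeW.
- apply: (@cvL2_cst _ (measurableTypeR R) R leb _ (@segI R) _ _ ms ms); exact: aeW.
Qed.
End Link.

Section SegmentAe.
Context (R : realType).
Notation leb := (@lebesgue_measure R).

(** Null sets are preserved by the reflection of the segment, by [lebesgue_affine] with slope -1. *)
Lemma segment_ae_rev (P : R -> Prop) : {ae leb, forall s, `[0, 1]%classic s -> P s} ->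
  {ae leb, forall s, `[0, 1]%classic s -> P (1 - s)}.
Proof.
move=> [N [mN N0 sub]]; exists ((fun s => (-1) * s + 1) @^-1` N); split.
- have mf : measurable_fun setT (fun s : measurableTypeR R => (-1) * s + 1 : measurableTypeR R).
    apply: continuous_measurable_fun => s; apply: cvgD; last exact: cvg_cst.
    by apply: cvgM; [exact: cvg_cst|exact: cvg_id].
  by rewrite -[X in measurable X]setTI; exact: mf.
- have := @lebesgue_affine R (-1) 1 N _ mN; rewrite N0 normrN1 mul1e => <- //.
- move=> s /= H; apply: sub => /= H'; apply: H => s01.
  have -> : 1 - s = (-1) * s + 1 by ring.
  by apply: H'; move: s01; rewrite /= !in_itv/=; lra.
Qed.

Lemma segment_ae_eq (f g : R -> R) : continuous f -> continuous g ->
  {ae leb, forall s, `[0, 1]%classic s -> f s = g s} ->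
  forall s, s \in (`[0, 1] : interval R) -> f s = g s.
Proof.
move=> cf cg [N [mN N0 sub]] s s01; apply/eqP/negPn/negP => fg.
have /nbhs_ballP[e /= e0 He] : \forall x \near s, f x - g x != 0.
  have : (fun x => f x - g x) @ s --> f s - g s by apply: cvgB; [exact: cf|exact: cg].
  move=> /(_ [set y | y != 0]); apply; apply: open_nbhs_nbhs; split; last by rewrite /= subr_eq0.
  exact: open_neq.
(* The part of the neighbourhood of [s] inside the segment is an interval of positive length, also
   when [s] is an endpoint. *)
pose a := Num.max 0 (s - e); pose b := Num.min 1 (s + e).
have ab : a < b.
  move: s01; rewrite /a /b in_itv/= gt_max !lt_min => /andP[s0 s1]; move: e0 s0 s1; clear; lra.
have : `]a, b[%classic `<=` N.
  move=> x /=; rewrite in_itv/= /a /b gt_max lt_min => /andP[/andP[x0 xs] /andP[x1 xe]].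
  apply: sub => /= H; have := He x.
  rewrite /ball/= (_ : (`|s - x| < e) = true); last by apply/ltr_normlP; split; move: xs xe; clear; lra.
  move=> /(_ isT); rewrite H ?subrr ?eqxx// in_itv/=; move: x0 x1; clear; lra.
move=> abN; have : (leb `]a, b[%classic <= 0)%E.
  by rewrite -N0; apply: le_measure; rewrite ?inE//; exact: measurable_itv.
rewrite lebesgue_measure_itv/= lte_fin ab -EFinD lee_fin; move: ab; clear; lra.
Qed.
End SegmentAe.

(** * Metrics as positive definite 2 x 2 matrices *)

Section Metric2.
Context (R : realType).

Lemma ord2P (k : 'I_2) (P : 'I_2 -> Prop) : P 0 -> P 1 -> P k.
Proof.
by case: k => [[|[|//]] Hk] P0 P1; [rewrite (_ : Ordinal Hk = 0)|rewrite (_ : Ordinal Hk = 1)] => //; exact: val_inj.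
Qed.

Lemma sum2 (V : zmodType) (F : 'I_2 -> V) : \sum_k F k = F 0 + F 1.
Proof. by rewrite big_ord_recl big_ord1; congr (_ + F _); exact: val_inj. Qed.

Lemma bilinE (x y : 'rV[R]_2) G : bilin x G y = \sum_i \sum_j x 0 i * y 0 j * G i j.
Proof.
by rewrite /bilin mxE !sum2 !mxE !sum2; ring.
Qed.

Lemma det2 (G : 'M[R]_2) : \det G = G 0 0 * G 1 1 - G 0 1 * G 1 0.
Proof.
rewrite (expand_det_row _ 0) sum2 /cofactor !det_mx11 !mxE/= expr0 expr1.
have -> : lift 0 0 = 1 :> 'I_2 by exact: val_inj.
have -> : lift 1 0 = 0 :> 'I_2 by exact: val_inj.
ring.
Qed.

Lemma ord2_11 : 1 + 1 = 0 :> 'I_2. Proof. exact: val_inj. Qed.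
Lemma ord2_01 : 0 + 1 = 1 :> 'I_2. Proof. exact: val_inj. Qed.

Lemma invmx2 (G : 'M[R]_2) i j : \det G != 0 ->
  invmx G i j = (\det G)^-1 * (if i == j then G (i + 1) (i + 1) else - G i j).
Proof.
move=> D0; pose M := \matrix_(i, j) ((\det G)^-1 * (if i == j then G (i + 1) (i + 1) else - G i j)).
suff -> : invmx G = M by rewrite mxE.
have GM : M *m G = 1%:M.
  apply/matrixP => a b; rewrite !mxE sum2 !mxE.
  move: D0; rewrite det2 => D0.
  elim/ord2P: a; elim/ord2P: b; rewrite /= ?ord2_11 ?ord2_01;
    move: (G 0 0) (G 0 1) (G 1 0) (G 1 1) D0 => a b c d D0; by field.
have uG : G \in unitmx by rewrite unitmxE unitfE.
by rewrite -[LHS]mul1mx -GM -mulmxA mulmxV// mulmx1.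
Qed.

Lemma posdef2 (G : 'M[R]_2) : G^T = G -> (forall x : 'rV[R]_2, x != 0 -> 0 < bilin x G x) ->
  [/\ G 1 0 = G 0 1, 0 < G 0 0, 0 < \det G &
    forall x : 'rV[R]_2, x != 0 -> 0 < bilin x (invmx G) x].
Proof.
move=> sG pG.
have s01 : G 1 0 = G 0 1 by rewrite -[in LHS]sG mxE.
pose v (a b : R) : 'rV[R]_2 := \row_i (if i == 0 then a else b).
have vE a b : bilin (v a b) G (v a b) = a ^+ 2 * G 0 0 + 2 * a * b * G 0 1 + b ^+ 2 * G 1 1.
  by rewrite bilinE !sum2 !mxE/= s01; ring.
have v0 a b : (a != 0) || (b != 0) -> v a b != 0.
  by apply: contraTneq => /matrixP h; have := h 0 0; have := h 0 1; rewrite !mxE/= => -> ->; rewrite eqxx.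
have g0 : 0 < G 0 0.
  by have := pG (v 1 0) (v0 _ _ _); rewrite vE oner_eq0 => /(_ isT); lra.
have D0 : 0 < \det G.
  (* At this vector the form takes the value [G 0 0 * \det G]. *)
  have := pG (v (- G 0 1) (G 0 0)) (v0 _ _ _); rewrite (gt_eqF g0) orbT => /(_ isT).
  rewrite vE (_ : _ + _ = G 0 0 * (\det G)) ?pmulr_rgt0//.
  by rewrite det2 s01; ring.
split => // x x0.
have {x0} : (x 0 0 != 0) || (x 0 1 != 0).
  apply: contraNT x0; rewrite negb_or !negbK => /andP[/eqP h0 /eqP h1].
  by apply/eqP/matrixP => i j; rewrite ord1 mxE; elim/ord2P: j.
have Dn : \det G != 0 by rewrite gt_eqF.
rewrite bilinE !sum2 !(invmx2 _ _ Dn) /= ord2_11 ord2_01.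
rewrite s01; have := D0; rewrite det2 s01; move: (x 0 0) (x 0 1) (G 0 0) (G 0 1) (G 1 1) g0 => a b g00 g01 g11 g0 D h.
(* Completing the square in the inverse form. *)
rewrite (_ : _ + _ = (g00 * g11 - g01 * g01)^-1 * (g00^-1 * ((g00 * b - g01 * a) ^+ 2 + (g00 * g11 - g01 * g01) * a ^+ 2))).
  apply: mulr_gt0; first by rewrite invr_gt0.
  apply: mulr_gt0; first by rewrite invr_gt0.
  have [a0|a0] := eqVneq a 0.
    move: h; rewrite a0 eqxx/= => b0; rewrite mulr0 subr0 expr0n/= mulr0 addr0.
    by rewrite exprn_even_gt0//= mulf_neq0// gt_eqF.
  by apply: ltr_wpDl; [exact: sqr_ge0|rewrite mulr_gt0// exprn_even_gt0].
have {}D : g00 * g11 - g01 * g01 != 0 by rewrite gt_eqF.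
by field; rewrite D gt_eqF.
Qed.
End Metric2.

Section MetricWeights.
Context (R : realType) (S : triangulation R) (g : tens_field S) (g_metric : regge_metric g).
Notation mu := (plane_measure R).

Lemma metric_posdef t p : triangle t p -> [/\ g t p 1 0 = g t p 0 1, 0 < g t p 0 0, 0 < \det (g t p) &
    forall x : 'rV[R]_2, x != 0 -> 0 < bilin x (invmx (g t p)) x].
Proof.
by case: g_metric => _ h _ /h[h1 h2]; exact: posdef2.
Qed.

Lemma metric_entry t i j : exists2 F, continuous F & forall p, triangle t p -> g t p i j = F p.
Proof.
by case: g_metric => h _ _; have [F sF HF] := h t i j; exists F => //; exact: (smooth_C1 sF).1.
Qed.

(** The metric is controlled only on the closed triangle. Its determinant is replaced by a positive
    continuous function on the whole plane, so that it can be inverted and integrated like any other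
    continuous function. *)
Lemma metric_det t : exists D : R * R -> R, [/\ continuous D, forall p, 0 < D p &
  forall p, triangle t p -> \det (g t p) = D p].
Proof.
have [F00 c00 E00] := metric_entry t 0 0; have [F01 c01 E01] := metric_entry t 0 1.
have [F10 c10 E10] := metric_entry t 1 0; have [F11 c11 E11] := metric_entry t 1 1.
pose D p := F00 p * F11 p - F01 p * F10 p.
have cD : continuous D.
  by move=> p; apply: cvgB; apply: cvgM; [exact: c00|exact: c11|exact: c01|exact: c10].
have DE p : triangle t p -> \det (g t p) = D p.
  by move=> tp; rewrite det2 E00// E01// E10// E11.
have D0 p : triangle t p -> 0 < D p.
  by move=> tp; rewrite -DE//; have [] := metric_posdef tp.
have [M HM] : exists M : R, forall p, triangle t p -> `|(D p)^-1| <= M.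
  apply: (@continuous_tri_bounded R (corner S t) (jac_corner t) (fun p => (D p)^-1)).
  apply/subspace_continuousP => p tp; apply: cvg_within_filter; apply: cvgV; last exact: cD.
  by rewrite gt_eqF// D0.
(* A lower bound of the determinant on the triangle, obtained from the upper bound [M] of its
   inverse; the maximum with [m] changes nothing there. *)
pose m := (1 + `|M|)^-1.
have m0 : 0 < m by rewrite invr_gt0; have := normr_ge0 M; lra.
exists (fun p => Num.max (D p) m); split.
- by move=> p; apply: continuous_max; [exact: cD|exact: cvg_cst].
- by move=> p; rewrite lt_max m0 orbT.
- move=> p tp; rewrite DE//; apply/esym/max_idPl.
  have := HM _ tp; rewrite gtr0_norm ?invr_gt0 ?D0// => h.
  have M1 : 0 < 1 + `|M| by rewrite ltr_pwDl.
  rewrite /m -[D p]invrK lef_pV2 ?posrE ?invr_gt0 ?D0//.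
  by apply: (le_trans h); apply: (le_trans (ler_norm M)); rewrite lerDr ler01.
Qed.

(** The weights extend the inverse metric times the volume density to continuous functions on the
    plane. *)
Lemma metric_form t : exists w : 'I_2 -> 'I_2 -> R * R -> R,
  (forall i j, continuous (w i j)) /\
  forall p, triangle t p -> forall x y,
    bilin x (invmx (g t p)) y * density g t p = \sum_i \sum_j x 0 i * y 0 j * w i j p.
Proof.
have [D [cD D0 DE]] := metric_det t.
have /(_ _)/cid2-/all_sig2[F cF FE] := metric_entry t 0.
have /(_ _)/cid2-/all_sig2[F' cF' FE'] := metric_entry t 1.
pose G (i : 'I_2) := if i == 0 then F else F'.
have cG i j : continuous (G i j) by rewrite /G; case: ifP.
have GE i j p : triangle t p -> g t p i j = G i j p.
  by move=> tp; elim/ord2P: i; rewrite /G/= -?FE -?FE'.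
exists (fun i j p => (D p)^-1 * (if i == j then G (i + 1) (i + 1) p else - G i j p) * Num.sqrt (D p)).
split.
  move=> i j p; apply: cvgM; last first.
    by apply: (continuous_comp (g := Num.sqrt)); [exact: cD|exact: sqrt_continuous].
  apply: cvgM; first by apply: cvgV; [rewrite gt_eqF|exact: cD].
  by case: ifP => _; [exact: cG|apply: cvgN; exact: cG].
move=> p tp x y; rewrite bilinE big_distrl; apply: eq_bigr => i _; rewrite big_distrl; apply: eq_bigr => j _ /=.
rewrite invmx2; last by rewrite DE// gt_eqF.
rewrite /density DE// -!mulrA; congr (_ * (_ * (_ * (_ * _)))).
by case: ifP => _; rewrite GE.
Qed.
End MetricWeights.

(** * The projection onto one-forms *)

Section LebAe.
Context (R : realType).
Notation leb := (@lebesgue_measure R).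
Implicit Types P Q K L : R -> Prop.

Lemma leb_aeS P Q : (forall s, P s -> Q s) ->
  {ae leb, forall s, P s} -> {ae leb, forall s, Q s}.
Proof. by move=> PQ; apply: (@filterS _ _ (ae_filter_ringOfSetsType leb)). Qed.

Lemma leb_aeS2 P Q K : (forall s, P s -> Q s -> K s) ->
  {ae leb, forall s, P s} -> {ae leb, forall s, Q s} -> {ae leb, forall s, K s}.
Proof. by move=> PQ; apply: (@filterS2 _ _ (ae_filter_ringOfSetsType leb)). Qed.

Lemma leb_aeS3 P Q K L : (forall s, P s -> Q s -> K s -> L s) ->
  {ae leb, forall s, P s} -> {ae leb, forall s, Q s} -> {ae leb, forall s, K s} ->
  {ae leb, forall s, L s}.
Proof. by move=> PQ; apply: (@filterS3 _ _ (ae_filter_ringOfSetsType leb)). Qed.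
End LebAe.

Section PolyForms.
Context (R : realType) (S : triangulation R) (r : nat).
Notation mu := (plane_measure R).
Notation leb := (@lebesgue_measure R).
Implicit Types (alpha beta : form_field S).

Lemma sobolev_measurable k (t : tri S) u : sobolev k (open_triangle t) u ->
  measurable_fun (open_triangle t) u.
Proof. by move=> [f [D [<- _ /(_ [::] isT)[]]]]. Qed.

Lemma poly_measurable (t : tri S) n f : is_poly n f -> measurable_fun (open_triangle t) f.
Proof.
move=> pf; apply: continuous_measurable_prod; first exact: measurable_open_triangle.
exact: (is_poly_C1 pf).1.1.
Qed.

Lemma poly_sobolev k (t : tri S) u n F : measurable_fun (open_triangle t) u -> is_poly n F ->
  {ae mu, forall p, open_triangle t p -> u p = F p} -> sobolev k (open_triangle t) u.
Proof.
move=> mu' pF uF; exists (fun=> F), (fun w => if w is [::] then u else pderivs w F).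
split => // [_|[|i w] _]; first exact: is_poly_smooth pF.
- split; [exact: mu'|exact: cvL2_poly pF uF].
- have [m pm] := is_poly_pderivs (i :: w) pF.
  have mp := @poly_measurable t _ _ pm.
  split; [exact: mp|apply: (cvL2_poly mp pm); exact: aeW].
Qed.

Lemma poly_on_cont n (t : tri S) f : {within triangle t, continuous f} ->
  poly_on n (open_triangle t) f -> exists2 F, is_poly n F & forall p, triangle t p -> f p = F p.
Proof.
move=> cf [F pF fF]; exists F => //.
apply: (@ae_tri_eq R (corner S t) (jac_corner t) f F cf _ fF).
exact: continuous_subspaceT (is_poly_C1 pF).1.1.
Qed.

Lemma side_point_in (h : side S) s : s \in (`[0, 1] : interval R) -> triangle h.1 (side_point h s).
Proof. exact: (@side_in R (corner S h.1) (jac_corner h.1) h.2 s). Qed.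

Definition form_poly_trace F (h : side S) (x : 'rV[R]_2) (s : R) : R :=
  \sum_j F h.1 j (side_point h s) * x 0 j.

Lemma continuous_side_poly n f (h : side S) : is_poly n f -> continuous (fun s => f (side_point h s)).
Proof.
move=> pf; apply: (@continuous_side_comp R (corner S h.1) f h.2); exact: (is_poly_C1 pf).1.1.
Qed.

Lemma continuous_form_poly_trace n F h x : (forall t j, is_poly n (F t j)) ->
  continuous (form_poly_trace F h x).
Proof.
move=> pF s; rewrite /continuous_at /form_poly_trace sum2; rewrite (_ : (fun s => _) = fun s => F h.1 0 (side_point h s) * x 0 0 + F h.1 1 (side_point h s) * x 0 1); last by apply/funext => s'; rewrite sum2.
have c0 := @continuous_side_poly _ _ h (pF h.1 0); have c1 := @continuous_side_poly _ _ h (pF h.1 1).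
by apply: cvgD; apply: cvgM; [exact: c0|exact: cvg_cst|exact: c1|exact: cvg_cst].
Qed.

Lemma form_trace_poly n F alpha (h : side S) : (forall t j, is_poly n (F t j)) ->
  (forall t j, measurable_fun (open_triangle t) (fun p => alpha t p 0 j)) ->
  (forall t j, {ae mu, forall p, open_triangle t p -> alpha t p 0 j = F t j p}) ->
  {ae leb, forall s, `[0, 1]%classic s -> forall x, form_trace alpha h x s = form_poly_trace F h x s}.
Proof.
move=> pF ma aF.
have E j : {ae leb, forall s, `[0, 1]%classic s ->
    edge_trace h (fun p => alpha h.1 p 0 j) s = F h.1 j (side_point h s)}.
  exact: edge_trace_poly (ma _ _) (pF _ _) (aF _ _).
apply: leb_aeS2 (E 0) (E 1) => s h0 h1 s01 x.
by rewrite /form_trace /form_poly_trace !sum2 h0// h1.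
Qed.

(** [Wh_space] in terms of polynomial representatives: the conditions on the edges hold at every
    point and involve no trace operator. *)
Definition poly_form (F : tri S -> 'I_2 -> R * R -> R) := [/\ forall t j, is_poly r.+2 (F t j),
  forall t, poly_on r.+2 (open_triangle t) (fun p => \sum_j row_of p 0 j * F t j p),
  forall h h' : side S, twin h h' -> forall s, s \in (`[0, 1] : interval R) ->
    form_poly_trace F h (side_vec h) s = - form_poly_trace F h' (side_vec h') (1 - s) &
  forall h : side S, boundary_side h -> forall s, s \in (`[0, 1] : interval R) ->
    form_poly_trace F h (side_vec h) s = 0].

Definition ae_form alpha F := forall t j,
  {ae mu, forall p, open_triangle t p -> alpha t p 0 j = F t j p}.

Definition measurable_form alpha := forall t j,
  measurable_fun (open_triangle t) (fun p => alpha t p 0 j).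

Lemma ae_form_kos alpha F t : ae_form alpha F ->
  {ae mu, forall p, open_triangle t p ->
    \sum_j row_of p 0 j * alpha t p 0 j = \sum_j row_of p 0 j * F t j p}.
Proof.
move=> aF; apply: plane_aeS2 (aF t 0) (aF t 1) => p h0 h1 tp.
by rewrite !sum2 h0// h1.
Qed.

Lemma onem_itv (s : R) : s \in (`[0, 1] : interval R) -> 1 - s \in (`[0, 1] : interval R).
Proof. by rewrite !in_itv/=; lra. Qed.

Lemma Wh_measurable alpha : Wh_space r alpha -> measurable_form alpha.
Proof. by move=> [[h _ _] _ _] t j; exact: sobolev_measurable (h t j). Qed.

(** The trace of a polynomial is its restriction, and continuous functions that agree almost
    everywhere on a segment agree everywhere. *)
Lemma Wh_poly alpha : Wh_space r alpha -> exists2 F, poly_form F & ae_form alpha F.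
Proof.
move=> Wa; have ma := Wh_measurable Wa; case: Wa => [[_ tw bd] pa ka].
have H t j : exists F, is_poly r.+2 F /\ {ae mu, forall p, open_triangle t p -> alpha t p 0 j = F p}.
  by have [F pF aF] := pa t j; exists F.
pose F t j := sval (cid (H t j)).
have pF t j : is_poly r.+2 (F t j) := (svalP (cid (H t j))).1.
have aF : ae_form alpha F by move=> t j; exact: (svalP (cid (H t j))).2.
have cF h x := @continuous_form_poly_trace _ F h x pF.
have tF h := form_trace_poly h pF ma aF.
exists F => //; split => //.
- move=> t; have [G pG aG] := ka t; exists G => //.
  by apply: plane_aeS2 aG (ae_form_kos t aF) => p h1 h2 tp; rewrite -h2// h1.
- move=> h h' hh'; apply: segment_ae_eq.
  + exact: cF.
  + move=> s; apply: cvgN; exact: (@continuous_comp _ _ _ (fun s : R => 1 - s) (form_poly_trace F h' (side_vec h')) s (@continuous_onem R 1 s) (cF _ _ _)).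
  + have := segment_ae_rev (tF h'); apply: leb_aeS3 (tw h h' hh') (tF h) => s e1 e2 e3 s01.
    by rewrite -e2// e1// e3.
- move=> h bh; apply: segment_ae_eq; [exact: cF|exact: cst_continuous|].
  by apply: leb_aeS2 (bd h bh) (tF h) => s e1 e2 s01; rewrite -e2// e1.
Qed.

Lemma poly_Wh alpha F : measurable_form alpha -> poly_form F -> ae_form alpha F -> Wh_space r alpha.
Proof.
move=> ma [pF kF tw bd] aF; have tF h := form_trace_poly h pF ma aF.
split.
- split.
  + by move=> t j; exact: poly_sobolev (ma t j) (pF t j) (aF t j).
  + move=> h h' hh'; have := segment_ae_rev (tF h'); apply: leb_aeS2 (tF h) => s e1 e2 s01.
    by rewrite e1// e2// (tw h h').
  + by move=> h bh; apply: leb_aeS (tF h) => s e1 s01; rewrite e1// bd.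
- by move=> t j; exists (F t j).
- move=> t; have [G pG aG] := kF t; exists G => //.
  by apply: plane_aeS2 aG (ae_form_kos t aF) => p h1 h2 tp; rewrite h2// h1.
Qed.

Lemma poly_formL a F G : poly_form F -> poly_form G ->
  poly_form (fun t j p => a * F t j p + G t j p).
Proof.
move=> [pF kF tF bF] [pG kG tG bG].
have E h x s : form_poly_trace (fun t j p => a * F t j p + G t j p) h x s =
    a * form_poly_trace F h x s + form_poly_trace G h x s.
  by rewrite /form_poly_trace !sum2; ring.
split.
- by move=> t j; apply: is_polyD => //; exact: is_polyZ.
- move=> t; have [H pH aH] := kF t; have [K pK aK] := kG t.
  exists (fun p => a * H p + K p); first by apply: is_polyD => //; exact: is_polyZ.
  by apply: plane_aeS2 aH aK => p e1 e2 tp; rewrite -e1// -e2// !sum2; ring.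
- by move=> h h' hh' s s01; rewrite !E (tF h h')// (tG h h')//; ring.
- by move=> h bh s s01; rewrite E bF// bG//; ring.
Qed.

Lemma poly_form0 : poly_form (fun _ _ _ => 0).
Proof.
have E h x s : form_poly_trace (fun _ _ _ => 0) h x s = 0.
  by rewrite /form_poly_trace big1// => j _; rewrite mul0r.
split.
- by move=> _ _; exact: is_poly_cst0.
- move=> t; exists (fun=> 0); first exact: is_poly_cst0.
  by apply: aeW => p _; rewrite big1// => j _; rewrite mulr0.
- by move=> h h' _ s _; rewrite !E oppr0.
- by move=> h _ s _; rewrite E.
Qed.

Definition form_of F : form_field S := fun t p => \row_j F t j p.

Lemma ae_form_of F : ae_form (form_of F) F.
Proof. by move=> t j; apply: aeW => p _; rewrite mxE. Qed.

Lemma measurable_form_of n F : (forall t j, is_poly n (F t j)) -> measurable_form (form_of F).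
Proof.
move=> pF t j; rewrite (_ : (fun p => _) = F t j); first exact: poly_measurable (pF t j).
by apply/funext => p; rewrite mxE.
Qed.

Lemma Wh_form_of F : poly_form F -> Wh_space r (form_of F).
Proof. by move=> pF; apply: (poly_Wh _ pF (ae_form_of F)); case: pF => /measurable_form_of. Qed.

Lemma Wh_L a alpha beta : Wh_space r alpha -> Wh_space r beta ->
  Wh_space r (fun t p => a *: alpha t p + beta t p).
Proof.
move=> Wa Wb; have ma := Wh_measurable Wa; have mb := Wh_measurable Wb.
have [F pF aF] := Wh_poly Wa; have [G pG aG] := Wh_poly Wb.
apply: (poly_Wh _ (poly_formL a pF pG)).
- move=> t j; rewrite (_ : (fun p => _) = fun p => a * alpha t p 0 j + beta t p 0 j).
    by apply: measurable_funD; [apply: measurable_funM; [exact: measurable_cst|exact: ma]|exact: mb].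
  by apply/funext => p; rewrite !mxE.
- by move=> t j; apply: plane_aeS2 (aF t j) (aG t j) => p e1 e2 tp; rewrite !mxE e1// e2.
Qed.

Lemma twin_side_line (h : side S) (s : R) :
  side_point h s = corner S h.1 (h.2 + 1) + s *: edge (corner S h.1) h.2.
Proof. exact: side_ptE. Qed.

Lemma side_vecE (h : side S) j : side_vec h 0 j =
  if j == 0 then (edge (corner S h.1) h.2).1 else (edge (corner S h.1) h.2).2.
Proof. by rewrite /side_vec /edge !mxE; case: ifP. Qed.

Lemma form_poly_trace_d n (V : tri S -> R * R -> R) (h : side S) s : (forall t, is_poly n (V t)) ->
  form_poly_trace (fun t j => pderiv j (V t)) h (side_vec h) s =
  dir_deriv (V h.1) (edge (corner S h.1) h.2) (side_point h s).
Proof.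
move=> pV; rewrite /form_poly_trace sum2 !side_vecE /dir_deriv/=; ring.
Qed.

(** The tangential component of dv is the derivative of v along the side: matching values on twin
    sides have opposite derivatives, as the opposite directions require. The Koszul differential of
    dv has degree at most r + 1 because dv has degree at most r. *)
Lemma ext_d_Wh v : Vh_space r v -> Wh_space r (ext_d v) /\
  exists V, (forall t, is_poly r.+2 (V t)) /\ ae_form (ext_d v) (fun t j => pderiv j (V t)).
Proof.
move=> [[sv cv tv bv] pv].
have H t : exists F, is_poly r.+2 F /\ forall p, triangle t p -> v t p = F p.
  by have [F pF vF] := poly_on_cont (cv t) (pv t); exists F.
pose V t := sval (cid (H t)).
have pV t : is_poly r.+2 (V t) := (svalP (cid (H t))).1.
have vV t : forall p, triangle t p -> v t p = V t p := (svalP (cid (H t))).2.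
have W t j := @weak_pderiv_poly R S t j (v t) _ _ (sobolev_measurable (sv t)) (pV t)
  (aeW mu (fun p (tp : open_triangle t p) => vV t p (@open_tri_sub R (corner S t) p tp))).
have aV : ae_form (ext_d v) (fun t j => pderiv j (V t)).
  move=> t j; apply: plane_aeS (W t j).2 => p e tp; by rewrite mxE e.
have mV : measurable_form (ext_d v).
  move=> t j; rewrite (_ : (fun p => _) = weak_pderiv (open_triangle t) j (v t)); first exact: (W t j).1.
  by apply/funext => p; rewrite mxE.
have pdV t j : is_poly r.+1 (pderiv j (V t)) := (is_poly_C1 (pV t)).2 j.
split; last by exists V.
apply: (poly_Wh mV _ aV).
have lin (h : side S) : exists2 q : {poly R}, forall s, V h.1 (side_point h s) = q.[s] & True.
  have [q _ qE] := is_poly_line (corner S h.1 (h.2 + 1)) (edge (corner S h.1) h.2) (pV h.1).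
  by exists q => // s; rewrite twin_side_line qE.
have D h s : is_derive s (1 : R) (fun s => V h.1 (side_point h s))
    (dir_deriv (V h.1) (edge (corner S h.1) h.2) (side_point h s)).
  rewrite (_ : (fun s => _) = fun s => V h.1 (corner S h.1 (h.2 + 1) + s *: edge (corner S h.1) h.2)).
    rewrite twin_side_line; apply: C1_line; exact: (is_poly_C1 (pV h.1)).1.
  by apply/funext => s'; rewrite twin_side_line.
split.
- by move=> t j; exact: is_poly_S.
- move=> t; exists (fun p => p.1 * pderiv 0 (V t) p + p.2 * pderiv 1 (V t) p).
    by apply: is_polyD; [exact: is_poly_X1|exact: is_poly_X2].
  by apply: aeW => p _; rewrite sum2 !mxE.
- move=> h h' hh' s s01; rewrite !(form_poly_trace_d _ _ pV).
  have [q qE _] := lin h; have [q' qE' _] := lin h'.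
  (* As polynomials in [s] the two restrictions agree on the whole line, so they can be
     differentiated at the endpoints as well. *)
  have E : forall s, V h.1 (side_point h s) = V h'.1 (side_point h' (1 - s)).
    have e0 : q - (q' \Po (1 - 'X)) = 0.
      apply: poly_segment0 => x x01; rewrite hornerD hornerN horner_comp !hornerE -qE -qE'.
      rewrite -vV; last exact: side_point_in.
      rewrite -vV; last by apply: side_point_in; exact: onem_itv.
      by rewrite (tv h h')// subrr.
    move=> x; rewrite qE qE'; move/eqP: e0; rewrite subr_eq0 => /eqP ->.
    by rewrite horner_comp !hornerE.
  have D' : is_derive s (1 : R) (fun s => V h'.1 (side_point h' (1 - s)))
      (- dir_deriv (V h'.1) (edge (corner S h'.1) h'.2) (side_point h' (1 - s))).
    have := @is_derive1_comp R _ (fun s : R => 1 - s) s _ (-1) (D h' (1 - s)).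
    rewrite mulrN1; apply.
    by have := is_deriveB (is_derive_cst (1 : R) s (1 : R)) (is_derive_id s (1 : R)); rewrite sub0r.
  move: D'; rewrite -(funext E) => D'.
  by have [_ <-] := D h s; have [_ <-] := D'.
- move=> h bh s s01; rewrite (form_poly_trace_d _ _ pV).
  have [q qE _] := lin h.
  have q0 : q = 0.
    apply: poly_segment0 => x x01; rewrite -qE -vV; last exact: side_point_in.
    exact: bv.
  have [_ <-] := D h s; rewrite (_ : (fun s => _) = cst 0); first exact: derive_cst.
  by apply/funext => x; rewrite qE q0 horner0.
Qed.
End PolyForms.

Section FormInner.
Context (R : realType) (S : triangulation R) (r : nat) (gh : tens_field S).
Hypothesis gh_metric : regge_metric gh.
Notation mu := (plane_measure R).
Implicit Types (alpha beta : form_field S).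

Lemma Rintegral_ae_eq (t : tri S) (f g : R * R -> R) : measurable_fun (open_triangle t) f ->
  measurable_fun (open_triangle t) g -> {ae mu, forall p, open_triangle t p -> f p = g p} ->
  \int[mu]_(p in open_triangle t) f p = \int[mu]_(p in open_triangle t) g p.
Proof.
move=> mf mg fg; congr fine; apply: (@ae_eq_integral _ (plane R) R mu (open_triangle t) _ _ (measurable_open_triangle t)).
- by apply/measurable_EFinP; exact: mf.
- by apply/measurable_EFinP; exact: mg.
- by apply: plane_aeS fg => p h tp; rewrite h.
Qed.

Lemma continuous_tri_int (t : tri S) (f : R * R -> R) : continuous f ->
  mu.-integrable (open_triangle t) (EFin \o f).
Proof. exact: (@continuous_tri_integrable R (corner S t) (jac_corner t) f). Qed.

Lemma tri_intD (t : tri S) (f g : R * R -> R) : continuous f -> continuous g ->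
  \int[mu]_(p in open_triangle t) (f p + g p) =
  \int[mu]_(p in open_triangle t) f p + \int[mu]_(p in open_triangle t) g p.
Proof.
move=> cf cg; exact: (@RintegralD _ (plane R) R mu _ f g (measurable_open_triangle t)
  (continuous_tri_int t cf) (continuous_tri_int t cg)).
Qed.

Lemma tri_intZ (t : tri S) a (f : R * R -> R) : continuous f ->
  \int[mu]_(p in open_triangle t) (a * f p) = a * \int[mu]_(p in open_triangle t) f p.
Proof.
move=> cf; exact: (@RintegralZl _ (plane R) R mu _ f a (measurable_open_triangle t)
  (continuous_tri_int t cf)).
Qed.

(** [q] is the square of the continuous function [Num.sqrt q], so its integral is a squared norm. *)
Lemma tri_int_eq0 (t : tri S) (q : R * R -> R) : continuous q ->
  (forall p, open_triangle t p -> 0 <= q p) -> \int[mu]_(p in open_triangle t) q p = 0 ->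
  {ae mu, forall p, open_triangle t p -> q p = 0}.
Proof.
move=> cq q0 I0; pose f p := Num.sqrt (q p).
have cf : continuous f.
  by move=> p; apply: (continuous_comp (g := Num.sqrt)); [exact: cq|exact: sqrt_continuous].
have Lf := @continuous_L2 R (corner S t) (jac_corner t) f cf.
have sf0 : sqint mu (open_triangle t) f = 0%E.
  rewrite (@sqint_fin _ (plane R) R mu (open_triangle t) f Lf) -[RHS]/(0%:E) -I0; congr (_%:E).
  by apply: eq_Rintegral => p; rewrite inE => tp; rewrite sqr_sqrtr// q0.
have := @sqint_eq0 _ (plane R) R mu _ (measurable_open_triangle t) f Lf.1 sf0.
by apply: plane_aeS => p h tp; rewrite -(sqr_sqrtr (q0 p tp)) -/(f p) h// expr0n.
Qed.

Lemma metric_forms : exists w : tri S -> 'I_2 -> 'I_2 -> R * R -> R,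
  (forall t i j, continuous (w t i j)) /\
  forall t p, triangle t p -> forall x y,
    bilin x (invmx (gh t p)) y * density gh t p = \sum_i \sum_j x 0 i * y 0 j * w t i j p.
Proof.
pose w t := sval (cid (metric_form gh_metric t)).
exists w; split=> t; first exact: (svalP (cid (metric_form gh_metric t))).1.
exact: (svalP (cid (metric_form gh_metric t))).2.
Qed.

Lemma form_innerE (w : tri S -> 'I_2 -> 'I_2 -> R * R -> R) alpha beta :
  (forall t p, triangle t p -> forall x y,
    bilin x (invmx (gh t p)) y * density gh t p = \sum_i \sum_j x 0 i * y 0 j * w t i j p) ->
  form_inner gh alpha beta = \sum_t \int[mu]_(p in open_triangle t)
    (\sum_i \sum_j alpha t p 0 i * beta t p 0 j * w t i j p).
Proof.
move=> H; apply: eq_bigr => t _; rewrite /tri_int; apply: eq_Rintegral => p; rewrite inE => tp.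
by rewrite H//; exact: (@open_tri_sub R (corner S t)).
Qed.

Lemma form_inner_ae alpha beta beta' : measurable_form alpha -> measurable_form beta ->
  measurable_form beta' ->
  (forall t j, {ae mu, forall p, open_triangle t p -> beta t p 0 j = beta' t p 0 j}) ->
  form_inner gh alpha beta = form_inner gh alpha beta'.
Proof.
move=> ma mb mb' bb; have [w [cw wE]] := metric_forms; rewrite !(form_innerE _ _ wE).
have mw t i j : measurable_fun (open_triangle t) (w t i j).
  by apply: continuous_measurable_prod; [exact: measurable_open_triangle|exact: cw].
have mB b : measurable_form b -> forall t, measurable_fun (open_triangle t)
    (fun p => \sum_i \sum_j alpha t p 0 i * b t p 0 j * w t i j p).
  move=> mb0 t; rewrite (_ : (fun p => _) = fun p =>
    (alpha t p 0 0 * b t p 0 0 * w t 0 0 p + alpha t p 0 0 * b t p 0 1 * w t 0 1 p) +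
    (alpha t p 0 1 * b t p 0 0 * w t 1 0 p + alpha t p 0 1 * b t p 0 1 * w t 1 1 p)); last first.
    by apply/funext => p; rewrite !sum2.
  have mm i j : measurable_fun (open_triangle t) (fun p => alpha t p 0 i * b t p 0 j * w t i j p).
    by apply: measurable_funM; [apply: measurable_funM; [exact: ma|exact: mb0]|exact: mw].
  by apply: measurable_funD; apply: measurable_funD; exact: mm.
apply: eq_bigr => t _; apply: Rintegral_ae_eq; [exact: mB|exact: mB|].
by apply: plane_aeS2 (bb t 0) (bb t 1) => p h0 h1 tp; rewrite !sum2 h0// h1.
Qed.

Let I := (tri S * 'I_2 * ('I_r.+2 * 'I_r.+2))%type.
Let coefF (c : I -> R) (t : tri S) (j : 'I_2) := polyc (fun k => c (t, j, k)).

(** Riesz representation on the coefficients of the components. The second hypothesis makes the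
    functional compatible with equality almost everywhere, elements of W_h being representatives. *)
Lemma form_riesz (l : form_field S -> R) :
  (forall a alpha beta, Wh_space r alpha -> Wh_space r beta ->
    l (fun t p => a *: alpha t p + beta t p) = a * l alpha + l beta) ->
  (forall alpha, Wh_space r alpha -> ae_form alpha (fun _ _ _ => 0) -> l alpha = 0) ->
  exists alpha, Wh_space r alpha /\ forall beta, Wh_space r beta -> form_inner gh alpha beta = l beta.
Proof.
move=> lL l0; have [w [cw wE]] := metric_forms.
have pc c t j : is_poly r.+2 (coefF c t j) by exact: is_poly_polyc.
have cc c t j : continuous (coefF c t j) := (is_poly_C1 (pc c t j)).1.1.
have FL a c d : coefF (fun i => a * c i + d i) = fun t j p => a * coefF c t j p + coefF d t j p.
  by apply/funext => t; apply/funext => j; apply/funext => p; rewrite /coefF polycL.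
have formL a c d : form_of (coefF (fun i => a * c i + d i)) =
    fun t p => a *: form_of (coefF c) t p + form_of (coefF d) t p.
  by apply/funext => t; apply/funext => p; apply/matrixP => i j; rewrite FL !mxE.
pose B c d := form_inner gh (form_of (coefF c)) (form_of (coefF d)).
have BE c d : B c d = \sum_t \int[mu]_(p in open_triangle t)
    (\sum_i \sum_j coefF c t i p * coefF d t j p * w t i j p).
  rewrite /B (form_innerE _ _ wE); apply: eq_bigr => t _; apply: eq_Rintegral => p _.
  by apply: eq_bigr => i _; apply: eq_bigr => j _; rewrite !mxE.
have cB c d t : continuous (fun p => \sum_i \sum_j coefF c t i p * coefF d t j p * w t i j p).
  move=> p; rewrite (_ : (fun p => _) = fun p =>
    (coefF c t 0 p * coefF d t 0 p * w t 0 0 p + coefF c t 0 p * coefF d t 1 p * w t 0 1 p) +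
    (coefF c t 1 p * coefF d t 0 p * w t 1 0 p + coefF c t 1 p * coefF d t 1 p * w t 1 1 p)); last first.
    by apply/funext => q; rewrite !sum2.
  have mm i j : {for p, continuous (fun p => coefF c t i p * coefF d t j p * w t i j p)}.
    by apply: cvgM; [apply: cvgM; [exact: cc|exact: cc]|exact: cw].
  by apply: cvgD; apply: cvgD; exact: mm.
have [] := @riesz R I (fun c => poly_form r (coefF c)) B (fun c => l (form_of (coefF c))).
- move=> a c c' d; rewrite !BE big_distrr -big_split; apply: eq_bigr => t _ /=.
  rewrite -tri_intZ; last exact: cB.
  rewrite -tri_intD; last 2 first.
  + by move=> p; apply: cvgM; [exact: cvg_cst|exact: cB].
  + exact: cB.
  by apply: eq_Rintegral => p _; rewrite FL !sum2; ring.
- move=> a c d d'; rewrite !BE big_distrr -big_split; apply: eq_bigr => t _ /=.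
  rewrite -tri_intZ; last exact: cB.
  rewrite -tri_intD; last 2 first.
  + by move=> p; apply: cvgM; [exact: cvg_cst|exact: cB].
  + exact: cB.
  by apply: eq_Rintegral => p _; rewrite FL !sum2; ring.
- rewrite (_ : coefF _ = fun _ _ _ => 0); first exact: poly_form0.
  apply/funext => t; apply/funext => j; apply/funext => p.
  by rewrite /coefF /polyc big1// => i _; rewrite big1// => k _; rewrite !mul0r.
- by move=> a c d pc' pd; rewrite FL; exact: poly_formL.
- by move=> a c d pc' pd; rewrite formL lL//; exact: Wh_form_of.
- move=> c pF; rewrite BE => B0; apply: l0; first exact: Wh_form_of.
  have q0 t p : triangle t p -> 0 <= \sum_i \sum_j coefF c t i p * coefF c t j p * w t i j p /\
      (\sum_i \sum_j coefF c t i p * coefF c t j p * w t i j p = 0 -> forall j, coefF c t j p = 0).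
    move=> tp; have := wE t p tp (form_of (coefF c) t p) (form_of (coefF c) t p).
    rewrite !sum2 !mxE => <-.
    have [_ _ D0 pd] := metric_posdef gh_metric tp.
    have d0 : 0 < density gh t p by rewrite sqrtr_gt0.
    have [x0|x0] := eqVneq (form_of (coefF c) t p) 0.
      split; first by rewrite x0 /bilin !mul0mx !mxE mul0r.
      by move=> _ j; have /matrixP/(_ 0 j) := x0; rewrite !mxE.
    have h : 0 < bilin (form_of (coefF c) t p) (invmx (gh t p)) (form_of (coefF c) t p) * density gh t p.
      by rewrite mulr_gt0// pd.
    by split; [exact: ltW|move=> E; move: h; rewrite E ltxx].
  have I0 t : \int[mu]_(p in open_triangle t) (\sum_i \sum_j coefF c t i p * coefF c t j p * w t i j p) = 0.
    move/eqP: B0; rewrite psumr_eq0; last first.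
      move=> t' _; apply: Rintegral_ge0 => p tp; apply: (q0 t' p _).1.
      exact: (@open_tri_sub R (corner S t')).
    by move=> /allP/(_ t (mem_index_enum _)) /eqP.
  move=> t j.
  pose q p := \sum_i \sum_j coefF c t i p * coefF c t j p * w t i j p.
  have q0ae : {ae mu, forall p, open_triangle t p -> q p = 0}.
    by apply: tri_int_eq0; [exact: cB|move=> p tp; apply: (q0 t p _).1; exact: (@open_tri_sub R (corner S t))|exact: I0].
  apply: plane_aeS q0ae => p h tp; rewrite mxE; apply: (q0 t p _).2; last exact: h.
  exact: (@open_tri_sub R (corner S t)).
move=> c pc' Bc; have Wc := Wh_form_of pc'.
exists (form_of (coefF c)); split => // beta Wb.
have mb := Wh_measurable Wb; have mc := Wh_measurable Wc.
have [F pF bF] := Wh_poly Wb.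
have pF' t j : is_poly r.+2 (F t j) by case: pF.
pose d : I -> R := fun i => sval (cid (is_polyP (pF' i.1.1 i.1.2))) i.2.
have dF : coefF d = F.
  apply/funext => t; apply/funext => j; rewrite [RHS](svalP (cid (is_polyP (pF' t j)))).
  by congr polyc; apply/funext.
have WF := Wh_form_of pF.
have mF := Wh_measurable WF.
rewrite (form_inner_ae mc mb mF); last first.
  by move=> t j; apply: plane_aeS (bF t j) => p h tp; rewrite mxE h.
rewrite -dF; rewrite -dF in pF WF.
rewrite -/(B c d) Bc//.
(* [beta] and its polynomial representative differ by a form that is zero almost everywhere, on
   which [l] vanishes. *)
have WD := Wh_L (-1) WF Wb.
have := l0 _ WD; rewrite lL// => h; apply/eqP; rewrite eq_sym -subr_eq0 addrC -mulN1r; apply/eqP; apply: h.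
by move=> t j; apply: plane_aeS (bF t j) => p h tp; rewrite !mxE dF h//; ring.
Qed.
End FormInner.

Section DivProjection.
Context (R : realType) (S : triangulation R) (r : nat) (gh : tens_field S).
Hypothesis gh_metric : regge_metric gh.
Notation mu := (plane_measure R).

(** Hence a bounded functional vanishes on forms that are zero almost everywhere, as [form_riesz]
    requires. *)
Lemma W_norm_ae0 (alpha : form_field S) : measurable_form alpha ->
  ae_form alpha (fun _ _ _ => 0) -> W_norm alpha = 0.
Proof.
move=> ma a0; rewrite /W_norm big1 ?sqrtr0// => t _; rewrite big1// => j _.
have sq0 (f : R * R -> R) : measurable_fun (open_triangle t) f -> {ae mu, forall p, open_triangle t p -> f p = 0} ->
    \int[mu]_(p in open_triangle t) (f p ^+ 2) = 0.
  move=> mf f0; rewrite (Rintegral_ae_eq (g := fun=> 0)).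
  - by rewrite /Rintegral integral0.
  - by apply: measurable_funX; exact: mf.
  - exact: measurable_cst.
  - by apply: plane_aeS f0 => p h tp; rewrite h// expr0n.
have W i := @weak_pderiv_poly R S t i _ _ _ (ma t j) (is_poly_cst0 R 0) (a0 t j).
rewrite (sq0 _ (ma t j) (a0 t j)) add0r big1// => i _; apply: sq0; first exact: (W i).1.
apply: plane_aeS (W i).2 => p h tp; rewrite h//; exact: (C1_cst (0 : R)).2.
Qed.

Lemma pi_W_spec (l : form_field S -> R) : W_dual l ->
  Wh_space r (pi_W r gh l) /\ forall beta, Wh_space r beta -> form_inner gh (pi_W r gh l) beta = l beta.
Proof.
move=> [lL [C lC]].
have [||alpha [Wa Ha]] := @form_riesz R S r gh gh_metric l.
- by move=> a alpha beta [Wa _ _] [Wb _ _]; exact: lL.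
- move=> alpha Wa a0; have := lC alpha; case: (Wa) => Wa' _ _ /(_ Wa').
  by rewrite (W_norm_ae0 (Wh_measurable Wa) a0) mulr0 normr_le0 => /eqP.
rewrite /pi_W; case: xgetP => [x _ //|/(_ alpha)]; by case.
Qed.

Lemma div_h_pi_W (l : form_field S -> R) : W_dual l -> div_h r gh (pi_W r gh l) = pi_V r gh (div_dist l).
Proof.
move=> /pi_W_spec[_ H]; rewrite /div_h /pi_V; congr get; apply/seteqP; split=> w [Vw Hw]; split => // v Vv.
- by rewrite Hw// H//; exact: (ext_d_Wh Vv).1.
- by rewrite Hw// /div_dist H//; exact: (ext_d_Wh Vv).1.
Qed.
End DivProjection.

(** * Weighted projections onto polynomials *)

Section SegmentProj.
Context (R : realType).
Notation leb := (@lebesgue_measure R).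

(** The factor ['X * (1 - 'X)] supplies the zeros at the endpoints. *)
Lemma poly_open_segment0 (q : {poly R}) : (forall s, 0 < s < 1 -> q.[s] = 0) -> q = 0.
Proof.
move=> h; have : 'X * (1 - 'X) * q = 0.
  apply: poly_segment0 => s; rewrite in_itv/= !le_eqVlt => /andP[/orP[/eqP<-|s0] /orP[/eqP s1|s1]];
  rewrite !hornerE ?s1 ?subrr ?mulr0 ?mul0r//.
  by rewrite h ?s0// mulr0.
move/eqP; rewrite !mulf_eq0 polyX_eq0/= => /orP[/eqP X1|/eqP//].
have := congr1 (fun q : {poly R} => q.[0]) X1; rewrite !hornerE subr0 => /eqP.
by rewrite oner_eq0.
Qed.

Lemma segment_int_eq0 (q : R -> R) : continuous q ->
  (forall s, s \in (`[0, 1] : interval R) -> 0 <= q s) -> \int[leb]_(s in `[0, 1]) q s = 0 ->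
  forall s, s \in (`[0, 1] : interval R) -> q s = 0.
Proof.
move=> cq q0 I0; pose f p := Num.sqrt (q p).
have cf : continuous f.
  by move=> p; apply: (continuous_comp (g := Num.sqrt)); [exact: cq|exact: sqrt_continuous].
have Lf := continuous_L2_segment cf.
have sf0 : sqint leb `[0, 1] f = 0%E.
  rewrite (@sqint_fin _ _ R leb _ f Lf); congr (_%:E); rewrite -[RHS]I0.
  by apply: eq_Rintegral => p; rewrite inE => tp; rewrite sqr_sqrtr// q0.
have f0 := @sqint_eq0 _ _ R leb _ (@segI R) f Lf.1 sf0.
have := segment_ae_eq cf (@cst_continuous _ _ (0 : R)) f0.
by move=> h s s01; rewrite -(sqr_sqrtr (q0 s s01)) -/(f s) h// expr0n.
Qed.

Variables (n : nat) (om : R -> R).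
Hypothesis c_om : continuous om.
Hypothesis om_ge0 : forall s, s \in (`[0, 1] : interval R) -> 0 <= om s.
Hypothesis om_gt0 : forall s : R, 0 < s < 1 -> 0 < om s.

Lemma segment_weight_eq0 (p : {poly R}) : \int[leb]_(s in `[0, 1]) (om s * p.[s] * p.[s]) = 0 -> p = 0.
Proof.
move=> I0; apply: poly_open_segment0 => s s01.
have ch : continuous (fun s => om s * p.[s] * p.[s]).
  move=> x; apply: cvgM; last exact: continuous_horner.
  by apply: cvgM; [exact: c_om|exact: continuous_horner].
have := segment_int_eq0 ch _ I0.
have h0 : forall s, s \in (`[0, 1] : interval R) -> 0 <= om s * p.[s] * p.[s].
  by move=> x x01; rewrite -mulrA mulr_ge0 ?om_ge0// -expr2 sqr_ge0.
move=> /(_ h0 s); rewrite in_itv/=; have /andP[s0 s1] := s01; rewrite !ltW// => /(_ isT) /eqP.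
by rewrite -mulrA mulf_eq0 gt_eqF ?om_gt0//= -expr2 sqrf_eq0 => /eqP.
Qed.

Lemma L2_poly_integrable (w : R -> R) (v : R -> R) : L2 leb `[0, 1] w -> continuous v ->
  leb.-integrable `[0, 1] (EFin \o (fun s => w s * v s)).
Proof. by move=> Lw cv; apply: L2M_integrable; [exact: segI|exact: Lw|exact: continuous_L2_segment]. Qed.

(** The weight multiplies only the unknown. With [om = 1] this is the orthogonal projection; with
    [om] equal to s (1 - s), [om * p] is a correction that vanishes at both ends. *)
Lemma segment_proj (w : R -> R) : L2 leb `[0, 1] w ->
  exists2 p : {poly R}, (size p <= n)%N & forall v : {poly R}, (size v <= n)%N ->
    \int[leb]_(s in `[0, 1]) (om s * p.[s] * v.[s]) = \int[leb]_(s in `[0, 1]) (w s * v.[s]).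
Proof.
move=> Lw; pose P (c : 'I_n -> R) : {poly R} := \sum_i c i *: 'X^i.
have PL a c d : P (fun i => a * c i + d i) = a *: P c + P d.
  by rewrite /P scaler_sumr -big_split; apply: eq_bigr => i _; rewrite /= scalerDl scalerA.
have szP c : (size (P c) <= n)%N.
  apply: (leq_trans (size_sum _ _ _)); apply/bigmax_leqP => i _.
  by rewrite (leq_trans (size_scale_leq _ _))// size_polyXn.
have PP (v : {poly R}) : (size v <= n)%N -> v = P (fun i => v`_i).
  move=> sv; rewrite /P -(poly_def n (fun i => v`_i)); apply/polyP => i; rewrite coef_poly.
  by case: ltnP => // ni; rewrite nth_default// (leq_trans sv).
have c3 (p v : {poly R}) : continuous (fun s => om s * p.[s] * v.[s]).
  move=> x; apply: cvgM; last exact: continuous_horner.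
  by apply: cvgM; [exact: c_om|exact: continuous_horner].
have [] := @riesz R 'I_n setT
  (fun c d => \int[leb]_(s in `[0, 1]) (om s * (P c).[s] * (P d).[s]))
  (fun c => \int[leb]_(s in `[0, 1]) (w s * (P c).[s])).
- move=> a c c' d; rewrite -segment_intZ; last exact: c3.
  rewrite -segment_intD; [|by move=> x; apply: cvgM; [exact: cvg_cst|exact: c3]|exact: c3].
  by apply: eq_Rintegral => s _; rewrite PL hornerD hornerZ; ring.
- move=> a c d d'; rewrite -segment_intZ; last exact: c3.
  rewrite -segment_intD; [|by move=> x; apply: cvgM; [exact: cvg_cst|exact: c3]|exact: c3].
  by apply: eq_Rintegral => s _; rewrite PL hornerD hornerZ; ring.
- by [].
- by [].
- move=> a c d _ _.
  have iw c' := L2_poly_integrable Lw (@continuous_horner R (P c')).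
  rewrite -(@RintegralZl _ _ R leb _ _ a (@segI R) (iw c)).
  rewrite -(@RintegralD _ _ R leb _ _ _ (@segI R) _ (iw d)).
    by apply: eq_Rintegral => s _; rewrite PL hornerD hornerZ; ring.
  exact: (@integrableZl _ _ R leb _ (@segI R) a _ (iw c)).
- move=> c _ /segment_weight_eq0 ->; rewrite (_ : (fun s => _) = fun=> 0); first by rewrite /Rintegral integral0.
  by apply/funext => s; rewrite horner0 mulr0.
move=> c _ H; exists (P c) => // v sv; rewrite (PP v sv); exact: H.
Qed.
End SegmentProj.

Section TriProj.
Context (R : realType) (S : triangulation R) (t : tri S).
Notation mu := (plane_measure R).
Variables (n : nat) (om : R * R -> R).
Hypothesis c_om : continuous om.
Hypothesis om_gt0 : forall p, open_triangle t p -> 0 < om p.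

Lemma poly_continuous m (f : R * R -> R) : is_poly m f -> continuous f.
Proof. by move=> pf; exact: (is_poly_C1 pf).1.1. Qed.

Lemma L2_tri_integrable (f v : R * R -> R) : L2 mu (open_triangle t) f -> continuous v ->
  mu.-integrable (open_triangle t) (EFin \o (fun p => f p * v p)).
Proof.
move=> Lf cv; apply: (@L2M_integrable _ (plane R) R mu _ (measurable_open_triangle t)) => //.
exact: (@continuous_L2 R (corner S t) (jac_corner t) v cv).
Qed.

Lemma tri_weight_eq0 m (b : R * R -> R) : is_poly m b ->
  \int[mu]_(p in open_triangle t) (om p * b p * b p) = 0 -> forall p, triangle t p -> b p = 0.
Proof.
move=> pb I0; have cb := poly_continuous pb.
have ch : continuous (fun p => om p * b p * b p).
  by move=> x; apply: cvgM; [apply: cvgM; [exact: c_om|exact: cb]|exact: cb].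
have h0 p : open_triangle t p -> 0 <= om p * b p * b p.
  by move=> tp; rewrite -mulrA mulr_ge0 ?(ltW (om_gt0 tp))// -expr2 sqr_ge0.
have z : {ae mu, forall p, open_triangle t p -> b p = 0}.
  apply: plane_aeS (tri_int_eq0 ch h0 I0) => p h tp; apply/eqP; move/eqP: (h tp).
  by rewrite -mulrA mulf_eq0 gt_eqF ?om_gt0//= -expr2 sqrf_eq0.
apply: (@ae_tri_eq R (corner S t) (jac_corner t) b (fun=> 0) _ _ z); apply: continuous_subspaceT => //.
exact: cst_continuous.
Qed.

(** With a barycentric coordinate as weight the correction [om * b] vanishes on one side of the
    triangle, with the cubic bubble on all three. *)
Lemma tri_proj (f : R * R -> R) : L2 mu (open_triangle t) f ->
  exists2 b, is_poly n b & forall v, is_poly n v ->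
    \int[mu]_(p in open_triangle t) (om p * b p * v p) =
    \int[mu]_(p in open_triangle t) (f p * v p).
Proof.
move=> Lf.
have cP (c : 'I_n * 'I_n -> R) : continuous (polyc c) := poly_continuous (is_poly_polyc c).
have c3 (c d : 'I_n * 'I_n -> R) : continuous (fun p => om p * polyc c p * polyc d p).
  by move=> x; apply: cvgM; [apply: cvgM; [exact: c_om|exact: cP]|exact: cP].
have [] := @riesz R ('I_n * 'I_n)%type setT
  (fun c d => \int[mu]_(p in open_triangle t) (om p * polyc c p * polyc d p))
  (fun c => \int[mu]_(p in open_triangle t) (f p * polyc c p)).
- move=> a c c' d; rewrite -tri_intZ; last exact: c3.
  rewrite -tri_intD; [|by move=> x; apply: cvgM; [exact: cvg_cst|exact: c3]|exact: c3].
  by apply: eq_Rintegral => p _; rewrite polycL; ring.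
- move=> a c d d'; rewrite -tri_intZ; last exact: c3.
  rewrite -tri_intD; [|by move=> x; apply: cvgM; [exact: cvg_cst|exact: c3]|exact: c3].
  by apply: eq_Rintegral => p _; rewrite polycL; ring.
- by [].
- by [].
- move=> a c d _ _; have mT := measurable_open_triangle t.
  have iw c' := L2_tri_integrable Lf (cP c').
  rewrite -(@RintegralZl _ (plane R) R mu _ _ a mT (iw c)).
  rewrite -(@RintegralD _ (plane R) R mu _ _ _ mT _ (iw d)).
    by apply: eq_Rintegral => p _; rewrite polycL; ring.
  exact: (@integrableZl _ (plane R) R mu _ mT a _ (iw c)).
- move=> c _ /(tri_weight_eq0 (is_poly_polyc c)) c0.
  rewrite (@eq_Rintegral _ (plane R) R mu _ (fun=> 0)); first by rewrite /Rintegral integral0.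
  by move=> p; rewrite inE => tp; rewrite c0 ?mulr0//; exact: (@open_tri_sub R (corner S t)).
move=> c _ H; exists (polyc c); first exact: is_poly_polyc.
by move=> v /is_polyP[d ->]; exact: H.
Qed.
End TriProj.

(** * The projection onto tensors *)

Section SideTensors.
Context (R : realType) (S : triangulation R).

(** Minus the symmetrized product of the differentials of the barycentric coordinates [k + 1] and
    [k + 2]. These take the values -1 and 1 on the edge vector k, and on any other edge vector one
    of them vanishes. *)
Definition dual_tensor (t : tri S) (k : 'I_3) : 'M[R]_2 :=
  \matrix_(i, j) (- 2^-1 * (dlam (corner S t) (k + 1) (unit_vec R i) * dlam (corner S t) (k + 2) (unit_vec R j)
    + dlam (corner S t) (k + 2) (unit_vec R i) * dlam (corner S t) (k + 1) (unit_vec R j))).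

Definition side_comp (t : tri S) (k : 'I_3) (A : 'M[R]_2) : R :=
  bilin (side_vec ((t, k) : side S)) A (side_vec ((t, k) : side S)).

Lemma side_compE t k A : side_comp t k A = \sum_i \sum_j side_vec ((t, k) : side S) 0 i * side_vec ((t, k) : side S) 0 j * A i j.
Proof. by rewrite /side_comp bilinE. Qed.

Lemma dlam_unit (c : 'I_3 -> R * R) k i :
  dlam c k (unit_vec R i) = (if i == 0 then - (edge c k).2 else (edge c k).1) / jac c.
Proof. by rewrite /dlam /cross /unit_vec; elim/ord2P: i => /=; rewrite !mulr1n !mulr0n; congr (_ / _); ring. Qed.

Lemma edge_jac (c : 'I_3 -> R * R) : edge c 0 = - (edge c 1 + edge c 2) /\
  jac c = (edge c 1).1 * (edge c 2).2 - (edge c 1).2 * (edge c 2).1.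
Proof.
rewrite /edge /jac /cross ?ord3D; split; first by apply: pair_eqP; rewrite !pairE; ring.
by rewrite !pairE; ring.
Qed.

Lemma side_comp_dual t k l : side_comp t l (dual_tensor t k) = (k == l)%:R.
Proof.
have [e0 eJ] := edge_jac (corner S t); have := gt_eqF (jac_corner t); rewrite eJ => J0.
rewrite side_compE !sum2 !side_vecE !mxE !dlam_unit eJ {eJ}.
move: (edge (corner S t)) e0 J0 => e e0 J0.
elim/ord3P: k; elim/ord3P: l; rewrite /= ?ord3D ?eqxx ?ord3_neq ?mulr1n ?mulr0n ?e0 ?pairE;
move: (e 1).1 (e 1).2 (e 2).1 (e 2).2 J0 => a b c d J0;
by field; rewrite J0.
Qed.

(* The values sigma(x_k, x_k) on the three edge vectors x_k are coordinates on
   the symmetric tensors. *)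
Lemma sym_tensor_decomp t (A : 'M[R]_2) : A^T = A -> A = \sum_k side_comp t k A *: dual_tensor t k.
Proof.
move=> sA; have s10 : A 1 0 = A 0 1 by rewrite -[in LHS]sA mxE.
have [e0 eJ] := edge_jac (corner S t); have := gt_eqF (jac_corner t); rewrite eJ => J0.
apply/matrixP => i j; rewrite sum3 !mxE !side_compE !sum2 !side_vecE !dlam_unit eJ ?ord3D {eJ}.
rewrite s10; move: (edge (corner S t)) e0 J0 => e e0 J0.
elim/ord2P: i; elim/ord2P: j; rewrite /= ?s10 ?e0 ?pairE;
move: (A 0 0) (A 0 1) (A 1 1) (e 1).1 (e 1).2 (e 2).1 (e 2).2 J0 => x y z a b c d J0;
by field; rewrite J0.
Qed.

Lemma side_comp_lin t k a A B : side_comp t k (a *: A + B) = a * side_comp t k A + side_comp t k B.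
Proof. by rewrite !side_compE !sum2 !mxE; ring. Qed.

Lemma side_comp_sum t k (q : 'I_3 -> R) : side_comp t k (\sum_l q l *: dual_tensor t l) = q k.
Proof.
rewrite sum3 -[_ + _ *: dual_tensor t 2]addrC side_comp_lin -[q 0 *: _ + _]/(_) side_comp_lin.
have -> : q 1 *: dual_tensor t 1 = q 1 *: dual_tensor t 1 + 0 by rewrite addr0.
rewrite side_comp_lin !side_comp_dual (_ : side_comp t k 0 = 0); last first.
  by rewrite side_compE !sum2 !mxE; ring.
by elim/ord3P: k; rewrite ?eqxx ?ord3_neq /= ?mulr1n ?mulr0n; ring.
Qed.

Lemma dual_tensor_sym t k : (dual_tensor t k)^T = dual_tensor t k.
Proof. by apply/matrixP => i j; rewrite !mxE; congr (_ * _); ring. Qed.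
End SideTensors.

Section PolyTensors.
Context (R : realType) (S : triangulation R).
Notation mu := (plane_measure R).
Notation leb := (@lebesgue_measure R).
Implicit Types (sigma : tens_field S).

Lemma sobolev_L2 k (t : tri S) u : sobolev k (open_triangle t) u -> L2 mu (open_triangle t) u.
Proof.
move=> [f [D [<- sf /(_ [::] isT)[mD cD]]]].
apply: (@cvL2P _ (plane R) R mu _ (measurable_open_triangle t) f (D [::]) _ mD cD).1 => n.
exact: (@continuous_L2 R (corner S t) (jac_corner t) (f n) (smooth_C1 (sf n)).1).
Qed.

Definition tens_poly_trace (F : tri S -> 'I_2 -> 'I_2 -> R * R -> R) (h : side S) (x y : 'rV[R]_2) (s : R) : R :=
  \sum_i \sum_j F h.1 i j (side_point h s) * x 0 i * y 0 j.

Lemma tens_trace_poly n F sigma (h : side S) : (forall t i j, is_poly n (F t i j)) ->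
  (forall t i j, measurable_fun (open_triangle t) (fun p => sigma t p i j)) ->
  (forall t i j, {ae mu, forall p, open_triangle t p -> sigma t p i j = F t i j p}) ->
  {ae leb, forall s, `[0, 1]%classic s -> forall x y, tens_trace sigma h x y s = tens_poly_trace F h x y s}.
Proof.
move=> pF ms sF.
have E i j : {ae leb, forall s, `[0, 1]%classic s ->
    edge_trace h (fun p => sigma h.1 p i j) s = F h.1 i j (side_point h s)}.
  exact: edge_trace_poly (ms _ _ _) (pF _ _ _) (sF _ _ _).
have E0 := leb_aeS2 (fun s a b => conj a b) (E 0 0) (E 0 1).
have E1 := leb_aeS2 (fun s a b => conj a b) (E 1 0) (E 1 1).
apply: leb_aeS2 E0 E1 => s [h00 h01] [h10 h11] s01 x y.
by rewrite /tens_trace /tens_poly_trace !sum2 h00// h01// h10// h11.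
Qed.

Lemma tens_trace_L2 sigma (h : side S) x y : L2 leb `[0, 1] (tens_trace sigma h x y).
Proof.
rewrite (_ : tens_trace _ _ _ _ = fun s =>
  (x 0 0 * y 0 0 * edge_trace h (fun p => sigma h.1 p 0 0) s + x 0 0 * y 0 1 * edge_trace h (fun p => sigma h.1 p 0 1) s) +
  (x 0 1 * y 0 0 * edge_trace h (fun p => sigma h.1 p 1 0) s + x 0 1 * y 0 1 * edge_trace h (fun p => sigma h.1 p 1 1) s)).
  have L i j a := L2Z (@segI R) a (edge_trace_L2 h (fun p => sigma h.1 p i j)).
  exact: (L2D (@segI R) (L2D (@segI R) (L 0 0 _) (L 0 1 _)) (L2D (@segI R) (L 1 0 _) (L 1 1 _))).
apply/funext => s; rewrite /tens_trace !sum2.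
move: (edge_trace h _ s) (edge_trace h _ s) (edge_trace h _ s) (edge_trace h _ s) => a b c d.
move: (x 0 0) (x 0 1) (y 0 0) (y 0 1) => x0 x1 y0 y1; ring.
Qed.

Lemma tens_traceZ sigma (h : side S) a x s :
  tens_trace sigma h (a *: x) (a *: x) s = a ^+ 2 * tens_trace sigma h x x s.
Proof.
rewrite /tens_trace !sum2 !mxE.
move: (edge_trace h _ s) (edge_trace h _ s) (edge_trace h _ s) (edge_trace h _ s) (x 0 0) (x 0 1) => e f c d x0 x1.
ring.
Qed.

Lemma Sigma_comp_L2 sigma t i j : Sigma_space sigma -> L2 mu (open_triangle t) (fun p => sigma t p i j).
Proof. by move=> [h _ _]; exact: sobolev_L2 (h t i j). Qed.

Lemma side_comp_L2 sigma t k : (forall i j, L2 mu (open_triangle t) (fun p => sigma t p i j)) ->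
  L2 mu (open_triangle t) (fun p => side_comp t k (sigma t p)).
Proof.
move=> L; set x := side_vec ((t, k) : side S).
rewrite (_ : (fun p => _) = fun p =>
  (x 0 0 * x 0 0 * sigma t p 0 0 + x 0 0 * x 0 1 * sigma t p 0 1) +
  (x 0 1 * x 0 0 * sigma t p 1 0 + x 0 1 * x 0 1 * sigma t p 1 1)); last first.
  by apply/funext => s; rewrite side_compE !sum2.
have mT := measurable_open_triangle t.
have LZ i j a := @L2Z _ (plane R) R mu _ mT a _ (L i j).
have LD f g := @L2D _ (plane R) R mu _ mT f g.
exact: (LD _ _ (LD _ _ (LZ 0 0 _) (LZ 0 1 _)) (LD _ _ (LZ 1 0 _) (LZ 1 1 _))).
Qed.
End PolyTensors.

Section Edges.
Context (R : realType) (S : triangulation R).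
Implicit Types h : side S.

Lemma twin_sym h h' : twin h h' = twin h' h.
Proof. by rewrite /twin andbC ![vtx S h'.1 _ == _]eq_sym. Qed.

Lemma twin_uniq h h1 h2 : twin h h1 -> twin h h2 -> h1 = h2.
Proof.
case: S h h1 h2 => ve tr vt co H1 H2 H3 H4 H5 H6 h h1 h2; rewrite /twin/=.
move=> /andP[/eqP a1 /eqP b1] /andP[/eqP a2 /eqP b2].
by apply: (H4 h1 h2); rewrite -a1 -a2 -b1 -b2.
Qed.

Lemma twin_irrefl h : twin h h = false.
Proof.
case: S h => ve tr vt co H1 H2 H3 H4 H5 H6 h; rewrite /twin/=; apply/negbTE/negP => /andP[/eqP/H1 + _].
by case: (h) => t k /=; elim/ord3P: k; rewrite ?ord3D => /eqP; rewrite ord3_neq.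
Qed.

Lemma twin_edges h h' : twin h h' -> (h' \in edges S) = (h \notin edges S).
Proof.
move=> hh'.
have E k k' : twin k k' -> (k \in edges S) = (enum_rank k < enum_rank k')%N.
  move=> kk'; rewrite inE; apply/forallP/idP => [/(_ k')|lt h2]; first by rewrite kk'.
  by apply/implyP => /(twin_uniq kk') <-.
rewrite (E _ _ hh') (E h' h) 1?twin_sym// -leqNgt [in RHS]leq_eqVlt.
suff -> : (enum_rank h' == enum_rank h :> nat) = false by [].
apply/negbTE/eqP => /val_inj/enum_rank_inj e; by move: hh'; rewrite e twin_irrefl.
Qed.

Lemma notin_edges h : h \notin edges S -> exists h', twin h h'.
Proof.
by rewrite inE negb_forall => /existsP[h']; rewrite negb_imply => /andP[hh' _]; exists h'.
Qed.
End Edges.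

Section PolyMore.
Context (R : realType).

Lemma is_poly_horner n (p : {poly R}) (g : R * R -> R) : (size p <= n)%N -> is_poly 2 g ->
  is_poly n (fun x => p.[g x]).
Proof.
move=> sp pg.
have pw i : is_poly i.+1 (fun x => g x ^+ i).
  elim: i => [|i IH]; first by apply: is_poly_ext (is_poly_cst 1 0) => x; rewrite expr0.
  by apply: is_poly_ext (is_polyM2 pg IH) => x; rewrite exprS.
apply: (@is_poly_ext _ _ (fun x => \sum_(i < n) p`_i * g x ^+ i)).
  by move=> x; rewrite (horner_coef_wide _ sp).
apply: is_poly_sum => i; apply: is_polyZ; apply: is_poly_le (pw i); exact: ltn_ord.
Qed.

Lemma is_poly_mulmx n (L M : 'M[R]_2) (B : R * R -> 'M[R]_2) : (forall i j, is_poly n (fun p => B p i j)) ->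
  forall i j, is_poly n (fun p => (L *m B p *m M) i j).
Proof.
move=> pB i j.
apply: (@is_poly_ext _ _ (fun p => \sum_a \sum_b (M a j * L i b) * B p b a)).
  move=> p; rewrite !mxE; apply: eq_bigr => a _; rewrite mxE mulr_suml; apply: eq_bigr => b _; ring.
by apply: is_poly_sum => a; apply: is_poly_sum => b; exact: is_polyZ.
Qed.

(** All metric factors are moved to the second tensor, which leaves an entrywise pairing with
    [A]. *)
Lemma tens_dotE (G A B : 'M[R]_2) :
  tens_dot G A B = \sum_i \sum_j A i j * ((invmx G)^T *m B *m (invmx G)^T) i j.
Proof.
set K := invmx G; rewrite /tens_dot -/K -!mulmxA mxtrace_mulC.
rewrite /mxtrace; apply: eq_bigr => i _; rewrite -!mulmxA mxE; apply: eq_bigr => j _; congr (_ * _).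
have -> : K^T *m (B *m K^T) = (K *m (B^T *m K))^T by rewrite !trmx_mul trmxK mulmxA.
by rewrite [RHS]mxE.
Qed.
End PolyMore.

Section SigmaProjection.
Context (R : realType) (S : triangulation R) (r : nat).
Notation mu := (plane_measure R).
Notation leb := (@lebesgue_measure R).
Implicit Types (sigma sh : tens_field S).

Lemma segment_Rintegral_ae (f g : R -> R) : measurable_fun (`[0, 1]%classic : set (measurableTypeR R)) f ->
  measurable_fun (`[0, 1]%classic : set (measurableTypeR R)) g ->
  {ae leb, forall s, `[0, 1]%classic s -> f s = g s} ->
  \int[leb]_(s in `[0, 1]) f s = \int[leb]_(s in `[0, 1]) g s.
Proof.
move=> mf mg fg; congr fine; apply: (@ae_eq_integral _ _ R leb `[0, 1]%classic _ _ (@segI R)).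
- by apply/measurable_EFinP; exact: mf.
- by apply/measurable_EFinP; exact: mg.
- by apply: leb_aeS fg => p h tp; rewrite h.
Qed.

(** The moments in the definition of [pi_Sigma], expressed in the components on edge vectors and
    freed from the metric; [pi_Sigma_dofs] relates the two forms. *)
Definition sigma_dofs sigma sh :=
  (forall t k b, is_poly r b -> \int[mu]_(p in open_triangle t)
     ((side_comp t k (sh t p) - side_comp t k (sigma t p)) * b p) = 0) /\
  (forall h : side S, h \in edges S -> forall v : {poly R}, (size v <= r.+1)%N ->
     \int[leb]_(s in `[0, 1]) ((tens_trace sh h (side_vec h) (side_vec h) s -
        tens_trace sigma h (side_vec h) (side_vec h) s) * v.[s]) = 0).

Definition tens_of (q : tri S -> 'I_3 -> R * R -> R) : tens_field S :=
  fun t p => \sum_k q t k p *: dual_tensor t k.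

Lemma is_poly_tens_of q : (forall t k, is_poly r.+1 (q t k)) ->
  forall t i j, is_poly r.+1 (fun p => tens_of q t p i j).
Proof.
move=> pq t i j; apply: (@is_poly_ext _ _ (fun p => \sum_k dual_tensor t k i j * q t k p)).
  by move=> p; rewrite /tens_of summxE; apply: eq_bigr => k _; rewrite !mxE mulrC.
by apply: is_poly_sum => k; exact: is_polyZ.
Qed.

Lemma poly_Sigmah (F : tri S -> 'I_2 -> 'I_2 -> R * R -> R) sh :
  (forall t i j, measurable_fun (open_triangle t) (fun p => sh t p i j)) ->
  (forall t i j, is_poly r.+1 (F t i j)) ->
  (forall t i j, {ae mu, forall p, open_triangle t p -> sh t p i j = F t i j p}) ->
  (forall t, {ae mu, forall p, open_triangle t p -> (sh t p)^T = sh t p}) ->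
  (forall h h' : side S, twin h h' -> forall s, s \in (`[0, 1] : interval R) ->
     tens_poly_trace F h (side_vec h) (side_vec h) s =
     tens_poly_trace F h' (side_vec h') (side_vec h') (1 - s)) ->
  Sigmah_space r sh.
Proof.
move=> ms pF sF sym tw; split; last by move=> t i j; exists (F t i j).
split => //.
- by move=> t i j; exact: poly_sobolev (ms t i j) (pF t i j) (sF t i j).
- move=> h h' hh'; have tF h0 := tens_trace_poly h0 pF ms sF.
  apply: leb_aeS2 (tF h) (segment_ae_rev (tF h')) => s e1 e2 s01.
  by rewrite e1// e2// (tw h h').
Qed.

Lemma side_point_lam (h : side S) s : [/\ lam (corner S h.1) h.2 (side_point h s) = 0,
  lam (corner S h.1) (h.2 + 1) (side_point h s) = 1 - s & lam (corner S h.1) (h.2 + 2) (side_point h s) = s].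
Proof. exact: (@lam_side R (corner S h.1) (jac_corner h.1) h.2 s). Qed.

Lemma tens_poly_trace_of (q : tri S -> 'I_3 -> R * R -> R) (h : side S) s :
  tens_poly_trace (fun t i j p => tens_of q t p i j) h (side_vec h) (side_vec h) s =
  q h.1 h.2 (side_point h s).
Proof.
rewrite -(side_comp_sum h.1 h.2 (fun k => q h.1 k (side_point h s))) side_compE /tens_poly_trace.
by case: h => t k; rewrite !sum2; ring.
Qed.

(** Each component is built separately as g + lam_k b. Here g extends the projection of the edge
    values, and b adjusts the interior moments without changing the values on side k. *)
Lemma sigma_dofs_exist sigma : Sigma_space sigma ->
  exists sh, Sigmah_space r sh /\ sigma_dofs sigma sh.
Proof.
move=> Ss; have Ls t i j := Sigma_comp_L2 t i j Ss.
have Lc t k := side_comp_L2 k (Ls t).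
have Lt h := tens_trace_L2 sigma h (side_vec h) (side_vec h).
have one0 : forall s : R, s \in (`[0, 1] : interval R) -> 0 <= (1 : R) by [].
have one1 : forall s : R, 0 < s < 1 -> 0 < (1 : R) by [].
have c1 : continuous (fun _ : R => 1 : R) by exact: cst_continuous.
pose E h := segment_proj r.+1 c1 one0 one1 (Lt h).
pose Q h := s2val (cid2 (E h)).
have sQ h : (size (Q h) <= r.+1)%N := s2valP (cid2 (E h)).
have QE h := s2valP' (cid2 (E h)).
(* Twin sides must carry the same polynomial, hence that of the representative. *)
pose P h := if h \in edges S then Q h else
  if [pick h' | twin h h'] is Some h' then Q h' \Po (1 - 'X) else 0.
have szc (p : {poly R}) : (size (p \Po (1 - 'X)) <= size p)%N.
  by rewrite size_comp_poly2// -size_polyN opprB -[1]polyC1 size_XsubC.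
have sP h : (size (P h) <= r.+1)%N.
  rewrite /P; case: ifP => // _; case: pickP => [h' _|_]; last by rewrite size_poly0.
  by rewrite (leq_trans (szc _)).
have Ptw h h' : twin h h' -> forall s, (P h).[s] = (P h').[1 - s].
  have half k k' s : twin k k' -> k \in edges S -> (P k).[s] = (P k').[1 - s].
    move=> kk' ke; have k'e := twin_edges kk'; rewrite ke/= in k'e.
    rewrite /P ke k'e; case: pickP => [k2 k2t|/(_ k)]; last by rewrite twin_sym kk'.
    rewrite twin_sym in kk'; rewrite (twin_uniq kk' k2t) horner_comp !hornerE; congr (_.[_]); ring.
  move=> hh' s; have [he|he] := boolP (h \in edges S); first exact: half.
  rewrite (half h' h) 1?twin_sym// ?(twin_edges hh')//; congr (_.[_]); ring.
pose la t k : R * R -> R := lam (corner S t) k.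
have cla t k : continuous (la t k) by exact: (is_poly_C1 (is_poly_lam _ _)).1.1.
have la0 t k p : open_triangle t p -> 0 < la t k p.
  by move=> /(open_triP (jac_corner t)) /(_ k).
(* On side [k] the coordinate [la t (k + 2)] is the parameter of the side. *)
pose g t k p := (P (t, k)).[la t (k + 2) p].
have pg t k : is_poly r.+1 (g t k) by apply: is_poly_horner => //; exact: is_poly_lam.
have mT (t : tri S) : measurable (open_triangle t : set (plane R)) := measurable_open_triangle t.
have Lg t k : L2 mu (open_triangle t) (g t k).
  exact: (@continuous_L2 R (corner S t) (jac_corner t) (g t k) (poly_continuous (pg t k))).
have Lf t k : L2 mu (open_triangle t) (fun p => side_comp t k (sigma t p) - g t k p).
  exact: (@L2B _ (plane R) R mu _ (mT t) _ _ (Lc t k) (Lg t k)).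
pose B t k := tri_proj r (cla t k) (@la0 t k) (Lf t k).
pose b t k := s2val (cid2 (B t k)).
have pb t k : is_poly r (b t k) := s2valP (cid2 (B t k)).
have bE t k := s2valP' (cid2 (B t k)).
pose q t k p := g t k p + la t k p * b t k p.
have pq t k : is_poly r.+1 (q t k).
  by apply: is_polyD => //; apply: is_polyM2 => //; exact: is_poly_lam.
have tq h s : q h.1 h.2 (side_point h s) = (P h).[s].
  have [l0 _ l2] := side_point_lam h s.
  by rewrite /q /g /la l0 l2 mul0r addr0; case: (h).
have pS := is_poly_tens_of pq.
have mS t i j : measurable_fun (open_triangle t) (fun p => tens_of q t p i j) := poly_measurable (pS t i j).
have aS t i j : {ae mu, forall p, open_triangle t p -> tens_of q t p i j = tens_of q t p i j} by exact: aeW.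
exists (tens_of q); split; last split.
- apply: (poly_Sigmah mS pS aS).
    move=> t; apply: aeW => p _; apply/matrixP => i j; rewrite mxE /tens_of !summxE.
    by apply: eq_bigr => k _; rewrite ![in LHS]mxE -[in RHS]dual_tensor_sym ![in RHS]mxE.
  by move=> h h' hh' s _; rewrite !tens_poly_trace_of !tq; exact: Ptw.
- move=> t k v pv; have cv := poly_continuous pv.
  have cb := poly_continuous (pb t k).
  have h0 := bE t k v pv; move/eqP: h0; rewrite -subr_eq0 => /eqP h0.
  rewrite -[RHS]h0.
  rewrite -(@RintegralB _ (plane R) R mu _ _ _ (mT t)); last 2 first.
  + apply: continuous_tri_int => p; apply: cvgM; last exact: cv.
    by apply: cvgM; [exact: cla|exact: cb].
  + exact: L2_tri_integrable (Lf t k) cv.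
  apply: eq_Rintegral => p _; rewrite side_comp_sum /q -/(b t k).
  by move: (g t k p) (la t k p) (b t k p) (side_comp t k (sigma t p)) (v p) => x1 x2 x3 x4 x5; ring.
- move=> h he v sv; have h0 := QE h v sv; move/eqP: h0; rewrite -subr_eq0 => /eqP h0.
  rewrite -[RHS]h0.
  rewrite -(@RintegralB _ _ R leb _ _ _ (@segI R)); last 2 first.
  + apply: continuous_segment_integrable => s; apply: cvgM; last exact: continuous_horner.
    by apply: cvgM; [exact: cvg_cst|exact: continuous_horner].
  + exact: L2_poly_integrable (Lt h) (@continuous_horner _ v).
  have mv : measurable_fun (`[0, 1]%classic : set (measurableTypeR R)) (fun s => v.[s]).
    by apply: measurable_funTS; apply: continuous_measurable_fun; exact: continuous_horner.
  have mQ : measurable_fun (`[0, 1]%classic : set (measurableTypeR R)) (fun s => (Q h).[s]).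
    by apply: measurable_funTS; apply: continuous_measurable_fun; exact: continuous_horner.
  apply: segment_Rintegral_ae.
  + apply: measurable_funM mv; apply: measurable_funB; last exact: (Lt h).1.
    exact: (tens_trace_L2 (tens_of q) h (side_vec h) (side_vec h)).1.
  + apply: measurable_funB; last by apply: measurable_funM mv; exact: (Lt h).1.
    by apply: measurable_funM mv; apply: measurable_funM mQ; exact: measurable_cst.
  + apply: leb_aeS (tens_trace_poly h pS mS aS) => s e s01.
    rewrite e// (tens_poly_trace_of q) tq /P he -/(Q h).
    by move: (Q h).[s] (tens_trace _ _ _ _ s) v.[s] => x1 x2 x3; ring.
Qed.
End SigmaProjection.

Section SymPairing.
Context (R : realType) (S : triangulation R) (t : tri S).
Notation mu := (plane_measure R).

(** Expanding [A] in the dual tensors turns a tensor pairing into scalar pairings with the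
    components on edge vectors, the form in which the degrees of freedom are given. *)
Lemma sym_pairing (A N : R * R -> 'M[R]_2) :
  (forall i j, L2 mu (open_triangle t) (fun p => A p i j)) ->
  (forall i j, continuous (fun p => N p i j)) ->
  {ae mu, forall p, open_triangle t p -> (A p)^T = A p} ->
  \int[mu]_(p in open_triangle t) (\sum_i \sum_j A p i j * N p i j) =
  \sum_k \int[mu]_(p in open_triangle t)
    (side_comp t k (A p) * (\sum_i \sum_j dual_tensor t k i j * N p i j)).
Proof.
move=> LA cN sA; have mT : measurable (open_triangle t : set (plane R)) := measurable_open_triangle t.
pose n k p := \sum_i \sum_j dual_tensor t k i j * N p i j.
have cn k : continuous (n k).
  move=> p; rewrite /n /continuous_at sum2 !sum2 (_ : (fun x => _) = fun x =>
    (dual_tensor t k 0 0 * N x 0 0 + dual_tensor t k 0 1 * N x 0 1) +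
    (dual_tensor t k 1 0 * N x 1 0 + dual_tensor t k 1 1 * N x 1 1)); last first.
    by apply/funext => x; rewrite !sum2.
  by apply: cvgD; apply: cvgD; apply: cvgM; [exact: cvg_cst|exact: cN|exact: cvg_cst|exact: cN
    |exact: cvg_cst|exact: cN|exact: cvg_cst|exact: cN].
have Lc k := side_comp_L2 (sigma := fun _ => A) k LA.
have ik k := L2_tri_integrable (Lc k) (cn k).
have iAN i j := L2_tri_integrable (LA i j) (@cN i j).
have mAN i j : measurable_fun (open_triangle t) (fun p : plane R => A p i j * N p i j).
  by apply/measurable_EFinP; case/integrableP: (iAN i j).
have mk k : measurable_fun (open_triangle t) (fun p : plane R => side_comp t k (A p) * n k p).
  by apply/measurable_EFinP; case/integrableP: (ik k).
rewrite sum3 -/(n 0) -/(n 1) -/(n 2).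
rewrite -(@RintegralD _ (plane R) R mu _ _ _ mT (ik 0) (ik 1)).
rewrite -(@RintegralD _ (plane R) R mu _ _ _ mT _ (ik 2)); last first.
  exact: (@integrableD _ (plane R) R mu _ mT _ _ (ik 0) (ik 1)).
apply: Rintegral_ae_eq.
- rewrite (_ : (fun p => _) = fun p => (A p 0 0 * N p 0 0 + A p 0 1 * N p 0 1) + (A p 1 0 * N p 1 0 + A p 1 1 * N p 1 1)).
    by apply: measurable_funD; apply: measurable_funD; exact: mAN.
  by apply/funext => p; rewrite !sum2.
- by apply: measurable_funD; [apply: measurable_funD; exact: mk|exact: mk].
- apply: plane_aeS sA => p sAp tp.
  have E i j : A p i j = \sum_k side_comp t k (A p) * dual_tensor t k i j.
    by rewrite {1}(sym_tensor_decomp t (sAp tp)) summxE; apply: eq_bigr => k _; rewrite mxE.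
  rewrite /n !sum2 !E !sum3.
  move: (side_comp t 0 (A p)) (side_comp t 1 (A p)) (side_comp t 2 (A p)) (dual_tensor t) => a b c D.
  move: (D 0) (D 1) (D 2) (N p) => D0 D1 D2 M; ring.
Qed.
End SymPairing.

Section ConstMetric.
Context (R : realType) (S : triangulation R) (r : nat) (gbar : tens_field S).
Hypothesis gbar_metric : regge_metric_h 0 gbar.
Notation mu := (plane_measure R).
Notation leb := (@lebesgue_measure R).
Implicit Types (sigma sh : tens_field S).

Definition const_metric (t : tri S) : 'M[R]_2 := gbar t (corner S t 0).
Local Notation G := const_metric.

(** The metric is of degree 0 only almost everywhere in the open triangle; continuity makes it
    constant on the closed one. *)
Lemma const_metricE t p : triangle t p -> gbar t p = G t.
Proof.
move=> tp; case: gbar_metric => [[sm _ _] pl]; apply/matrixP => i j.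
have [F sF FE] := sm t i j; have [H pH HE] := pl t i j.
have FH : forall q, triangle t q -> F q = H q.
  apply: (@ae_tri_eq R (corner S t) (jac_corner t)).
  - apply: continuous_subspaceT; exact: (smooth_C1 sF).1.
  - apply: continuous_subspaceT; exact: (is_poly_C1 pH).1.1.
  - apply: plane_aeS HE => q h tq; rewrite -h// FE//; exact: (@open_tri_sub R (corner S t)).
have t0 : triangle t (corner S t 0) := @corner_in R (corner S t) (jac_corner t) 0.
rewrite /const_metric !FE// !FH//; have [c Hc] := pH.
by rewrite !Hc !big_ord_recl !big_ord0 !expr0.
Qed.

Lemma corner_triangle (t : tri S) : triangle t (corner S t 0).
Proof. exact: (@corner_in R (corner S t) (jac_corner t) 0). Qed.

Lemma const_metric_sym t : (G t)^T = G t.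
Proof. by case: gbar_metric => [[_ h _] _]; have [] := h t _ (corner_triangle t). Qed.

Lemma const_metric_det t : 0 < \det (G t).
Proof. by have [] := metric_posdef (proj1 gbar_metric) (corner_triangle t). Qed.

Lemma const_metric_unit t : G t \in unitmx.
Proof. by rewrite unitmxE unitfE gt_eqF// const_metric_det. Qed.

Lemma side_vec_neq0 (h : side S) : side_vec h != 0.
Proof.
apply/eqP => /matrixP e; have e0 := e 0 0; have e1 := e 0 1; rewrite !side_vecE !mxE/= in e0 e1.
have := dlam_sub (jac_corner h.1) (h.2 + 2) (h.2 + 2) (h.2 + 1).
rewrite /dlam /cross !pairE e0 e1 !mulr0 subrr mul0r eqxx.
case: (h) => t k /=; elim/ord3P: k; rewrite ?ord3D ?ord3_neq /= mulr1n mulr0n subr0 => /eqP;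
by rewrite eq_sym oner_eq0.
Qed.

Definition side_speed (h : side S) : R := Num.sqrt (bilin (side_vec h) (G h.1) (side_vec h)).

Lemma side_speed_gt0 h : 0 < side_speed h.
Proof.
rewrite sqrtr_gt0; case: gbar_metric => [[_ pd _] _].
by have [_] := pd h.1 _ (corner_triangle h.1); apply; exact: side_vec_neq0.
Qed.

Lemma speedE h s : s \in (`[0, 1] : interval R) -> speed gbar h s = side_speed h.
Proof. by move=> s01; rewrite /speed const_metricE//; exact: side_point_in. Qed.

(** For a constant metric, raising indices and the volume and length factors are constant and
    invertible, so they only permute the test tensors and rescale the test polynomials. *)
Lemma pi_Sigma_dofs sigma sh : Sigma_space sigma -> Sigmah_space r sh ->
  (((forall (t : tri S) (rho : R * R -> 'M[R]_2),
      (forall i j, is_poly r (fun p => rho p i j)) ->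
      (forall p, (rho p)^T = rho p) ->
      tri_int gbar t (fun p =>
        tens_dot (gbar t p) (sh t p - sigma t p) (rho p)) = 0) /\
    (forall h : side S, h \in edges S -> forall v : {poly R}, (size v <= r.+1)%N ->
      edge_int gbar h (fun s =>
        let tau := unit_tangent gbar h s in
        (tens_trace sh h tau tau s - tens_trace sigma h tau tau s) * v.[s]) = 0))
   <-> sigma_dofs r sigma sh).
Proof.
move=> Ss [Sh _].
have LA (t : tri S) i j : L2 mu (open_triangle t) (fun p => (sh t p - sigma t p) i j).
  rewrite (_ : (fun p => _) = fun p => sh t p i j - sigma t p i j); last first.
    by apply/funext => p; rewrite !mxE.
  have mT : measurable (open_triangle t : set (plane R)) := measurable_open_triangle t.
  exact: (@L2B _ (plane R) R mu _ mT _ _ (Sigma_comp_L2 t i j Sh) (Sigma_comp_L2 t i j Ss)).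
have sA (t : tri S) : {ae mu, forall p, open_triangle t p -> (sh t p - sigma t p)^T = sh t p - sigma t p}.
  case: Sh => _ sh1 _; case: Ss => _ sg1 _.
  by apply: plane_aeS2 (sh1 t) (sg1 t) => p h1 h2 tp; rewrite linearB/= h1// h2.
have compB (t : tri S) k p : side_comp t k (sh t p - sigma t p) = side_comp t k (sh t p) - side_comp t k (sigma t p).
  by rewrite -[sh t p - _]addrC -scaleN1r side_comp_lin; ring.
have triE (t : tri S) (rho : R * R -> 'M[R]_2) :
    tri_int gbar t (fun p => tens_dot (gbar t p) (sh t p - sigma t p) (rho p)) =
    \int[mu]_(p in open_triangle t) (\sum_i \sum_j (sh t p - sigma t p) i j *
      (Num.sqrt (\det (G t)) *: ((invmx (G t))^T *m rho p *m (invmx (G t))^T)) i j).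
  apply: eq_Rintegral => p; rewrite inE => tp.
  have tp' : triangle t p by exact: (@open_tri_sub R (corner S t)).
  rewrite /density const_metricE// tens_dotE !sum2.
  have ZE (a : R) (M : 'M[R]_2) i j : (a *: M) i j = a * M i j by rewrite mxE.
  rewrite !ZE.
  move: ((sh t p - sigma t p) 0 0) ((sh t p - sigma t p) 0 1) ((sh t p - sigma t p) 1 0) ((sh t p - sigma t p) 1 1) => a b c d.
  move: (_ *m _) => M; ring.
(* Two factors 1/speed from the unit tangents and one factor speed from ds leave a single 1/speed,
   moved to the test polynomial. *)
have edgeE (h : side S) (v : {poly R}) :
    edge_int gbar h (fun s => let tau := unit_tangent gbar h s in
        (tens_trace sh h tau tau s - tens_trace sigma h tau tau s) * v.[s]) =
    \int[leb]_(s in `[0, 1]) ((tens_trace sh h (side_vec h) (side_vec h) s -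
        tens_trace sigma h (side_vec h) (side_vec h) s) * ((side_speed h)^-1 *: v).[s]).
  apply: eq_Rintegral => s; rewrite inE => s01.
  rewrite /unit_tangent /= !tens_traceZ hornerZ speedE//.
  have := side_speed_gt0 h; move: (side_speed h) (tens_trace _ _ _ _ s) (tens_trace _ _ _ _ s) (v.[s]) => w a b c w0.
  by field; rewrite gt_eqF.
split=> [[H1 H2]|[H1 H2]]; split.
- move=> t k b pb; set x := side_vec ((t, k) : side S).
  pose d := Num.sqrt (\det (G t)); have d0 : d != 0 by rewrite gt_eqF// sqrtr_gt0 const_metric_det.
  (* After raising both indices and multiplying by the density [d], this becomes [b p] times the
     square of the edge vector, whose pairing with a tensor is its component [side_comp t k]. *)
  pose rho p := (d^-1 * b p) *: (G t *m x^T *m x *m G t).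
  have := H1 t rho; rewrite triE => H; rewrite -[RHS]H {H}.
  + apply: eq_Rintegral => p _; rewrite -compB side_compE.
    have -> : (invmx (G t))^T *m rho p *m (invmx (G t))^T = (d^-1 * b p) *: (x^T *m x).
      have uG := const_metric_unit t.
      rewrite trmx_inv const_metric_sym /rho -scalemxAr -scalemxAl !mulmxA mulVmx// mul1mx.
      by rewrite -!mulmxA mulmxV// mulmx1.
    rewrite !sum2 !mxE !big_ord1 !mxE -/d -/x.
    move: (x 0 0) (x 0 1) (sh t p 0 0 - _) (sh t p 0 1 - _) (sh t p 1 0 - _) (sh t p 1 1 - _) (b p) => x0 x1 a00 a01 a10 a11 y.
    by field.
  + move=> i j; apply: (@is_poly_ext _ _ (fun p => (d^-1 * (G t *m x^T *m x *m G t) i j) * b p)).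
      by move=> p; rewrite /rho [in RHS]mxE; ring.
    exact: is_polyZ.
  + by move=> p; rewrite /rho linearZ/= !trmx_mul trmxK const_metric_sym !mulmxA.
- move=> h he v sv; have := H2 h he (side_speed h *: v).
  rewrite edgeE scalerA mulVf ?gt_eqF ?side_speed_gt0// scale1r; apply.
  by rewrite (leq_trans (size_scale_leq _ _)).
- move=> t rho prho srho; rewrite triE.
  set N := fun p => Num.sqrt (\det (G t)) *: ((invmx (G t))^T *m rho p *m (invmx (G t))^T).
  have pN i j : is_poly r (fun p => N p i j).
    apply: (@is_poly_ext _ _ (fun p => Num.sqrt (\det (G t)) * ((invmx (G t))^T *m rho p *m (invmx (G t))^T) i j)).
      by move=> p; rewrite [in RHS]mxE.
    by apply: is_polyZ; exact: is_poly_mulmx.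
  rewrite (@sym_pairing R S t (fun p => sh t p - sigma t p) N (LA t) (fun i j => poly_continuous (pN i j)) (sA t)).
  rewrite big1// => k _.
  have pk : is_poly r (fun p => \sum_i \sum_j dual_tensor t k i j * N p i j).
    by apply: is_poly_sum => i; apply: is_poly_sum => j; exact: is_polyZ.
  by rewrite -[RHS](H1 t k _ pk); apply: eq_Rintegral => p _; rewrite compB.
- move=> h he v sv; rewrite edgeE; apply: H2 => //.
  by rewrite (leq_trans (size_scale_leq _ _)).
Qed.

Lemma pi_Sigma_spec sigma : Sigma_space sigma ->
  Sigmah_space r (pi_Sigma r gbar sigma) /\ sigma_dofs r sigma (pi_Sigma r gbar sigma).
Proof.
move=> Ss; have [sh [Sh dh]] := sigma_dofs_exist r Ss.
rewrite /pi_Sigma; case: xgetP => [x _ [Sx Hx1 Hx2]|/(_ sh)].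
  by split; [exact: Sx|exact: (pi_Sigma_dofs Ss Sx).1 (conj Hx1 Hx2)].
by have [h1 h2] := (pi_Sigma_dofs Ss Sh).2 dh; case.
Qed.
End ConstMetric.

(** * The bilinear form c_h *)

Section MetricLocality.
Context (R : realType) (S : triangulation R) (g g' : tens_field S).
Hypothesis gg' : metric_eq g g'.
Notation mu := (plane_measure R).

Lemma open_triangle_sub (t : tri S) p : open_triangle t p -> triangle t p.
Proof. exact: (@open_tri_sub R (corner S t)). Qed.

(** The metrics agree only on triangles, while a derivative sees a whole neighbourhood; hence the
    restriction to the open triangle. *)
Lemma christoffel_metric_eq t p k i j : open_triangle t p -> christoffel g t p k i j = christoffel g' t p k i j.
Proof.
move=> tp; rewrite /christoffel gg'; last exact: open_triangle_sub.
have E a b c : pderiv a (fun q => g t q b c) p = pderiv a (fun q => g' t q b c) p.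
  apply: near_eq_derive; have : nbhs p (open_triangle t) by apply: open_nbhs_nbhs; split => //; exact: open_interior.
  by apply: filterS => q tq; rewrite gg'//; exact: open_triangle_sub.
by congr (_ * _); apply: eq_bigr => l _; rewrite !E.
Qed.

Lemma unit_normal_metric_eq h s : s \in (`[0, 1] : interval R) -> unit_normal g h s = unit_normal g' h s.
Proof.
by move=> s01; rewrite /unit_normal /unit_tangent /speed /density gg'//; exact: side_point_in.
Qed.

Lemma c_h_metric_eq sigma alpha : c_h g sigma alpha = c_h g' sigma alpha.
Proof.
rewrite /c_h; apply: (congr2 +%R).
- apply: eq_bigr => t _; rewrite /tri_int; apply: eq_Rintegral => x; rewrite inE => xP.
  have tp := open_triangle_sub xP.
  have E : cov_deriv g alpha t x = cov_deriv g' alpha t x.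
    apply/matrixP => i j; rewrite !mxE; apply: (congr2 (fun a b => a - b)) => //.
    by apply: eq_bigr => k _; rewrite christoffel_metric_eq.
  by rewrite /density E gg'.
- apply: eq_bigr => h _; rewrite /edge_int; apply: eq_Rintegral => x; rewrite inE => xP.
  have E : jump (fun h' s' => form_trace alpha h' (unit_normal g h' s') s') h x =
      jump (fun h' s' => form_trace alpha h' (unit_normal g' h' s') s') h x.
    rewrite /jump unit_normal_metric_eq//; apply: (congr2 +%R) => //; apply: eq_bigr => h' _.
    by rewrite unit_normal_metric_eq//; exact: onem_itv.
  by rewrite E /unit_tangent /speed gg'//; exact: side_point_in.
Qed.
End MetricLocality.

Lemma sum_twin (R : realType) (S : triangulation R) (h h' : side S) (f : side S -> R) : twin h h' ->
  \sum_(k : side S | twin h k) f k = f h'.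
Proof.
move=> hh'; rewrite (big_pred1 h')// => k /=.
by apply/idP/eqP => [/(twin_uniq hh')|->].
Qed.

Section ConstCh.
Context (R : realType) (S : triangulation R) (G : tri S -> 'M[R]_2).
Hypothesis unitG : forall t, G t \in unitmx.
Hypothesis speed_gt0 : forall h : side S, 0 < bilin (side_vec h) (G h.1) (side_vec h).
Notation mu := (plane_measure R).
Notation leb := (@lebesgue_measure R).
Implicit Types (sigma : tens_field S) (F : tri S -> 'I_2 -> R * R -> R).

Definition const_field : tens_field S := fun t _ => G t.

Lemma christoffel_const t p k i j : christoffel const_field t p k i j = 0.
Proof.
rewrite /christoffel big1 ?mulr0// => l _.
have E a b c : pderiv a (fun q => const_field t q b c) p = 0 by exact: (C1_cst (G t b c)).2.
by rewrite !E; ring.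
Qed.

(** What a covariant derivative becomes when the operator S, the inverse metrics and the density are
    all moved away from [sigma]. *)
Definition div_weight (t : tri S) (B : 'M[R]_2) : 'M[R]_2 :=
  Num.sqrt (\det (G t)) *: ((invmx (G t))^T *m B *m (invmx (G t))^T
    - \tr (invmx (G t) *m B^T) *: (invmx (G t))^T).

Lemma tens_dot_S_op t A B : tens_dot (G t) (S_op (G t) A) B * Num.sqrt (\det (G t)) =
  \sum_i \sum_j A i j * div_weight t B i j.
Proof.
have e : tens_dot (G t) (G t) B = \tr (invmx (G t) *m B^T).
  by rewrite /tens_dot mulVmx// mul1mx.
rewrite /S_op; rewrite tens_dotE in e; rewrite tens_dotE.
have -> : \tr (invmx (G t) *m A) = \sum_i \sum_j A i j * (invmx (G t))^T i j.
  rewrite mxtrace_mulC; apply: eq_bigr => i _; rewrite mxE; apply: eq_bigr => j _.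
  by rewrite [in RHS]mxE.
rewrite /div_weight; move: e; move: (\tr _) (Num.sqrt _) => u d.
move: ((invmx (G t))^T *m B *m (invmx (G t))^T) => X; rewrite !sum2 => e.
rewrite !mxE; move: (invmx (G t)) => K.
rewrite -e; ring.
Qed.

Definition grad_mx F t p : 'M[R]_2 := \matrix_(i, j) pderiv i (F t j) p.

Definition const_speed (h : side S) : R := Num.sqrt (bilin (side_vec h) (G h.1) (side_vec h)).

Definition const_normal (h : side S) : 'rV[R]_2 := unit_normal const_field h 0.

(** For a constant metric the normal is constant along the side. The factor 1/speed is what the two
    unit tangents and the length element leave. *)
Definition normal_jump F (h : side S) (s : R) : R :=
  (const_speed h)^-1 * (form_poly_trace F h (const_normal h) s
    + \sum_(h' : side S | twin h h') form_poly_trace F h' (const_normal h') (1 - s)).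

(** The form c_h for a piecewise constant metric and a piecewise polynomial one-form, with [sigma]
    entering only through entrywise pairings and its traces on edge vectors. *)
Definition c_poly sigma F : R :=
  \sum_t \int[mu]_(p in open_triangle t)
    (\sum_i \sum_j sigma t p i j * div_weight t (grad_mx F t p) i j)
  + \sum_(h in edges S) \int[leb]_(s in `[0, 1])
    (tens_trace sigma h (side_vec h) (side_vec h) s * normal_jump F h s).

Lemma continuous_div_weight n F t i j : (forall t j, is_poly n (F t j)) ->
  is_poly n.-1 (fun p => div_weight t (grad_mx F t p) i j).
Proof.
move=> pF; have pG a b : is_poly n.-1 (fun p => grad_mx F t p a b).
  by apply: is_poly_ext ((is_poly_C1 (pF t b)).2 a) => p; rewrite mxE.
set K := invmx (G t); set d := Num.sqrt (\det (G t)).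
apply: (@is_poly_ext _ _ (fun p => d * ((K^T *m grad_mx F t p *m K^T) i j -
   (\sum_a \sum_b K a b * grad_mx F t p a b) * K^T i j))).
  move=> p; rewrite /div_weight -/K -/d [in RHS]mxE [in RHS]mxE; congr (_ * (_ + _)).
  rewrite [in RHS]mxE [in RHS]mxE; congr (- (_ * _)); apply: eq_bigr => a _; rewrite [in RHS]mxE.
  by apply: eq_bigr => b _; rewrite !mxE.
apply: is_polyZ; apply: is_polyB; first exact: is_poly_mulmx.
apply: (@is_poly_ext _ _ (fun p => K^T i j * \sum_a \sum_b K a b * grad_mx F t p a b)).
  by move=> p; rewrite mulrC.
by apply: is_polyZ; apply: is_poly_sum => a; apply: is_poly_sum => b; exact: is_polyZ.
Qed.

Lemma is_poly_normal_jump n F h : (forall t j, is_poly n (F t j)) ->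
  exists2 q : {poly R}, (size q <= n)%N & forall s, normal_jump F h s = q.[s].
Proof.
move=> pF.
have tr k x : exists2 q : {poly R}, (size q <= n)%N & forall s, form_poly_trace F k x s = q.[s].
  have pk : is_poly n (fun p => \sum_j x 0 j * F k.1 j p).
    by apply: is_poly_sum => j; exact: is_polyZ.
  have [q sq qE] := is_poly_side (corner S k.1) k.2 pk; exists q => // s.
  by rewrite -qE /form_poly_trace; apply: eq_bigr => j _; rewrite mulrC.
pose Q k := s2val (cid2 (tr k (const_normal k))).
have sQ k : (size (Q k) <= n)%N := s2valP (cid2 (tr k (const_normal k))).
have QE k s : form_poly_trace F k (const_normal k) s = (Q k).[s] := s2valP' (cid2 (tr k (const_normal k))) s.
exists ((const_speed h)^-1 *: (Q h + \sum_(h' : side S | twin h h') (Q h' \Po (1 - 'X)))).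
  rewrite (leq_trans (size_scale_leq _ _))// (leq_trans (size_polyD _ _))// geq_max sQ/=.
  rewrite (leq_trans (size_sum _ _ _))//; apply/bigmax_leqP => k _.
  by rewrite size_comp_poly2// -size_polyN opprB -[1]polyC1 size_XsubC.
move=> s; rewrite hornerZ hornerD horner_sum /normal_jump QE; congr (_ * (_ + _)).
by apply: eq_bigr => k _; rewrite QE horner_comp !hornerE.
Qed.

Lemma L2_pair_integrable (t : tri S) (A N : R * R -> 'M[R]_2) :
  (forall i j, L2 mu (open_triangle t) (fun p => A p i j)) ->
  (forall i j, continuous (fun p => N p i j)) ->
  mu.-integrable (open_triangle t) (EFin \o (fun p => \sum_i \sum_j A p i j * N p i j)).
Proof.
move=> LA cN; have mT : measurable (open_triangle t : set (plane R)) := measurable_open_triangle t.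
have iAN i j := L2_tri_integrable (LA i j) (@cN i j).
rewrite (_ : (fun p => _) = fun p => (A p 0 0 * N p 0 0 + A p 0 1 * N p 0 1) + (A p 1 0 * N p 1 0 + A p 1 1 * N p 1 1)); last first.
  by apply/funext => p; rewrite !sum2.
exact: (@integrableD _ (plane R) R mu _ mT _ _
  (@integrableD _ (plane R) R mu _ mT _ _ (iAN 0 0) (iAN 0 1))
  (@integrableD _ (plane R) R mu _ mT _ _ (iAN 1 0) (iAN 1 1))).
Qed.

(** The Christoffel symbols vanish, and the weak derivatives and traces of [alpha] are almost
    everywhere those of its polynomials. *)
Lemma c_h_poly n sigma alpha F : (forall t i j, L2 mu (open_triangle t) (fun p => sigma t p i j)) ->
  (forall t j, is_poly n (F t j)) -> measurable_form alpha -> ae_form alpha F ->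
  c_h const_field sigma alpha = c_poly sigma F.
Proof.
move=> Ls pF ma aF; rewrite /c_h /c_poly; congr (_ + _).
- apply: eq_bigr => t _.
  have W i j := @weak_pderiv_poly R S t i _ _ _ (ma t j) (pF t j) (aF t j).
  pose B p : 'M[R]_2 := \matrix_(i, j) weak_pderiv (open_triangle t) i (fun q => alpha t q 0 j) p.
  have E : tri_int const_field t (fun p => tens_dot (const_field t p) (S_op (const_field t p) (sigma t p))
      (cov_deriv const_field alpha t p)) =
    \int[mu]_(p in open_triangle t) (\sum_i \sum_j sigma t p i j * div_weight t (B p) i j).
    apply: eq_Rintegral => p _; rewrite -tens_dot_S_op; congr (tens_dot _ _ _ * _).
    apply/matrixP => i j; rewrite !mxE big1 ?subr0// => k _.
    by rewrite christoffel_const mul0r.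
  rewrite E; have mT : measurable (open_triangle t : set (plane R)) := measurable_open_triangle t.
  have mB i j : measurable_fun (open_triangle t) (fun p : plane R => div_weight t (B p) i j).
    set K := invmx (G t); set d := Num.sqrt (\det (G t)).
    have mb a b : measurable_fun (open_triangle t) (fun p : plane R => B p a b).
      rewrite (_ : (fun p => _) = weak_pderiv (open_triangle t) a (fun q => alpha t q 0 b)); first exact: (W a b).1.
      by apply/funext => p; rewrite mxE.
    have mZ (a : R) f : measurable_fun (open_triangle t) (f : plane R -> R) -> measurable_fun (open_triangle t) (fun p => a * f p).
      by move=> mf; apply: measurable_funM mf; exact: measurable_cst.
    have -> : (fun p : plane R => div_weight t (B p) i j) = fun p : plane R =>
       (((d * (K 0 i * K j 0 - K 0 0 * K j i)) * B p 0 0 + (d * (K 0 i * K j 1 - K 0 1 * K j i)) * B p 0 1) +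
       ((d * (K 1 i * K j 0 - K 1 0 * K j i)) * B p 1 0 + (d * (K 1 i * K j 1 - K 1 1 * K j i)) * B p 1 1)).
      apply/funext => p; rewrite /div_weight -/K -/d /mxtrace; move: (B p) => b.
      rewrite !(mxE, sum2); move: (b 0 0) (b 0 1) (b 1 0) (b 1 1) => b00 b01 b10 b11; clear; ring.
    by apply: measurable_funD; apply: measurable_funD; apply: mZ; exact: mb.
  have ms i j : measurable_fun (open_triangle t) (fun p : plane R => sigma t p i j) := (Ls t i j).1.
  have mS (C : R * R -> 'M[R]_2) : (forall i j, measurable_fun (open_triangle t) (fun p : plane R => C p i j)) ->
      measurable_fun (open_triangle t) (fun p : plane R => \sum_i \sum_j sigma t p i j * C p i j).
    move=> mC; rewrite (_ : (fun p => _) = fun p : plane R => (sigma t p 0 0 * C p 0 0 + sigma t p 0 1 * C p 0 1) + (sigma t p 1 0 * C p 1 0 + sigma t p 1 1 * C p 1 1)); last first.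
      by apply/funext => p; rewrite !sum2.
    by apply: measurable_funD; apply: measurable_funD; apply: measurable_funM; [exact: ms|exact: mC|exact: ms|exact: mC|exact: ms|exact: mC|exact: ms|exact: mC].
  apply: Rintegral_ae_eq.
  + exact: (mS (fun p => div_weight t (B p)) mB).
  + apply: (mS (fun p => div_weight t (grad_mx F t p))) => i j; exact: poly_measurable (continuous_div_weight t i j pF).
  + have E0 := plane_aeS2 (fun p a b => conj a b) (W 0 0).2 (W 0 1).2.
    have E1 := plane_aeS2 (fun p a b => conj a b) (W 1 0).2 (W 1 1).2.
    apply: plane_aeS2 E0 E1 => p [e00 e01] [e10 e11] tp; apply: eq_bigr => i _; apply: eq_bigr => j _; congr (_ * div_weight t _ i j).
    apply/matrixP => {}i {}j; rewrite !mxE; elim/ord2P: i; elim/ord2P: j; [exact: e00|exact: e01|exact: e10|exact: e11].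
- apply: eq_bigr => h _.
  pose J s := (const_speed h)^-1 * (form_trace alpha h (const_normal h) s
    + \sum_(h' : side S | twin h h') form_trace alpha h' (const_normal h') (1 - s)).
  have w0 : 0 < const_speed h by rewrite sqrtr_gt0.
  have -> : edge_int const_field h (fun s => tens_trace sigma h (unit_tangent const_field h s) (unit_tangent const_field h s) s *
      jump (fun h' s' => form_trace alpha h' (unit_normal const_field h' s') s') h s) =
    \int[leb]_(s in `[0, 1]) (tens_trace sigma h (side_vec h) (side_vec h) s * J s).
    apply: eq_Rintegral => s _; rewrite tens_traceZ -/(const_speed h) /speed -/(const_speed h) /jump /J.
    move: (tens_trace _ _ _ _ _) (_ + _) => a b; field; by rewrite gt_eqF.
  have tF k := form_trace_poly k pF ma aF.
  have mform k x : measurable_fun (`[0, 1]%classic : set (measurableTypeR R)) (form_trace alpha k x).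
    rewrite (_ : form_trace _ _ _ = fun s => edge_trace k (fun p => alpha k.1 p 0 0) s * x 0 0 + edge_trace k (fun p => alpha k.1 p 0 1) s * x 0 1); last first.
      by apply/funext => s; rewrite /form_trace sum2.
    by apply: measurable_funD; apply: measurable_funM; [exact: (edge_trace_L2 _ _).1|exact: measurable_cst|exact: (edge_trace_L2 _ _).1|exact: measurable_cst].
  have mrev k x : measurable_fun (`[0, 1]%classic : set (measurableTypeR R)) (fun s => form_trace alpha k x (1 - s)).
    apply: (@measurable_comp _ _ _ (measurableTypeR R) (measurableTypeR R) _ `[0, 1]%classic (form_trace alpha k x) _ (fun s : R => 1 - s)) => //.
    + by move=> _ [s s01 <-]; exact: onem_itv.
    + by apply: measurable_funTS; apply: continuous_measurable_fun; exact: continuous_onem.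
  have [q _ qE] := is_poly_normal_jump h pF.
  have mt := (tens_trace_L2 sigma h (side_vec h) (side_vec h)).1.
  apply: segment_Rintegral_ae.
  + apply: measurable_funM mt _; apply: measurable_funM; first exact: measurable_cst.
    apply: measurable_funD; first exact: mform.
    case: (pickP (twin h)) => [k hk|hk].
      rewrite (_ : (fun x => _) = fun x => form_trace alpha k (const_normal k) (1 - x)); first exact: mrev.
      by apply/funext => x; exact: (sum_twin (fun k => form_trace alpha k (const_normal k) (1 - x)) hk).
    rewrite (_ : (fun x => _) = fun=> 0); first exact: measurable_cst.
    by apply/funext => x; exact: big_pred0.
  + apply: measurable_funM mt _; rewrite (_ : normal_jump F h = fun s => q.[s]); last exact/funext.
    by apply: measurable_funTS; apply: continuous_measurable_fun; exact: continuous_horner.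
  + case: (pickP (twin h)) => [k hk|hk].
      apply: leb_aeS2 (tF h) (segment_ae_rev (tF k)) => s e1 e2 s01.
      rewrite /J /normal_jump; congr (_ * (_ * _)); apply: (congr2 +%R); first exact: e1.
      rewrite (sum_twin (fun k => form_trace alpha k (const_normal k) (1 - s)) hk).
      by rewrite (sum_twin (fun k => form_poly_trace F k (const_normal k) (1 - s)) hk); exact: e2.
    by apply: leb_aeS (tF h) => s e1 s01; rewrite /J /normal_jump; congr (_ * (_ * _)); apply: (congr2 +%R); [exact: e1|by rewrite !big_pred0].
Qed.
End ConstCh.

Section CPoly.
Context (R : realType) (S : triangulation R) (G : tri S -> 'M[R]_2).
Notation mu := (plane_measure R).
Notation leb := (@lebesgue_measure R).
Implicit Types (sigma : tens_field S) (F : tri S -> 'I_2 -> R * R -> R).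

Lemma pairingL a (A B C D : 'M[R]_2) : (forall i j, D i j = a * B i j + C i j) ->
  \sum_i \sum_j A i j * D i j = a * (\sum_i \sum_j A i j * B i j) + \sum_i \sum_j A i j * C i j.
Proof. by move=> e; rewrite !sum2 !e; ring. Qed.

Lemma c_polyL n sigma a F F' : (forall t i j, L2 mu (open_triangle t) (fun p => sigma t p i j)) ->
  (forall t j, is_poly n (F t j)) -> (forall t j, is_poly n (F' t j)) ->
  c_poly G sigma (fun t j p => a * F t j p + F' t j p) = a * c_poly G sigma F + c_poly G sigma F'.
Proof.
move=> Ls pF pF'; pose F2 := fun t j p => a * F t j p + F' t j p.
have wL t p i j : div_weight G t (grad_mx F2 t p) i j =
    a * div_weight G t (grad_mx F t p) i j + div_weight G t (grad_mx F' t p) i j.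
  have -> : grad_mx F2 t p = a *: grad_mx F t p + grad_mx F' t p.
    apply/matrixP => k l; rewrite !mxE.
    have [CZ dZ] := C1Z a (is_poly_C1 (pF t l)).1.
    by have [_ ->] := C1D CZ (is_poly_C1 (pF' t l)).1; rewrite dZ.
  have trL (K A B : 'M[R]_2) : \tr (K *m (a *: A + B)^T) = a * \tr (K *m A^T) + \tr (K *m B^T).
    by rewrite linearD/= linearZ/= mulmxDr -scalemxAr mxtraceD mxtraceZ.
  have mL (K A B : 'M[R]_2) : K *m (a *: A + B) *m K = a *: (K *m A *m K) + K *m B *m K.
    by rewrite mulmxDr mulmxDl -scalemxAr -scalemxAl.
  rewrite /div_weight trL mL.
  set K := invmx (G t); set d := Num.sqrt _.
  move: (\tr (K *m (grad_mx F t p)^T)) (\tr (K *m (grad_mx F' t p)^T)) => x y.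
  move: (K^T *m grad_mx F t p *m K^T) (K^T *m grad_mx F' t p *m K^T) => A B.
  by move: K^T d => L d; rewrite !mxE; ring.
have jL h s : normal_jump G F2 h s = a * normal_jump G F h s + normal_jump G F' h s.
  have tL k x y : form_poly_trace F2 k x y = a * form_poly_trace F k x y + form_poly_trace F' k x y.
    by rewrite /form_poly_trace !sum2 /F2; ring.
  rewrite /normal_jump tL (eq_bigr _ (fun k _ => tL k _ _)) big_split/= -mulr_sumr.
  move: (_^-1) (form_poly_trace F _ _ _) (form_poly_trace F' _ _ _) (\sum_(i | _) _) (\sum_(i | _) _) => x1 x2 x3 x4 x5; ring.
rewrite /c_poly -/F2 mulrDr addrACA; clearbody F2.
apply: (congr2 +%R).
- rewrite mulr_sumr -big_split; apply: eq_bigr => t _ /=.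
  have mT : measurable (open_triangle t : set (plane R)) := measurable_open_triangle t.
  have i1 := L2_pair_integrable (Ls t) (fun i j => poly_continuous (continuous_div_weight G t i j pF)).
  have i2 := L2_pair_integrable (Ls t) (fun i j => poly_continuous (continuous_div_weight G t i j pF')).
  rewrite -(@RintegralZl _ (plane R) R mu _ _ a mT i1).
  rewrite -(@RintegralD _ (plane R) R mu _ _ _ mT _ i2); last exact: (@integrableZl _ (plane R) R mu _ mT a _ i1).
  apply: eq_Rintegral => p _; exact: (pairingL (sigma t p) (wL t p)).
- rewrite mulr_sumr -big_split; apply: eq_bigr => h _ /=.
  have Lt := tens_trace_L2 sigma h (side_vec h) (side_vec h).
  have cj F0 : (forall t j, is_poly n (F0 t j)) -> continuous (normal_jump G F0 h).
    move=> pF0; have [q _ qE] := is_poly_normal_jump G h pF0.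
    rewrite (_ : normal_jump _ _ _ = fun s => q.[s]); [exact: continuous_horner|exact/funext].
  have i1 := L2_poly_integrable Lt (cj _ pF).
  have i2 := L2_poly_integrable Lt (cj _ pF').
  rewrite -(@RintegralZl _ _ R leb _ _ a (@segI R) i1).
  rewrite -(@RintegralD _ _ R leb _ _ _ (@segI R) _ i2); last exact: (@integrableZl _ _ R leb _ (@segI R) a _ i1).
  by apply: eq_Rintegral => s _; rewrite jL; ring.
Qed.

Lemma c_poly0 sigma : (forall t i j, L2 mu (open_triangle t) (fun p => sigma t p i j)) ->
  c_poly G sigma (fun _ _ _ => 0) = 0.
Proof.
move=> Ls; have p0 : forall (t : tri S) (j : 'I_2), is_poly 0 (fun _ : R * R => 0 : R) by move=> *; exact: is_poly_cst0.
have := @c_polyL 0 sigma (-1) (fun _ _ _ => 0) (fun _ _ _ => 0) Ls p0 p0.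
rewrite [X in c_poly G sigma X](_ : _ = fun _ _ _ => 0); first by move=> ->; rewrite mulN1r addNr.
by apply/funext => t; apply/funext => j; apply/funext => p; rewrite mulr0 addr0.
Qed.

(** Here [F] has degree at most r, so [div_weight] has degree at most r - 1 and the jump has degree
    at most r on each edge: both are admissible tests for the moments. *)
Lemma c_poly_dofs r sigma sh F : Sigma_space sigma -> Sigma_space sh -> sigma_dofs r sigma sh ->
  (forall t j, is_poly r.+1 (F t j)) -> c_poly G sh F = c_poly G sigma F.
Proof.
move=> Ss Sh [d1 d2] pF; rewrite /c_poly; apply: (congr2 +%R).
- apply: eq_bigr => t _; have mT : measurable (open_triangle t : set (plane R)) := measurable_open_triangle t.
  pose N p := div_weight G t (grad_mx F t p).
  have pN i j : is_poly r (fun p => N p i j) := continuous_div_weight G t i j pF.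
  have cN i j := poly_continuous (pN i j).
  have [_ ss _] := Ss; have [_ sh' _] := Sh.
  rewrite (sym_pairing (fun i j => Sigma_comp_L2 t i j Sh) cN (sh' t)).
  rewrite (sym_pairing (fun i j => Sigma_comp_L2 t i j Ss) cN (ss t)).
  apply: eq_bigr => k _; apply/eqP; rewrite -subr_eq0.
  have pk : is_poly r (fun p => \sum_i \sum_j dual_tensor t k i j * N p i j).
    by apply: is_poly_sum => i; apply: is_poly_sum => j; exact: is_polyZ.
  have Lk s (H : Sigma_space s) := L2_tri_integrable
    (side_comp_L2 k (fun i j => Sigma_comp_L2 t i j H)) (poly_continuous pk).
  rewrite -(@RintegralB _ (plane R) R mu _ _ _ mT (Lk _ Sh) (Lk _ Ss)).
  by rewrite -[X in _ == X](d1 t k _ pk); apply/eqP/eq_Rintegral => p _; rewrite mulrBl.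
- apply: eq_bigr => h he; have [q sq qE] := is_poly_normal_jump G h pF.
  apply/eqP; rewrite -subr_eq0; have cq := @continuous_horner _ q.
  have Lt s := L2_poly_integrable (tens_trace_L2 s h (side_vec h) (side_vec h)) cq.
  rewrite (_ : normal_jump G F h = fun s => q.[s]); last exact/funext.
  rewrite -(@RintegralB _ _ R leb _ _ _ (@segI R) (Lt sh) (Lt sigma)).
  by rewrite -[X in _ == X](d2 h he q sq); apply/eqP/eq_Rintegral => p _; rewrite mulrBl.
Qed.
End CPoly.

Section DivDivProjection.
Context (R : realType) (S : triangulation R) (r : nat) (g gh gbar : tens_field S).
Hypothesis gh_metric : regge_metric gh.
Hypothesis gbar_metric : regge_metric_h 0 gbar.
Hypothesis ggh : metric_eq g gh.
Hypothesis ghgbar : metric_eq gh gbar.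
Notation mu := (plane_measure R).
Local Notation G := (const_metric gbar).

Let unitG t : G t \in unitmx := const_metric_unit gbar_metric t.

Let speed_gt0 (h : side S) : 0 < bilin (side_vec h) (G h.1) (side_vec h).
Proof.
case: gbar_metric => [[_ pd _] _].
by have [_] := pd h.1 _ (corner_triangle h.1); apply; exact: side_vec_neq0.
Qed.

Let ghG : metric_eq gh (const_field G).
Proof. by move=> t p tp; rewrite ghgbar// (const_metricE gbar_metric). Qed.

Let gG : metric_eq g (const_field G).
Proof. by move=> t p tp; rewrite ggh// ghG. Qed.

Lemma c_h_gh n sigma alpha F : Sigma_space sigma -> (forall t j, is_poly n (F t j)) ->
  measurable_form alpha -> ae_form alpha F ->
  c_h gh sigma alpha = c_poly G sigma F /\ c_h g sigma alpha = c_poly G sigma F.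
Proof.
move=> Ss pF ma aF; rewrite (c_h_metric_eq gG) (c_h_metric_eq ghG).
have := c_h_poly unitG speed_gt0 (fun t i j => Sigma_comp_L2 t i j Ss) pF ma aF.
by split.
Qed.

(** Going through polynomial representatives shows that c_h is linear in the form and vanishes on
    forms that are zero almost everywhere, so [form_riesz] applies. *)
Lemma divS_h_spec sigma : Sigma_space sigma -> Wh_space r (divS_h r gh sigma) /\
  forall alpha, Wh_space r alpha -> form_inner gh (divS_h r gh sigma) alpha = - c_h gh sigma alpha.
Proof.
move=> Ss; have Ls t i j := Sigma_comp_L2 t i j Ss.
have [||beta [Wb Hb]] := @form_riesz R S r gh gh_metric (fun alpha => - c_h gh sigma alpha).
- move=> a alpha beta Wa Wb; have [F pF aF] := Wh_poly Wa; have [F' pF' aF'] := Wh_poly Wb.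
  have WL := Wh_L a Wa Wb; have pL := poly_formL a pF pF'.
  have aL : ae_form (fun t p => a *: alpha t p + beta t p) (fun t j p => a * F t j p + F' t j p).
    by move=> t j; apply: plane_aeS2 (aF t j) (aF' t j) => p e1 e2 tp; rewrite !mxE e1// e2.
  case: pF pF' pL => pF _ _ _ [pF' _ _ _] [pL _ _ _].
  rewrite (c_h_gh Ss pL (Wh_measurable WL) aL).1 (c_h_gh Ss pF (Wh_measurable Wa) aF).1.
  rewrite (c_h_gh Ss pF' (Wh_measurable Wb) aF').1 (c_polyL _ _ Ls pF pF').
  by rewrite opprD mulrN.
- move=> alpha Wa a0.
  have p0 : forall (t : tri S) (j : 'I_2), is_poly 0 (fun _ : R * R => 0 : R) by move=> *; exact: is_poly_cst0.
  by rewrite (c_h_gh Ss p0 (Wh_measurable Wa) a0).1 c_poly0// oppr0.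
rewrite /divS_h; case: xgetP => [x _ //|/(_ beta)]; by case.
Qed.

Lemma divdivS_h_pi_Sigma sigma : Sigma_space sigma ->
  divdivS_h r gh (pi_Sigma r gbar sigma) = pi_V r gh (divdivS_dist g sigma).
Proof.
move=> Ss; have [[Sh ph] dh] := pi_Sigma_spec r gbar_metric Ss.
have [_ H] := divS_h_spec Sh.
rewrite /divdivS_h /div_h /pi_V; congr get.
have E v : Vh_space r v -> - form_inner gh (divS_h r gh (pi_Sigma r gbar sigma)) (ext_d v) =
    divdivS_dist g sigma v.
  move=> Vv; have [Wd [V [pV aV]]] := ext_d_Wh Vv.
  have pdV t j : is_poly r.+1 (pderiv j (V t)) := (is_poly_C1 (pV t)).2 j.
  rewrite (H _ Wd) opprK /divdivS_dist /div_dist /divS_dist opprK.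
  rewrite (c_h_gh Sh pdV (Wh_measurable Wd) aV).1 (c_h_gh Ss pdV (Wh_measurable Wd) aV).2.
  exact: c_poly_dofs Ss Sh dh pdV.
apply/seteqP; split=> w [Vw Hw]; split => // v Vv; by rewrite Hw// E.
Qed.
End DivDivProjection.

(** * Functions of class H2 and their deformation *)

Section Sobolev2.
Context (R : realType) (S : triangulation R) (t : tri S) (phi : R * R -> R).
Hypothesis sphi : sobolev 2 (open_triangle t) phi.
Hypothesis cphi : {within triangle t, continuous phi}.
Notation mu := (plane_measure R).
Notation leb := (@lebesgue_measure R).
Local Notation T := (open_triangle t).
Local Notation wd i := (weak_pderiv (open_triangle t) i phi).

(** A single smooth sequence serves all purposes: L^2 convergence with first derivatives, L^2
    convergence of the traces of these derivatives, and uniform convergence on the closed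
    triangle. *)
Lemma sobolev2_data : exists f : nat -> R * R -> R,
  [/\ forall n, smooth (f n), L2_cvg T f phi,
      forall i, measurable_fun T (wd i) /\ L2_cvg T (fun n => pderiv i (f n)) (wd i),
      forall i, sobolev 1 T (wd i) &
      ((forall i k, cvL2 leb `[0, 1] (fun n s => pderiv i (f n) (side_point ((t, k) : side S) s))
         (edge_trace ((t, k) : side S) (wd i))) /\
      forall e : R, 0 < e -> exists N, forall n, (N <= n)%N -> forall p, triangle t p -> `|f n p - phi p| <= e) /\
      forall i k, is_trace ((t, k) : side S) (wd i) (edge_trace ((t, k) : side S) (wd i))].
Proof.
have [f [D [D0 sf HD]]] := sphi.
have unif := @sobolev2_uniform R (corner S t) (jac_corner t) f phi D sf D0 HD cphi.
have mT : measurable (open_triangle t : set (plane R)) := measurable_open_triangle t.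
have [mphi cf] := HD [::] isT; rewrite D0 in mphi cf.
have mf g : smooth g -> measurable_fun T g.
  by move=> sg; apply: continuous_measurable_prod => //; exact: (smooth_C1 sg).1.
have W i := weak_pderiv_ae mphi (HD [:: i] isT).1 sf cf (HD [:: i] isT).2.
have cW i : L2_cvg T (fun n => pderiv i (f n)) (wd i).
  have md n := mf _ (smooth_pderiv i (sf n)).
  apply: (@cvL2_ext _ (plane R) R mu T mT (fun n => pderiv i (f n)) (fun n => pderiv i (f n))
    (D [:: i]) (wd i) md md (HD [:: i] isT).1 (W i).1 _ (HD [:: i] isT).2).
  by move=> n; apply: plane_aeS (W i).2 => p e tp; rewrite e.
exists f; split => //.
- by move=> i; split; [exact: (W i).1|exact: cW].
(* [pderivs] applies the last index of the word first, so an inner derivative is appended at the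
   end. *)
- move=> i; exists (fun n => pderiv i (f n)), (fun w => if w is [::] then wd i else D (rcons w i)).
  split; [by []|by move=> n; exact: smooth_pderiv|move=> w sw].
  have E n : pderivs w (pderiv i (f n)) = pderivs (rcons w i) (f n) by rewrite /pderivs foldr_rcons.
  have -> : (fun n => pderivs w (pderiv i (f n))) = fun n => pderivs (rcons w i) (f n) by apply/funext.
  case: w sw {E} => [|j w] sw; first by split; [exact: (W i).1|exact: cW].
  by apply: HD; rewrite size_rcons.
- have sd i n : smooth (pderiv i (f n)) by exact: smooth_pderiv.
  have Cd i n := smooth_C1 (sd i n).
  have tr i k : exists2 w, is_trace ((t, k) : side S) (wd i) w &
      cvL2 leb `[0, 1] (fun n s => pderiv i (f n) (side_point ((t, k) : side S) s)) w.
    have H2 j := HD [:: j; i] isT.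
    have [w [Lw cw]] := @trace_exists R (corner S t) (jac_corner t) (fun n => pderiv i (f n)) (wd i)
      (fun j => D [:: j; i]) k (Cd i) (W i).1 (fun j => (H2 j).1) (cW i) (fun j => (H2 j).2).
    exists w => //; split; first exact: Lw.1.
    exists (fun n => pderiv i (f n)), (fun j => D [:: j; i]); split => //; exact: cW.
  split; last by move=> i k; have [w tw _] := tr i k; exact: edge_trace_is_trace tw.
  split => // i k; have [w tw cw] := tr i k; set h := ((t, k) : side S).
  have ms n : measurable_fun (`[0, 1]%classic : set (measurableTypeR R)) (fun s => pderiv i (f n) (side_point h s)).
    apply: measurable_funTS; apply: continuous_measurable_fun.
    apply: (@continuous_side_comp R (corner S t) (pderiv i (f n)) k); exact: (Cd i n).1.
  have ew := edge_trace_ae (h := h) (W i).1 tw.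
  apply: (@cvL2_ext _ _ R leb _ (@segI R) _ _ w (edge_trace h (wd i)) ms ms (is_trace_L2 tw).1 (edge_trace_L2 h (wd i)).1 _ cw).
  by move=> n; apply: leb_aeS ew => s e s01; rewrite e.
Qed.

(** [phi] is continuous only within the triangle; clamping the parameter gives a continuous function
    on the whole line with the same values on the segment. *)
Lemma continuous_side_clamp k : continuous (fun s : R => phi (side_point ((t, k) : side S) (Num.max 0 (Num.min 1 s)))).
Proof.
move=> s; set cl := fun s : R => Num.max 0 (Num.min 1 s).
have ccl : continuous cl.
  move=> x; apply: continuous_max; first exact: cst_continuous.
  by apply: continuous_min; [exact: cst_continuous|exact: cvg_id].
have cl01 x : cl x \in (`[0, 1] : interval R).
  by rewrite in_itv/= /cl le_max lexx/= ge_max ler01 ge_min lexx.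
pose ga x := side_point ((t, k) : side S) (cl x).
have cga : continuous ga.
  by move=> x; apply: continuous_comp; [exact: ccl|exact: (@continuous_side R (corner S t) k)].
have gaT x : triangle t (ga x) by exact: (@side_point_in R S ((t, k) : side S) (cl x) (cl01 x)).
have := (subspace_continuousP _ _).1 cphi (ga s) (gaT s).
move=> H; apply: cvg_trans H => A /= HA.
have : nbhs s (ga @^-1` [set p | triangle t p -> A (phi p)]) by apply: cga; exact: HA.
by apply: filterS => x /(_ (gaT x)).
Qed.

Lemma clamp01 (s : R) : s \in (`[0, 1] : interval R) -> Num.max 0 (Num.min 1 s) = s.
Proof. by rewrite in_itv/= => /andP[s0 s1]; rewrite (min_idPr s1) (max_idPr s0). Qed.

Lemma phi_side_L2 k : L2 leb `[0, 1] (fun s => phi (side_point ((t, k) : side S) s)).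
Proof.
have [m f] := continuous_L2_segment (@continuous_side_clamp k).
split.
  apply: eq_measurable_fun m => s; rewrite inE => s01; by rewrite clamp01.
rewrite (@eq_sqint _ _ R leb _ _ (fun s => phi (side_point ((t, k) : side S) (Num.max 0 (Num.min 1 s))))) => //.
by move=> s; rewrite inE => s01; rewrite clamp01.
Qed.

Lemma phi_side_cvL2 (f : nat -> R * R -> R) k : (forall n, smooth (f n)) ->
  (forall e : R, 0 < e -> exists N, forall n, (N <= n)%N -> forall p, triangle t p -> `|f n p - phi p| <= e) ->
  cvL2 leb `[0, 1] (fun n s => f n (side_point ((t, k) : side S) s)) (fun s => phi (side_point ((t, k) : side S) s)).
Proof.
move=> sf H; set h := ((t, k) : side S).
apply/fine_cvgP.
have Lf n : L2 leb `[0, 1] (fun s => f n (side_point h s) - phi (side_point h s)).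
  apply: (L2B (@segI R)); last exact: phi_side_L2.
  apply: continuous_L2_segment; apply: (@continuous_side_comp R (corner S t) (f n) k).
  exact: (smooth_C1 (sf n)).1.
have E n : sqint leb `[0, 1] (fun s => f n (side_point h s) - phi (side_point h s)) =
    (\int[leb]_(s in `[0, 1]) ((f n (side_point h s) - phi (side_point h s)) ^+ 2))%:E by exact: sqint_fin.
split; first by apply: nearW => n; rewrite E.
rewrite (_ : _ \o _ = fun n => \int[leb]_(s in `[0, 1]) ((f n (side_point h s) - phi (side_point h s)) ^+ 2)); last first.
  by apply/funext => n /=; rewrite E.
apply/cvgrPdist_le => e e0.
have [|N HN] := H (Num.sqrt e); first by rewrite sqrtr_gt0.
exists N => // n /= Nn; rewrite sub0r normrN ger0_norm; last by apply: Rintegral_ge0 => s _; exact: sqr_ge0.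
have : (sqint leb `[0%R, 1%R] (fun s => f n (side_point h s) - phi (side_point h s))%R <= sqint leb `[0%R, 1%R] (fun _ => Num.sqrt e))%E.
  apply: (@le_sqint _ _ R leb _ (@segI R) (fun s => f n (side_point h s) - phi (side_point h s)) (fun=> Num.sqrt e) (Lf n).1 (measurable_cst _)).
  move=> s s01; rewrite (ger0_norm (sqrtr_ge0 e)); apply: HN => //.
  exact: (@side_point_in R S h s s01).
rewrite E /sqint; rewrite (eq_integral (fun _ => e%:E)); last by move=> x _; rewrite sqr_sqrtr// ltW.
by rewrite integral_cst//= lebesgue_measure_itv/= lte01 oppr0 adde0 mule1 lee_fin.
Qed.

(** The derivative of [phi] with respect to the parameter of the side, defined through the traces of
    the weak gradient. *)
Definition side_deriv (k : 'I_3) (s : R) : R :=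
  \sum_i edge_trace ((t, k) : side S) (wd i) s * side_vec ((t, k) : side S) 0 i.

Lemma side_deriv_L2 k : L2 leb `[0, 1] (side_deriv k).
Proof.
rewrite (_ : side_deriv k = fun s => side_vec ((t, k) : side S) 0 0 * edge_trace ((t, k) : side S) (wd 0) s
  + side_vec ((t, k) : side S) 0 1 * edge_trace ((t, k) : side S) (wd 1) s); last first.
  by apply/funext => s; rewrite /side_deriv sum2; apply: (congr2 +%R); exact: mulrC.
by apply: (L2D (@segI R)); apply: (L2Z (@segI R)); exact: edge_trace_L2.
Qed.

Lemma side_deriv_cv (f : nat -> R * R -> R) k : (forall n, smooth (f n)) ->
  (forall i, cvL2 leb `[0, 1] (fun n s => pderiv i (f n) (side_point ((t, k) : side S) s))
         (edge_trace ((t, k) : side S) (wd i))) ->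
  cvL2 leb `[0, 1] (fun n s => dir_deriv (f n) (edge (corner S t) k) (side_point ((t, k) : side S) s)) (side_deriv k).
Proof.
move=> sf H; set h := ((t, k) : side S); set e := edge (corner S t) k.
have mf i n : measurable_fun (`[0, 1]%classic : set (measurableTypeR R)) (fun s => pderiv i (f n) (side_point h s)).
  apply: measurable_funTS; apply: continuous_measurable_fun.
  apply: (@continuous_side_comp R (corner S t) (pderiv i (f n)) k).
  exact: (smooth_C1 (smooth_pderiv i (sf n))).1.
have me i := (edge_trace_L2 h (wd i)).1.
have mZ (a : R) g : measurable_fun (`[0, 1]%classic : set (measurableTypeR R)) g ->
    measurable_fun (`[0, 1]%classic : set (measurableTypeR R)) (fun s => a * g s).
  by move=> mg; apply: measurable_funM mg; exact: measurable_cst.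
have c0 := cvL2Z (@segI R) e.1 (mf 0) (me 0) (H 0).
have c1 := cvL2Z (@segI R) e.2 (mf 1) (me 1) (H 1).
have := cvL2D (@segI R) (fun n => mZ e.1 _ (mf 0 n)) (fun n => mZ e.2 _ (mf 1 n)) (mZ e.1 _ (me 0)) (mZ e.2 _ (me 1)) c0 c1.
rewrite (_ : (fun x => _ + _) = side_deriv k); first exact.
by apply/funext => s; rewrite /side_deriv sum2 !side_vecE/= mulrC [X in _ + X]mulrC.
Qed.
End Sobolev2.

Section ByParts.
Context (R : realType) (S : triangulation R) (t : tri S) (phi : R * R -> R).
Hypothesis sphi : sobolev 2 (open_triangle t) phi.
Hypothesis cphi : {within triangle t, continuous phi}.
Notation mu := (plane_measure R).
Notation leb := (@lebesgue_measure R).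
Local Notation T := (open_triangle t).
Local Notation wd i := (weak_pderiv (open_triangle t) i phi).
Local Notation sd k := ((t, k) : side S).

Lemma uniform_cvg (f : nat -> R * R -> R) p :
  (forall e : R, 0 < e -> exists N, forall n, (N <= n)%N -> forall p, triangle t p -> `|f n p - phi p| <= e) ->
  triangle t p -> (fun n => f n p) @ \oo --> phi p.
Proof.
move=> H tp; apply/cvgrPdist_le => e e0; have [N HN] := H e e0.
by exists N => // n /= Nn; rewrite distrC; exact: HN.
Qed.

Lemma side_is_derive (f : R * R -> R) k s : C1 f ->
  is_derive s (1 : R) (fun s => f (side_point (sd k) s)) (dir_deriv f (edge (corner S t) k) (side_point (sd k) s)).
Proof.
move=> Cf; rewrite (_ : (fun s => _) = fun s => f (corner S t (k + 1) + s *: edge (corner S t) k)).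
  by rewrite twin_side_line; exact: C1_line.
by apply/funext => x; rewrite twin_side_line.
Qed.

Lemma continuous_side_dir (f : R * R -> R) k : C1 f ->
  continuous (fun s => dir_deriv f (edge (corner S t) k) (side_point (sd k) s)).
Proof.
move=> Cf; apply: (@continuous_side_comp R (corner S t) (dir_deriv f (edge (corner S t) k)) k).
exact: continuous_dir_deriv.
Qed.

Lemma in01_0 : (0 : R) \in (`[0, 1] : interval R).
Proof. by rewrite in_itv/= lexx ler01. Qed.

Lemma in01_1 : (1 : R) \in (`[0, 1] : interval R).
Proof. by rewrite in_itv/= lexx ler01. Qed.

(** True for the smooth approximations by the fundamental theorem of calculus. The end values pass
    to the limit by uniform convergence, the integrals by L^2 convergence. *)
Lemma side_by_parts k (v : {poly R}) :
  \int[leb]_(s in `[0, 1]) (side_deriv t phi k s * v.[s]) =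
  phi (side_point (sd k) 1) * v.[1] - phi (side_point (sd k) 0) * v.[0]
  - \int[leb]_(s in `[0, 1]) (phi (side_point (sd k) s) * v^`().[s]).
Proof.
have [f [sf _ _ _ [[cs unif] _]]] := sobolev2_data sphi cphi.
have Cf n := smooth_C1 (sf n).
have cph := phi_side_cvL2 cphi k sf unif.
have csd := side_deriv_cv sf (fun i => cs i k).
have Lv (q : {poly R}) : L2 leb `[0, 1] (fun s => q.[s]) := continuous_L2_segment (@continuous_horner R q).
have cfs n : continuous (fun s => f n (side_point (sd k) s)).
  apply: (@continuous_side_comp R (corner S t) (f n) k); exact: (Cf n).1.
have I1 := cvL2_int (@segI R) (fun n => continuous_L2_segment (@continuous_side_dir (f n) k (Cf n))) (side_deriv_L2 t phi k) (Lv v) csd.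
have I2 := cvL2_int (@segI R) (fun n => continuous_L2_segment (cfs n)) (phi_side_L2 cphi k) (Lv v^`()) cph.
have ev n : \int[leb]_(s in `[0, 1]) (dir_deriv (f n) (edge (corner S t) k) (side_point (sd k) s) * v.[s]) =
   f n (side_point (sd k) 1) * v.[1] - f n (side_point (sd k) 0) * v.[0]
   - \int[leb]_(s in `[0, 1]) (f n (side_point (sd k) s) * v^`().[s]).
  have ca : continuous (fun s => dir_deriv (f n) (edge (corner S t) k) (side_point (sd k) s) * v.[s]).
    by move=> s; apply: cvgM; [exact: (@continuous_side_dir (f n) k (Cf n))|exact: continuous_horner].
  have cb : continuous (fun s => f n (side_point (sd k) s) * v^`().[s]).
    by move=> s; apply: cvgM; [exact: cfs|exact: continuous_horner].
  have cab : continuous (fun s => dir_deriv (f n) (edge (corner S t) k) (side_point (sd k) s) * v.[s] + f n (side_point (sd k) s) * v^`().[s]).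
    by move=> s; apply: cvgD; [exact: ca|exact: cb].
  apply/eqP; rewrite eq_sym subr_eq eq_sym -segment_intD//; apply/eqP.
  pose F s := f n (side_point (sd k) s) * v.[s].
  have dF s : is_derive s (1 : R) F (dir_deriv (f n) (edge (corner S t) k) (side_point (sd k) s) * v.[s] + f n (side_point (sd k) s) * v^`().[s]).
    have D1 := side_is_derive k s (Cf n); have D2 := is_derive_poly v s.
    have := is_deriveM D1 D2; rewrite /F => D; apply: is_derive_eq D _.
    by rewrite addrC; congr (_ + _); rewrite /GRing.scale/= mulrC.
  by rewrite /Rintegral (@ftc_line R F _ 0 1 ler01 dF cab).
have := cvg_lim (@Rhausdorff R) I1 => <-; apply: cvg_lim; first exact: Rhausdorff.
rewrite (funext ev); apply: cvgB => //; apply: cvgB; apply: cvgM; try exact: cvg_cst.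
- by apply: uniform_cvg => //; apply: (@side_point_in R S (sd k)); exact: in01_1.
- by apply: uniform_cvg => //; apply: (@side_point_in R S (sd k)); exact: in01_0.
Qed.

(** The same limit argument, tested with the indicator function of the interval from 0 to [b]. *)
Lemma side_primitive k b : b \in (`[0, 1] : interval R) ->
  \int[leb]_(s in `[0, b]) side_deriv t phi k s = phi (side_point (sd k) b) - phi (side_point (sd k) 0).
Proof.
move=> b01; have [f [sf _ _ _ [[cs unif] _]]] := sobolev2_data sphi cphi.
have Cf n := smooth_C1 (sf n).
have csd := side_deriv_cv sf (fun i => cs i k).
have mb : measurable (`[0, b]%classic : set (measurableTypeR R)) by exact: measurable_itv.
have fin01 : (leb `[0%R, 1%R]%classic < +oo)%E by rewrite lebesgue_measure_itv/= lte01 ltry.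
have Li : L2 leb `[0, 1] (\1_(`[0, b]%classic) : R -> R).
  apply: (@L2_bounded _ _ R leb _ (@segI R) _ 1); first exact: fin01.
    exact: measurable_indic.
  by move=> s _; rewrite indicE; case: (_ \in _); rewrite ?normr1 ?normr0 ?ler01.
have I1 := cvL2_int (@segI R) (fun n => continuous_L2_segment (@continuous_side_dir (f n) k (Cf n))) (side_deriv_L2 t phi k) Li csd.
have res (g : R -> R) : \int[leb]_(s in `[0, 1]) (g s * \1_(`[0, b]%classic) s) = \int[leb]_(s in `[0, b]) g s.
  rewrite -[in RHS](_ : `[0, 1] `&` `[0, b] = `[0, b])%classic.
    by rewrite Rintegral_mkcondr patch_indic.
  apply/seteqP; split=> [x [] //|x xb]; split => //; move: xb b01; rewrite /= !in_itv/=.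
  by move=> /andP[-> xb] /andP[_ b1]; rewrite (le_trans xb b1).
rewrite res in I1.
have ev n : \int[leb]_(s in `[0, 1]) (dir_deriv (f n) (edge (corner S t) k) (side_point (sd k) s) * \1_(`[0, b]%classic) s) =
   f n (side_point (sd k) b) - f n (side_point (sd k) 0).
  rewrite res; have b0 : 0 <= b by move: b01; rewrite in_itv/= => /andP[].
  by rewrite /Rintegral (@ftc_line R _ _ 0 b b0 (fun s => side_is_derive k s (Cf n)) (@continuous_side_dir (f n) k (Cf n))).
have := cvg_lim (@Rhausdorff R) I1 => <-; apply: cvg_lim; first exact: Rhausdorff.
rewrite (funext ev); apply: cvgB.
- by apply: uniform_cvg => //; exact: (@side_point_in R S (sd k)).
- by apply: uniform_cvg => //; apply: (@side_point_in R S (sd k)); exact: in01_0.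
Qed.

(** By [side_primitive] the restriction is the primitive of an integrable function, so Lebesgue's
    differentiation theorem gives a classical derivative almost everywhere. *)
Lemma side_derive_ae k : {ae leb, forall s : R, `[0, 1]%classic s ->
  0 < s < 1 /\ is_derive s (1 : R) (fun s => phi (side_point (sd k) s)) (side_deriv t phi k s)}.
Proof.
set w := side_deriv t phi k; pose wr := w \_ `[0, 1]%classic.
have Lw : L2 leb `[0, 1] w := side_deriv_L2 t phi k.
have fin01 : (leb `[0%R, 1%R]%classic < +oo)%E by rewrite lebesgue_measure_itv/= lte01 ltry.
have iw : leb.-integrable `[0, 1] (EFin \o w) by exact: (L2_integrable (@segI R) fin01 Lw).
have iwr : leb.-integrable setT (EFin \o wr).
  by rewrite -restrict_EFin; apply/(integrable_mkcond _ (@segI R)).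
have lw : locally_integrable [set: R] wr by exact: (integrable_locally (@segI R) iw).
have H := @FTC1 R wr (BLeft 0) (fun y => @integrableS _ _ R leb setT _ _ measurableT (measurable_itv _) (@subsetT _ _) iwr) lw.
(* The endpoints are discarded because a two-sided derivative needs a neighbourhood inside the
   segment. *)
have ends : {ae leb, forall s, s != 0 /\ s != 1}.
  exists [set 0; 1]; split.
  - by apply: measurableU; exact: measurable_set1.
  - apply/eqP; rewrite -measure_le0; apply: (le_trans (measureU2 _ _ _)).
    + exact: measurable_set1.
    + exact: measurable_set1.
    suff : (leb [set 0%R] + leb [set 1%R] <= 0)%E by [].
    by rewrite !lebesgue_measure_set1 adde0.
  - move=> x /= nx; apply: contrapT => xN; apply: nx; split; apply/eqP => e; apply: xN; [left|right] => //.
apply: leb_aeS2 H ends => s H [s0 s1] /=; rewrite in_itv/= => /andP[s0' s1'].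
have s01 : 0 < s < 1 by rewrite !lt_neqAle eq_sym s0 s0' s1 s1'.
split; first exact: s01.
have lt0 : ((0 : R)%:E < s%:E)%E by rewrite lte_fin; case/andP: s01.
have [dF F's] := H lt0.
set F := fun x => _ in dF F's.
have FE x : x \in (`[0, 1] : interval R) -> F x = phi (side_point (sd k) x) - phi (side_point (sd k) 0).
  move=> x01; rewrite -side_primitive// /F; apply: eq_Rintegral => y; rewrite inE/= in_itv/= => /andP[y0 yx].
  rewrite /wr patchE mem_set//= in_itv/= y0/=; apply: (le_trans yx); by move: x01; rewrite in_itv/= => /andP[].
have dF' : is_derive s (1 : R) F (w s).
  apply: DeriveDef => //; rewrite -derive1E F's /wr patchE mem_set//= in_itv/=.
  by case/andP: s01 => /ltW -> /ltW ->.
have dG : is_derive s (1 : R) (fun x => F x + phi (side_point (sd k) 0)) (w s).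
  have := is_deriveD dF' (is_derive_cst (phi (side_point (sd k) 0)) s (1 : R)).
  by rewrite addr0.
apply: near_eq_is_derive dG.
have : \forall x \near s, x \in (`]0, 1[ : interval R) by apply: near_in_itvoo; rewrite in_itv.
apply: filterS => x; rewrite in_itv/= => /andP[x0 x1].
by rewrite FE ?subrK// in_itv/= !ltW.
Qed.

(** Green's formula for the approximations. The interior terms converge in L^2 of the triangle, the
    boundary terms by uniform convergence. *)
Lemma tri_by_parts v m0 (b : R * R -> R) : is_poly m0 b ->
  \int[mu]_(p in T) ((v.1 * wd 0 p + v.2 * wd 1 p) * b p) =
  (- \int[mu]_(p in T) (phi p * dir_deriv b v p))
  - (\sum_k cross (edge (corner S t) k) v *
      \int[leb]_(s in `[0, 1]) (phi (side_point (sd k) s) * b (side_point (sd k) s))).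
Proof.
move=> pb; have Cb := (is_poly_C1 pb).1.
have mT : measurable (open_triangle t : set (plane R)) := measurable_open_triangle t.
have [f [sf cf cd _ [[_ unif] _]]] := sobolev2_data sphi cphi.
have Cf n := smooth_C1 (sf n).
have cL (g : R * R -> R) : continuous g -> L2 mu T g := @continuous_L2 R (corner S t) (jac_corner t) g.
have mg (g : R * R -> R) (cg : continuous g) : measurable_fun T g := (cL g cg).1.
have mZ (a : R) (g : R * R -> R) : measurable_fun T g -> measurable_fun T (fun p => a * g p).
  by move=> m; apply: measurable_funM m; exact: measurable_cst.
have cdi i n : continuous (pderiv i (f n)) := (smooth_C1 (smooth_pderiv i (sf n))).1.
have c0 := @cvL2Z _ (plane R) R mu T mT _ _ v.1 (fun n => mg _ (cdi 0 n)) (cd 0).1 (cd 0).2.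
have c1 := @cvL2Z _ (plane R) R mu T mT _ _ v.2 (fun n => mg _ (cdi 1 n)) (cd 1).1 (cd 1).2.
have c2 := @cvL2D _ (plane R) R mu T mT _ _ _ _ (fun n => mZ v.1 _ (mg _ (cdi 0 n))) (fun n => mZ v.2 _ (mg _ (cdi 1 n)))
  (mZ v.1 _ (cd 0).1) (mZ v.2 _ (cd 1).1) c0 c1.
have Ld m : L2 mu T (fun p => v.1 * pderiv 0 (f m) p + v.2 * pderiv 1 (f m) p).
  exact: (cL _ (@continuous_dir_deriv R (f m) v (Cf m))).
have mw : measurable_fun T (fun p => v.1 * wd 0 p + v.2 * wd 1 p).
  by apply: measurable_funD; apply: mZ; [exact: (cd 0).1|exact: (cd 1).1].
have Lw := (@cvL2P _ (plane R) R mu T mT _ _ Ld mw c2).1.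
have I1 := @cvL2_int _ (plane R) R mu T mT _ _ _ Ld Lw (cL _ Cb.1) c2.
have I2 := @cvL2_int _ (plane R) R mu T mT _ _ _ (fun n => cL _ (Cf n).1) (sobolev_L2 sphi)
  (cL _ (@continuous_dir_deriv R b v Cb)) cf.
have cs (g : R * R -> R) k : continuous g -> continuous (fun s => g (side_point (sd k) s)).
  by move=> cg; exact: (@continuous_side_comp R (corner S t) g k).
have I3 k := cvL2_int (@segI R) (fun n => continuous_L2_segment (cs _ k (Cf n).1)) (phi_side_L2 cphi k)
  (continuous_L2_segment (cs _ k Cb.1)) (phi_side_cvL2 cphi k sf unif).
have := cvg_lim (@Rhausdorff R) I1 => <-; apply: cvg_lim; first exact: Rhausdorff.
rewrite (_ : (fun n => _) = fun n => (- \int[mu]_(p in T) (f n p * dir_deriv b v p))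
  - (\sum_k cross (edge (corner S t) k) v *
      \int[leb]_(s in `[0, 1]) (f n (side_point (sd k) s) * b (side_point (sd k) s)))); last first.
  by apply/funext => n; exact: (@Green_mul R (corner S t) (jac_corner t) (f n) b v (Cf n) Cb).
apply: cvgB; first by apply: cvgN.
rewrite sum3; rewrite (_ : (fun n => _) = fun n => cross (edge (corner S t) 0) v *
      \int[leb]_(s in `[0, 1]) (f n (side_point (sd 0) s) * b (side_point (sd 0) s)) +
    cross (edge (corner S t) 1) v *
      \int[leb]_(s in `[0, 1]) (f n (side_point (sd 1) s) * b (side_point (sd 1) s)) +
    cross (edge (corner S t) 2) v *
      \int[leb]_(s in `[0, 1]) (f n (side_point (sd 2) s) * b (side_point (sd 2) s))); last first.
  by apply/funext => n; rewrite sum3.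
by apply: cvgD; [apply: cvgD|]; apply: cvgM; [exact: cvg_cst|exact: I3|exact: cvg_cst|exact: I3|exact: cvg_cst|exact: I3].
Qed.
End ByParts.

Section SmoothLin.
Context (R : realType).

Lemma pderivsL w (x y : R) (f g : R * R -> R) : smooth f -> smooth g ->
  pderivs w (fun p => x * f p + y * g p) = fun p => x * pderivs w f p + y * pderivs w g p.
Proof.
move=> sf sg; elim: w => [//|i w IH]; rewrite -[LHS]/(pderiv i (pderivs w _)) IH.
have C (f' : R * R -> R) : smooth f' -> C1 (pderivs w f').
  move=> sf'; apply: smooth_C1 => v; have := sf' (v ++ w); by rewrite /pderivs foldr_cat.
have [Cf df] := C1Z x (C _ sf); have [Cg dg] := C1Z y (C _ sg).
by apply/funext => p; rewrite (C1D Cf Cg).2 df dg.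
Qed.

Lemma smoothL (x y : R) (f g : R * R -> R) : smooth f -> smooth g -> smooth (fun p => x * f p + y * g p).
Proof.
move=> sf sg w; rewrite pderivsL//.
have C (f' : R * R -> R) : smooth f' -> C1 (pderivs w f').
  move=> sf'; apply: smooth_C1 => v; have := sf' (v ++ w); by rewrite /pderivs foldr_cat.
have [Cf _] := C1Z x (C _ sf); have [Cg _] := C1Z y (C _ sg).
have [[c d] _] := C1D Cf Cg; split; [exact: c|by move=> i; exact: (d i).1].
Qed.
End SmoothLin.

Section SobolevLin.
Context (R : realType) (S : triangulation R).
Notation mu := (plane_measure R).
Notation leb := (@lebesgue_measure R).

Lemma L2_cvg_lin (t : tri S) (x y : R) (f g : nat -> R * R -> R) (a b c : R * R -> R) :
  (forall n, smooth (f n)) -> (forall n, smooth (g n)) ->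
  measurable_fun (open_triangle t) a -> measurable_fun (open_triangle t) b ->
  (forall p, open_triangle t p -> c p = x * a p + y * b p) ->
  L2_cvg (open_triangle t) f a -> L2_cvg (open_triangle t) g b ->
  measurable_fun (open_triangle t) c /\ L2_cvg (open_triangle t) (fun n p => x * f n p + y * g n p) c.
Proof.
move=> sf sg ma mb cE cf cg; have mT : measurable (open_triangle t : set (plane R)) := measurable_open_triangle t.
have mf (h : R * R -> R) : smooth h -> measurable_fun (open_triangle t) h.
  by move=> sh; apply: continuous_measurable_prod => //; exact: (smooth_C1 sh).1.
have mZ (z : R) h : measurable_fun (open_triangle t) (h : plane R -> R) -> measurable_fun (open_triangle t) (fun p => z * h p).
  by move=> m; apply: measurable_funM m; exact: measurable_cst.
have mc : measurable_fun (open_triangle t) c.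
  apply: (@eq_measurable_fun _ _ (plane R) (measurableTypeR R) _ (fun p => x * a p + y * b p)).
    by move=> p; rewrite inE => tp; rewrite cE.
  by apply: measurable_funD; exact: mZ.
split; first exact: mc.
have c0 := @cvL2Z _ (plane R) R mu _ mT _ _ x (fun n => mf _ (sf n)) ma cf.
have c1 := @cvL2Z _ (plane R) R mu _ mT _ _ y (fun n => mf _ (sg n)) mb cg.
have c2 := @cvL2D _ (plane R) R mu _ mT _ _ _ _ (fun n => mZ x _ (mf _ (sf n))) (fun n => mZ y _ (mf _ (sg n)))
  (mZ x _ ma) (mZ y _ mb) c0 c1.
have mfg n : measurable_fun (open_triangle t) (fun p => x * f n p + y * g n p).
  by apply: measurable_funD; apply: mZ; exact: mf.
have mab : measurable_fun (open_triangle t) (fun p => x * a p + y * b p).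
  by apply: measurable_funD; exact: mZ.
apply: (@cvL2_ext _ (plane R) R mu _ mT _ _ _ c mfg mfg mab mc _ c2).
by move=> n; apply: aeW => p tp; rewrite cE.
Qed.

Lemma sobolev_lin k (t : tri S) (x y : R) (a b c : R * R -> R) : sobolev k (open_triangle t) a -> sobolev k (open_triangle t) b ->
  (forall p, open_triangle t p -> c p = x * a p + y * b p) -> sobolev k (open_triangle t) c.
Proof.
move=> [f [D [D0 sf HD]]] [g [E [E0 sg HE]]] cE.
exists (fun n p => x * f n p + y * g n p), (fun w => if w is [::] then c else fun p => x * D w p + y * E w p).
split; [by []|by move=> n; exact: smoothL|move=> w sw].
have [mD cD] := HD w sw; have [mE cE'] := HE w sw.
have sw' (h : R * R -> R) : smooth h -> smooth (pderivs w h).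
  by move=> sh v; have := sh (v ++ w); rewrite /pderivs foldr_cat.
rewrite (_ : (fun n => pderivs w _) = fun n p => x * pderivs w (f n) p + y * pderivs w (g n) p); last first.
  by apply/funext => n; exact: pderivsL.
apply: (L2_cvg_lin _ _ mD mE _ cD cE') => [n|n|p tp]; [exact: sw'|exact: sw'|].
by case: w sw {mD cD mE cE' sw'} => [|i w] sw //; rewrite D0 E0 cE.
Qed.

Lemma is_trace_lin (h : side S) (x y : R) (a b c : R * R -> R) (wa wb : R -> R) :
  measurable_fun (open_triangle h.1) a -> measurable_fun (open_triangle h.1) b ->
  is_trace h a wa -> is_trace h b wb ->
  (forall p, open_triangle h.1 p -> c p = x * a p + y * b p) ->
  is_trace h c (fun s => x * wa s + y * wb s).
Proof.
move=> ma mb [mwa [f [F [sf cf cF cwa]]]] [mwb [g [G [sg cg cG cwb]]]] cE.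
have mZ (z : R) (w : R -> R) : measurable_fun (`[0, 1]%classic : set (measurableTypeR R)) w ->
    measurable_fun (`[0, 1]%classic : set (measurableTypeR R)) (fun s => z * w s).
  by move=> mg; apply: measurable_funM mg; exact: measurable_cst.
split; first by apply: measurable_funD; exact: mZ.
exists (fun n p => x * f n p + y * g n p), (fun i p => x * F i p + y * G i p); split.
- by move=> n; exact: smoothL.
- exact: (L2_cvg_lin sf sg ma mb cE cf cg).2.
- move=> i; have [mF cF'] := cF i; have [mG cG'] := cG i.
  rewrite (_ : (fun n => pderiv i _) = fun n p => x * pderiv i (f n) p + y * pderiv i (g n) p); last first.
    by apply/funext => n; have := @pderivsL R [:: i] x y _ _ (sf n) (sg n).
  exact: (L2_cvg_lin (fun n => smooth_pderiv i (sf n)) (fun n => smooth_pderiv i (sg n)) mF mG (fun p _ => erefl) cF' cG').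
- have mf (q : R * R -> R) : smooth q -> measurable_fun (`[0, 1]%classic : set (measurableTypeR R)) (fun s => q (side_point h s)).
    move=> sq; apply: measurable_funTS; apply: continuous_measurable_fun.
    apply: (@continuous_side_comp R (corner S h.1) q h.2); exact: (smooth_C1 sq).1.
  have c0 := cvL2Z (@segI R) x (fun n => mf _ (sf n)) mwa cwa.
  have c1 := cvL2Z (@segI R) y (fun n => mf _ (sg n)) mwb cwb.
  exact: (cvL2D (@segI R) (fun n => mZ x _ (mf _ (sf n))) (fun n => mZ y _ (mf _ (sg n))) (mZ x _ mwa) (mZ y _ mwb) c0 c1).
Qed.
End SobolevLin.

(** * The deformation of a vector field in the Euclidean metric *)

Section Deformation.
Context (R : realType) (S : triangulation R) (g : tens_field S).
Hypothesis gE : metric_eq g (euclidean S).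
Notation mu := (plane_measure R).
Notation leb := (@lebesgue_measure R).
Implicit Types (u : R * R -> 'rV[R]_2).
Local Notation wd t i u j := (weak_pderiv (open_triangle (S := S) t) i (fun q => u q 0 j)).

(** The Euclidean metric has zero derivatives inside the triangle, so the Lie derivative reduces to
    the symmetric gradient. *)
Lemma def_opE u t p i j : open_triangle t p ->
  def_op g u t p i j = 2^-1 * wd t i u j p + 2^-1 * wd t j u i p.
Proof.
move=> tp; have tp' := open_triangle_sub tp.
have E a b c : pderiv a (fun q => g t q b c) p = 0.
  rewrite -[RHS]((C1_cst ((1%:M : 'M[R]_2) b c)).2 a p).
  apply: near_eq_derive; have : nbhs p (open_triangle t) by apply: open_nbhs_nbhs; split => //; exact: open_interior.
  by apply: filterS => q tq; rewrite gE//; exact: open_triangle_sub.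
rewrite /def_op mxE sum2 !E gE// /euclidean !mxE.
have [W WE] : exists W : 'I_2 -> 'I_2 -> R, forall k l, wd t k u l p = W k l by exists (fun k l => wd t k u l p).
rewrite !WE; move: (u p 0 0) (u p 0 1) => e f {E WE}.
by elim/ord2P: i; elim/ord2P: j; rewrite /= ?mulr1n ?mulr0n; ring.
Qed.

(** The conditions of [U_space] that concern single triangles. *)
Definition regular u := (forall t j, sobolev 2 (open_triangle (S := S) t) (fun p => u p 0 j)) /\
  forall t j, {within triangle (S := S) t, continuous (fun p => u p 0 j)}.

Lemma def_op_sobolev u t i j : regular u -> sobolev 1 (open_triangle t) (fun p => def_op g u t p i j).
Proof.
move=> [su cu].
have sw k l : sobolev 1 (open_triangle t) (wd t k u l).
  by have [f [_ _ _ h _]] := sobolev2_data (su t l) (cu t l); exact: h.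
by apply: (sobolev_lin (sw i j) (sw j i)) => p tp; exact: def_opE.
Qed.

Lemma def_op_sym u t p : open_triangle t p -> (def_op g u t p)^T = def_op g u t p.
Proof. by move=> tp; apply/matrixP => i j; rewrite mxE (def_opE _ _ _ tp) (def_opE _ _ _ tp); exact: addrC. Qed.

Lemma sym_contract (E W : 'I_2 -> 'I_2 -> R) (x : 'I_2 -> R) :
  (forall i j, E i j = 2^-1 * W i j + 2^-1 * W j i) ->
  \sum_i \sum_j E i j * x i * x j = \sum_j x j * \sum_i W i j * x i.
Proof. by move=> h; rewrite !sum2 !h; field. Qed.

Lemma def_tens_trace u (h : side S) : regular u -> {ae leb, forall s, `[0, 1]%classic s ->
  tens_trace (def_op g u) h (side_vec h) (side_vec h) s =
  \sum_j side_vec h 0 j * side_deriv h.1 (fun p => u p 0 j) h.2 s}.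
Proof.
case: h => t k [su cu]; set h := ((t, k) : side S).
have tr i j : measurable_fun (open_triangle t) (wd t i u j) /\
    is_trace h (wd t i u j) (edge_trace h (wd t i u j)).
  have [f [_ _ m _ [_ tr]]] := sobolev2_data (su t j) (cu t j).
  by split; [exact: (m i).1|exact: tr].
have E i j : {ae leb, forall s, `[0, 1]%classic s -> edge_trace h (fun p => def_op g u t p i j) s =
    2^-1 * edge_trace h (wd t i u j) s + 2^-1 * edge_trace h (wd t j u i) s}.
  apply: edge_trace_ae; first exact: sobolev_measurable (def_op_sobolev t i j (conj su cu)).
  apply: (is_trace_lin (h := h) (tr i j).1 (tr j i).1 (tr i j).2 (tr j i).2) => p tp; exact: def_opE.
have E0 := leb_aeS2 (fun s a b => conj a b) (E 0 0) (E 0 1).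
have E1 := leb_aeS2 (fun s a b => conj a b) (E 1 0) (E 1 1).
apply: leb_aeS2 E0 E1 => s [h00 h01] [h10 h11] s01.
apply: sym_contract => i j; elim/ord2P: i; elim/ord2P: j; [exact: h00|exact: h01|exact: h10|exact: h11].
Qed.

Lemma def_side_comp u t k p : open_triangle t p ->
  side_comp t k (def_op g u t p) =
  \sum_j side_vec ((t, k) : side S) 0 j *
    ((edge (corner S t) k).1 * wd t 0 u j p + (edge (corner S t) k).2 * wd t 1 u j p).
Proof.
move=> tp; rewrite side_compE !sum2 !(def_opE _ _ _ tp) !side_vecE/=.
have [W WE] : exists W : 'I_2 -> 'I_2 -> R, forall k l, wd t k u l p = W k l by exists (fun k l => wd t k u l p).
rewrite !WE.
move: (edge (corner S t) k).1 (edge (corner S t) k).2 => x y; by field.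
Qed.

Hypothesis planarS : planar S.

Lemma twin_corner (h h' : side S) : twin h h' ->
  corner S h.1 (h.2 + 1) = corner S h'.1 (h'.2 + 2) /\ corner S h.1 (h.2 + 2) = corner S h'.1 (h'.2 + 1).
Proof.
have [P [PE _]] := planarS.
by move=> /andP[/eqP e1 /eqP e2]; rewrite !PE e1 e2.
Qed.

Lemma twin_side_point (h h' : side S) s : twin h h' -> side_point h s = side_point h' (1 - s).
Proof.
by move=> /twin_corner[e1 e2]; rewrite /side_point e1 e2 addrC; congr (_ *: _ + _); ring.
Qed.

Lemma twin_side_vec (h h' : side S) : twin h h' -> side_vec h = - side_vec h'.
Proof. by move=> /twin_corner[e1 e2]; rewrite /side_vec e1 e2 opprB. Qed.

(** Twin sides are the same segment of the plane traversed in opposite directions, and [u] is one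
    function on the plane. So the derivatives along the two sides are opposite wherever both exist,
    and the opposite edge vectors compensate the sign. *)
Lemma def_op_Sigma u : regular u -> Sigma_space (def_op g u).
Proof.
move=> ru; case: (ru) => su cu; split.
- by move=> t i j; exact: def_op_sobolev.
- by move=> t; apply: aeW => p tp; exact: def_op_sym.
- move=> h h' hh'.
  have D j (k : side S) := side_derive_ae (su k.1 j) (cu k.1 j) k.2.
  have key j : {ae leb, forall s, `[0, 1]%classic s -> side_deriv h.1 (fun p => u p 0 j) h.2 s =
      - side_deriv h'.1 (fun p => u p 0 j) h'.2 (1 - s)}.
    apply: leb_aeS2 (D j h) (segment_ae_rev (D j h')) => s /[swap] H2 /[swap] s01 /(_ s01)[s01' D1].
    have [_ D2] := H2 s01.
    have D3 : is_derive s (1 : R) (fun x => u (side_point h' (1 - x)) 0 j) (- side_deriv h'.1 (fun p => u p 0 j) h'.2 (1 - s)).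
      have D2' : is_derive (1 - s) (1 : R) (fun x => u (side_point h' x) 0 j) (side_deriv h'.1 (fun p => u p 0 j) h'.2 (1 - s)).
        by case: (h') D2.
      have := @is_derive1_comp R (fun x => u (side_point h' x) 0 j) (fun x : R => 1 - x) s _ (-1) D2'.
      rewrite mulrN1; apply; by have := is_deriveB (is_derive_cst (1 : R) s (1 : R)) (is_derive_id s (1 : R)); rewrite sub0r.
    have E : (fun x => u (side_point h' (1 - x)) 0 j) = fun x => u (side_point h x) 0 j.
      by apply/funext => x; rewrite (twin_side_point x hh').
    rewrite E in D3; have [_ <-] := D3; have [_ <-] := D1.
    by case: (h).
  have T1 := leb_aeS2 (fun s a b => conj a b) (def_tens_trace h ru) (segment_ae_rev (def_tens_trace h' ru)).
  have T2 := leb_aeS2 (fun s a b => conj a b) (key 0) (key 1).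
  apply: leb_aeS2 T1 T2 => s [e1 e2] [k0 k1] s01.
  rewrite (e1 s01) (e2 s01); apply: eq_bigr => j _.
  have -> : side_vec h 0 j = - side_vec h' 0 j by rewrite (twin_side_vec hh') mxE.
  have K : side_deriv h.1 (fun p => u p 0 j) h.2 s = - side_deriv h'.1 (fun p => u p 0 j) h'.2 (1 - s).
    by elim/ord2P: j; [exact: k0|exact: k1].
  by rewrite [X in _ * X]K mulrNN.
Qed.
End Deformation.

(** * Unisolvence of the degrees of freedom for tensors *)

Section SigmaUnique.
Context (R : realType) (S : triangulation R) (r : nat).
Notation mu := (plane_measure R).
Notation leb := (@lebesgue_measure R).
Implicit Types (sigma sh : tens_field S).

Lemma sub_eq0 (a b : R) : a = 0 -> b = 0 -> a - b = 0.
Proof. by move=> -> ->; rewrite subrr. Qed.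

Lemma Sigmah_poly sh : Sigmah_space r sh -> exists F : tri S -> 'I_2 -> 'I_2 -> R * R -> R,
  (forall t i j, is_poly r.+1 (F t i j)) /\
  forall t i j, {ae mu, forall p, open_triangle t p -> sh t p i j = F t i j p}.
Proof.
move=> [_ ph].
have H t i j : exists F, is_poly r.+1 F /\ {ae mu, forall p, open_triangle t p -> sh t p i j = F p}.
  by have [F pF aF] := ph t i j; exists F.
exists (fun t i j => sval (cid (H t i j))); split=> t i j; have := svalP (cid (H t i j)); by case.
Qed.

Lemma side_compB t k (A B : 'M[R]_2) : side_comp (S := S) t k (A - B) = side_comp t k A - side_comp t k B.
Proof. by rewrite -[A - _]addrC -scaleN1r side_comp_lin; ring. Qed.

Lemma tens_poly_traceE F (h : side S) s : tens_poly_trace F h (side_vec h) (side_vec h) s =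
  side_comp h.1 h.2 (\matrix_(i, j) F h.1 i j (side_point h s)).
Proof. by rewrite side_compE /tens_poly_trace; case: h => t k; rewrite !sum2 !mxE; ring. Qed.

(** Let q be a component of the difference. On an edge q is orthogonal to itself, hence zero. So q =
    lam_k b with b of degree r - 1; testing with b makes the integral of lam_k b^2 vanish, and b =
    0. *)
Lemma sigma_dofs_unique sigma sh1 sh2 : Sigma_space sigma -> Sigmah_space r sh1 -> Sigmah_space r sh2 ->
  sigma_dofs r sigma sh1 -> sigma_dofs r sigma sh2 ->
  forall t, {ae mu, forall p, open_triangle t p -> sh1 t p = sh2 t p}.
Proof.
move=> Ss S1 S2 [d1 e1] [d2 e2].
have [F1 [p1 a1]] := Sigmah_poly S1; have [F2 [p2 a2]] := Sigmah_poly S2.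
have m1 t i j : measurable_fun (open_triangle t) (fun p => sh1 t p i j) := (Sigma_comp_L2 t i j S1.1).1.
have m2 t i j : measurable_fun (open_triangle t) (fun p => sh2 t p i j) := (Sigma_comp_L2 t i j S2.1).1.
have t1 h := tens_trace_poly h p1 m1 a1; have t2 h := tens_trace_poly h p2 m2 a2.
pose D t p : 'M[R]_2 := \matrix_(i, j) F1 t i j p - \matrix_(i, j) F2 t i j p.
pose q t k p := side_comp t k (D t p).
have pq t k : is_poly r.+1 (q t k).
  apply: (@is_poly_ext _ _ (fun p => \sum_i \sum_j (side_vec ((t, k) : side S) 0 i * side_vec ((t, k) : side S) 0 j) * (F1 t i j p - F2 t i j p))).
    by move=> p; rewrite /q side_compE !sum2 !mxE.
  by apply: is_poly_sum => i; apply: is_poly_sum => j; apply: is_polyZ; exact: is_polyB.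
pose tr sh (h : side S) := tens_trace sh h (side_vec h) (side_vec h).
have trq h : {ae leb, forall s, `[0, 1]%classic s -> tr sh1 h s - tr sh2 h s = q h.1 h.2 (side_point h s)}.
  apply: leb_aeS2 (t1 h) (t2 h) => s h1 h2 s01.
  by rewrite /tr h1// h2// !tens_poly_traceE /q /D side_compB.
have sideq h : exists2 Q : {poly R}, (size Q <= r.+1)%N & forall s, q h.1 h.2 (side_point h s) = Q.[s].
  by have [Q sQ QE] := is_poly_side (corner S h.1) h.2 (pq h.1 h.2); exists Q.
have Lt sh h : L2 leb `[0, 1] (tr sh h) := tens_trace_L2 sh h (side_vec h) (side_vec h).
have zero_rep h : h \in edges S -> forall s, q h.1 h.2 (side_point h s) = 0.
  move=> he s; have [Q sQ QE] := sideq h; rewrite QE.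
  have cQ := @continuous_horner _ Q.
  have iQ sh := L2_poly_integrable (Lt sh h) cQ.
  have LB : L2 leb `[0, 1] (fun s => tr sh1 h s - tr sigma h s) := L2B (@segI R) (Lt sh1 h) (Lt sigma h).
  have LB2 : L2 leb `[0, 1] (fun s => tr sh2 h s - tr sigma h s) := L2B (@segI R) (Lt sh2 h) (Lt sigma h).
  have I0 : \int[leb]_(s in `[0, 1]) (1 * Q.[s] * Q.[s]) = 0.
    apply: (eq_trans _ (sub_eq0 (e1 h he Q sQ) (e2 h he Q sQ))).
    rewrite -(@RintegralB _ _ R leb _ _ _ (@segI R) (L2_poly_integrable LB cQ) (L2_poly_integrable LB2 cQ)).
    have mQ : measurable_fun (`[0, 1]%classic : set (measurableTypeR R)) (fun s => Q.[s]) by exact: (continuous_L2_segment cQ).1.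
    apply: segment_Rintegral_ae.
    - by apply: (measurable_funM _ mQ); apply: (measurable_funM _ mQ); exact: measurable_cst.
    - by apply: measurable_funB; apply: (measurable_funM _ mQ); [exact: LB.1|exact: LB2.1].
    - apply: leb_aeS (trq h) => x hx x01; move: (hx x01); rewrite QE /tr.
      move: (tens_trace sh1 _ _ _ _) (tens_trace sh2 _ _ _ _) (tens_trace sigma _ _ _ _) => a b c <-; ring.
  have := @segment_weight_eq0 R (fun=> 1) (@cst_continuous _ _ (1 : R)) (fun _ _ => ler01 : 0 <= (1 : R)) (fun _ _ => ltr01 : 0 < (1 : R)) Q I0.
  by move=> ->; rewrite horner0.
(* The moments are given on one side of each edge only; the other side follows from tangential
   continuity. *)
have zero h : forall s, s \in (`[0, 1] : interval R) -> q h.1 h.2 (side_point h s) = 0.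
  have [he|he] := boolP (h \in edges S); first by move=> s _; exact: zero_rep.
  have [h' hh'] := notin_edges he; have h'e : h' \in edges S by rewrite (twin_edges hh').
  apply: segment_ae_eq.
  - exact: (@continuous_side_poly R S _ _ h (pq h.1 h.2)).
  - exact: cst_continuous.
  - have [[_ _ w1] _] := S1; have [[_ _ w2] _] := S2.
    apply: leb_aeS2 (leb_aeS2 (fun s a b => conj a b) (w1 h h' hh') (w2 h h' hh'))
      (leb_aeS2 (fun s a b => conj a b) (trq h) (segment_ae_rev (trq h'))) => s [x1 x2] [y1 y2] s01.
    by rewrite -(y1 s01) /tr (x1 s01) (x2 s01) -/(tr sh1 h' (1 - s)) -/(tr sh2 h' (1 - s)) (y2 s01) zero_rep.
have q0 t k p : triangle t p -> q t k p = 0.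
  have [b pb qb] := is_poly_factor_lam (jac_corner t) (pq t k) (zero (t, k)).
  move=> tp; rewrite qb; suff -> : b p = 0 by rewrite mulr0.
  have cb := poly_continuous pb.
  have mT : measurable (open_triangle t : set (plane R)) := measurable_open_triangle t.
  have Lc sh (H : Sigma_space sh) := side_comp_L2 k (fun i j => Sigma_comp_L2 t i j H).
  have LB := @L2B _ (plane R) R mu _ mT _ _ (Lc _ S1.1) (Lc _ Ss).
  have LB2 := @L2B _ (plane R) R mu _ mT _ _ (Lc _ S2.1) (Lc _ Ss).
  apply: (@tri_weight_eq0 R S t (lam (corner S t) k)) tp.
  - exact: (is_poly_C1 (is_poly_lam _ _)).1.1.
  - by move=> x /(open_triP (jac_corner t)) /(_ k).
  - exact: pb.
  apply: (eq_trans _ (sub_eq0 (d1 t k b pb) (d2 t k b pb))).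
  rewrite -(@RintegralB _ (plane R) R mu _ _ _ mT (L2_tri_integrable LB cb) (L2_tri_integrable LB2 cb)).
  have mb : measurable_fun (open_triangle t) b := poly_measurable pb.
  have ml : measurable_fun (open_triangle t) (lam (corner S t) k) := poly_measurable (is_poly_lam _ k).
  apply: Rintegral_ae_eq.
  - by apply: (measurable_funM _ mb); exact: measurable_funM ml mb.
  - by apply: measurable_funB; apply: (measurable_funM _ mb); [exact: LB.1|exact: LB2.1].
  - have E0 := plane_aeS2 (fun p a b => conj a b) (a1 t 0 0) (a1 t 0 1).
    have E1 := plane_aeS2 (fun p a b => conj a b) (a1 t 1 0) (a1 t 1 1).
    have E2 := plane_aeS2 (fun p a b => conj a b) (a2 t 0 0) (a2 t 0 1).
    have E3 := plane_aeS2 (fun p a b => conj a b) (a2 t 1 0) (a2 t 1 1).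
    apply: plane_aeS2 (plane_aeS2 (fun p a b => conj a b) E0 E1) (plane_aeS2 (fun p a b => conj a b) E2 E3).
    move=> x [[x1 x2] [x3 x4]] [[y1 y2] [y3 y4]] tx.
    have M1 : \matrix_(i, j) F1 t i j x = sh1 t x.
      by apply/matrixP => i j; rewrite mxE; elim/ord2P: i; elim/ord2P: j; rewrite ?x1 ?x2 ?x3 ?x4.
    have M2 : \matrix_(i, j) F2 t i j x = sh2 t x.
      by apply/matrixP => i j; rewrite mxE; elim/ord2P: i; elim/ord2P: j; rewrite ?y1 ?y2 ?y3 ?y4.
    rewrite -qb /q /D M1 M2 side_compB.
    move: (side_comp _ _ (sh1 t x)) (side_comp _ _ (sh2 t x)) (side_comp _ _ (sigma t x)) (b x) => a c d e; ring.
move=> t.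
have [[_ s1 _] _] := S1; have [[_ s2 _] _] := S2.
have E0 := plane_aeS2 (fun p a b => conj a b) (a1 t 0 0) (a1 t 0 1).
have E1 := plane_aeS2 (fun p a b => conj a b) (a1 t 1 0) (a1 t 1 1).
have E2 := plane_aeS2 (fun p a b => conj a b) (a2 t 0 0) (a2 t 0 1).
have E3 := plane_aeS2 (fun p a b => conj a b) (a2 t 1 0) (a2 t 1 1).
have E4 := plane_aeS2 (fun p a b => conj a b) (s1 t) (s2 t).
apply: plane_aeS2 E4 (plane_aeS2 (fun p a b => conj a b) (plane_aeS2 (fun p a b => conj a b) E0 E1) (plane_aeS2 (fun p a b => conj a b) E2 E3)).
move=> x [z1 z2] [[[x1 x2] [x3 x4]] [[y1 y2] [y3 y4]]] tx.
have M1 : \matrix_(i, j) F1 t i j x = sh1 t x.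
  by apply/matrixP => i j; rewrite mxE; elim/ord2P: i; elim/ord2P: j; rewrite ?x1 ?x2 ?x3 ?x4.
have M2 : \matrix_(i, j) F2 t i j x = sh2 t x.
  by apply/matrixP => i j; rewrite mxE; elim/ord2P: i; elim/ord2P: j; rewrite ?y1 ?y2 ?y3 ?y4.
apply/eqP; rewrite -subr_eq0; apply/eqP; rewrite [LHS](sym_tensor_decomp t).
  apply: big1 => k _; have := q0 t k x (open_triangle_sub tx); rewrite /q /D M1 M2 => ->.
  by rewrite scale0r.
by rewrite linearB/= z1// z2.
Qed.
End SigmaUnique.

Lemma sub_eq (R : realType) (a b : R) : a = b -> a - b = 0.
Proof. by move=> ->; exact: subrr. Qed.

(** * Moments of a deformation in terms of the vector field *)

Section DefDofs.
Context (R : realType) (S : triangulation R) (g : tens_field S) (r : nat).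
Hypothesis gE : metric_eq g (euclidean S).
Notation mu := (plane_measure R).
Notation leb := (@lebesgue_measure R).
Implicit Types (u : R * R -> 'rV[R]_2).
Local Notation wd t i u j := (weak_pderiv (open_triangle (S := S) t) i (fun q => u q 0 j)).

(** The conditions that define [pi_U], for single components, freed from the metric, and imposed on
    both sides of every edge. *)
Definition vector_dofs u uh := [/\ forall (t : tri S) k, uh (corner S t k) = u (corner S t k),
  forall (h : side S) j (v : {poly R}), (size v <= r)%N ->
    \int[leb]_(s in `[0, 1]) ((uh (side_point h s) 0 j - u (side_point h s) 0 j) * v.[s]) = 0 &
  forall (t : tri S) j b, is_poly r.-1 b ->
    \int[mu]_(p in open_triangle t) ((uh p 0 j - u p 0 j) * b p) = 0].

Let edge_grad u (t : tri S) k j p := (edge (corner S t) k).1 * wd t 0 u j p + (edge (corner S t) k).2 * wd t 1 u j p.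

Lemma edge_grad_L2 u t k j : regular S u -> L2 mu (open_triangle t) (edge_grad u t k j).
Proof.
move=> [su cu]; have [f [_ _ _ sw _]] := sobolev2_data (su t j) (cu t j).
have mT : measurable (open_triangle t : set (plane R)) := measurable_open_triangle t.
have LZ i a := @L2Z _ (plane R) R mu _ mT a _ (sobolev_L2 (sw i)).
exact: (@L2D _ (plane R) R mu _ mT _ _ (LZ 0 _) (LZ 1 _)).
Qed.

(** For [b] of degree r - 1, integration by parts leaves interior moments against a derivative of
    degree r - 2 and edge moments against restrictions of degree r - 1. *)
Lemma edge_grad_dofs u uh t k j b : regular S u -> regular S uh -> vector_dofs u uh -> is_poly r b ->
  \int[mu]_(p in open_triangle t) (edge_grad uh t k j p * b p) =
  \int[mu]_(p in open_triangle t) (edge_grad u t k j p * b p).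
Proof.
move=> [su cu] [suh cuh] [_ dE dI] pb.
apply: (eq_trans (tri_by_parts (suh t j) (cuh t j) _ pb)).
apply: (eq_trans _ (esym (tri_by_parts (su t j) (cu t j) _ pb))).
have mT : measurable (open_triangle t : set (plane R)) := measurable_open_triangle t.
have pd : is_poly r.-1 (dir_deriv b (edge (corner S t) k)).
  have [_ pdb] := is_poly_C1 pb.
  by apply: is_polyD; apply: is_polyZ; exact: pdb.
have cd := poly_continuous pd.
have -> : \int[mu]_(p in open_triangle t) (uh p 0 j * dir_deriv b (edge (corner S t) k) p) =
    \int[mu]_(p in open_triangle t) (u p 0 j * dir_deriv b (edge (corner S t) k) p).
  apply/eqP; rewrite -subr_eq0.
  rewrite -(@RintegralB _ (plane R) R mu _ _ _ mT (L2_tri_integrable (sobolev_L2 (suh t j)) cd) (L2_tri_integrable (sobolev_L2 (su t j)) cd)).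
  by rewrite -[X in _ == X](dI t j _ pd); apply/eqP/eq_Rintegral => p _; rewrite mulrBl.
congr (_ - _); apply: eq_bigr => l _; congr (_ * _).
have [q sq qE] := is_poly_side (corner S t) l pb.
have cq := @continuous_horner _ q.
have qE' s : b (side_point ((t, l) : side S) s) = q.[s] by exact: qE.
apply/eqP; rewrite -subr_eq0.
have E (w : R * R -> 'rV[R]_2) : \int[leb]_(s in `[0, 1]) (w (side_point ((t, l) : side S) s) 0 j * b (side_point ((t, l) : side S) s)) =
    \int[leb]_(s in `[0, 1]) (w (side_point ((t, l) : side S) s) (0 : 'I_1) j * q.[s]).
  by apply: eq_Rintegral => s _; rewrite qE'.
rewrite !E.
rewrite -(@RintegralB _ _ R leb _ _ _ (@segI R) (L2_poly_integrable (phi_side_L2 (cuh t j) l) cq) (L2_poly_integrable (phi_side_L2 (cu t j) l) cq)).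
by rewrite -[X in _ == X](dE (t, l) j _ sq); apply/eqP/eq_Rintegral => p _; rewrite mulrBl.
Qed.

(** The boundary terms are values at vertices, and differentiating [v] lowers its degree from r to r
    - 1. *)
Lemma side_deriv_dofs u uh (t : tri S) k j (v : {poly R}) : regular S u -> regular S uh -> vector_dofs u uh ->
  (size v <= r.+1)%N ->
  \int[leb]_(s in `[0, 1]) (side_deriv t (fun p => uh p 0 j) k s * v.[s]) =
  \int[leb]_(s in `[0, 1]) (side_deriv t (fun p => u p 0 j) k s * v.[s]).
Proof.
move=> [su cu] [suh cuh] [dV dE _] sv.
apply: (eq_trans (side_by_parts (suh t j) (cuh t j) k v)).
apply: (eq_trans _ (esym (side_by_parts (su t j) (cu t j) k v))).
have e0 : side_point ((t, k) : side S) 0 = corner S t (k + 1) by rewrite /side_point subr0 scale1r scale0r addr0.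
have e1 : side_point ((t, k) : side S) 1 = corner S t (k + 2) by rewrite /side_point subrr scale1r scale0r add0r.
rewrite e0 e1 !dV; congr (_ - _); apply/eqP; rewrite -subr_eq0.
have cq := @continuous_horner _ v^`().
have sd : (size v^`() <= r)%N.
  have [->|v0] := eqVneq v 0; first by rewrite deriv0 size_poly0.
  by rewrite -ltnS (leq_trans _ sv)// lt_size_deriv.
rewrite -(@RintegralB _ _ R leb _ _ _ (@segI R) (L2_poly_integrable (phi_side_L2 (cuh t j) k) cq) (L2_poly_integrable (phi_side_L2 (cu t j) k) cq)).
by rewrite -[X in _ == X](dE (t, k) j _ sd); apply/eqP/eq_Rintegral => p _; rewrite mulrBl.
Qed.

Lemma def_op_dofs u uh : regular S u -> regular S uh -> vector_dofs u uh ->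
  sigma_dofs r (def_op g u) (def_op g uh).
Proof.
move=> ru ruh d; split.
- move=> t k b pb; have cb := poly_continuous pb.
  have mT : measurable (open_triangle t : set (plane R)) := measurable_open_triangle t.
  pose x j := side_vec ((t, k) : side S) 0 j.
  have iG w j (rw : regular S w) := L2_tri_integrable (edge_grad_L2 t k j rw) cb.
  have iZ w j (rw : regular S w) := @integrableZl _ (plane R) R mu _ mT (x j) _ (iG w j rw).
  have E w : regular S w -> \int[mu]_(p in open_triangle t) (side_comp t k (def_op g w t p) * b p) =
      x 0 * \int[mu]_(p in open_triangle t) (edge_grad w t k 0 p * b p) +
      x 1 * \int[mu]_(p in open_triangle t) (edge_grad w t k 1 p * b p).
    move=> rw.
    rewrite -(@RintegralZl _ (plane R) R mu _ _ (x 0) mT (iG w 0 rw)) -(@RintegralZl _ (plane R) R mu _ _ (x 1) mT (iG w 1 rw)).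
    rewrite -(@RintegralD _ (plane R) R mu _ _ _ mT (iZ w 0 rw) (iZ w 1 rw)).
    apply: eq_Rintegral => p; rewrite inE => tp; rewrite (def_side_comp gE _ _ tp) sum2 -!/(edge_grad w t k _ p) -!/(x _).
    by move: (edge_grad w t k 0 p) (edge_grad w t k 1 p) (x 0) (x 1) => a c e f; ring.
  have Lc w (rw : regular S w) := side_comp_L2 k (fun i j => sobolev_L2 (def_op_sobolev gE t i j rw)).
  apply: (eq_trans (y := \int[mu]_(p in open_triangle t) (side_comp t k (def_op g uh t p) * b p) -
    \int[mu]_(p in open_triangle t) (side_comp t k (def_op g u t p) * b p))).
    rewrite -(@RintegralB _ (plane R) R mu _ _ _ mT (L2_tri_integrable (Lc _ ruh) cb) (L2_tri_integrable (Lc _ ru) cb)).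
    by apply: eq_Rintegral => p _; rewrite mulrBl.
  apply: sub_eq; apply: (eq_trans (E uh ruh)); apply: (eq_trans _ (esym (E u ru))).
  by apply: (congr2 (fun a b => x 0 * a + x 1 * b)); exact: edge_grad_dofs.
- move=> h he v sv; have cv := @continuous_horner _ v.
  case: h he => t k he; pose h := ((t, k) : side S); pose x j := side_vec h 0 j.
  have iG (w : R * R -> 'rV[R]_2) (j : 'I_2) := L2_poly_integrable (side_deriv_L2 t (fun p => w p (0 : 'I_1) j) k) cv.
  have iZ (w : R * R -> 'rV[R]_2) (j : 'I_2) := @integrableZl _ _ R leb _ (@segI R) (x j) _ (iG w j).
  have Lt (w : R * R -> 'rV[R]_2) := L2_poly_integrable (tens_trace_L2 (def_op g w) h (side_vec h) (side_vec h)) cv.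
  have mv : measurable_fun (`[0, 1]%classic : set (measurableTypeR R)) (fun s => v.[s]) := (continuous_L2_segment cv).1.
  have E (w : R * R -> 'rV[R]_2) : regular S w -> \int[leb]_(s in `[0, 1]) (tens_trace (def_op g w) h (side_vec h) (side_vec h) s * v.[s]) =
      x 0 * \int[leb]_(s in `[0, 1]) (side_deriv t (fun p => w p 0 0) k s * v.[s]) +
      x 1 * \int[leb]_(s in `[0, 1]) (side_deriv t (fun p => w p 0 1) k s * v.[s]).
    move=> rw.
    rewrite -(@RintegralZl _ _ R leb _ _ (x 0) (@segI R) (iG w 0)) -(@RintegralZl _ _ R leb _ _ (x 1) (@segI R) (iG w 1)).
    rewrite -(@RintegralD _ _ R leb _ _ _ (@segI R) (iZ w 0) (iZ w 1)).
    apply: segment_Rintegral_ae.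
    + by apply: measurable_funM mv; exact: (tens_trace_L2 (def_op g w) h (side_vec h) (side_vec h)).1.
    + have md (j : 'I_2) := (side_deriv_L2 t (fun p => w p (0 : 'I_1) j) k).1.
      by apply: measurable_funD; apply: measurable_funM; [exact: measurable_cst|exact: measurable_funM (md 0) mv|exact: measurable_cst|exact: measurable_funM (md 1) mv].
    + apply: leb_aeS (def_tens_trace gE h rw) => s e s01; rewrite (e s01) sum2 -!/(x _) /=.
      by move: (side_deriv t (fun p => w p 0 0) k s) (side_deriv t (fun p => w p 0 1) k s) (x 0) (x 1) => a b c f; ring.
  apply: (eq_trans (y := \int[leb]_(s in `[0, 1]) (tens_trace (def_op g uh) h (side_vec h) (side_vec h) s * v.[s]) -
    \int[leb]_(s in `[0, 1]) (tens_trace (def_op g u) h (side_vec h) (side_vec h) s * v.[s]))).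
    rewrite -(@RintegralB _ _ R leb _ _ _ (@segI R) (Lt uh) (Lt u)).
    by apply: eq_Rintegral => p _; rewrite mulrBl.
  apply: sub_eq; apply: (eq_trans (E uh ruh)); apply: (eq_trans _ (esym (E u ru))).
  by apply: (congr2 (fun a b => x 0 * a + x 1 * b)); exact: side_deriv_dofs.
Qed.
End DefDofs.

(** * Planar triangulations *)

Section PlanarGeometry.
Context (R : realType) (S : triangulation R).
Hypothesis planarS : planar S.
Notation mu := (plane_measure R).

Lemma vtx_inj (t : tri S) : injective (vtx S t).
Proof. by case: S t. Qed.

Lemma side_inj (h h' : side S) : vtx S h.1 (h.2 + 1) = vtx S h'.1 (h'.2 + 1) ->
  vtx S h.1 (h.2 + 2) = vtx S h'.1 (h'.2 + 2) -> h = h'.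
Proof. by case: S h h' => ve tr vt co H1 H2 H3 H4 H5 H6 h h' /= e1 e2; apply: (H4 h h'); rewrite e1 e2. Qed.

Lemma tri_vertices_inj (t t' : tri S) : (forall k, vtx S t k \in codom (vtx S t')) -> t = t'.
Proof.
move=> h; have i := @vtx_inj t; have i' := @vtx_inj t'.
case: S t t' h i i' => ve tr vt co H1 H2 H3 H4 H5 H6 t t' /= h i i'; apply: (H2).
apply/eqP; rewrite eqEcard !card_imset// leqnn andbT; apply/fintype.subsetP => z /imsetP[k _ ->].
by have /codomP[k' ->] := h k; apply/imsetP; exists k'.
Qed.

Lemma ord3_add2 (k : 'I_3) : [/\ k + 1 + 1 = k + 2, k + 1 + 2 = k, k + 2 + 1 = k & k + 2 + 2 = k + 1].
Proof. by split; apply: val_inj; elim/ord3P: k. Qed.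

Lemma sum_codom (V : zmodType) (t : tri S) (F : vert S -> V) :
  (forall z, F z != 0 -> z \in codom (vtx S t)) -> \sum_z F z = \sum_k F (vtx S t k).
Proof.
move=> h; rewrite (bigID (mem (codom (vtx S t))))/= [X in _ + X]big1 ?addr0; last first.
  by move=> z zt; apply/eqP; apply: contraNT zt => /h.
rewrite (eq_bigl (mem [set vtx S t k | k in 'I_3]%SET)); last first.
  by move=> z /=; apply/codomP/imsetP => [[k ->]|[k _ ->]]; [exists k|exists k].
by rewrite big_imset//= => k k' _ _; exact: vtx_inj.
Qed.

(** Planarity writes [p] as a convex combination of common vertices; by uniqueness of barycentric
    coordinates these weights are its coordinates in both triangles. *)
Lemma planar_weights (t t' : tri S) p : triangle t p -> triangle t' p ->
  exists l : vert S -> R, [/\ forall k, lam (corner S t) k p = l (vtx S t k),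
    forall k, lam (corner S t') k p = l (vtx S t' k) &
    forall z, l z != 0 -> (z \in codom (vtx S t)) && (z \in codom (vtx S t'))].
Proof.
have [P [PE cap]] := planarS => tp tp'; have [l [l0 ls l1 lp]] := cap t t' p tp tp'.
have E (s : tri S) : (forall z, l z != 0 -> z \in codom (vtx S s)) ->
    forall k, lam (corner S s) k p = l (vtx S s k).
  move=> h k; rewrite lp (@sum_codom _ s); last first.
    by move=> z nz; apply: h; apply: contraNneq nz => ->; rewrite scale0r.
  rewrite (eq_bigr (fun k => l (vtx S s k) *: corner S s k)); last by move=> j _; rewrite PE.
  by rewrite (lam_comb (jac_corner s))// -l1 (sum_codom h).
by exists l; split => //; apply: E => z /ls /andP[].
Qed.

(** At an interior point of [t] all three coordinates are nonzero, so all three vertices of [t]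
    belong to [t']. *)
Lemma open_triangle_disj (t t' : tri S) p : open_triangle t p -> triangle t' p -> t = t'.
Proof.
move=> tp tp'; have [l [E _ ls]] := planar_weights (open_triangle_sub tp) tp'.
apply: tri_vertices_inj => k; have /andP[] // : (vtx S t k \in codom (vtx S t)) && (vtx S t k \in codom (vtx S t')).
by apply: ls; rewrite -E gt_eqF//; move/(open_triP (jac_corner t)): tp => /(_ k).
Qed.

(** Both ends of the side are vertices of [t']. If [t'] traverses the edge in the same direction it
    is [t], since a directed edge determines its triangle; otherwise the two sides are twins. *)
Lemma side_neighbour (t t' : tri S) k p : triangle t p -> triangle t' p ->
  lam (corner S t) (k + 1) p != 0 -> lam (corner S t) (k + 2) p != 0 ->
  t = t' \/ exists k', twin ((t, k) : side S) (t', k').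
Proof.
move=> tp tp'; have [l [E _ ls]] := planar_weights tp tp'.
rewrite !E => /ls/andP[_ /codomP[i ei]] /ls/andP[_ /codomP[j ej]].
have ij : i != j.
  apply: contra_eq_neq (ei) => ->; rewrite -ej.
  by apply/eqP => /vtx_inj/eqP; elim/ord3P: k {ei ej}; rewrite ?ord3D ord3_neq.
have [ji|ji] : j = i + 1 \/ j = i + 2.
  by elim/ord3P: i ij {ei}; elim/ord3P: j {ej}; rewrite ?eqxx ?ord3D //; auto.
- left; have := @side_inj (t, k) (t', i + 2) => /=; have [_ _ -> ->] := ord3_add2 i.
  by rewrite ei ej ji => /(_ erefl erefl) [].
- by right; exists (i + 1); rewrite /twin/=; have [-> -> _ _] := ord3_add2 i; rewrite ei ej ji !eqxx.
Qed.

(** The choice of a triangle matters only where several meet, and [glueE] makes it irrelevant once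
    the pieces agree; outside the union the value is 0. *)
Definition glue (F : tri S -> R * R -> R) (p : R * R) : R :=
  if [pick t | `[< triangle t p >]] is Some t then F t p else 0.

Lemma side_pt_lam (t : tri S) k p : lam (corner S t) k p = 0 ->
  side_point ((t, k) : side S) (lam (corner S t) (k + 2) p) = p.
Proof. exact: (side_ptK (jac_corner t)). Qed.

Lemma corner_lam1 (t : tri S) k p : lam (corner S t) (k + 1) p = 0 -> lam (corner S t) (k + 2) p = 0 ->
  p = corner S t k.
Proof.
move=> h1 h2; rewrite [LHS](lam_baryc (jac_corner t) p).
have := sum_lam (jac_corner t) p; rewrite !sum3.
by elim/ord3P: k h1 h2; rewrite ?ord3D => -> ->; rewrite ?add0r ?addr0 => ->; rewrite !scale0r scale1r ?add0r ?addr0.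
Qed.

(** By the number of vanishing barycentric coordinates [p] is a vertex, lies inside an edge, or is
    interior. Triangles may share just a vertex, so their values there are compared through
    [phi]. *)
Lemma glue_agree (F : tri S -> R * R -> R) (phi : R * R -> R) :
  (forall t k, F t (corner S t k) = phi (corner S t k)) ->
  (forall h h' : side S, twin h h' -> forall s, F h.1 (side_point h s) = F h'.1 (side_point h' (1 - s))) ->
  forall t t' p, triangle t p -> triangle t' p -> F t p = F t' p.
Proof.
move=> Fv Ft t t' p tp tp'.
have vertex k : lam (corner S t) (k + 1) p = 0 -> lam (corner S t) (k + 2) p = 0 -> F t p = F t' p.
  move=> h1 h2; have pk := corner_lam1 h1 h2.
  have [l [E _ ls]] := planar_weights tp tp'.
  have /ls/andP[_ /codomP[j ej]] : l (vtx S t k) != 0.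
    by rewrite -E pk (lam_corner (jac_corner t)) eqxx oner_eq0.
  have [P [PE _]] := planarS; have pj : p = corner S t' j by rewrite pk !PE ej.
  by rewrite [in LHS]pk Fv -pk pj Fv.
have edge k : lam (corner S t) k p = 0 -> F t p = F t' p.
  move=> h0; have [h1|h1] := eqVneq (lam (corner S t) (k + 1) p) 0.
    by apply: (vertex (k + 2)); have [_ _ e1 e2] := ord3_add2 k; rewrite ?e1 ?e2.
  have [h2|h2] := eqVneq (lam (corner S t) (k + 2) p) 0.
    by apply: (vertex (k + 1)); have [e1 e2 _ _] := ord3_add2 k; rewrite ?e1 ?e2.
  have [->//|[k' tw]] := side_neighbour tp tp' h1 h2.
  have := Ft _ _ tw (lam (corner S t) (k + 2) p); rewrite -(twin_side_point planarS _ tw).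
  by rewrite side_pt_lam.
have [h0|h0] := eqVneq (lam (corner S t) 0 p) 0; first exact: edge h0.
have [h1|h1] := eqVneq (lam (corner S t) 1 p) 0; first exact: edge h1.
have [h2|h2] := eqVneq (lam (corner S t) 2 p) 0; first exact: edge h2.
suff tpo : open_triangle t p by rewrite (open_triangle_disj tpo tp').
apply/(open_triP (jac_corner t)) => k; rewrite lt_neqAle eq_sym.
by move/(tri_setP (jac_corner t)): tp => /(_ k) ->; rewrite andbT; elim/ord3P: k.
Qed.

Lemma glueE (F : tri S -> R * R -> R) : (forall t t' p, triangle t p -> triangle t' p -> F t p = F t' p) ->
  forall t p, triangle t p -> glue F p = F t p.
Proof.
move=> h t p tp; rewrite /glue; case: pickP => [t' /asboolP tp'|/(_ t)]; first exact: h.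
by move=> /negbT/asboolPn.
Qed.

Lemma open_triangle_domain (t : tri S) : open_triangle t `<=` domain S.
Proof. by apply: interiorS => p tp; exists t. Qed.

Lemma domain_triangle p : domain S p -> exists t : tri S, triangle t p.
Proof. by move=> /interior_subset[t _ tp]; exists t. Qed.

(** No other triangle contains the point, and triangles are closed, so near it there is only [t].
    Were it interior to the union, it would be interior to [t], where no barycentric coordinate
    vanishes. *)
Lemma boundary_not_domain (h : side S) s : boundary_side h -> 0 < s < 1 -> ~ domain S (side_point h s).
Proof.
case: h => t k bh s01; set p := side_point _ s.
have [l0 l1 l2] := side_point_lam ((t, k) : side S) s; rewrite -/p/= in l0 l1 l2.
have tp : triangle t p by apply: side_point_in; rewrite in_itv/=; lra.
move=> Dp.
have far (t' : tri S) : t' != t -> \forall q \near p, ~ triangle t' q.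
  move=> tt'; have : open (~` triangle t') by apply: closed_openC; exact: (@closed_tri_set R (corner S t') (jac_corner t')).
  move=> o; apply: (open_nbhs_nbhs (conj o _)) => tp'.
  have [e|[k' tw]] : t = t' \/ exists k', twin ((t, k) : side S) (t', k').
  - by apply: (side_neighbour tp tp'); rewrite ?l1 ?l2; apply/eqP; lra.
  - by rewrite e eqxx in tt'.
  - by move/forallP: bh => /(_ (t', k')); rewrite tw.
have far' : \forall q \near p, forall t', t' != t -> ~ triangle t' q.
  apply: (@filter_forall _ _ (fun t' q => t' != t -> ~ triangle t' q) _ (nbhs_filter p)) => t'; have [->|tt'] := eqVneq t' t; first by apply: nearW.
  by have := far t' tt'; apply: filterS => q nq _.
have : open_triangle t p.
  apply: filterS2 Dp far' => q [t' _ tq] nq.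
  by have [<-//|/nq] := eqVneq t' t.
by move=> /(open_triP (jac_corner t)) /(_ k); rewrite l0 ltxx.
Qed.

(** In the parametrization of the triangle the zero set is a vertical axis, a product with a factor
    of measure zero. *)
Lemma lam_neq0_ae (t : tri S) k : {ae mu, forall p, lam (corner S t) k p != 0}.
Proof.
pose N : set (plane R) := [set p | lam (corner S t) k p = 0].
have mN : measurable N.
  apply: closed_measurable_prod; apply: (@preimage_closed _ _ (lam (corner S t) k) [set 0]).
  - by move=> p _; exact: continuous_lam.
  - exact: closed_eq.
exists N; split; [exact: mN| |by move=> p /= /negP; rewrite negbK => /eqP].
rewrite ((scales_tri_map (jac_corner t) (k + 2)).2 N mN).
rewrite (_ : tri_map (corner S t) (k + 2) @^-1` N = [set 0] `*` setT).
  rewrite /plane_measure (@product_measure1E _ _ (measurableTypeR R) (measurableTypeR R) R)//.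
  apply: (eq_trans (congr1 (fun x => (_ * (x * _))%E) (lebesgue_measure_set1 (0 : R)))).
  by rewrite mul0e mule0.
have [_ _ kk _] := ord3_add2 k.
apply/seteqP; split => p; have [e _ _] := lam_tri_map (jac_corner t) (k + 2) p; rewrite kk in e.
  by rewrite /N/= => h; split => //; rewrite -e.
by case=> /= h _; rewrite /N/= e.
Qed.

Let U : set (plane R) := \big[setU/set0]_(t <- index_enum (tri S)) open_triangle t.

Let UE p : U p <-> exists t : tri S, open_triangle t p.
Proof.
rewrite /U -bigcup_seq; split => [[t _ tp]|[t tp]]; first by exists t.
by exists t => //=; rewrite mem_index_enum.
Qed.

Let mU : measurable U. Proof. by apply: bigsetU_measurable => t _; exact: measurable_open_triangle. Qed.

Lemma measurable_domain : measurable (domain S : set (plane R)).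
Proof. by apply: open_measurable_prod; exact: open_interior. Qed.

Let UD : U `<=` domain S.
Proof. by move=> p /UE[t]; exact: open_triangle_domain. Qed.

(** A point of the domain outside all open triangles has a vanishing barycentric coordinate in some
    triangle, so it lies on one of finitely many lines. *)
Let D0 : mu (domain S `\` U) = 0%E.
Proof.
have ae : {ae mu, forall p, domain S p -> U p}.
  have h : {ae mu, forall p, forall tk : side S, lam (corner S tk.1) tk.2 p != 0}.
    by apply: (@filter_forall _ _ _ _ (ae_filter_ringOfSetsType mu)) => -[t k]; exact: lam_neq0_ae.
  apply: plane_aeS h => p h /domain_triangle[t tp]; apply/UE; exists t.
  apply/(open_triP (jac_corner t)) => k; rewrite lt_neqAle eq_sym (h (t, k)).
  by move/(tri_setP (jac_corner t)): tp => /(_ k).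
apply: (@measure_negligible _ (plane R) R mu _ (measurableD measurable_domain mU)).
by apply: (negligibleS _ ae) => p [Dp Up] /= /(_ Dp).
Qed.

Let triU : trivIset [set` index_enum (tri S)] (fun t => open_triangle t).
Proof.
apply/trivIsetP => t t' _ _ tt'; apply/seteqP; split => // p [tp tp'].
by move/eqP: tt'; apply; exact: open_triangle_disj tp (open_triangle_sub tp').
Qed.

Let DU : domain S `\` (domain S `\` U) = U.
Proof. by rewrite setDD; apply: setIidr. Qed.

Lemma ge0_integral_domain (f : R * R -> \bar R) : measurable_fun (domain S : set (plane R)) f ->
  (forall p, domain S p -> (0 <= f p)%E) ->
  (\int[mu]_(p in domain S) f p = \sum_(t : tri S) \int[mu]_(p in open_triangle t) f p)%E.
Proof.
move=> mf f0; rewrite (@ge0_negligible_integral _ (plane R) R mu _ _ f (measurableD measurable_domain mU) measurable_domain mf f0 D0).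
rewrite DU (@ge0_integral_bigsetU _ (plane R) R mu _ (fun t : tri S => open_triangle t) f (index_enum (tri S)) (@measurable_open_triangle R S) (index_enum_uniq _) triU)//.
- exact: measurable_funS measurable_domain UD mf.
- by move=> p /UD; exact: f0.
Qed.

Lemma domain_L2 f : measurable_fun (domain S : set (plane R)) f ->
  (forall t : tri S, L2 mu (open_triangle t) f) -> L2 mu (domain S) f.
Proof.
move=> mf Lf; split => //; rewrite /sqint ge0_integral_domain.
- by apply: lte_sum_pinfty => t _; exact: (Lf t).2.
- exact: (@measurable_sq _ (plane R) R).
- by move=> p _; rewrite lee_fin sqr_ge0.
Qed.

Lemma Rintegral_domain f : mu.-integrable (domain S) (EFin \o f) ->
  \int[mu]_(p in domain S) f p = \sum_(t : tri S) \int[mu]_(p in open_triangle t) f p.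
Proof.
move=> If.
have It (t : tri S) : mu.-integrable (open_triangle t) (EFin \o f).
  exact: (@integrableS _ (plane R) R mu _ _ _ measurable_domain (measurable_open_triangle t) (@open_triangle_domain t) If).
rewrite /Rintegral (@negligible_integral _ (plane R) R mu _ _ _ (measurableD measurable_domain mU) measurable_domain If D0) DU.
rewrite (@integral_bigsetU_EFin _ (plane R) R mu _ (fun t : tri S => open_triangle t) f (index_enum (tri S)) (@measurable_open_triangle R S) (index_enum_uniq _) triU).
  rewrite -sum_fine// => t _.
  exact: (@integral_fune_fin_num _ (plane R) R mu _ (measurable_open_triangle t) _ (It t)).
have [mf _] := integrableP _ _ _ If.
exact: measurable_funS measurable_domain UD mf.
Qed.

Lemma measurable_domain_tri (f : plane R -> R) :
  (forall t : tri S, measurable_fun (triangle t : set (plane R)) f) -> measurable_fun (domain S : set (plane R)) f.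
Proof.
move=> mf; pose V s : set (plane R) := \big[setU/set0]_(t <- s) triangle (t : tri S).
have mT (t : tri S) : measurable (triangle t : set (plane R)).
  by apply: closed_measurable_prod; exact: (@closed_tri_set R (corner S t) (jac_corner t)).
have mV s : measurable (V s) by apply: bigsetU_measurable => t _; exact: mT.
have h s : measurable_fun (V s) f.
  elim: s => [|t s IH]; rewrite /V ?big_nil ?big_cons; first exact: measurable_fun_set0.
  by apply/measurable_funU => //; exact: mV.
apply: (measurable_funS (mV (index_enum (tri S))) _ (h _)) => p /domain_triangle[t tp].
by rewrite /V -bigcup_seq; exists t => //=; rewrite mem_index_enum.
Qed.
End PlanarGeometry.

(** * Continuous piecewise polynomials belong to H^1 of the domain *)

Section GluedPolynomials.
Context (R : realType) (S : triangulation R).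
Hypothesis planarS : planar S.
Notation mu := (plane_measure R).
Notation leb := (@lebesgue_measure R).

(** Each term is minus the sum over its twins; exchanging the two summations shows that the total
    equals its own opposite. *)
Lemma sum_twin_odd (A : side S -> R) : (forall h h', twin h h' -> A h = - A h') ->
  (forall h, boundary_side h -> A h = 0) -> \sum_h A h = 0.
Proof.
move=> At Ab.
have E h : A h = - \sum_(h' | twin h h') A h'.
  have [[h' hh']|hb] := pselect (exists h', twin h h'); first by rewrite (sum_twin _ hh') (At _ _ hh').
  have nt h' : twin h h' = false by apply/negP => hh'; apply: hb; exists h'.
  by rewrite big_pred0// oppr0 Ab//; apply/forallP => h'; rewrite nt.
have : \sum_h A h = - \sum_h A h.
  rewrite [in LHS](eq_bigr _ (fun h _ => E h)) sumrN (exchange_big_dep xpredT)//=; congr (- _).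
  apply: eq_bigr => h _; under eq_bigl do rewrite twin_sym.
  have [[h' hh']|hb] := pselect (exists h', twin h h'); first by rewrite (sum_twin _ hh').
  have nt h' : twin h h' = false by apply/negP => hh'; apply: hb; exists h'.
  by rewrite big_pred0// Ab//; apply/forallP => h'; rewrite nt.
by lra.
Qed.

Variables (n : nat) (F : tri S -> R * R -> R).
Hypothesis pF : forall t, is_poly n (F t).
Hypothesis agree : forall t t' p, triangle t p -> triangle t' p -> F t p = F t' p.
Let CF t : C1 (F t) := (is_poly_C1 (pF t)).1.

Lemma glue_measurable (t : tri S) : measurable_fun (triangle t : set (plane R)) (glue F).
Proof.
apply: (@eq_measurable_fun _ _ (plane R) (measurableTypeR R) _ (F t)).
  by move=> p; rewrite inE => tp; rewrite (glueE agree tp).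
apply: continuous_measurable_prod; last exact: (CF t).1.
by apply: closed_measurable_prod; exact: (@closed_tri_set R (corner S t) (jac_corner t)).
Qed.

Let continuous_tri_L2 (t : tri S) (f : R * R -> R) : continuous f -> L2 mu (open_triangle t) f.
Proof. exact: (@continuous_L2 R (corner S t) (jac_corner t) f). Qed.

Lemma glue_L2 : L2 mu (domain S) (glue F).
Proof.
apply: (domain_L2 planarS); first exact: measurable_domain_tri glue_measurable.
move=> t; have [mF IF] := continuous_tri_L2 t (CF t).1.
have E p : open_triangle t p -> F t p = glue F p by move=> tp; rewrite (glueE agree (open_triangle_sub tp)).
split.
  by apply: (@eq_measurable_fun _ _ (plane R) (measurableTypeR R) _ (F t)) mF => p; rewrite inE; exact: E.
by rewrite -(@eq_sqint _ (plane R) R mu _ (F t))// => p; rewrite inE; exact: E.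
Qed.

(** The candidate weak derivative: the classical one inside each triangle, and zero on the null set
    of edges. *)
Let dglue i p := \sum_(t : tri S) \1_(open_triangle t) p * pderiv i (F t) p.

Let dglueE i t p : open_triangle t p -> dglue i p = pderiv i (F t) p.
Proof.
move=> tp; rewrite /dglue (bigD1 t)//= indicE mem_set// mul1r big1 ?addr0// => t' tt'.
rewrite indicE memNset ?mul0r// => tp'.
by move/eqP: tt'; apply; exact: open_triangle_disj planarS _ _ _ tp' (open_triangle_sub tp).
Qed.

Let dglue_L2 i : L2 mu (domain S) (dglue i).
Proof.
apply: (domain_L2 planarS).
  apply: (@measurable_sum _ (plane R) R) => t; apply: measurable_funM.
    by apply: measurable_indic; exact: measurable_open_triangle.
  by apply: continuous_measurable_prod; [exact: measurable_domain|exact: ((CF t).2 i).2].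
move=> t; have [mF IF] := continuous_tri_L2 t ((CF t).2 i).2.
split.
  by apply: (@eq_measurable_fun _ _ (plane R) (measurableTypeR R) _ (pderiv i (F t))) mF => p; rewrite inE => /dglueE.
by rewrite -(@eq_sqint _ (plane R) R mu _ (pderiv i (F t)))// => p; rewrite inE => /dglueE.
Qed.

Lemma continuous_domain_L2 (f : R * R -> R) : continuous f -> L2 mu (domain S) f.
Proof.
move=> cf; apply: (domain_L2 planarS); last by move=> t; exact: continuous_tri_L2.
by apply: continuous_measurable_prod => //; exact: measurable_domain.
Qed.

Lemma glue_green i phi : test_function (domain S) phi ->
  \int[mu]_(p in domain S) (glue F p * pderiv i phi p) = - \int[mu]_(p in domain S) (dglue i p * phi p).
Proof.
move=> [sphi [K [_ KD phi0]]]; have Cphi := smooth_C1 sphi.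
have mD := measurable_domain S.
have I1 := @L2M_integrable _ (plane R) R mu _ mD _ _ glue_L2 (continuous_domain_L2 (Cphi.2 i).2).
have I2 := @L2M_integrable _ (plane R) R mu _ mD _ _ (dglue_L2 i) (continuous_domain_L2 Cphi.1).
rewrite (Rintegral_domain planarS I1) (Rintegral_domain planarS I2).
pose v := unit_vec R i.
have dv f p : dir_deriv f v p = pderiv i f p.
  by rewrite /dir_deriv /v /unit_vec/=; elim/ord2P: i {I1 I2 v}; rewrite /= !(mulr1n, mulr0n) ?mul1r ?mul0r ?addr0 ?add0r.
pose A (h : side S) : R := cross (edge (corner S h.1) h.2) v *
  \int[leb]_(s in `[0, 1]) (F h.1 (side_point h s) * phi (side_point h s)).
have G (t : tri S) : \int[mu]_(p in open_triangle t) (glue F p * pderiv i phi p) =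
    (- \int[mu]_(p in open_triangle t) (dglue i p * phi p)) - \sum_k A (t, k).
  have := @Green_mul R (corner S t) (jac_corner t) (F t) phi v (CF t) Cphi.
  rewrite (_ : \int[mu]_(p in _) (dir_deriv (F t) v p * phi p) = \int[mu]_(p in open_triangle t) (dglue i p * phi p)); last first.
    by apply: eq_Rintegral => p; rewrite inE => tp; rewrite dv (dglueE i tp).
  rewrite (_ : \int[mu]_(p in _) (F t p * dir_deriv phi v p) = \int[mu]_(p in open_triangle t) (glue F p * pderiv i phi p)); last first.
    by apply: eq_Rintegral => p; rewrite inE => tp; rewrite dv (glueE agree (open_triangle_sub tp)).
  rewrite -[\sum_(k < 3) cross _ _ * _]/(\sum_k A (t, k)).
  by move: (\int[mu]_(p in _) _) (\int[mu]_(p in _) _) (\sum_k _) => a b c ->; ring.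
rewrite (eq_bigr _ (fun t _ => G t)) sumrB sumrN pair_bigA/=.
suff -> : \sum_(h : side S) A (h.1, h.2) = 0 by rewrite subr0.
have cs (h : side S) (f : R * R -> R) : continuous f -> continuous (fun s => f (side_point h s)).
  by move=> cf; exact: (@continuous_side_comp R (corner S h.1) f h.2 cf).
have cA (h : side S) : continuous (fun s => F h.1 (side_point h s) * phi (side_point h s)).
  by move=> s; apply: cvgM; [exact: (cs h _ (CF h.1).1)|exact: (cs h _ Cphi.1)].
rewrite (eq_bigr A); last by case.
apply: sum_twin_odd => [h h' hh'|h bh].
- rewrite /A/=; have [e1 e2] := twin_corner planarS hh'.
  have -> : cross (edge (corner S h.1) h.2) v = - cross (edge (corner S h'.1) h'.2) v.
    by rewrite /edge e1 e2 /cross !pairE; ring.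
  rewrite mulNr; congr (- (_ * _)); rewrite -(integral_onem (cA h')).
  apply: eq_Rintegral => s; rewrite inE/= => s01.
  have sp := twin_side_point planarS s hh'.
  have t1 : triangle h.1 (side_point h s) := side_point_in h s01.
  by rewrite -sp; congr (_ * _); apply: agree t1 _; rewrite sp; apply: side_point_in; exact: onem_itv.
- rewrite /A/= (_ : \int[leb]_(s in _) _ = 0) ?mulr0//.
  (* Points inside a boundary side are outside the domain, where [phi] is zero; the two endpoints do
     not affect the integral. *)
  rewrite /Rintegral (@eq_integral_itv_bounded R 0 1 (fun=> 0)).
  + by rewrite integral0.
  + by apply: measurable_funTS; apply: continuous_measurable_fun; exact: cA h.
  + exact: measurable_cst.
  + move=> s; rewrite in_itv/= => s01; rewrite phi0 ?mulr0// => /KD.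
    exact: boundary_not_domain.
Qed.

Lemma glue_H1 : H1_domain (domain S) (glue F).
Proof.
split; first exact: glue_L2.
by move=> i; exists (dglue i); [exact: dglue_L2|exact: glue_green].
Qed.

Lemma glue_within (t : tri S) : {within triangle t, continuous (glue F)}.
Proof.
apply: (@subspace_eq_continuous _ _ _ (F t)).
  by move=> p; rewrite inE => tp; exact: (esym (glueE agree tp)).
by apply: continuous_subspaceT; exact: (CF t).1.
Qed.

Lemma glue_ae (t : tri S) : {ae mu, forall p, open_triangle t p -> glue F p = F t p}.
Proof. by apply: aeW => p tp; rewrite (glueE agree (open_triangle_sub tp)). Qed.

Lemma glue_sobolev k (t : tri S) : sobolev k (open_triangle t) (glue F).
Proof.
apply: (poly_sobolev k _ (pF t) (glue_ae t)).
apply: (@measurable_funS _ _ (plane R) (measurableTypeR R) (triangle t)).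
- by apply: closed_measurable_prod; exact: (@closed_tri_set R (corner S t) (jac_corner t)).
- exact: open_triangle_sub.
- exact: glue_measurable.
Qed.
End GluedPolynomials.

(** * The projection onto vector fields *)

Section SegmentReversal.
Context (R : realType).
Notation leb := (@lebesgue_measure R).

(* [integral_onem] wants a globally continuous integrand, whence the clamping. *)
Lemma segment_int_rev (f f' : R -> R) : continuous (fun s : R => f' (Num.max 0 (Num.min 1 s))) ->
  (forall s, s \in (`[0, 1] : interval R) -> f s = f' (1 - s)) ->
  \int[leb]_(s in `[0, 1]) f s = \int[leb]_(s in `[0, 1]) f' s.
Proof.
move=> cf ff'; apply: (eq_trans (y := \int[leb]_(s in `[0, 1]) f' (Num.max 0 (Num.min 1 (1 - s))))).
  by apply: eq_Rintegral => s; rewrite inE/= => s01; rewrite clamp01 ?ff'//; exact: onem_itv.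
rewrite (integral_onem cf); apply: eq_Rintegral => s; rewrite inE/= => s01; by rewrite clamp01.
Qed.

Lemma size_comp_onem (p : {poly R}) : (size (p \Po (1 - 'X)) <= size p)%N.
Proof. by rewrite size_comp_poly2// -size_polyN opprB -[1]polyC1 size_XsubC. Qed.

Lemma horner_onem (p : {poly R}) s : (p \Po (1 - 'X)).[s] = p.[1 - s].
Proof. by rewrite horner_comp !hornerE. Qed.
End SegmentReversal.

Section Interpolation.
Context (R : realType) (S : triangulation R) (r : nat).
Hypothesis planarS : planar S.
Notation mu := (plane_measure R).
Notation leb := (@lebesgue_measure R).
Variable phi : R * R -> R.
Hypothesis Lphi : forall t : tri S, L2 mu (open_triangle t) phi.
Hypothesis cphi : forall t : tri S, {within triangle t, continuous phi}.

Let ph (h : side S) (s : R) : R := phi (side_point h s).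
Let cl (s : R) : R := Num.max 0 (Num.min 1 s).

Lemma continuous_clamp : continuous (cl : R -> R).
Proof.
move=> x; apply: continuous_max; first exact: cst_continuous.
by apply: continuous_min; [exact: cst_continuous|exact: cvg_id].
Qed.

Let cph h : continuous (fun s => ph h (cl s)).
Proof. by case: h => t k; exact: (continuous_side_clamp (@cphi t)). Qed.

Let ph_twin h h' s : twin h h' -> ph h s = ph h' (1 - s).
Proof. by move=> hh'; rewrite /ph (twin_side_point planarS s hh'). Qed.

Lemma side_int_twin h h' (v : {poly R}) : twin h h' ->
  \int[leb]_(s in `[0, 1]) (ph h s * v.[s]) = \int[leb]_(s in `[0, 1]) (ph h' s * (v \Po (1 - 'X)).[s]).
Proof.
move=> hh'; apply: segment_int_rev.
  move=> s; apply: cvgM; first exact: (@cph h').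
  by apply: (continuous_comp (f := cl)); [exact: continuous_clamp|exact: continuous_horner].
by move=> s s01; rewrite (ph_twin s hh') horner_onem subKr.
Qed.

Let om (s : R) := s * (1 - s).
Let c_om : continuous om.
Proof. by move=> s; apply: cvgM; [exact: cvg_id|exact: continuous_onem]. Qed.
Let om_ge0 s : s \in (`[0, 1] : interval R) -> 0 <= om s.
Proof. by rewrite in_itv/= => /andP[s0 s1]; rewrite mulr_ge0// subr_ge0. Qed.
Let om_gt0 (s : R) : 0 < s < 1 -> 0 < om s.
Proof. by move=> /andP[s0 s1]; rewrite mulr_gt0// subr_gt0. Qed.

Let lin h (s : R) : R := (1 - s) * ph h 0 + s * ph h 1.
Let c_lin h : continuous (lin h).
Proof.
move=> s; apply: cvgD; apply: cvgM; try exact: cvg_cst; last exact: cvg_id.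
exact: continuous_onem.
Qed.
Let w h s := ph h s - lin h s.

Let ph_L2 h : L2 leb `[0, 1] (ph h).
Proof. by case: h => t k; exact: (phi_side_L2 (@cphi t) k). Qed.

Let w_L2 h : L2 leb `[0, 1] (w h).
Proof. exact: (L2B (@segI R) (ph_L2 h) (continuous_L2_segment (@c_lin h))). Qed.

Let cw h : continuous (fun s => w h (cl s)).
Proof.
move=> s; apply: cvgB; first exact: cph.
by apply: (continuous_comp (f := cl)); [exact: continuous_clamp|exact: c_lin].
Qed.

Let w_twin h h' s : twin h h' -> w h s = w h' (1 - s).
Proof. by move=> hh'; rewrite /w /lin !(ph_twin _ hh') subr0 subrr; ring. Qed.

(** Twin sides carry reversed data and the weight s (1 - s) is symmetric, so the reversed solution
    of one side solves the problem of the other; the weighted form is definite, and the two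
    coincide. *)
Lemma edge_interpolation : exists Q : side S -> {poly R}, [/\ forall h, (size (Q h) <= r)%N,
  forall h (v : {poly R}), (size v <= r)%N ->
    \int[leb]_(s in `[0, 1]) (om s * (Q h).[s] * v.[s]) = \int[leb]_(s in `[0, 1]) (w h s * v.[s]) &
  forall h h', twin h h' -> forall s, (Q h).[s] = (Q h').[1 - s]].
Proof.
pose E h := segment_proj r c_om om_ge0 om_gt0 (w_L2 h).
pose Q h := s2val (cid2 (E h)).
have sQ h : (size (Q h) <= r)%N := s2valP (cid2 (E h)).
have QE h := s2valP' (cid2 (E h)); exists Q; split => // h h' hh'.
have c3 (p v : {poly R}) : continuous (fun s => om s * p.[s] * v.[s]).
  move=> x; apply: cvgM; last exact: continuous_horner.
  by apply: cvgM; [exact: c_om|exact: continuous_horner].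
pose Q' := Q h' \Po (1 - 'X); pose D := Q h - Q'.
have sc (p : {poly R}) : (size p <= r)%N -> (size (p \Po (1 - 'X)) <= r)%N.
  by move=> sp; rewrite (leq_trans (size_comp_onem _)).
have sD : (size D <= r)%N by rewrite (leq_trans (size_polyD _ _))// size_polyN geq_max sQ sc.
suff D0 : D = 0 by move=> s; rewrite -horner_onem (subr0_eq D0).
apply: (@segment_weight_eq0 R om c_om om_ge0 om_gt0).
have -> : \int[leb]_(s in `[0, 1]) (om s * D.[s] * D.[s]) =
    \int[leb]_(s in `[0, 1]) (om s * (Q h).[s] * D.[s]) - \int[leb]_(s in `[0, 1]) (om s * Q'.[s] * D.[s]).
  rewrite -(@RintegralB _ _ R leb _ _ _ (@segI R) (continuous_segment_integrable (c3 (Q h) D)) (continuous_segment_integrable (c3 Q' D))).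
  by apply: eq_Rintegral => s _; rewrite hornerD hornerN; ring.
apply/eqP; rewrite subr_eq0; apply/eqP.
rewrite (QE h D sD); apply: (eq_trans (y := \int[leb]_(s in `[0, 1]) (w h' s * (D \Po (1 - 'X)).[s]))).
  apply: segment_int_rev.
    move=> s; apply: cvgM; first exact: (@cw h').
    by apply: (continuous_comp (f := cl)); [exact: continuous_clamp|exact: continuous_horner].
  by move=> s s01; rewrite (w_twin s hh') horner_onem subKr.
rewrite -(QE h' _ (sc _ sD)) -(integral_onem (c3 (Q h') (D \Po (1 - 'X)))).
by apply: eq_Rintegral => s _; rewrite !horner_onem subKr /om subKr; ring.
Qed.

(** The vertex part fixes the corner values; the edge bubbles lam_(k+1) lam_(k+2) Q_k vanish at the
    corners and on the other sides; the cubic bubble vanishes on the whole boundary. So each stage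
    leaves the earlier conditions intact. *)
Lemma interpolation : exists F : tri S -> R * R -> R, [/\ forall t, is_poly r.+2 (F t),
  forall t k, F t (corner S t k) = phi (corner S t k),
  forall h h' : side S, twin h h' -> forall s, F h.1 (side_point h s) = F h'.1 (side_point h' (1 - s)),
  forall (h : side S) (v : {poly R}), (size v <= r)%N ->
    \int[leb]_(s in `[0, 1]) ((F h.1 (side_point h s) - phi (side_point h s)) * v.[s]) = 0 &
  forall t b, is_poly r.-1 b -> \int[mu]_(p in open_triangle t) ((F t p - phi p) * b p) = 0].
Proof.
have [Q [sQ QE Qtw]] := edge_interpolation.
pose la (t : tri S) k : R * R -> R := lam (corner S t) k.
have pla t k : is_poly 2 (la t k) by exact: is_poly_lam.
pose E t p := \sum_k phi (corner S t k) * la t k p +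
  \sum_k la t (k + 1) p * (la t (k + 2) p * (Q (t, k)).[la t (k + 2) p]).
pose bub t p := la t 0 p * (la t 1 p * la t 2 p).
have pE t : is_poly r.+2 (E t).
  apply: is_polyD; apply: is_poly_sum => k.
    by apply: is_polyZ; apply: is_poly_le (pla t k).
  by do 2 apply: is_polyM2 => //; apply: is_poly_horner.
have cla t k : continuous (la t k) := (is_poly_C1 (pla t k)).1.1.
have cbub t : continuous (bub t) by move=> p; apply: cvgM; [exact: cla|apply: cvgM; exact: cla].
have bub_gt0 t p : open_triangle t p -> 0 < bub t p.
  move=> /(open_triP (jac_corner t)) h; apply: mulr_gt0; last apply: mulr_gt0; exact: (h _).
have mT (t : tri S) : measurable (open_triangle t : set (plane R)) := measurable_open_triangle t.
have LE t : L2 mu (open_triangle t) (E t).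
  exact: (@continuous_L2 R (corner S t) (jac_corner t) (E t) (poly_continuous (pE t))).
have LB t := @L2B _ (plane R) R mu _ (mT t) _ _ (Lphi t) (LE t).
pose B t := tri_proj r.-1 (@cbub t) (@bub_gt0 t) (LB t).
pose b t := s2val (cid2 (B t)).
have pb t : is_poly r.-1 (b t) := s2valP (cid2 (B t)).
have bE t := s2valP' (cid2 (B t)).
pose F t p := E t p + bub t p * b t p.
have pF t : is_poly r.+2 (F t).
  apply: is_polyD => //; have p3 : is_poly (r.-1).+3 (fun p => la t 0 p * (la t 1 p * (la t 2 p * b t p))).
    by do 3 apply: is_polyM2 => //.
  (* For [r = 0] the truncated predecessor would give a degree that is too high by one, but then
     [b t] is zero. *)
  have [r0|r0] := posnP r.
    apply: is_poly_ext (is_poly_cst0 _ _) => p; suff -> : b t p = 0 by rewrite mulr0.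
    by have := pb t; rewrite r0 => /is_poly0.
  by apply: is_poly_ext (is_poly_le _ p3) => [p|]; [rewrite /bub; ring|rewrite -ltnS prednK].
have Fside h s : F h.1 (side_point h s) = lin h s + om s * (Q h).[s].
  have [l0 l1 l2] := side_point_lam h s; case: h l0 l1 l2 => t k /=.
  rewrite /F /E /bub /la /lin /ph /om /side_point /= !subr0 !subrr !scale0r !scale1r add0r addr0.
  set p := (1 - s) *: _ + _; rewrite !sum3.
  by elim/ord3P: k @p => p; rewrite ?ord3D => -> -> ->; ring.
exists F; split => //.
- move=> t k; rewrite /F /E /bub /la !sum3 !ord3D !(lam_corner (jac_corner t)).
  by elim/ord3P: k; rewrite ?eqxx ?ord3_neq /=; ring.
- move=> h h' hh' s; rewrite !Fside (Qtw h h' hh') /lin !(ph_twin _ hh') /om subr0 subrr; ring.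
- move=> h v sv; have := QE h v sv => /eqP; rewrite -subr_eq0 => /eqP h0; rewrite -[RHS]h0.
  have c3 : continuous (fun s => om s * (Q h).[s] * v.[s]).
    move=> x; apply: cvgM; last exact: continuous_horner.
    by apply: cvgM; [exact: c_om|exact: continuous_horner].
  rewrite -(@RintegralB _ _ R leb _ _ _ (@segI R) (continuous_segment_integrable c3) (L2_poly_integrable (w_L2 h) (@continuous_horner _ v))).
  by apply: eq_Rintegral => s _; rewrite Fside /w -/(ph h s); ring.
- move=> t v pv; have := bE t v pv => /eqP; rewrite -subr_eq0 => /eqP h0; rewrite -[RHS]h0.
  have cv := poly_continuous pv; have cb := poly_continuous (pb t).
  have c3 : continuous (fun p => bub t p * b t p * v p).
    by move=> x; apply: cvgM; [apply: cvgM; [exact: cbub|exact: cb]|exact: cv].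
  rewrite -(@RintegralB _ (plane R) R mu _ _ _ (mT t) (continuous_tri_int t c3) (L2_tri_integrable (LB t) cv)).
  apply: eq_Rintegral => p _; rewrite -/(b t) /F.
  by move: (E t p) (bub t p) (b t p) (phi p) (v p) => x1 x2 x3 x4 x5; ring.
Qed.
End Interpolation.

Section ProjectionU.
Context (R : realType) (S : triangulation R) (r : nat) (gbar : tens_field S).
Hypothesis planarS : planar S.
Hypothesis gbarE : metric_eq gbar (euclidean S).
Notation mu := (plane_measure R).
Notation leb := (@lebesgue_measure R).
Implicit Types (u uh : R * R -> 'rV[R]_2).

Lemma Uregular u : U_space S u -> regular S u.
Proof. by case. Qed.

Let dist u uh (j : 'I_2) p := uh p 0 j - u p 0 j.

Lemma euclid_tri_int u uh (t : tri S) (v : R * R -> 'rV[R]_2) n : regular S u -> regular S uh ->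
  (forall j, is_poly n (fun p => v p 0 j)) ->
  tri_int gbar t (fun p => bilin (uh p - u p) (gbar t p) (v p)) =
  \sum_j \int[mu]_(p in open_triangle t) ((uh p 0 j - u p 0 j) * v p 0 j).
Proof.
move=> [su _] [suh _] pv.
have mT : measurable (open_triangle t : set (plane R)) := measurable_open_triangle t.
have I j := L2_tri_integrable (@L2B _ (plane R) R mu _ mT _ _ (sobolev_L2 (suh t j)) (sobolev_L2 (su t j))) (poly_continuous (pv j)).
rewrite sum2 -(@RintegralD _ (plane R) R mu _ _ _ mT (I 0) (I 1)).
apply: eq_Rintegral => p; rewrite inE => /open_triangle_sub tp.
by rewrite /density gbarE// /euclidean det1 sqrtr1 mulr1 /bilin mulmx1 mxE sum2 !mxE.
Qed.

Lemma euclid_edge_int u uh (h : side S) (v : 'I_2 -> {poly R}) : regular S u -> regular S uh ->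
  edge_int gbar h (fun s => \sum_j (uh (side_point h s) - u (side_point h s)) 0 j * (v j).[s]) =
  Num.sqrt (bilin (side_vec h) 1%:M (side_vec h)) *
  \sum_j \int[leb]_(s in `[0, 1]) ((uh (side_point h s) 0 j - u (side_point h s) 0 j) * (v j).[s]).
Proof.
case: h => t k; set h := ((t, k) : side S) => -[_ cu] [_ cuh].
have I j := L2_poly_integrable (L2B (@segI R) (phi_side_L2 (cuh t j) k) (phi_side_L2 (cu t j) k)) (@continuous_horner _ (v j)).
have ID := @integrableD _ _ R leb _ (@segI R) _ _ (I 0) (I 1).
rewrite sum2 -(@RintegralD _ _ R leb _ _ _ (@segI R) (I 0) (I 1)).
rewrite -(@RintegralZl _ _ R leb _ _ _ (@segI R) ID).
apply: eq_Rintegral => s; rewrite inE/= => s01; rewrite /speed gbarE; last exact: (@side_point_in R S h s s01).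
by rewrite /euclidean sum2 !mxE mulrC.
Qed.

Lemma euclid_speed_neq0 (h : side S) : Num.sqrt (bilin (side_vec h) 1%:M (side_vec h)) != 0 :> R.
Proof.
rewrite gt_eqF// sqrtr_gt0 /bilin mulmx1 mxE sum2 ![_^T _ _]mxE -!expr2.
have := side_vec_neq0 h; apply: contraNT; rewrite -leNgt => h0.
have : side_vec h 0 0 ^+ 2 + side_vec h 0 1 ^+ 2 == 0 by rewrite eq_le h0 addr_ge0 ?sqr_ge0.
rewrite paddr_eq0 ?sqr_ge0// !sqrf_eq0 => /andP[/eqP z0 /eqP z1].
by apply/eqP/matrixP => i j; rewrite [RHS]mxE ord1; elim/ord2P: j.
Qed.

Definition pi_U_problem u uh := [/\ Uh_space S r uh,
  forall (t : tri S) (v : R * R -> 'rV[R]_2), (forall j, is_poly r.-1 (fun p => v p 0 j)) ->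
    tri_int gbar t (fun p => bilin (uh p - u p) (gbar t p) (v p)) = 0,
  forall h : side S, h \in edges S -> forall v : 'I_2 -> {poly R}, (forall j, (size (v j) <= r)%N) ->
    edge_int gbar h (fun s => \sum_j (uh (side_point h s) - u (side_point h s)) 0 j * (v j).[s]) = 0 &
  forall (t : tri S) (k : 'I_3), uh (corner S t k) = u (corner S t k)].

(** Test fields with a single nonzero component separate the components, the Euclidean speed is a
    nonzero constant on each side, and reversing the parameter gives the moments on the side that
    does not represent its edge. *)
Lemma pi_U_problemP u uh : regular S u -> Uh_space S r uh -> pi_U_problem u uh <-> vector_dofs S r u uh.
Proof.
move=> ru Uuh; have ruh := Uregular Uuh.1; split => [[_ dI dE dV]|[dV dE dI]].
- have E h j (v : {poly R}) : h \in edges S -> (size v <= r)%N ->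
      \int[leb]_(s in `[0, 1]) ((uh (side_point h s) 0 j - u (side_point h s) 0 j) * v.[s]) = 0.
    move=> he sv; have := dE h he (fun l => if l == j then v else 0); rewrite euclid_edge_int//.
    have Z l : \int[leb]_(s in `[0, 1]) ((uh (side_point h s) 0 l - u (side_point h s) 0 l) * (0 : {poly R}).[s]) = 0.
      by rewrite /Rintegral integral0_eq// => s _; rewrite horner0 mulr0.
    have sl (l : 'I_2) : (size (if l == j then v else 0%R) <= r)%N by case: ifP => // _; rewrite size_poly0.
    move/(_ sl)/eqP; rewrite mulf_eq0 (negbTE (euclid_speed_neq0 h))/= => /eqP.
    by rewrite (bigD1 j)//= eqxx big1 ?addr0// => l /negbTE ->; exact: Z.
  split => // [h j v sv|t j b pb].
    have [he|he] := boolP (h \in edges S); first exact: E.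
    have [h' hh'] := notin_edges he; have h'e : h' \in edges S by rewrite (twin_edges hh').
    have cd t : {within triangle (S := S) t, continuous (dist u uh j)}.
      by move=> p; apply: cvgB; [exact: (ruh.2 t j p)|exact: (ru.2 t j p)].
    rewrite (side_int_twin planarS cd v hh'); apply: E => //.
    by rewrite (leq_trans (size_comp_onem _)).
  have := dI t (fun p => \row_l (if l == j then b p else 0)).
  have pv l : is_poly r.-1 (fun p => (\row_l' (if l' == j then b p else 0)) 0 l : R).
    have [e|e] := eqVneq l j.
      by apply: is_poly_ext pb => p; rewrite mxE e eqxx.
    by apply: is_poly_ext (is_poly_cst0 _ _) => p; rewrite mxE (negbTE e).
  rewrite (euclid_tri_int t ru ruh pv) => /(_ pv).
  rewrite (bigD1 j)//= big1 ?addr0; last first.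
    by move=> l lj; rewrite /Rintegral integral0_eq// => p _; rewrite mxE (negbTE lj) mulr0.
  by move=> H; rewrite -[RHS]H; apply: eq_Rintegral => p _; rewrite mxE eqxx.
- split=> //.
  + by move=> t v pv; rewrite (euclid_tri_int t ru ruh pv) big1// => j _; exact: dI.
  + by move=> h _ v sv; rewrite euclid_edge_int// big1 ?mulr0// => j _; exact: dE.
Qed.

Lemma vector_dofs_exist u : U_space S u -> exists uh, Uh_space S r uh /\ vector_dofs S r u uh.
Proof.
move=> Uu; have [su cu] := Uregular Uu.
have H j := interpolation r planarS (fun t => sobolev_L2 (su t j)) (fun t => cu t j).
pose F j := sval (cid (H j)).
have pF j : forall t, is_poly r.+2 (F j t) by have [] := svalP (cid (H j)).
have vF j : forall t k, F j t (corner S t k) = u (corner S t k) 0 j by have [] := svalP (cid (H j)).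
have tF j : forall h h' : side S, twin h h' -> forall s, F j h.1 (side_point h s) = F j h'.1 (side_point h' (1 - s)).
  by have [] := svalP (cid (H j)).
have agree j := glue_agree planarS (phi := fun p => u p 0 j) (vF j) (tF j).
pose uh p : 'rV[R]_2 := \row_j glue (F j) p.
have uhE j : (fun p => uh p 0 j) = glue (F j) by apply/funext => p; rewrite mxE.
have uhT t j p : triangle t p -> uh p 0 j = F j t p by move=> tp; rewrite mxE (glueE (agree j) tp).
exists uh; split; [split; [split|]|split].
- by move=> j; rewrite uhE; exact: (glue_H1 planarS (pF j) (agree j)).
- by move=> t j; rewrite uhE; exact: (glue_sobolev (pF j) (agree j)).
- by move=> t j; rewrite uhE; exact: (glue_within (pF j) (agree j)).
- by move=> t j; rewrite uhE; exists (F j t); [exact: pF|exact: (glue_ae (agree j))].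
- move=> t k; apply/rowP => j; rewrite (uhT t) ?vF//; exact: (@corner_in R (corner S t) (jac_corner t) k).
- move=> h j v sv; have [_ _ _ dE _] := svalP (cid (H j)); rewrite -[RHS](dE h v sv).
  by apply: eq_Rintegral => s; rewrite inE/= => s01; rewrite (uhT h.1) //; exact: side_point_in.
- move=> t j b pb; have [_ _ _ _ dI] := svalP (cid (H j)); rewrite -[RHS](dI t b pb).
  by apply: eq_Rintegral => p; rewrite inE => /open_triangle_sub tp; rewrite (uhT t).
Qed.

Lemma pi_U_spec u : U_space S u -> Uh_space S r (pi_U r gbar u) /\ vector_dofs S r u (pi_U r gbar u).
Proof.
move=> Uu; have ru := Uregular Uu; have [uh [Uuh d]] := vector_dofs_exist Uu.
have : pi_U_problem u (pi_U r gbar u).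
  by rewrite /pi_U; case: xgetP => [w -> //|/(_ uh) []]; apply/pi_U_problemP.
by move=> P; split; [case: P|apply/pi_U_problemP => //; case: P].
Qed.
End ProjectionU.

Section DefProjection.
Context (R : realType) (S : triangulation R) (r : nat) (g gbar : tens_field S).
Hypothesis planarS : planar S.
Hypothesis gE : metric_eq g (euclidean S).
Hypothesis gbar_metric : regge_metric_h 0 gbar.
Hypothesis gbarE : metric_eq gbar (euclidean S).
Notation mu := (plane_measure R).

Lemma def_op_Sigmah uh : Uh_space S r uh -> Sigmah_space r (def_op g uh).
Proof.
move=> [Uuh puh]; have ruh := Uregular Uuh.
split; first exact: (def_op_Sigma gE planarS ruh).
have W (t : tri S) i j : exists F, is_poly r.+1 F /\
    {ae mu, forall p, open_triangle t p -> weak_pderiv (open_triangle t) i (fun q => uh q 0 j) p = F p}.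
  have [F pF aF] := puh t j; exists (pderiv i F); split; first exact: (is_poly_C1 pF).2.
  exact: (weak_pderiv_poly i (sobolev_measurable (ruh.1 t j)) pF aF).2.
move=> t i j; have [F [pF aF]] := W t i j; have [G [pG aG]] := W t j i.
exists (fun p => 2^-1 * F p + 2^-1 * G p); first by apply: is_polyD; exact: is_polyZ.
by apply: plane_aeS2 aF aG => p eF eG tp; rewrite (def_opE gE _ _ _ tp) eF// eG.
Qed.

Lemma def_op_pi_U u : U_space S u -> forall t, {ae mu, forall p, open_triangle t p ->
  def_op g (pi_U r gbar u) t p = pi_Sigma r gbar (def_op g u) t p}.
Proof.
move=> Uu; have [Uuh d] := pi_U_spec r planarS gbarE Uu.
have ru := Uregular Uu; have ruh := Uregular Uuh.1.
have Ss := def_op_Sigma gE planarS ru.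
have [Sp dp] := pi_Sigma_spec r gbar_metric Ss.
exact: (sigma_dofs_unique Ss (def_op_Sigmah Uuh) Sp (def_op_dofs gE ru ruh d) dp).
Qed.
End DefProjection.

Theorem theorem7p8 (R : realType) (S : triangulation R) (r : nat)
    (g gh gbar : tens_field S)
    (g_metric : regge_metric g)
    (gh_metric : regge_metric_h r gh)
    (gbar_metric : regge_metric_h 0 gbar) :
  [/\ forall l : form_field S -> R, W_dual l ->
        forall t p, triangle t p ->
          div_h r gh (pi_W r gh l) t p = pi_V r gh (div_dist l) t p,
      metric_eq g gh -> metric_eq gh gbar ->
        forall sigma : tens_field S, Sigma_space sigma ->
        forall t p, triangle t p ->
          divdivS_h r gh (pi_Sigma r gbar sigma) t p =
          pi_V r gh (divdivS_dist g sigma) t p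
    & planar S ->
        metric_eq g (euclidean S) -> metric_eq gh (euclidean S) ->
        metric_eq gbar (euclidean S) ->
        forall u : R * R -> 'rV[R]_2, U_space S u ->
        forall t, \forall p \ae plane_measure R, open_triangle t p ->
          def_op g (pi_U r gbar u) t p = pi_Sigma r gbar (def_op g u) t p].
Proof.
split.
- by move=> l dl t p _; rewrite (div_h_pi_W r (proj1 gh_metric) dl).
- move=> ggh ghgbar sigma Ss t p _.
  by rewrite (divdivS_h_pi_Sigma r (proj1 gh_metric) gbar_metric ggh ghgbar Ss).
- move=> planarS gE ghE gbarE u Uu t.
  exact: (def_op_pi_U r planarS gE gbar_metric gbarE Uu).
Qed.
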